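(* Let $p>2$. For $\lambda>0$ consider the problem $$(P_\lambda)\qquad -\Delta u-\frac{1}{\lambda^2}[x_1\partial_{x_2}-x_2\partial_{x_1}]^2u+u=|u|^{p-2}u\ \text{ on }\mathbb{R}^2,\qquad u(x)\to 0\ \text{ as }|x|\to\infty .$$ For every $\lambda>0$ there exists a least energy nodal solution of $(P_\lambda)$. Furthermore, there exist $0<\lambda_0\le\Lambda_0<\infty$ with the following properties: (i) For $\lambda<\lambda_0$, every least energy nodal solution of $(P_\lambda)$ is radial. (ii) For $\lambda>\Lambda_0$, every least energy nodal solution of $(P_\lambda)$ is nonradial.
   Context: All functions are real-valued. Write $\partial_\theta:=x_1\partial_{x_2}-x_2\partial_{x_1}$ (in the weak sense), and $$H:=\Big\{u\in H^1(\mathbb{R}^2):\ \int_{\mathbb{R}^2}|\partial_\theta u|^2\,dx<\infty\Big\},\qquad \langle u,v\rangle_\lambda:=\int_{\mathbb{R}^2}\Big(\nabla u\cdot\nabla v+\frac{1}{\lambda^2}(\partial_\theta u)(\partial_\theta v)+uv\Big)dx .$$ A (weak) solution of $(P_\lambda)$ is a function $u\in H$ with $\langle u,v\rangle_\lambda=\int_{\mathbb{R}^2}|u|^{p-2}uv\,dx$ for all $v\in H$; equivalently, a critical point of the $C^1$-functional $E_\lambda:H\to\mathbb{R}$, $$E_\lambda(u):=\frac12\int_{\mathbb{R}^2}\Big(|\nabla u|^2+\frac{1}{\lambda^2}|\partial_\theta u|^2+|u|^2\Big)dx-\frac1p\int_{\mathbb{R}^2}|u|^p\,dx .$$ Nodal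 means sign-changing. A least energy nodal solution of $(P_\lambda)$ is a minimizer of $E_\lambda$ within the class of sign-changing solutions of $(P_\lambda)$. *)

(* Defs.v *)
From HB Require Import structures.
From mathcomp Require Import all_boot all_order all_algebra.
From mathcomp Require Import all_classical all_reals all_analysis.

Set Implicit Arguments.
Unset Strict Implicit.
Unset Printing Implicit Defensive.

Import Order.TTheory GRing.Theory Num.Theory.
Import numFieldNormedType.Exports.

Local Open Scope classical_set_scope.
Local Open Scope ring_scope.

(* Elements of function spaces are represented by Borel measurable functions,
   not by classes modulo almost everywhere equality. *)

Definition leb2 (R : realType) :
    {measure set (measurableTypeR R * measurableTypeR R)%type -> \bar R} :=
  (@lebesgue_measure R \x @lebesgue_measure R)%E.

Section sobolev.
Context {R : realType}.
Local Notation R2 := (R * R)%type.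
Local Notation mu := (leb2 R).
Implicit Types (u v w phi : R2 -> R) (e : R2).

Definition axis1 : R2 := (1, 0).
Definition axis2 : R2 := (0, 1).

Definition iter_derive (es : seq R2) phi : R2 -> R :=
  foldr (fun e f => 'D_e f) phi es.

Definition smooth phi : Prop := forall es : seq R2,
  continuous (iter_derive es phi) /\
  forall x e, derivable (iter_derive es phi) x e.

Definition test_function phi : Prop :=
  smooth phi /\ compact (closure [set x | phi x != 0]).

Definition locally_integrable2 u : Prop :=
  forall K : set R2, compact K -> mu.-integrable K (EFin \o u).

Definition is_weak_derive e u w : Prop :=
  [/\ locally_integrable2 u, locally_integrable2 w &
      forall phi, test_function phi ->
        \int[mu]_x (u x * 'D_e phi x) = - \int[mu]_x (w x * phi x)].

(* Weak derivatives are unique up to null sets, so the choice made by [get] is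
   immaterial; the value is meaningless when no weak derivative exists. *)
Definition weak_derive e u : R2 -> R := get [set w | is_weak_derive e u w].

Definition sobolevH1 : set (R2 -> R) := [set u | u \in Lfun mu 2%:E /\
  forall e, e \in [:: axis1; axis2] ->
    exists2 w, is_weak_derive e u w & w \in Lfun mu 2%:E].

Definition dtheta u : R2 -> R :=
  fun x => x.1 * weak_derive axis2 u x - x.2 * weak_derive axis1 u x.

Definition Hspace : set (R2 -> R) := [set u | sobolevH1 u /\
  (\int[mu]_x (`|dtheta u x| ^+ 2)%:E < +oo)%E].

Definition grad_dot u v : R2 -> R := fun x =>
  weak_derive axis1 u x * weak_derive axis1 v x +
  weak_derive axis2 u x * weak_derive axis2 v x.

Definition innerH (lambda : R) u v : R :=
  \int[mu]_x (grad_dot u v x + (lambda ^+ 2)^-1 * (dtheta u x * dtheta v x)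
              + u x * v x).

Definition solution (p lambda : R) u : Prop :=
  Hspace u /\ forall v, Hspace v ->
    innerH lambda u v = \int[mu]_x (`|u x| `^ (p - 2) * u x * v x).

Definition energy (p lambda : R) u : R :=
  2^-1 * \int[mu]_x (grad_dot u u x + (lambda ^+ 2)^-1 * `|dtheta u x| ^+ 2
                     + `|u x| ^+ 2)
  - p^-1 * \int[mu]_x (`|u x| `^ p).

Definition nodal u : Prop :=
  (0 < mu [set x | (0 < u x)%R])%E /\ (0 < mu [set x | (u x < 0)%R])%E.

Definition least_energy_nodal_solution (p lambda : R) u : Prop :=
  [/\ solution p lambda u, nodal u &
      forall v, solution p lambda v -> nodal v ->
        energy p lambda u <= energy p lambda v].

Definition radial u : Prop := exists g : R -> R,
  {ae mu, forall x, u x = g (Num.sqrt (x.1 ^+ 2 + x.2 ^+ 2))}.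

End sobolev.

(* Main.v *)
From HB Require Import structures.
Require Import Defs.
From mathcomp Require Import all_boot all_order all_algebra.
From mathcomp Require Import all_classical all_reals all_analysis.
From mathcomp Require Import measurable_realfun lebesgue_integral_fubini.
From mathcomp Require Import ring lra.

(* Least energy nodal solutions are the minimisers of the L^p norm over the
   functions u in H whose positive and negative parts are nonzero and satisfy
   Q(u) <= P(u), where Q is the quadratic form of the problem and P(u) is the
   integral of |u|^p.  Such minimisers exist because bounded sequences of H are
   precompact in L^p: the angular derivative makes u almost rotation invariant
   at small angular scales, so mass far from the origin is spread over many
   disjoint rotated cells and cannot concentrate.  A minimiser is critical,
   since along a direction of negative slope one can rebalance the two parts by
   the intermediate value theorem and contradict minimality.

   For small lambda, w = u(R x) - u(x) with R a rotation of angle pi / 2^k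
   is controlled in L2 by lambda times its energy norm as soon as u is
   invariant under R^2, and the difference of the two equations gives w = 0;
   dyadic angles are dense, so u is radial.

   If radial least energy solutions existed for arbitrarily large lambda, their
   L^p norm would not depend on lambda, and two far apart bumps would show that
   one of the two parts, w say, minimises the quotient of the H^1 and L^p norms
   among compactly supported functions.  Hence w is a weak supersolution, and
   the logarithmic estimate for supersolutions prevents w from vanishing on a
   set of positive measure, although it does on the support of the other
   part. *)

Set Implicit Arguments.
Unset Strict Implicit.
Unset Printing Implicit Defensive.

Import Order.TTheory GRing.Theory Num.Theory.
Import numFieldNormedType.Exports.

Local Open Scope classical_set_scope.
Local Open Scope ring_scope.

(** * Integrable functions and the space L2 *)

Section Generic_integral.
Context d (T : measurableType d) (R : realType) (mu : {measure set T -> \bar R}).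
Implicit Types f g h : T -> R.

(** Elements of H are functions and their weak derivatives are chosen by [get], so calculus is done
    with the relation [wd] and transferred almost everywhere; chain and product rules are obtained
    on lines, from absolutely continuous representatives. The obstacle to existence is the
    translation invariance of the H^1 norm. The angular term removes it for each fixed lambda, with
    a strength that fades as lambda grows; the competitor made of two distant bumps exploits exactly
    this. On functions whose two parts satisfy Q = P the energy is (1/2 - 1/p) P, which is why the
    L^p norm is the quantity minimised. Two uniformities in lambda carry the symmetry results. The
    embedding constants involve only the H^1 norm, which the quadratic form dominates for every
    lambda, and a fixed radial sign-changing function bounds the minimal level. Hence all minimisers
    are bounded by one constant, and the smallness condition on lambda can be fixed in advance. For
    radial functions the quadratic form does not see lambda at all, so a radial minimiser can be
    compared with competitors for every other lambda. *)

Definition meas f := measurable_fun [set: T] f.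
Definition itg f := mu.-integrable [set: T] (EFin \o f).

Lemma measD f g : meas f -> meas g -> meas (fun x => f x + g x).
Proof. exact: measurable_funD. Qed.
Lemma measB f g : meas f -> meas g -> meas (fun x => f x - g x).
Proof. exact: measurable_funB. Qed.
Lemma measM f g : meas f -> meas g -> meas (fun x => f x * g x).
Proof. exact: measurable_funM. Qed.
Lemma measN f : meas f -> meas (fun x => - f x).
Proof. exact: measurableT_comp. Qed.
Lemma measX f n : meas f -> meas (fun x => f x ^+ n).
Proof. exact: measurable_funX. Qed.
Lemma meas_norm f : meas f -> meas (fun x => `|f x|).
Proof. exact: measurableT_comp. Qed.
Lemma meas_cst (c : R) : meas (fun _ => c).
Proof. exact: measurable_cst. Qed.
Lemma meas_max f g : meas f -> meas g -> meas (fun x => Num.max (f x) (g x)).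
Proof. exact: measurable_maxr. Qed.
Lemma meas_powR f r : meas f -> meas (fun x => f x `^ r).
Proof. by move=> mf; apply: (measurableT_comp (measurable_powR r)). Qed.
Lemma meas_cont (F : R -> R) f : continuous F -> meas f -> meas (fun x => F (f x)).
Proof.
by move=> cF mf; apply: measurableT_comp mf; exact: continuous_measurable_fun.
Qed.
Lemma meas_indic (A : set T) : measurable A -> meas (\1_A).
Proof. by move=> mA; exact: measurable_indic. Qed.

Lemma aeS (P Q : T -> Prop) : {ae mu, forall x, P x} -> (forall x, P x -> Q x) ->
  {ae mu, forall x, Q x}.
Proof. by move=> hP PQ; apply: filterS hP => x /=; exact: PQ. Qed.

Lemma aeS2 (P Q S : T -> Prop) : {ae mu, forall x, P x} -> {ae mu, forall x, Q x} ->
  (forall x, P x -> Q x -> S x) -> {ae mu, forall x, S x}.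
Proof. by move=> hP hQ PQ; apply: filterS2 hP hQ => x /=; exact: PQ. Qed.

Lemma itg_meas f : itg f -> meas f.
Proof. by move=> /measurable_int /measurable_EFinP. Qed.

Lemma itgP f : meas f -> (\int[mu]_x `|f x|%:E < +oo)%E -> itg f.
Proof. by move=> mf fi; apply/integrableP; split; [exact/measurable_EFinP|]. Qed.

Lemma itg_lt f : itg f -> (\int[mu]_x `|f x|%:E < +oo)%E.
Proof. by move=> /integrableP[_]. Qed.

Lemma itg_ge0P f : (forall x, 0 <= f x) -> meas f ->
  (\int[mu]_x (f x)%:E < +oo)%E -> itg f.
Proof.
move=> f0 mf fi; apply: itgP => //.
by under eq_integral do rewrite ger0_norm//.
Qed.

Lemma itg_le f g : meas f -> itg g -> (forall x, `|f x| <= g x) -> itg f.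
Proof.
move=> mf ig fg; apply: (le_integrable measurableT _ _ ig).
  exact/measurable_EFinP.
by move=> x _; rewrite lee_fin (le_trans (fg x))// ler_norm.
Qed.

Lemma itgD f g : itg f -> itg g -> itg (fun x => f x + g x).
Proof. by move=> fi gi; exact: (integrableD measurableT fi gi). Qed.
Lemma itgB f g : itg f -> itg g -> itg (fun x => f x - g x).
Proof. by move=> fi gi; exact: (integrableB measurableT fi gi). Qed.
Lemma itgZ (k : R) f : itg f -> itg (fun x => k * f x).
Proof. by move=> fi; exact: (integrableZl measurableT k fi). Qed.
Lemma itgN f : itg f -> itg (fun x => - f x).
Proof. by move=> fi; exact: (integrableN fi). Qed.
Lemma itg0 : itg (fun _ => 0).
Proof. exact: integrable0. Qed.
Lemma itg_norm f : itg f -> itg (fun x => `|f x|).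
Proof. by move=> fi; exact: (integrable_norm fi). Qed.

Lemma itgMb h f (M : R) : meas h -> (forall x, `|h x| <= M) -> itg f ->
  itg (fun x => h x * f x).
Proof.
move=> mh hM fi; apply: (@itg_le _ (fun x => M * `|f x|)).
- by apply: measM => //; exact: itg_meas.
- by apply: itgZ; exact: itg_norm.
- by move=> x; rewrite normrM ler_wpM2r.
Qed.

Lemma IE f : itg f -> (\int[mu]_x f x)%:E = (\int[mu]_x (f x)%:E)%E.
Proof. by move=> fi; rewrite /Rintegral fineK//; exact: integrable_fin_num. Qed.

Lemma ID f g : itg f -> itg g ->
  \int[mu]_x (f x + g x) = \int[mu]_x f x + \int[mu]_x g x.
Proof. exact: RintegralD. Qed.
Lemma IB f g : itg f -> itg g ->
  \int[mu]_x (f x - g x) = \int[mu]_x f x - \int[mu]_x g x.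
Proof. exact: RintegralB. Qed.
Lemma IZ k f : itg f -> \int[mu]_x (k * f x) = k * \int[mu]_x f x.
Proof. exact: RintegralZl. Qed.
Lemma IN f : itg f -> \int[mu]_x (- f x) = - \int[mu]_x f x.
Proof.
move=> fi; rewrite -mulN1r -IZ//; apply: eq_Rintegral => x _.
by rewrite mulN1r.
Qed.
Lemma I0 : \int[mu]_x (0 : R) = 0.
Proof. by rewrite /Rintegral integral0. Qed.

Lemma I_le f g : itg f -> itg g -> (forall x, f x <= g x) ->
  \int[mu]_x f x <= \int[mu]_x g x.
Proof. by move=> fi gi fg; apply: le_Rintegral. Qed.

Lemma I_ge0 f : (forall x, 0 <= f x) -> 0 <= \int[mu]_x f x.
Proof. by move=> f0; apply: Rintegral_ge0. Qed.

Lemma I_ae f g : meas f -> meas g -> {ae mu, forall x, f x = g x} ->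
  \int[mu]_x f x = \int[mu]_x g x.
Proof.
move=> mf mg fg; congr fine; apply: ae_eq_integral => //.
- exact/measurable_EFinP.
- exact/measurable_EFinP.
- by apply: filterS fg => x /= -> .
Qed.

Lemma itg_ae f g : itg f -> meas g -> {ae mu, forall x, f x = g x} -> itg g.
Proof.
move=> fi mg fg; apply: itgP => //.
rewrite (_ : (\int[mu]_x `|g x|%:E)%E = (\int[mu]_x `|f x|%:E)%E); first exact: itg_lt.
apply: ae_eq_integral => //.
- by apply/measurable_EFinP; exact: meas_norm.
- by apply/measurable_EFinP; apply: meas_norm; exact: itg_meas.
- by apply: filterS fg => x /= -> .
Qed.

Lemma I_le_ae f g : itg f -> itg g -> {ae mu, forall x, f x <= g x} ->
  \int[mu]_x f x <= \int[mu]_x g x.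
Proof.
move=> fi gi fg.
have -> : \int[mu]_x f x = \int[mu]_x (Num.min (f x) (g x)).
  apply: I_ae; [exact: itg_meas| |].
    by apply: measurable_minr; exact: itg_meas.
  by apply: filterS fg => x /= xx; rewrite min_l.
apply: I_le => //; last by move=> x; rewrite ge_min lexx orbT.
apply: (@itg_le _ (fun x => `|f x| + `|g x|)).
- by apply: measurable_minr; exact: itg_meas.
- by apply: itgD; exact: itg_norm.
- move=> x; rewrite /Num.min; case: ifP => _.
    by rewrite ler_wpDr.
  by rewrite ler_wpDl.
Qed.

Lemma I_eq0_ae f : itg f -> (forall x, 0 <= f x) -> \int[mu]_x f x = 0 ->
  {ae mu, forall x, f x = 0}.
Proof.
move=> fi f0 If.
have mf : measurable_fun setT (EFin \o f) by exact/measurable_EFinP/itg_meas.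
have /(ae_eq_integral_abs mu measurableT mf) : (\int[mu]_x `|(EFin \o f) x| = 0)%E.
  under eq_integral do rewrite /= ger0_norm//.
  by rewrite -IE// If.
by apply: filterS => x /= /(_ I) [].
Qed.

Lemma itg_DCT (f_ : nat -> T -> R) f g : (forall n, meas (f_ n)) -> meas f ->
  itg g -> {ae mu, forall x, f_ ^~ x @ \oo --> f x} ->
  {ae mu, forall x, forall n, `|f_ n x| <= g x} ->
  itg f /\ (fun n => \int[mu]_x f_ n x) @ \oo --> \int[mu]_x f x.
Proof.
move=> mf_ mf gi cf fg.
have [] := @dominated_convergence _ T R mu setT measurableT
  (fun n => EFin \o f_ n) (EFin \o f) (EFin \o g).
- by move=> n; exact/measurable_EFinP/mf_.
- exact/measurable_EFinP.
- apply: filterS cf => x /= cx _; apply: (cvg_EFin (FF := @eventually_filter)) => //.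
  exact: nearW.
- exact: gi.
- by apply: filterS fg => x /= cx n _; rewrite lee_fin.
move=> fi _ cvgi; split => //.
by move: cvgi; rewrite -IE// => /fine_cvg.
Qed.

(** Fatou's lemma for a convergent sequence: the common bound [C] on the integrals yields
    integrability of the limit together with the same bound, so membership in L2 can be inferred
    from norms alone. *)
Lemma itg_Fatou (F : nat -> T -> R) f C : (forall n, itg (F n)) -> meas f ->
  (forall n x, 0 <= F n x) -> {ae mu, forall x, F ^~ x @ \oo --> f x} ->
  (forall n, \int[mu]_x F n x <= C) ->
  {ae mu, forall x, 0 <= f x} -> itg f /\ \int[mu]_x f x <= C.
Proof.
move=> iF mf F0 cF FC f0.
have mF n : measurable_fun setT (EFin \o F n) by exact/measurable_EFinP/itg_meas.
have F0' n x : setT x -> (0 <= (EFin \o F n) x)%E by rewrite lee_fin.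
have ht := fatou mu measurableT mF F0'.
have aE : {ae mu, forall x, (EFin (`|f x|) = limn_esup (fun n => (F n x)%:E))}.
  apply: filterS2 cF f0 => x /= cx fx; apply/esym; rewrite ger0_norm//.
  by apply cvg_limn_einf_sup; apply: (cvg_EFin (FF := @eventually_filter)) => //; exact: nearW.
have aE' : {ae mu, forall x, limn_esup (fun n => (F n x)%:E) = limn_einf (fun n => (F n x)%:E)}.
  apply: filterS cF => x /= cx.
  have /cvg_limn_einf_sup[-> ->//] : (fun n => (F n x)%:E) @ \oo --> (f x)%:E.
  by apply: (cvg_EFin (FF := @eventually_filter)) => //; exact: nearW.
have mle : measurable_fun setT (fun x => limn_einf (fun n => (F n x)%:E)).
  (* The liminf is minus the limsup of the negatives, and measurability passes to a limsup of
     measurable functions. *)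
  rewrite (_ : (fun x => _) = (fun x => - limn_esup (fun n => (- F n x)%:E))%E).
    apply: measurableT_comp => //; apply: measurable_fun_limn_esup => n.
    by apply/measurable_EFinP/measN/itg_meas.
  by apply/funext => x; rewrite -limn_einfN; congr limn_einf; apply/funext => n /=; rewrite opprK.
have le1 : (\int[mu]_x `|f x|%:E <= C%:E)%E.
  rewrite (_ : (\int[mu]_x `|f x|%:E)%E = (\int[mu]_x limn_einf (fun n => (F n x)%:E))%E); last first.
    apply: ae_eq_integral => //; first by apply/measurable_EFinP; exact: meas_norm.
    by apply: filterS2 aE aE' => x /= -> ->.
  apply: (le_trans ht).
  rewrite limn_einf_lim; apply: lime_le; first exact: is_cvg_einfs.
  apply: nearW => n; apply: ge_ereal_inf.
  exists (\int[mu]_x (F n x)%:E)%E; first by exists n => //=.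
  by rewrite -IE// lee_fin.
have fi : itg f by apply: itgP => //; apply: (le_lt_trans le1); rewrite ltry.
split=> //; rewrite -lee_fin IE//.
apply: le_trans le1.
by apply: le_integral => //; [exact: itg_norm| move=> x _; rewrite lee_fin ler_norm].
Qed.

Definition sqi f := meas f /\ itg (fun x => f x ^+ 2).
(** The square of the L2 norm; keeping it squared makes the estimates polynomial in the
    integrals. *)
Definition n2 f := \int[mu]_x (f x ^+ 2).

Lemma sqi_itgM f g : sqi f -> sqi g -> itg (fun x => f x * g x).
Proof.
move=> [mf f2] [mg g2]; apply: (@itg_le _ (fun x => f x ^+ 2 + g x ^+ 2)).
- exact: measM.
- exact: itgD.
- move=> x; rewrite ler_norml; have := sqr_ge0 (f x - g x); have := sqr_ge0 (f x + g x); nra.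
Qed.

Lemma sqi_le f g : meas f -> sqi g -> (forall x, `|f x| <= `|g x|) -> sqi f.
Proof.
move=> mf [mg g2] fg; split => //; apply: (itg_le _ g2) => [|x]; first exact: measX.
by rewrite normrX -[leRHS]real_normK ?num_real// ler_sqr ?nnegrE.
Qed.

Lemma sqiZ (k : R) f : sqi f -> sqi (fun x => k * f x).
Proof.
move=> [mf f2]; split; first by apply: measM => //; exact: meas_cst.
by rewrite (_ : (fun _ => _) = (fun x => k ^+ 2 * f x ^+ 2)); [exact: itgZ|
  apply/funext => x; rewrite exprMn].
Qed.

Lemma sqiD f g : sqi f -> sqi g -> sqi (fun x => f x + g x).
Proof.
move=> sf sg; have [mf f2] := sf; have [mg g2] := sg; split; first exact: measD.
rewrite (_ : (fun _ => _) = (fun x => f x ^+ 2 + (2 * (f x * g x)  + g x ^+ 2))).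
  by apply: itgD => //; apply: itgD => //; apply: itgZ; exact: sqi_itgM.
by apply/funext => x; ring.
Qed.

Lemma sqiN f : sqi f -> sqi (fun x => - f x).
Proof. by move=> /(sqiZ (-1)); under eq_fun do rewrite mulN1r. Qed.

Lemma sqiB f g : sqi f -> sqi g -> sqi (fun x => f x - g x).
Proof. by move=> sf /sqiN; exact: sqiD. Qed.

Lemma sqi0 : sqi (fun _ => 0).
Proof. by split; [exact: meas_cst|rewrite expr0n/=; exact: itg0]. Qed.

Lemma sqi_norm f : sqi f -> sqi (fun x => `|f x|).
Proof. by move=> sf; apply: (sqi_le (meas_norm sf.1) sf) => x; rewrite normr_id. Qed.

Lemma sqiMb h f (M : R) : meas h -> (forall x, `|h x| <= M) -> sqi f ->
  sqi (fun x => h x * f x).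
Proof.
move=> mh hM sf; have M0 (t : T) : 0 <= M by rewrite (le_trans _ (hM t)).
apply: (@sqi_le _ (fun x => M * f x)); first exact: (measM mh sf.1).
  exact: sqiZ.
by move=> x; rewrite !normrM ler_wpM2r// (le_trans (hM x))// ler_norm.
Qed.

Lemma sqi_ae f g : sqi f -> meas g -> {ae mu, forall x, f x = g x} -> sqi g.
Proof.
move=> [mf f2] mg fg; split => //; apply: (itg_ae f2); first exact: measX.
by apply: filterS fg => x /= ->.
Qed.

Lemma n2_ae f g : meas f -> meas g -> {ae mu, forall x, f x = g x} -> n2 f = n2 g.
Proof.
move=> mf mg fg; apply: I_ae; [exact: measX|exact: measX|].
by apply: filterS fg => x /= ->.
Qed.

Lemma n2_ge0 f : 0 <= n2 f.
Proof. by apply: I_ge0 => x; exact: sqr_ge0. Qed.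

Lemma n2Z k f : sqi f -> n2 (fun x => k * f x) = k ^+ 2 * n2 f.
Proof.
by move=> [mf f2]; rewrite /n2 -IZ//; apply: eq_Rintegral => x _; rewrite exprMn.
Qed.

Lemma n2N f : n2 (fun x => - f x) = n2 f.
Proof. by apply: eq_Rintegral => x _; rewrite sqrrN. Qed.

Lemma n2E f g : sqi f -> sqi g ->
  n2 (fun x => f x + g x) = n2 f + 2 * \int[mu]_x (f x * g x) + n2 g.
Proof.
move=> sf sg; have [mf f2] := sf; have [mg g2] := sg; have fg := sqi_itgM sf sg.
rewrite /n2 -IZ// -ID//; last exact: itgZ.
rewrite -ID//; last by apply: itgD => //; exact: itgZ.
by apply: eq_Rintegral => x _; ring.
Qed.

Lemma n2BE f g : sqi f -> sqi g ->
  n2 (fun x => f x - g x) = n2 f - 2 * \int[mu]_x (f x * g x) + n2 g.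
Proof.
move=> sf sg; rewrite n2E//; last exact: sqiN.
rewrite n2N; congr (_ + _ + _).
under eq_Rintegral do rewrite mulrN.
by rewrite IN ?mulrN//; exact: sqi_itgM.
Qed.

End Generic_integral.

Lemma quad_disc (R : realType) (a b c : R) :
  (forall t : R, 0 <= a + 2 * b * t + c * t ^+ 2) -> 0 <= a -> 0 <= c ->
  b ^+ 2 <= a * c.
Proof.
move=> h a0 c0; have [cE|cn0] := eqVneq c 0.
  rewrite {}cE in h c0 *.
  have [->|bn0] := eqVneq b 0; first by rewrite mulr0 expr0n.
  (* At this point the affine function [a + 2 * b * t] equals -1, so a zero leading coefficient
     forces [b = 0]. *)
  have := h (- (a + 1) / (2 * b)); rewrite mul0r addr0.
  have -> : 2 * b * (- (a + 1) / (2 * b)) = - (a + 1) by field.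
  by lra.
have c1 : 0 < c by rewrite lt_neqAle eq_sym cn0.
have := h (- b / c).
have -> : a + 2 * b * (- b / c) + c * (- b / c) ^+ 2 = (a * c - b ^+ 2) / c by field.
by rewrite pmulr_lge0 ?invr_gt0// subr_ge0.
Qed.

Section L2_norm.
Context d (T : measurableType d) (R : realType) (mu : {measure set T -> \bar R}).
Implicit Types f g h : T -> R.
Local Notation n2 := (n2 mu).
Local Notation sqi := (sqi mu).

Lemma CS f g : sqi f -> sqi g -> (\int[mu]_x (f x * g x)) ^+ 2 <= n2 f * n2 g.
Proof.
move=> sf sg; apply: quad_disc; [|exact: n2_ge0|exact: n2_ge0] => t.
have sfg : sqi (fun x => t * g x) by exact: sqiZ.
have := n2_ge0 mu (fun x => f x + t * g x).
rewrite n2E// n2Z//.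
rewrite (_ : \int[mu]_x (f x * (t * g x)) = t * \int[mu]_x (f x * g x)); first by lra.
by rewrite -IZ; [apply: eq_Rintegral => x _; ring|exact: sqi_itgM].
Qed.

Lemma n2_le f g : meas f -> sqi g -> (forall x, `|f x| <= `|g x|) -> n2 f <= n2 g.
Proof.
move=> mf sg fg; have sf := sqi_le mf sg fg.
apply: I_le; [exact: sf.2|exact: sg.2|move=> x].
by rewrite -real_normK ?num_real// -[leRHS]real_normK ?num_real// ler_sqr ?nnegrE.
Qed.

Lemma n2D_le f g : sqi f -> sqi g -> n2 (fun x => f x + g x) <= 2 * n2 f + 2 * n2 g.
Proof.
move=> sf sg; rewrite /Defs.leb2; have := n2_ge0 mu (fun x => f x - g x); rewrite n2BE// n2E//; lra.
Qed.

Lemma n2_eq0 f : sqi f -> n2 f = 0 -> {ae mu, forall x, f x = 0}.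
Proof.
move=> [mf f2] f0; have := I_eq0_ae f2 (fun x => sqr_ge0 (f x)) f0.
by apply: filterS => x /= /eqP; rewrite sqrf_eq0 => /eqP.
Qed.

Lemma cvg_geo_step (u : nat -> R) (C : R) :
  (forall k, `|u k.+1 - u k| <= C * 2^-1 ^+ k) -> cvgn u.
Proof.
move=> hu.
have h2 : `|2^-1 : R| < 1 by rewrite gtr0_norm ?invr_gt0// invf_lt1// ltr1n.
have cs : cvgn (series (telescope u)).
  apply: normed_cvg; apply: (@series_le_cvg _ _ (geometric C 2^-1)).
  - by move=> n /=.
  - by move=> n; rewrite /geometric/= (le_trans _ (hu n)).
  - by move=> n; rewrite /geometric/= /telescope/=.
  - exact: is_cvg_geometric_series.
rewrite (_ : u = (fun n => u 0%N + series (telescope u) n)).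
  by apply: is_cvgD => //; exact: is_cvg_cst.
by apply/funext => n; rewrite -eq_sum_telescope.
Qed.

(** Riesz-Fischer. Along a subsequence the squared norms of the increments are at most 8^-k;
    weighted by 4^k they still have a finite sum [S] almost everywhere, and finiteness of [S x]
    bounds the increments at [x] by [sqrt (S x)] times 2^-k. Fatou's lemma then gives convergence in
    norm of the whole sequence. *)
Theorem L2_complete (f : nat -> T -> R) : (forall n, sqi (f n)) ->
  (forall e, 0 < e -> exists N, forall n m, (N <= n)%N -> (N <= m)%N ->
     n2 (fun x => f n x - f m x) <= e) ->
  exists2 g, sqi g & forall e, 0 < e -> exists N, forall n, (N <= n)%N ->
     n2 (fun x => f n x - g x) <= e.
Proof.
move=> sf cf.
have e8 (k : nat) : (0 : R) < 8^-1 ^+ k by rewrite exprn_gt0// invr_gt0.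
have [phi phiP] := choice (fun k => cf _ (e8 k)).
(* The maximum over all earlier thresholds lets consecutive indices meet the Cauchy bound of rank
   [k], and [k <= nk k] serves at the end to pass the threshold [N]. *)
pose nk k := maxn k (\max_(j < k.+1) phi j)%N.
have nkP j k : (j <= k)%N -> (phi j <= nk k)%N.
  move=> jk; rewrite /nk leq_max; apply/orP; right.
  by apply: (@leq_bigmax _ (fun j : 'I_k.+1 => phi j) (Ordinal (jk : (j < k.+1)%N))).
pose h k := f (nk k).
have sh k : sqi (h k) by exact: sf.
have hk k : n2 (fun x => h k.+1 x - h k x) <= 8^-1 ^+ k.
  by apply: phiP; apply: nkP.
pose F k (x : T) := (4 ^+ k * (h k.+1 x - h k x) ^+ 2 : R).
have F0 k (x : T) : 0 <= F k x by apply: mulr_ge0; [exact: exprn_ge0|exact: sqr_ge0].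
have iF k : itg mu (F k) by apply: itgZ; exact: (sqiB (sh _) (sh _)).2.
have mF k : measurable_fun setT (EFin \o F k) by exact/measurable_EFinP/itg_meas.
pose S (x : T) := (\sum_(0 <= k <oo) (F k x)%:E)%E.
have mS : measurable_fun setT S.
  apply: (@ge0_emeasurable_sum _ _ _ _ (fun k x => (F k x)%:E) xpredT) => //.
  - by move=> k x _ _; rewrite lee_fin.
  - by move=> k _; exact: mF.
have S0 (x : T) : (0 <= S x)%E by apply: nneseries_ge0 => k _ _; rewrite lee_fin.
have IS : (\int[mu]_x S x < +oo)%E.
  rewrite integral_nneseries//; last by move=> k x _; rewrite lee_fin.
  apply: (@le_lt_trans _ _ (\sum_(0 <= k <oo) (2^-1 ^+ k : R)%:E)%E).
    apply: lee_nneseries => [k _ _|k _].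
      by apply: integral_ge0 => x _; rewrite lee_fin.
    rewrite -IE// lee_fin IZ; last exact: (sqiB (sh _) (sh _)).2.
    apply: (@le_trans _ _ (4 ^+ k * 8^-1 ^+ k)); first by apply: ler_wpM2l; [exact: exprn_ge0|exact: hk].
    by rewrite -exprMn (_ : 4 * 8^-1 = 2^-1 :> R)//; field.
  have h2 : `|2^-1 : R| < 1 by rewrite gtr0_norm ?invr_gt0// invf_lt1// ltr1n.
  have := @cvg_geometric_series R 1 2^-1 h2.
  move=> cg.
  have -> : (\sum_(0 <= k <oo) (2^-1 ^+ k : R)%:E)%E = (1 * (1 - 2^-1)^-1)%:E.
    apply/cvg_lim => //.
    rewrite (_ : (fun n => _) = EFin \o series (geometric 1 2^-1)).
      by apply: (cvg_EFin (FF := @eventually_filter)) => //; exact: nearW.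
    apply/funext => n /=; rewrite /series/= -sumEFin; apply: eq_bigr => i _.
    by rewrite /geometric/= mul1r.
  exact: ltry.
have iS : mu.-integrable setT S.
  by apply/integrableP; split => //; under eq_integral do rewrite gee0_abs//.
pose A := [set x | (S x < +oo)%E].
have mA : measurable A by rewrite -[A]setTI; exact: emeasurable_fun_infty_o.
have aA : {ae mu, forall x, A x}.
  have := integrable_ae measurableT iS; apply: filterS => x /= /(_ I).
  by rewrite fin_numE => /andP[_ /eqP Sy]; rewrite /A/= ltey; apply/eqP.
(* Setting the sequence to 0 off [A] makes it converge everywhere, so that its limit is
   measurable. *)
pose h' k x := h k x * \1_A x.
have ch' (x : T) : cvgn (h' ^~ x).
  have [Ax|Ax] := pselect (A x); last first.
    rewrite (_ : h' ^~ x = (fun _ => 0)); first exact: is_cvg_cst.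
    by apply/funext => k; rewrite /h' indicE memNset// mulr0.
  have SE : (S x)%E = (fine (S x))%:E by rewrite fineK// ge0_fin_numE.
  apply: (@cvg_geo_step _ (Num.sqrt (fine (S x)))) => k.
  rewrite /h' indicE mem_set// !mulr1.
  have : ((F k x)%:E <= S x)%E.
    apply: (le_trans _ (nneseries_lim_ge k.+1 _)); last by move=> i _ _; rewrite lee_fin.
    by rewrite sumEFin lee_fin big_nat_recr//= lerDr sumr_ge0.
  have s0 : 0 <= fine (S x) by exact: fine_ge0.
  rewrite SE lee_fin /F; move: (fine (S x)) s0 => s s0 Fk.
  rewrite -(@ler_pXn2r _ 2%N) ?nnegrE ?mulr_ge0 ?sqrtr_ge0 ?exprn_ge0//.
  rewrite real_normK ?num_real// exprMn sqr_sqrtr//.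
  rewrite -exprM mulnC exprM -(@ler_pM2l _ (4 ^+ k)) ?exprn_gt0//.
  have E4 : 4 ^+ k * (2^-1 ^+ 2) ^+ k = 1 :> R.
    by rewrite -exprMn (_ : 4 * 2^-1 ^+ 2 = 1 :> R) ?expr1n//; field.
  by rewrite [leRHS]mulrCA E4 mulr1.
pose g x := lim (h' ^~ x @ \oo).
have hg (x : T) : h' ^~ x @ \oo --> g x by exact: ch'.
have mh' k : meas (h' k) by apply: measM; [exact: (sh k).1|exact: meas_indic].
have mg : meas g by apply: (@measurable_fun_cvg _ _ _ _ h') => // x _; exact: hg.
have key e : 0 < e -> exists N, forall n, (N <= n)%N ->
    itg mu (fun x => (f n x - g x) ^+ 2) /\ n2 (fun x => f n x - g x) <= e.
  move=> e0; have [N NP] := cf _ e0.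
  exists N => n nN.
  have sfh k : sqi (fun x => f n x - h (k + N)%N x) by exact: sqiB.
  have sfh' k : sqi (fun x => f n x - h' (k + N)%N x).
    apply: (sqi_ae (sfh k)); first by apply: measB => //; exact: (sf n).1.
    by apply: filterS aA => x Ax; rewrite /h' indicE mem_set// mulr1.
  apply: (@itg_Fatou _ _ _ mu (fun k x => (f n x - h' (k + N)%N x) ^+ 2)).
  - by move=> k; exact: (sfh' k).2.
  - by apply/measX/measB => //; exact: (sf n).1.
  - by move=> k x; exact: sqr_ge0.
  - apply: aeW => x.
    have hgN : (fun k => h' (k + N)%N x) @ \oo --> g x.
      by rewrite (cvg_shiftn N (h' ^~ x)); exact: hg.
    by apply: cvgM; apply: cvgB => //; exact: cvg_cst.
  - move=> k; apply: le_trans (NP n (nk (k + N)%N) nN _); last first.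
      by rewrite /nk leq_max leq_addl.
    rewrite le_eqVlt; apply/orP; left; apply/eqP.
    apply: n2_ae; [exact: (sfh' k).1|exact: (sfh k).1|].
    by apply: filterS aA => x Ax; rewrite /h' indicE mem_set// mulr1.
  - by apply: aeW => x; exact: sqr_ge0.
exists g; last by move=> e e0; have [N NP] := key e e0; exists N => n /NP[].
have [N /(_ N (leqnn _))[i1 _]] := key 1 ltr01.
have s1 : sqi (fun x => f N x - g x) by split => //; apply: measB => //; exact: (sf N).1.
have := sqiB (sf N) s1; rewrite (_ : (fun x => _) = g)//.
by apply/funext => x; ring.
Qed.

End L2_norm.

(** * Measure-preserving maps of the plane *)

Section Measure_preserving.
Context d (T : measurableType d) (R : realType) (mu : {measure set T -> \bar R}).

Definition mpres (A : T -> T) := measurable_fun setT A /\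
  forall S, measurable S -> mu (A @^-1` S) = mu S.

Lemma mpres_id : mpres id.
Proof. by split. Qed.

Lemma mpres_comp A B : mpres A -> mpres B -> mpres (A \o B).
Proof.
move=> [mA hA] [mB hB]; split; first exact: measurableT_comp.
move=> S mS; rewrite comp_preimage hB ?hA// -[X in measurable X]setTI.
exact: mA.
Qed.

Lemma mp_int A (f : T -> \bar R) : mpres A -> measurable_fun setT f ->
  (forall x, 0 <= f x)%E -> (\int[mu]_x f (A x) = \int[mu]_x f x)%E.
Proof.
move=> [mA hA] mf f0.
rewrite -[LHS](@ge0_integral_pushforward _ _ T T R A mA mu setT f)//.
by apply: eq_measure_integral => S mS _ /=; exact: hA.
Qed.

Lemma mp_meas A (f : T -> R) : mpres A -> meas f -> meas (f \o A).
Proof. by move=> [mA _] mf; exact: measurableT_comp. Qed.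

Lemma mp_itg A (f : T -> R) : mpres A -> itg mu f -> itg mu (f \o A).
Proof.
move=> pA fi; apply: itgP; first exact: mp_meas (itg_meas fi).
have -> : (\int[mu]_x `|(f \o A) x|%:E = \int[mu]_x `|f x|%:E)%E.
  rewrite (@mp_int A (fun x => `|f x|%:E))//.
  by apply/measurable_EFinP/meas_norm; exact: itg_meas fi.
exact: itg_lt.
Qed.

Lemma mp_I A (f : T -> R) : mpres A -> itg mu f ->
  \int[mu]_x f (A x) = \int[mu]_x f x.
Proof.
move=> pA fi; congr fine; have [mA hA] := pA.
rewrite -[LHS](@integral_pushforward _ _ T T R A mA mu setT (EFin \o f))//.
- by apply: eq_measure_integral => S mS _ /=; exact: hA.
- by apply/measurable_EFinP; exact: itg_meas fi.
- by rewrite preimage_setT; exact: (mp_itg pA fi).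
Qed.

Lemma mp_ae A (P : T -> Prop) : mpres A ->
  {ae mu, forall x, P x} -> {ae mu, forall x, P (A x)}.
Proof.
move=> [mA hA] [N [mN N0 PN]]; exists (A @^-1` N); split.
- by rewrite -[X in measurable X]setTI; exact: mA.
- by rewrite hA.
- by move=> x /= nP; apply: PN.
Qed.

Lemma mp_sqi A (f : T -> R) : mpres A -> sqi mu f -> sqi mu (f \o A).
Proof. by move=> pA [mf f2]; split; [exact: mp_meas|exact: mp_itg pA f2]. Qed.

Lemma mp_n2 A (f : T -> R) : mpres A -> sqi mu f -> n2 mu (f \o A) = n2 mu f.
Proof. by move=> pA [mf f2]; exact: (mp_I pA f2). Qed.

End Measure_preserving.

Section Plane.
Context {R : realType}.
Local Notation M := (measurableTypeR R).
Local Notation T2 := (M * M)%type.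
Local Notation lam := (@lebesgue_measure R).
Local Notation mu := (leb2 R).

(** The pushforward and Lebesgue measure agree on half-open intervals, which determine them. *)
Lemma mpres_shift (a : R) : mpres lam (fun x : M => (x + a : M)).
Proof.
have ma : measurable_fun setT (fun x : M => (x + a : M)).
  exact: (measD (@measurable_id _ _ _) (meas_cst _)).
split=> // S mS.
have := @lebesgue_measure_unique R (pushforward lam (fun x : M => (x + a : M))).
move=> h; apply/esym; apply: (h ma _ S mS).
move=> _ [[c e]] _ <- /=.
rewrite /pushforward.
rewrite (_ : _ @^-1` _ = `]c - a, e - a]%classic); last first.
  by apply/seteqP; split=> x /=; rewrite !in_itv/= ltrBlDr lerBrDr.
rewrite !lebesgue_measure_itv/= !lte_fin ltrD2r -!EFinB.
by rewrite (_ : e - a - (c - a) = e - c)//; ring.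
Qed.

Lemma mpres_swap : mpres mu (fun x : T2 => (x.2, x.1) : T2).
Proof.
have ms : measurable_fun setT (fun x : T2 => (x.2, x.1) : T2) by exact: measurable_swap.
split; [exact: ms|move=> S mS].
have := @product_measure_unique _ _ M M R lam lam (pushforward mu (fun x : T2 => (x.2, x.1) : T2)).
move=> h; apply/esym; apply: (h ms _ S mS) => A B mA mB; rewrite -[LHS]/(mu ((fun x : T2 => (x.2, x.1) : T2) @^-1` (A `*` B))).
rewrite (_ : _ @^-1` _ = B `*` A); last by apply/seteqP; split=> x /= [].
by apply: (etrans (product_measure1E lam lam mB mA)); rewrite muleC.
Qed.

(** Each vertical section of the preimage is a translate of a section of the set, so the claim is
    translation invariance on lines followed by integration in the first variable. *)
Lemma mpres_shear (b : M -> M) : measurable_fun setT b ->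
  mpres mu (fun x : T2 => (x.1, x.2 + b x.1) : T2).
Proof.
move=> mb.
have ms : measurable_fun setT (fun x : T2 => (x.1, x.2 + b x.1) : T2).
  apply: measurable_fun_pair => //=.
  by apply: measurable_funD => //; exact: measurableT_comp.
split; [exact: ms|move=> S mS]; rewrite /leb2 /= /product_measure1/=; apply: eq_integral => x _ /=.
rewrite -((mpres_shift (b x)).2 (xsection S x)); last exact: measurable_xsection.
by congr (lam _); rewrite !xsectionE.
Qed.

Lemma mpres_translate (a : R * R) : mpres mu (fun x : T2 => (x.1 + a.1, x.2 + a.2) : T2).
Proof.
have s2 : mpres mu (fun x : T2 => (x.1, x.2 + a.2) : T2).
  by apply: (@mpres_shear (fun=> a.2)); exact: measurable_cst.
have s1 : mpres mu (fun x : T2 => (x.1, x.2 + a.1) : T2).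
  by apply: (@mpres_shear (fun=> a.1)); exact: measurable_cst.
exact: (mpres_comp (mpres_comp (mpres_comp mpres_swap s1) mpres_swap) s2).
Qed.

Definition rot (c s : R) (x : R * R) : R * R := (c * x.1 - s * x.2, s * x.1 + c * x.2).

Lemma rot_comp c s c' s' x :
  rot c s (rot c' s' x) = rot (c * c' - s * s') (s * c' + c * s') x.
Proof. by rewrite /rot/=; congr (_, _); ring. Qed.

Lemma rot10 x : rot 1 0 x = x.
Proof. by case: x => x y; rewrite /rot/=; congr (_, _); ring. Qed.

(** For [s != 0] a rotation is a product of three shears: along the first axis by [(c - 1) / s],
    along the second by [s], and the first one again. The half turn is the square of the quarter
    turn. *)
Lemma mpres_rot (c s : R) : c ^+ 2 + s ^+ 2 = 1 -> mpres mu (rot c s : T2 -> T2).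
Proof.
have sh1 (a : R) : mpres mu (fun x : T2 => (x.1, x.2 + a * x.1) : T2).
  by apply: (@mpres_shear (fun t : M => a * t : M)); exact: (measM (meas_cst _) (@measurable_id _ _ _)).
have sh2 (a : R) : mpres mu (fun x : T2 => (x.1 + a * x.2, x.2) : T2).
  exact: (mpres_comp (mpres_comp mpres_swap (sh1 a)) mpres_swap).
have main c' s' : s' != 0 -> c' ^+ 2 + s' ^+ 2 = 1 -> mpres mu (rot c' s' : T2 -> T2).
  move=> s0 cs.
  have := mpres_comp (mpres_comp (sh2 ((c' - 1) / s')) (sh1 s')) (sh2 ((c' - 1) / s')).
  congr mpres; apply/funext => x; rewrite /rot/=; congr (_, _); last by field.
  have sE : s' = - ((c' ^+ 2 - 1) / s') by apply: (mulIf s0); rewrite mulNr divfK//; lra.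
  rewrite [s' * x.2](_ : _ = - ((c' ^+ 2 - 1) / s') * x.2); last by rewrite -sE.
  by field.
move=> cs; have [s0|s0] := eqVneq s 0; last exact: main.
have : c = 1 \/ c = -1.
  have /eqP : (c - 1) * (c + 1) = 0 by rewrite s0 in cs; lra.
  by rewrite mulf_eq0 subr_eq0 addr_eq0 => /orP[] /eqP; [left|right].
have pq : mpres mu (rot 0 1 : T2 -> T2) by apply: main; [exact: oner_neq0|ring].
case=> ->; rewrite s0.
  by have := mpres_id mu; congr mpres; apply/funext => x /=; rewrite rot10.
have := mpres_comp pq pq; congr mpres; apply/funext => x /=.
by rewrite rot_comp; congr rot; ring.
Qed.

End Plane.

(** * Test functions *)

Section Smooth1.
Context {R : realType}.
Implicit Types f g : R -> R.

(* Coinductive characterization of C^infinity functions, which makes closure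
   properties one-step verifications. *)
Definition smooth1 f := exists C : set (R -> R), C f /\
  forall g, C g -> exists g', C g' /\ forall x, is_derive x (1 : R) g (g' x).

Lemma smooth1_der f : smooth1 f ->
  exists f', smooth1 f' /\ forall x, is_derive x (1 : R) f (f' x).
Proof. by move=> [C [Cf hC]]; have [f' [Cf' df]] := hC _ Cf; exists f'; split => //; exists C. Qed.

(** Coinduction up to smoothness: a derivative may leave the class [C] as long as it is already
    known to be smooth. *)
Lemma smooth1_coind (C : set (R -> R)) : (forall g, C g ->
    exists g', (C g' \/ smooth1 g') /\ forall x, is_derive x (1 : R) g (g' x)) ->
  forall f, C f -> smooth1 f.
Proof.
move=> hC f Cf; exists (fun g => C g \/ smooth1 g); split; first by left.
move=> g [/hC//|/smooth1_der[g' [sg' dg]]].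
by exists g'; split => //; right.
Qed.

Lemma smooth1_cont f : smooth1 f -> continuous f.
Proof.
move=> /smooth1_der[f' [_ df]] x.
apply/differentiable_continuous/derivable1_diffP.
by have [] := df x.
Qed.

Lemma smooth1_lin (c : R) f g : smooth1 f -> smooth1 g -> smooth1 (fun x => c * f x + g x).
Proof.
move=> sf sg.
pose C := [set h : R -> R | exists f g, [/\ smooth1 f, smooth1 g & h = (fun x => c * f x + g x)]].
apply: (@smooth1_coind C); last by exists f, g.
move=> _ [f1 [g1 [/smooth1_der[f' [sf' df]] /smooth1_der[g' [sg' dg]] ->]]].
exists (fun x => c * f' x + g' x); split; first by left; exists f', g'.
by move=> x; apply: is_deriveD; apply: is_deriveZ.
Qed.

(** By the Leibniz rule the derivative of a product of smooth functions is a sum of such products.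
    This class is therefore stable under differentiation, which is what coinduction asks for. *)
Inductive prodcl : (R -> R) -> Prop :=
| prodcl_mul f g : smooth1 f -> smooth1 g -> prodcl (fun x => f x * g x)
| prodcl_add f g : prodcl f -> prodcl g -> prodcl (fun x => f x + g x).

Lemma smooth1M f g : smooth1 f -> smooth1 g -> smooth1 (fun x => f x * g x).
Proof.
move=> sf sg; apply: (@smooth1_coind prodcl); last exact: prodcl_mul.
move=> h; elim=> {f g sf sg h} [f g sf sg|f g _ [f' [sf' df]] _ [g' [sg' dg]]].
  have [f' [sf' df]] := smooth1_der sf; have [g' [sg' dg]] := smooth1_der sg.
  exists (fun x => f x * g' x + g x * f' x); split.
    by left; apply: prodcl_add; apply: prodcl_mul.
  by move=> x; exact: is_deriveM.
have P1 h : prodcl h \/ smooth1 h -> prodcl h.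
  case=> // sh.
  have s1 : smooth1 (fun=> 1).
    exists [set h | exists c : R, h = fun=> c]; split; first by exists 1.
    by move=> _ [c ->]; exists (fun=> 0); split; [exists 0|move=> x; exact: is_derive_cst].
  rewrite (_ : h = (fun x => 1 * h x)); first exact: prodcl_mul.
  by apply/funext => x; rewrite mul1r.
exists (fun x => f' x + g' x); split; first by left; apply: prodcl_add; exact: P1.
by move=> x; exact: is_deriveD.
Qed.

Lemma smooth1_poly (p : {poly R}) : smooth1 (horner p).
Proof.
exists (range (fun p : {poly R} => horner p)); split; first by exists p.
move=> _ [q _ <-]; exists (horner q^`()); split; first by exists q^`().
by move=> x; exact: is_derive_poly.
Qed.

Lemma smooth1_id : smooth1 id.
Proof. by have := smooth1_poly 'X; congr smooth1; apply/funext => x; rewrite hornerX. Qed.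

Lemma smooth1_cst (c : R) : smooth1 (fun=> c).
Proof. by have := smooth1_poly c%:P; congr smooth1; apply/funext => x; rewrite hornerC. Qed.

Lemma is_derive_affine (a b x : R) : is_derive x 1 (fun t : R => a * t + b) a.
Proof.
have h := @is_deriveD R R R _ _ x 1 _ _ (@is_deriveZ R R R id a x 1 1 (is_derive_id x 1)) (is_derive_cst b x 1).
by apply: (is_derive_eq h); rewrite addr0 [_ *: _]mulr1.
Qed.

Lemma smooth1_affine (a b : R) f : smooth1 f -> smooth1 (fun x => f (a * x + b)).
Proof.
move=> sf.
pose C := [set h : R -> R | exists f, smooth1 f /\ h = (fun x => f (a * x + b))].
apply: (@smooth1_coind C); last by exists f.
move=> _ [f1 [/smooth1_der[f' [sf' df]] ->]].
exists (fun x => a * f' (a * x + b)); split.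
  left; exists (fun x => a * f' x + 0); split; first by apply: smooth1_lin => //; exact: smooth1_cst.
  by apply/funext => x; rewrite addr0.
move=> x; rewrite mulrC.
exact: (@is_derive1_comp R f1 (fun x : R => a * x + b) x _ _ (df _) (is_derive_affine a b x)).
Qed.

Lemma smooth1_primitive f F : smooth1 f -> (forall x, is_derive x (1 : R) F (f x)) ->
  smooth1 F.
Proof.
move=> sf dF; apply: (@smooth1_coind [set F]) => // _ ->.
by exists f; split => //; right.
Qed.

(** The growth bound behind the flatness of exp(-1/x) at 0: with t = 1/x and [k = 2] it makes p(1/x)
    exp(-1/x) of order x^2 there. *)
Lemma poly_expN_bound (p : {poly R}) k :
  exists2 C : R, 0 <= C & forall t, 0 <= t -> `|p.[t]| * t ^+ k * expR (- t) <= C.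
Proof.
have e1 n t : 0 <= t -> t ^+ n * expR (- t) <= n`!%:R.
  move=> t0; rewrite expRN ler_pdivrMr ?expR_gt0//.
  case: n => [|n]; first by rewrite expr0 mul1r (le_trans _ (expR_ge1Dx t))// lerDl.
  rewrite mulrC -ler_pdivrMr ?ltr0n ?fact_gt0//.
  by rewrite (le_trans _ (expR_ge1Dxn n t0))// lerDr.
elim/poly_ind: p k => [|p c ih] k.
  by exists 0 => // t t0; rewrite horner0 normr0 !mul0r.
have [C C0 hC] := ih k.+1.
exists (C + `|c| * k`!%:R) => [|t t0]; first by rewrite addr_ge0// mulr_ge0.
rewrite hornerMXaddC.
apply: (@le_trans _ _ (`|p.[t]| * t ^+ k.+1 * expR (- t) + `|c| * (t ^+ k * expR (- t)))).
  rewrite (_ : _ + _ = (`|p.[t] * t| + `|c|) * t ^+ k * expR (- t)).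
    by rewrite !ler_wpM2r ?expR_ge0 ?exprn_ge0// ler_normD.
  by rewrite normrM (ger0_norm t0) exprS; ring.
by apply: lerD; [exact: hC|rewrite ler_wpM2l// e1].
Qed.

Lemma is_derive_quadratic (g : R -> R) (x C : R) :
  (forall h, `|g (h + x) - g x| <= C * h ^+ 2) -> is_derive x (1 : R) g 0.
Proof.
move=> gC.
have cv : (fun h => h^-1 *: ((g \o shift x) (h *: (1 : R)) - g x)) @ 0^' --> (0 : R).
  apply/cvgr0Pnorm_le => e e0; near=> h.
  have h0 : h != 0 by near: h; exact: nbhs_dnbhs_neq.
  rewrite /= [_ *: 1]mulr1 normrM normfV.
  rewrite ler_pdivrMl ?normr_gt0//; apply: (le_trans (gC h)).
  rewrite -real_normK ?num_real// expr2 mulrCA ler_wpM2l//.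
  apply: (@le_trans _ _ ((`|C| + 1) * `|h|)).
    by rewrite ler_wpM2r// (le_trans (ler_norm C))// lerDl.
  rewrite mulrC -ler_pdivlMr ?ltr_wpDl//.
  near: h; apply: dnbhs0_le; by rewrite divr_gt0// ltr_wpDl.
by apply: DeriveDef; [apply/cvg_ex; exists 0|exact/cvg_lim].
Unshelve. all: by end_near. Qed.

(** The function p(1/x) exp(-1/x) on the positive half-line, extended by 0. Carrying the polynomial
    along makes the family stable under differentiation, [p] being replaced by X^2 (p - p'). *)
Definition flat (p : {poly R}) (x : R) : R :=
  if 0 < x then p.[x^-1] * expR (- x^-1) else 0.

Lemma is_derive_near (f g : R -> R) (x a : R) : (\forall y \near x, f y = g y) ->
  is_derive x (1 : R) f a -> is_derive x (1 : R) g a.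
Proof.
move=> fg [df <-]; apply: DeriveDef.
  by apply: (near_eq_derivable _ df) => //; near: fg.
exact/esym/near_eq_derive.
Qed.

Lemma flat_der p x : is_derive x (1 : R) (flat p) (flat ('X^2 * (p - p^`())) x).
Proof.
have [x0|x0|x0] := ltgtP x 0.
- rewrite {2}/flat ltNge (ltW x0)/=.
  apply: (@is_derive_near (fun=> 0)).
  by near=> y; rewrite /flat ltNge ltW//; near: y; exact: lt_nbhsl.
- have xi : is_derive x (1 : R) (fun t : R => t^-1) (- x^-2 *: (1 : R)).
    by apply: (@is_deriveV R id x 1 1); exact: lt0r_neq0.
  apply: (@is_derive_near (fun t => p.[t^-1] * expR (- t^-1))).
    near=> y; rewrite /flat ifT//; near: y; exact: lt_nbhsr.
  have h1 := @is_derive1_comp R (horner p) _ x _ _ (is_derive_poly p x^-1) xi.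
  have h2 := @is_derive1_comp R (expR \o -%R) _ x _ _ (@is_derive1_comp R expR -%R x^-1 _ _ (is_derive_expR _) (is_deriveNid _ _)) xi.
  have h3 := @is_deriveM R R _ _ x 1 _ _ h1 h2; apply: (is_derive_eq h3).
  rewrite /flat x0 /= !hornerE/= -![_ *: _]/(_ * _).
  by field; exact: lt0r_neq0.
- rewrite x0 {2}/flat ltxx.
  have [C C0 hC] := poly_expN_bound p 2.
  apply: (@is_derive_quadratic _ _ C) => h; rewrite addr0 {2}/flat ltxx subr0 /flat.
  case: ifPn => h0; last by rewrite normr0 mulr_ge0// sqr_ge0.
  have := hC h^-1; rewrite invr_ge0 (ltW h0) => /(_ isT).
  rewrite normrM (gtr0_norm (expR_gt0 _)) mulrAC exprVn -ler_pdivlMr ?invr_gt0 ?exprn_gt0//.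
  by rewrite invrK.
Unshelve. all: by end_near. Qed.

Lemma smooth1_flat p : smooth1 (flat p).
Proof.
exists (range flat); split; first by exists p.
move=> _ [q _ <-]; exists (flat ('X^2 * (q - q^`()))); split; first by exists ('X^2 * (q - q^`())).
exact: flat_der.
Qed.

Definition bump f := smooth1 f /\ exists K : R, forall x, K < `|x| -> f x = 0.

Lemma bump_lin (c : R) f g : bump f -> bump g -> bump (fun x => c * f x + g x).
Proof.
move=> [sf [K hK]] [sg [L hL]]; split; first exact: smooth1_lin.
exists (Num.max K L) => x; rewrite gt_max => /andP[Kx Lx].
by rewrite hK// hL// mulr0 addr0.
Qed.

Lemma bumpMl f g : smooth1 f -> bump g -> bump (fun x => f x * g x).
Proof.
move=> sf [sg [L hL]]; split; first exact: smooth1M.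
by exists L => x Lx; rewrite hL// mulr0.
Qed.

Lemma bump_der f : bump f -> exists f', bump f' /\ forall x, is_derive x (1 : R) f (f' x).
Proof.
move=> [sf [K hK]]; have [f' [sf' df]] := smooth1_der sf.
exists f'; split => //; split => //; exists K => x Kx.
have h : is_derive x (1 : R) f 0.
  apply: (@is_derive_near (fun=> 0)).
  near=> y; rewrite hK//; near: y.
  have /(_ x) cn : continuous (fun t : R => `|t|) by exact: norm_continuous.
  exact: (cvgr_gt _ cn).
by have [_ <-] := df x; have [_ ->] := h.
Unshelve. all: by end_near. Qed.

Lemma bump_bounded f : bump f -> exists M : R, forall x, `|f x| <= M.
Proof.
move=> [sf [K hK]].
have cf : compact (f @` `[- K, K]%classic).
  apply: continuous_compact; last exact: segment_compact.
  by apply: continuous_subspaceT; exact: smooth1_cont.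
have [M [_ hM]] := compact_bounded cf.
have := hM (M + 1) (ltac:(by rewrite ltrDl)) => hM'.
exists (Num.max (M + 1) 0) => x; have [xK|/hK ->] := leP `|x| K; last by rewrite normr0 le_max lexx orbT.
by rewrite le_max hM'//=; exists x => //; rewrite /= in_itv/= -ler_norml.
Qed.

(** A smooth bump supported in [a, b]: each factor is exp(-1/t) with t equal to [n] times the
    distance to one endpoint. As [n] grows it tends to 1 inside, so indicators of intervals are
    bounded limits of bumps. *)
Definition box (n : nat) (a b x : R) : R :=
  flat 1 (n%:R * x + - (n%:R * a)) * flat 1 ((- n%:R) * x + n%:R * b).

Lemma flat1_bound x : 0 <= flat 1 x <= 1.
Proof.
rewrite /flat; case: ifPn => x0; last by rewrite lexx ler01.
rewrite hornerE mul1r expR_ge0/= -expR0 ler_expR oppr_le0 invr_ge0.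
exact: ltW.
Qed.

Lemma box_bound n a b x : 0 <= box n a b x <= 1.
Proof.
have /andP[h1 h2] := flat1_bound (n%:R * x + - (n%:R * a)).
have /andP[h3 h4] := flat1_bound ((- n%:R) * x + n%:R * b).
by rewrite mulr_ge0//= mulr_ile1.
Qed.

Lemma box_out n a b x : ~~ (a < x < b) -> box n a b x = 0.
Proof.
rewrite negb_and -!leNgt => /orP[xa|bx].
  rewrite /box {1}/flat ifF ?mul0r//; apply/negbTE; rewrite -leNgt.
  by rewrite subr_le0 ler_wpM2l.
rewrite /box {2}/flat ifF ?mulr0//; apply/negbTE; rewrite -leNgt.
by rewrite mulNr addrC subr_le0 ler_wpM2l.
Qed.

Lemma bump_box n a b : bump (box n a b).
Proof.
split.
  by apply: smooth1M; apply: (@smooth1_affine _ _ (flat 1)); exact: smooth1_flat.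
exists (Num.max `|a| `|b|) => x; rewrite gt_max => /andP[ax bx].
apply: box_out; apply/negP => /andP[ax' bx'].
have [x0|x0] := leP 0 x.
  have := ler_norm b; have := ger0_norm x0; lra.
have := ler_norm (- a); rewrite normrN; have := ltr0_norm x0; lra.
Qed.

Lemma flat1_cvg x : 0 < x -> (fun n : nat => flat 1 (n%:R * x)) @ \oo --> (1 : R).
Proof.
move=> x0; rewrite -[X in _ --> X](expR0) -oppr0.
have cz : (fun n : nat => (n%:R * x)^-1) @ \oo --> (0 : R).
  apply/cvgrPdist_le => e e0; near=> n.
  rewrite sub0r normrN gtr0_norm ?invr_gt0 ?mulr_gt0// ?ltr0n; last by near: n; exact: nbhs_infty_gt.
  rewrite invfM -ler_pdivlMr ?invr_gt0// invrK -[leRHS]invrK lef_pV2 ?posrE ?invr_gt0 ?mulr_gt0// ?ltr0n; last first.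
    by near: n; exact: nbhs_infty_gt.
  by near: n; exact: nbhs_infty_ger.
have : (fun n : nat => expR (- (n%:R * x)^-1)) @ \oo --> expR (- 0).
  apply: (cvg_comp _ _ (cvgN cz)); exact: continuous_expR.
apply: cvg_trans; apply: near_eq_cvg; near=> n.
by rewrite /flat ifT ?hornerE ?mul1r// mulr_gt0// ltr0n; near: n; exact: nbhs_infty_gt.
Unshelve. all: by end_near. Qed.

End Smooth1.

Section Smooth2.
Context {R : realType}.
Local Notation R2 := (R * R)%type.
Implicit Types (f g phi : R2 -> R) (x e : R2).

Lemma is_derive_line f x e (df : R) :
  is_derive (0 : R) (1 : R) (fun h : R => f (h *: e + x)) df -> is_derive x e f df.
Proof.
have E : (fun h => h^-1 *: ((f \o shift x) (h *: e) - f x)) =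
  (fun h => h^-1 *: (((fun h : R => f (h *: e + x)) \o shift 0) (h *: (1 : R)) - f (0 *: e + x))).
  by apply/funext => h /=; rewrite addr0 scale0r add0r [_ *: 1]mulr1.
by move=> [d1 d2]; apply: DeriveDef; [rewrite /derivable E|rewrite /derive E].
Qed.

Lemma is_derive_lineP f x e (df : R) :
  is_derive x e f df -> is_derive (0 : R) (1 : R) (fun h : R => f (h *: e + x)) df.
Proof.
have E : (fun h => h^-1 *: ((f \o shift x) (h *: e) - f x)) =
  (fun h => h^-1 *: (((fun h : R => f (h *: e + x)) \o shift 0) (h *: (1 : R)) - f (0 *: e + x))).
  by apply/funext => h /=; rewrite addr0 scale0r add0r [_ *: 1]mulr1.
by move=> [d1 d2]; apply: DeriveDef; [rewrite /derivable -E|rewrite /derive -E].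
Qed.

Lemma smooth_coind (C : set (R2 -> R)) : (forall g, C g -> continuous g /\
    forall e, exists g', C g' /\ forall x, is_derive x e g (g' x)) ->
  forall g, C g -> smooth g.
Proof.
move=> hC g Cg es.
have Ces : C (iter_derive es g).
  elim: es => //= e es ih; have [_ /(_ e)[g' [Cg' dg]]] := hC _ ih.
  by rewrite (_ : 'D_e _ = g')//; apply/funext => x; have [] := dg x.
have [cg dg] := hC _ Ces; split => // x e; have [g' [_ /(_ x)[]]] := dg e.
by [].
Qed.

Lemma smooth_cont f : smooth f -> continuous f.
Proof. by move=> /(_ [::])[]. Qed.

Lemma smooth_der f e : smooth f -> smooth ('D_e f) /\ forall x, is_derive x e f ('D_e f x).
Proof.
move=> sf; split; last by move=> x; apply: derivableP; have [_] := sf [::]; exact.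
by move=> es; have := sf (rcons es e); rewrite /iter_derive foldr_rcons.
Qed.

(** Linear combinations of tensor products of smooth functions of one variable are stable under
    every directional derivative, hence smooth by coinduction; they provide the test functions used
    in the fundamental lemma. *)
Inductive tens : (R2 -> R) -> Prop :=
| tens_mul (a b : R -> R) : smooth1 a -> smooth1 b -> tens (fun x => a x.1 * b x.2)
| tens_lin (c : R) f g : tens f -> tens g -> tens (fun x => c * f x + g x).

Lemma is_derive_fst (a a' : R -> R) x e : (forall t, is_derive t (1 : R) a (a' t)) ->
  is_derive x e (fun x => a x.1) (a' x.1 * e.1).
Proof.
move=> da; apply: is_derive_line => /=.
have := @is_derive1_comp R a (fun h => e.1 * h + x.1) 0 _ _ (da _) (is_derive_affine _ _ _).
rewrite mulr0 add0r; congr (is_derive _ _ _ _).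
by apply/funext => h /=; rewrite mulrC.
Qed.

Lemma is_derive_snd (a a' : R -> R) x e : (forall t, is_derive t (1 : R) a (a' t)) ->
  is_derive x e (fun x => a x.2) (a' x.2 * e.2).
Proof.
move=> da; apply: is_derive_line => /=.
have := @is_derive1_comp R a (fun h => e.2 * h + x.2) 0 _ _ (da _) (is_derive_affine _ _ _).
rewrite mulr0 add0r; congr (is_derive _ _ _ _).
by apply/funext => h /=; rewrite mulrC.
Qed.

Lemma is_derive_tens (a a' b b' : R -> R) x e : (forall t, is_derive t (1 : R) a (a' t)) ->
  (forall t, is_derive t (1 : R) b (b' t)) ->
  is_derive x e (fun x => a x.1 * b x.2) (e.1 * (a' x.1 * b x.2) + e.2 * (a x.1 * b' x.2)).
Proof.
move=> da db; have h := @is_deriveM R _ _ _ x e _ _ (is_derive_fst x e da) (is_derive_snd x e db).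
by apply: (is_derive_eq h); rewrite -![_ *: _]/(_ * _); ring.
Qed.

Lemma smooth_tens f : tens f -> smooth f.
Proof.
apply: smooth_coind => {}f; elim=> {f} [a b sa sb|c f g tf [cf df] tg [cg dg]]; split.
- move=> x; apply: (@cvgM _ _ _ _ (fun x => a x.1) (fun x => b x.2)).
    by apply: (@continuous_comp _ _ _ fst a x); [exact: cvg_fst|exact: smooth1_cont].
  by apply: (@continuous_comp _ _ _ snd b x); [exact: cvg_snd|exact: smooth1_cont].
- move=> e; have [a' [sa' da]] := smooth1_der sa; have [b' [sb' db]] := smooth1_der sb.
  exists (fun x => e.1 * (a' x.1 * b x.2) + (e.2 * (a x.1 * b' x.2) + 0 * 0)).
  split.
    exact: (tens_lin e.1 (tens_mul sa' sb) (tens_lin e.2 (tens_mul sa sb') (tens_mul (smooth1_cst 0) (smooth1_cst 0)))).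
  by move=> x; apply: (is_derive_eq (is_derive_tens x e da db)) => /=; rewrite mulr0 addr0.
- move=> x; apply: cvgD; last exact: cg.
  by apply: cvgMr; exact: cf.
- move=> e; have [f' [tf' df']] := df e; have [g' [tg' dg']] := dg e.
  exists (fun x => c * f' x + g' x); split; first exact: tens_lin.
  by move=> x; apply: is_deriveD; apply: is_deriveZ.
Qed.

(** The last hypothesis says that [A] is affine with linear part [L], so that differentiating
    [f \o A] along [e] means differentiating [f] along [L e]. *)
Lemma smooth_affine (L A : R2 -> R2) f : smooth f -> continuous A ->
  (forall h x e, A (h *: e + x) = h *: L e + A x) ->
  smooth (f \o A) /\ forall e x, is_derive x e (f \o A) ('D_(L e) f (A x)).
Proof.
move=> sf cA hA.
have dA g e x : smooth g -> is_derive x e (g \o A) ('D_(L e) g (A x)).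
  move=> sg; apply: is_derive_line; have [_ dg] := smooth_der (L e) sg.
  by have := is_derive_lineP (dg (A x)); under [X in is_derive _ _ X _]eq_fun do rewrite -hA.
split; last by move=> e x; exact: dA.
apply: (@smooth_coind [set g | exists f, smooth f /\ g = f \o A]); last by exists f.
move=> _ [g [sg ->]]; split.
  by move=> x; apply: continuous_comp; [exact: cA|exact: smooth_cont].
move=> e; exists ('D_(L e) g \o A); split; last by move=> x; exact: dA.
have [sg' _] := smooth_der (L e) sg.
by exists ('D_(L e) g); split; [exact: sg'|reflexivity].
Qed.

Lemma testP phi : test_function phi <-> smooth phi /\
  exists K : R, forall x, K < `|x.1| \/ K < `|x.2| -> phi x = 0.
Proof.
split=> -[sphi h]; split=> //.
  have [M [_ hM]] := compact_bounded h.
  have := hM (M + 1) (ltac:(by rewrite ltrDl)) => hM'.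
  exists (M + 1) => x hx; apply: contrapT => /eqP px.
  have : `|x| <= M + 1 by apply: hM'; exact: subset_closure.
  rewrite prod_normE ge_max => /andP[h1 h2].
  by case: hx => hx; [have := lt_le_trans hx h1|have := lt_le_trans hx h2]; rewrite ltxx.
have [K hK] := h.
apply: (@subclosed_compact _ _ (`[- K, K]%classic `*` `[- K, K]%classic)).
- exact: closed_closure.
- by apply: compact_setX; exact: segment_compact.
- rewrite [X in _ `<=` X](_ : _ = closure (`[- K, K]%classic `*` `[- K, K]%classic)).
    apply: closureS => x /= px; split=> /=; rewrite in_itv/= -ler_norml leNgt; apply/negP => Kx; move/eqP: px; apply; apply: hK.
      by left.
    by right.
  apply/closure_id; apply: compact_closed.
    exact: (@norm_hausdorff R (R * R)%type).
  by apply: compact_setX; exact: segment_compact.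
Qed.

Lemma test_tens (a b : R -> R) : bump a -> bump b -> test_function (fun x => a x.1 * b x.2).
Proof.
move=> [sa [K hK]] [sb [L hL]]; apply/testP; split.
  by apply: smooth_tens; exact: tens_mul.
exists (Num.max K L) => x []; rewrite gt_max => /andP[h1 h2]; first by rewrite hK// mul0r.
by rewrite hL// mulr0.
Qed.

End Smooth2.

(** * Absolutely continuous functions of one variable *)

Section AC.
Context {R : realType}.
Local Notation M := (measurableTypeR R).
Local Notation lam := (@lebesgue_measure R).
Implicit Types f g h : M -> R.

Definition J g (a b : R) : R := \int[lam]_(x in `[a, b]) g x.
Definition itgon g (a b : R) := lam.-integrable `[a, b] (EFin \o g).
Definition loc1 g := meas g /\ forall a b, itgon g a b.

Lemma itgonD g h a b : itgon g a b -> itgon h a b -> itgon (fun x => g x + h x) a b.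
Proof. move=> gi hi; apply: (integrableD _ gi hi); exact: measurable_itv. Qed.
Lemma itgonZ c g a b : itgon g a b -> itgon (fun x => c * g x) a b.
Proof. move=> gi; apply: (integrableZl _ c gi); exact: measurable_itv. Qed.
Lemma itgon_norm g a b : itgon g a b -> itgon (fun x => `|g x|) a b.
Proof. by move=> gi; exact: (integrable_norm gi). Qed.

Lemma itgon_le g h a b : meas g -> itgon h a b ->
  (forall x, a <= x <= b -> `|g x| <= h x) -> itgon g a b.
Proof.
move=> mg hi gh; apply: (le_integrable _ _ _ hi) => //.
  by apply/measurable_EFinP; exact: measurable_funS mg.
by move=> x /=; rewrite in_itv/= => /gh gx; rewrite lee_fin (le_trans gx)// ler_norm.
Qed.

Lemma itgonM h g a b (K : R) : meas h -> meas g -> itgon g a b ->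
  (forall x, a <= x <= b -> `|h x| <= K) -> itgon (fun x => h x * g x) a b.
Proof.
move=> mh mg gi hK; apply: (@itgon_le _ (fun x => K * `|g x|)).
- exact: measM.
- by apply: itgonZ; exact: itgon_norm.
- by move=> x /hK hx; rewrite normrM ler_wpM2r.
Qed.

Lemma JD g h a b : itgon g a b -> itgon h a b ->
  J (fun x => g x + h x) a b = J g a b + J h a b.
Proof. by move=> gi hi; apply: RintegralD. Qed.
Lemma JZ c g a b : itgon g a b -> J (fun x => c * g x) a b = c * J g a b.
Proof. by move=> gi; apply: RintegralZl. Qed.
Lemma J_le g h a b : itgon g a b -> itgon h a b ->
  (forall x, a <= x <= b -> g x <= h x) -> J g a b <= J h a b.
Proof. by move=> gi hi gh; apply: le_Rintegral => // x /=; rewrite in_itv/=; exact: gh. Qed.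
Lemma J_norm g a b : itgon g a b -> `|J g a b| <= J (fun x => `|g x|) a b.
Proof. by move=> gi; apply: le_normr_Rintegral. Qed.
Lemma J_ge0 g a b : (forall x, 0 <= g x) -> 0 <= J g a b.
Proof. by move=> g0; apply: Rintegral_ge0. Qed.
Lemma J_eq g h a b : (forall x, a <= x <= b -> g x = h x) -> J g a b = J h a b.
Proof. by move=> gh; apply: eq_Rintegral => x; rewrite inE/= in_itv/=; exact: gh. Qed.

Lemma J_cat g a b c : a <= b -> b <= c -> itgon g a c -> J g a c = J g a b + J g b c.
Proof.
move=> ab bc gi; have := @Rintegral_itvB R g (BLeft a) (BRight c) b gi.
rewrite !bnd_simp => /(_ ab bc) h.
have e1 : J g b c = \int[lam]_(x in `]b, c]) g x.
  rewrite /J -(@Rintegral_itv_obnd_cbnd _ b (BRight c))//.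
  by apply: integrableS gi => // x /=; rewrite !in_itv/= => /andP[bx ->]; rewrite (le_trans ab (ltW bx)).
by rewrite e1 -h /J addrC subrK.
Qed.

Lemma J_pt g a : J g a a = 0.
Proof. by rewrite /J set_itv1 Rintegral_set1. Qed.

(** The primitive is continuous, so it takes half its final value: an interval can be bisected with
    respect to the measure of density [g]. *)
Lemma J_mid g a b : a <= b -> (forall x, 0 <= g x) -> itgon g a b ->
  exists2 m, a <= m <= b & J g a m = J g a b / 2.
Proof.
move=> ab g0 gi.
have cJ := parameterized_integral_continuous ab gi.
have [] := @IVT R (fun x => J g a x) a b (J g a b / 2) ab.
- exact: cJ.
- rewrite J_pt min_l ?J_ge0// max_r ?J_ge0//.
  have := J_ge0 a b g0; lra.
- by move=> m; rewrite in_itv/= => mab hm; exists m.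
Qed.

(* An additive interval function that is quadratically small with respect to
   an atomless measure vanishes: bisect with respect to that measure. *)
Lemma additive_quadratic0 (D : R -> R -> R) g (C : R) :
  (forall a b c, a <= b -> b <= c -> D a c = D a b + D b c) ->
  (forall x, 0 <= g x) -> (forall a b, itgon g a b) ->
  (forall a b, a <= b -> `|D a b| <= C * J g a b ^+ 2) ->
  forall a b, a <= b -> D a b = 0.
Proof.
move=> Dadd g0 gi DC a b ab.
have h (k : nat) : forall a b, a <= b -> `|D a b| <= C * J g a b ^+ 2 * 2^-1 ^+ k.
  elim: k => [|k ih] {}a {}b {}ab; first by rewrite expr0 mulr1; exact: DC.
  have [m /andP[am mb] hm] := J_mid ab g0 (gi a b).
  rewrite (Dadd a m b)//; apply: (le_trans (ler_normD _ _)).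
  have hm2 : J g m b = J g a b / 2.
    by have := J_cat am mb (gi a b); rewrite hm; clear => *; lra.
  have := ih _ _ am; have := ih _ _ mb; rewrite hm hm2 [2^-1 ^+ k.+1]exprS.
  set j := J g a b; set t := 2^-1 ^+ k; clear; lra.
have : `|D a b| <= 0.
  have cv : (fun k : nat => C * J g a b ^+ 2 * 2^-1 ^+ k) @ \oo --> C * J g a b ^+ 2 * 0.
    apply: cvgMr; apply: cvg_expr; rewrite gtr0_norm ?invr_gt0//.
    by rewrite invf_lt1// ltr1n.
  rewrite mulr0 in cv; rewrite -(cvg_lim _ cv)//; apply: limr_ge; first by apply/cvg_ex; eexists; exact: cv.
  by apply: nearW => k; exact: h.
by rewrite normr_le0 => /eqP.
Qed.

(** Absolute continuity encoded by the fundamental theorem of calculus: [f] is an indefinite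
    integral of the locally integrable density [g]. *)
Definition ac f g := [/\ meas f, loc1 g & forall a b, a <= b -> f b - f a = J g a b].

Lemma ac_var f g a b x : ac f g -> a <= x <= b -> `|f x - f a| <= J (fun x => `|g x|) a b.
Proof.
move=> [_ [mg gi] fE] /andP[ax xb]; rewrite (fE _ _ ax).
apply: (le_trans (J_norm (gi a x))).
rewrite (J_cat ax xb) ?lerDl ?J_ge0//; last by apply: itgon_norm.
Qed.

Lemma ac_bound f g a b x : ac f g -> a <= x <= b ->
  `|f x| <= `|f a| + J (fun x => `|g x|) a b.
Proof.
move=> fg xab; rewrite -[f x](subrK (f a)) addrC; apply: (le_trans (ler_normD _ _)).
by rewrite lerD2l; exact: (ac_var fg xab).
Qed.

Lemma J_Mle h g a b (K : R) : meas h -> meas g -> itgon g a b ->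
  (forall x, a <= x <= b -> `|h x| <= K) ->
  `|J (fun x => h x * g x) a b| <= K * J (fun x => `|g x|) a b.
Proof.
move=> mh mg gi hK; have hgi := itgonM mh mg gi hK.
apply: (le_trans (J_norm hgi)); rewrite -JZ; last exact: itgon_norm.
apply: J_le; [exact: itgon_norm|by apply: itgonZ; exact: itgon_norm|].
by move=> x /hK hx; rewrite normrM ler_wpM2r.
Qed.

(** The defect of the product rule over [a, b] is additive in the interval. Freezing each factor at
    the left endpoint shows that it is at most 3 times the square of the integral of [|g1| + |g2|],
    hence zero. *)
Lemma ac_prod f1 g1 f2 g2 : ac f1 g1 -> ac f2 g2 ->
  ac (fun x => f1 x * f2 x) (fun x => f1 x * g2 x + f2 x * g1 x).
Proof.
move=> a1 a2; have [mf1 [mg1 gi1] E1] := a1; have [mf2 [mg2 gi2] E2] := a2.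
have i1 a b : itgon (fun x => f1 x * g2 x) a b.
  by apply: (itgonM mf1 mg2) => // x xab; exact: (ac_bound a1 xab).
have i2 a b : itgon (fun x => f2 x * g1 x) a b.
  by apply: (itgonM mf2 mg1) => // x xab; exact: (ac_bound a2 xab).
split; first exact: measM.
  by split=> [|a b]; [apply: measD; exact: measM|exact: itgonD].
move=> a b ab; apply/eqP; rewrite -subr_eq0; apply/eqP.
pose G x := `|g1 x| + `|g2 x|.
apply: (@additive_quadratic0 (fun a b => f1 b * f2 b - f1 a * f2 a - J (fun x => f1 x * g2 x + f2 x * g1 x) a b) G 3) => //.
- move=> {ab}{}a {}b c ab bc; rewrite (J_cat ab bc); first by ring.
  exact: itgonD.
- by move=> x; exact: addr_ge0.
- by move=> {ab}{}a {}b; apply: itgonD; exact: itgon_norm.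
move=> {ab}{}a {}b ab.
rewrite JD// /G JD; [|exact: itgon_norm|exact: itgon_norm].
have d1 : J (fun x => f1 x * g2 x) a b = f1 a * J g2 a b + J (fun x => (f1 x - f1 a) * g2 x) a b.
  rewrite -JZ// -JD; [|exact: itgonZ|].
    by apply: J_eq => x _; ring.
  apply: (itgonM _ mg2) => // [|x xab]; last exact: (ac_var a1 xab).
  by apply: measB => //; exact: meas_cst.
have d2 : J (fun x => f2 x * g1 x) a b = f2 a * J g1 a b + J (fun x => (f2 x - f2 a) * g1 x) a b.
  rewrite -JZ// -JD; [|exact: itgonZ|].
    by apply: J_eq => x _; ring.
  apply: (itgonM _ mg1) => // [|x xab]; last exact: (ac_var a2 xab).
  by apply: measB => //; exact: meas_cst.
have b1 := @J_Mle (fun x => f1 x - f1 a) g2 a b _ (measB mf1 (meas_cst _)) mg2 (gi2 a b) (fun x xab => ac_var a1 xab).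
have b2 := @J_Mle (fun x => f2 x - f2 a) g1 a b _ (measB mf2 (meas_cst _)) mg1 (gi1 a b) (fun x xab => ac_var a2 xab).
have n1 := J_norm (gi1 a b); have n2 := J_norm (gi2 a b).
have p1 : 0 <= J (fun x => `|g1 x|) a b by exact: J_ge0.
have p2 : 0 <= J (fun x => `|g2 x|) a b by exact: J_ge0.
rewrite d1 d2.
have -> : f1 b = f1 a + J g1 a b by rewrite -E1// addrC subrK.
have -> : f2 b = f2 a + J g2 a b by rewrite -E2// addrC subrK.
move: b1 b2 n1 n2 p1 p2; set x1 := J _ a b; set y1 := J _ a b; set x2 := J _ a b; set y2 := J _ a b.
set z1 := J g1 a b; set z2 := J g2 a b => b1 b2 n1 n2 p1 p2.
rewrite (_ : _ - _ = z1 * z2 - x1 - y2); last by ring.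
have b3 : `|z1 * z2| <= y1 * x2 by rewrite normrM ler_pM.
apply: (le_trans (ler_normB _ _)); apply: (le_trans (lerD (ler_normB _ _) b2)).
apply: (@le_trans _ _ (3 * (y1 * x2))); first by lra.
rewrite ler_wpM2l//; clear => *; nra.
Qed.

(* Over an interval both sides differ by an additive quantity which is quadratic in the variation of [f]. *)
Lemma ac_chain f g (S : set R) (F F' : R -> R) (L : R) : ac f g -> 0 <= L ->
  (forall x, S (f x)) -> meas (fun x => F (f x)) -> meas (fun x => F' (f x)) ->
  (forall s t, S s -> S t -> `|F t - F s - F' s * (t - s)| <= L * (t - s) ^+ 2) ->
  (forall s t, S s -> S t -> `|F' t - F' s| <= L * `|t - s|) ->
  ac (fun x => F (f x)) (fun x => F' (f x) * g x).
Proof.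
move=> a1 L0 Sf mF mF' hF hF'; have [mf1 [mg1 gi1] E1] := a1.
have vb a b x : a <= x <= b -> `|F' (f x) - F' (f a)| <= L * J (fun x => `|g x|) a b.
  move=> xab; apply: (le_trans (hF' _ _ (Sf a) (Sf x))).
  by rewrite ler_wpM2l//; exact: (ac_var a1 xab).
have i1 a b : itgon (fun x => F' (f x) * g x) a b.
  apply: (@itgonM _ _ _ _ (`|F' (f a)| + L * J (fun x => `|g x|) a b)) => // x xab.
  rewrite -[F' (f x)](subrK (F' (f a))) addrC; apply: (le_trans (ler_normD _ _)).
  by rewrite lerD2l; exact: vb.
split => //; first by split=> [|a b]; [exact: measM|exact: i1].
move=> a b ab; apply/eqP; rewrite -subr_eq0; apply/eqP.
apply: (@additive_quadratic0 (fun a b => F (f b) - F (f a) - J (fun x => F' (f x) * g x) a b) (fun x => `|g x|) (2 * L)) => //.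
- by move=> {ab}{}a {}b c ab bc; rewrite (J_cat ab bc)//; ring.
- by move=> {ab}{}a {}b; exact: itgon_norm.
move=> {ab}{}a {}b ab.
have i2 : itgon (fun x => (F' (f x) - F' (f a)) * g x) a b.
  apply: (itgonM _ mg1) => // [|x xab]; last exact: (vb _ _ _ xab).
  by apply: measB => //; exact: meas_cst.
have d1 : J (fun x => F' (f x) * g x) a b = F' (f a) * J g a b + J (fun x => (F' (f x) - F' (f a)) * g x) a b.
  rewrite -JZ// -JD//; last exact: itgonZ.
  by apply: J_eq => x _; ring.
have b1 := @J_Mle (fun x => F' (f x) - F' (f a)) g a b _ (measB mF' (meas_cst _)) mg1 (gi1 a b) (fun x xab => vb a b x xab).
have n1 := J_norm (gi1 a b).
have p1 : 0 <= J (fun x => `|g x|) a b by exact: J_ge0.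
have b2 := hF _ _ (Sf a) (Sf b); rewrite E1// in b2.
rewrite d1 opprD addrA; apply: (le_trans (ler_normB _ _)).
move: b1 n1 p1 b2; set y := J _ a b; set z := J g a b; set x := J _ a b => b1 n1 p1 b2.
have zx : z ^+ 2 <= x ^+ 2 by rewrite -real_normK ?num_real// ler_sqr ?nnegrE.
have Lzx : L * z ^+ 2 <= L * x ^+ 2 by rewrite ler_wpM2l.
by apply: (le_trans (lerD b2 b1)); rewrite expr2 in Lzx *; lra.
Qed.

Lemma ac_C1 (f g : R -> R) : (forall x, is_derive x (1 : R) f (g x)) -> continuous g -> ac f g.
Proof.
move=> df cg.
have cf : continuous f.
  by move=> x; apply/differentiable_continuous/derivable1_diffP; have [] := df x.
split; first exact: continuous_measurable_fun.
  split; first exact: continuous_measurable_fun.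
  move=> a b; apply: continuous_compact_integrable; first exact: segment_compact.
  exact: continuous_subspaceT.
move=> a b; rewrite le_eqVlt => /predU1P[->|ab]; first by rewrite subrr J_pt.
have h := @continuous_FTC2 R g f a b ab (continuous_subspaceT cg).
rewrite /J /Rintegral h//.
- split; first by move=> x _; have [] := df x.
  + by apply: cvg_at_right_filter; exact: cf.
  + by apply: cvg_at_left_filter; exact: cf.
- by move=> x _; rewrite derive1E; have [_ ->] := df x.
Qed.

End AC.

(** * Weak derivatives and absolute continuity on lines *)

Section Zero_on_sigma.
Context d (T : measurableType d) (R : realType) (mu : {measure set T -> \bar R}).
Context d' (T' : measurableType d').

Lemma meas_indic_comp (p : T -> T') (A : set T') : measurable_fun setT p -> measurable A ->
  meas (fun x => \1_A (p x) : R).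
Proof.
move=> mp mA; rewrite (_ : (fun x => _) = \1_(p @^-1` A)).
  by apply: meas_indic; rewrite -[X in measurable X]setTI; exact: mp.
by apply/funext => x; rewrite !indicE; congr (_%:R); congr nat_of_bool; apply/idP/idP => /set_mem h; apply/mem_set.
Qed.

Lemma indic_le1 (U : Type) (A : set U) (x : U) : `|\1_A x : R| <= 1.
Proof. by rewrite indicE; case: (_ \in _); rewrite ?normr1// normr0. Qed.

Lemma itg_indic_mul (p : T -> T') (A : set T') f : measurable_fun setT p -> measurable A ->
  itg mu f -> itg mu (fun x => \1_A (p x) * f x).
Proof.
move=> mp mA fi; apply: (@itgMb _ _ _ _ _ _ 1) => //; first exact: meas_indic_comp.
by move=> x; exact: indic_le1.
Qed.

(** Dynkin's argument: the sets [A] over whose preimage [f] integrates to zero form a lambda-system,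
    so vanishing on a generating pi-system extends to all measurable sets. *)
Lemma zero_on_sigma (f : T -> R) (p : T -> T') (G : set (set T')) :
  itg mu f -> measurable_fun setT p -> setI_closed G ->
  (measurable : set (set T')) = <<s G >> -> \int[mu]_x f x = 0 ->
  (forall A, G A -> \int[mu]_x (\1_A (p x) * f x) = 0) ->
  forall A, measurable A -> \int[mu]_x (\1_A (p x) * f x) = 0.
Proof.
move=> fi mp GI GE If0 Gf A mA.
pose H := [set A : set T' | measurable A /\ \int[mu]_x (\1_A (p x) * f x) = 0].
have mG B : G B -> measurable B by rewrite GE; exact: sub_sigma_algebra.
have HL : lambda_system setT H.
  split => //.
  - split => //; rewrite -[RHS]If0; apply: eq_Rintegral => x _.
    by rewrite indicT mul1r.
  - move=> B C CB [mB hB] [mC hC]; split; first exact: measurableD.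
    rewrite -[RHS](subrr (0 : R)) -{1}hB -hC -IB; [|exact: itg_indic_mul..].
    apply: eq_Rintegral => x _; rewrite -mulrBl; congr (_ * _).
    rewrite !indicE; have [Cx|Cx] := pselect (C (p x)).
      by rewrite memNset ?mem_set ?subrr//; [exact: CB|case].
    rewrite (memNset Cx) subr0; congr (_%:R); congr nat_of_bool.
    by apply/idP/idP => /set_mem; [case=> ? _; apply/mem_set|move=> Bx; apply/mem_set].
  - move=> F ndF hF; have mF i : measurable (F i) by have [] := hF i.
    have mU : measurable (\bigcup_i F i) by exact: bigcupT_measurable.
    split => //.
    have [] := @itg_DCT _ _ _ mu (fun n x => \1_(F n) (p x) * f x) (fun x => \1_(\bigcup_i F i) (p x) * f x) (fun x => `|f x|).
    + by move=> n; apply: itg_meas; exact: itg_indic_mul.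
    + by apply: itg_meas; exact: itg_indic_mul.
    + exact: itg_norm.
    + apply: aeW => x; apply: cvgMl; rewrite indicE.
      have [Ux|Ux] := pselect ((\bigcup_i F i) (p x)).
        rewrite mem_set//; have [N _ FN] := Ux.
        apply: cvg_near_cst; near=> n; rewrite indicE mem_set//.
        have : (N <= n)%N by near: n; exact: nbhs_infty_ge.
        by move=> /ndF /subsetPset; apply.
      rewrite memNset//; apply: cvg_near_cst; apply: nearW => n.
      by rewrite indicE memNset// => Fn; apply: Ux; exists n.
    + apply: aeW => x n; rewrite normrM ler_piMl//; exact: indic_le1.
    move=> _; rewrite (_ : (fun n => _) = (fun=> 0)) => [h|].
      by rewrite -(cvg_lim _ h)// lim_cst.
    by apply/funext => n; have [] := hF n.
have GH : G `<=` H by move=> B GB; split; [exact: mG|exact: Gf].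
have := @lambda_system_subset _ G GI setT H HL GH.
by rewrite -GE => /(_ (fun _ _ _ _ => I) A mA)[].
Unshelve. all: by end_near. Qed.

End Zero_on_sigma.

(** * The fundamental lemma of the calculus of variations *)

Section Fundamental_lemma.
Context {R : realType}.
Local Notation M := (measurableTypeR R).
Local Notation T2 := (M * M)%type.
Local Notation mu := (leb2 R).

Definition rays : set (set R) := [set A | exists x, A = `]x, +oo[%classic].

Lemma rays_setI : setI_closed rays.
Proof.
move=> _ _ [x ->] [y ->]; exists (Num.max x y); apply/seteqP; split=> z /=; rewrite !in_itv/= !andbT gt_max.
  by move=> [-> ->].
by move=> /andP[].
Qed.

Lemma bump_meas (a : R -> R) : bump a -> @meas _ M R a.
Proof. by move=> [sa _]; apply: continuous_measurable_fun; exact: smooth1_cont. Qed.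

Lemma meas_fst (a : R -> R) : @meas _ M R a -> meas (fun x : T2 => a x.1).
Proof. by move=> ma; apply: measurableT_comp ma _; exact: measurable_fst. Qed.
Lemma meas_snd (a : R -> R) : @meas _ M R a -> meas (fun x : T2 => a x.2).
Proof. by move=> ma; apply: measurableT_comp ma _; exact: measurable_snd. Qed.

Lemma flat1E (t : R) : 0 < t -> flat 1 t = expR (- t^-1).
Proof. by move=> t0; rewrite /flat t0 hornerE mul1r. Qed.

Lemma boxray_cvg (a x : R) : (fun n : nat => box n a (a + n%:R) x) @ \oo --> (\1_(`]a, +oo[%classic) x : R).
Proof.
rewrite indicE; have [/set_mem /=|] := boolP (x \in `]a, +oo[%classic).
  rewrite in_itv/= andbT => ax; rewrite /box -[X in _ --> X]mulr1.
  apply: cvgM.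
    have := @flat1_cvg R (x - a); rewrite subr_gt0 => /(_ ax).
    by under eq_fun do rewrite mulrBr.
  have h1 := @flat1_cvg R 1 ltr01.
  apply: squeeze_cvgr h1 _; last exact: cvg_cst.
  near=> n; have /andP[_ ->] := flat1_bound (- n%:R * x + n%:R * (a + n%:R)).
  rewrite andbT mulr1.
  have n0 : (0 < n)%N by near: n; exact: nbhs_infty_gt.
  have n0' : (0 : R) < n%:R by rewrite ltr0n.
  have nx : x - a + 1 <= n%:R by near: n; exact: nbhs_infty_ger.
  have e1 : n%:R <= - n%:R * x + n%:R * (a + n%:R).
    rewrite -subr_ge0 (_ : _ - _ = n%:R * (n%:R - (x - a + 1))); last by ring.
    by rewrite mulr_ge0// ?subr_ge0// ltW.
  have e0 := lt_le_trans n0' e1.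
  by rewrite !flat1E// ler_expR lerN2 lef_pV2.
move=> /negP nx; rewrite (_ : (fun n => _) = (fun=> 0)); first exact: cvg_cst.
apply/funext => n; apply: box_out; apply/negP => /andP[h _]; apply: nx.
by apply/mem_set; rewrite /= in_itv/= h.
Unshelve. all: by end_near. Qed.

Lemma boxT_cvg (x : R) : (fun n : nat => box n (- n%:R) n%:R x) @ \oo --> (1 : R).
Proof.
have h1 := @flat1_cvg R 1 ltr01.
have h2 : (fun n : nat => flat 1 (n%:R * 1) * flat 1 (n%:R * 1) : R) @ \oo --> (1 : R).
  by rewrite -[X in _ --> X]mulr1; exact: cvgM.
apply: squeeze_cvgr h2 _; last exact: cvg_cst.
near=> n; have /andP[_ ->] := box_bound n (- n%:R) n%:R x; rewrite andbT /box.
have n0 : (0 < n)%N by near: n; exact: nbhs_infty_gt.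
have n0' : (0 : R) < n%:R by rewrite ltr0n.
have nx : `|x| + 1 <= n%:R by near: n; exact: nbhs_infty_ger.
have key (t : R) : n%:R <= t -> flat 1 (n%:R * 1) <= flat 1 t.
  move=> nt; have t0 := lt_le_trans n0' nt.
  by rewrite mulr1 !flat1E// ler_expR lerN2 lef_pV2.
have f0 (t : R) : 0 <= flat 1 t by have /andP[] := flat1_bound t.
have := ler_norm x; have := ler_norm (- x); rewrite normrN => hx1 hx2.
apply: ler_pM => //; apply: key.
  rewrite -subr_ge0 (_ : _ - _ = n%:R * (n%:R + x - 1)); last by ring.
  by apply: mulr_ge0; [exact: ltW|lra].
rewrite -subr_ge0 (_ : _ - _ = n%:R * (n%:R - x - 1)); last by ring.
by apply: mulr_ge0; [exact: ltW|lra].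
Unshelve. all: by end_near. Qed.

(** Half-lines and the whole line are bounded limits of bumps, so [f] integrates to zero over
    quadrants. Passing to Borel sets in one variable, then in the other, and finally from rectangles
    to all measurable sets of the plane gives zero integral over every set. *)
Lemma FL_int (f : T2 -> R) : itg mu f ->
  (forall a b : R -> R, bump a -> bump b -> \int[mu]_x (f x * (a x.1 * b x.2)) = 0) ->
  {ae mu, forall x, f x = 0}.
Proof.
move=> fi hf.
pose good (A : R -> R) := exists a : nat -> R -> R, [/\ forall n, bump (a n),
  forall n x, `|a n x| <= 1 & forall x, (fun n => a n x) @ \oo --> A x].
have gray x : good (\1_(`]x, +oo[%classic)).
  exists (fun n => box n x (x + n%:R)); split => [n|n y|y]; [exact: bump_box| |exact: boxray_cvg].
  by have /andP[h0 h1] := box_bound n x (x + n%:R) y; rewrite ger0_norm.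
have gT : good (fun=> 1).
  exists (fun n => box n (- n%:R) n%:R); split => [n|n y|y]; [exact: bump_box| |exact: boxT_cvg].
  by have /andP[h0 h1] := box_bound n (- n%:R) n%:R y; rewrite ger0_norm.
have hgood A B : good A -> good B -> @meas _ M R A -> @meas _ M R B ->
    \int[mu]_x (A x.1 * (B x.2 * f x)) = 0.
  move=> [a [ba a1 ca]] [b [bb b1 cb]] mA mB.
  have [] := @itg_DCT _ T2 _ mu (fun n x => a n x.1 * (b n x.2 * f x)) (fun x => A x.1 * (B x.2 * f x)) (fun x => `|f x|).
  - move=> n; apply: measM; first by apply: meas_fst; exact: bump_meas.
    by apply: measM; [apply: meas_snd; exact: bump_meas|exact: itg_meas fi].
  - apply: measM; first exact: meas_fst.
    by apply: measM; [exact: meas_snd|exact: itg_meas fi].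
  - exact: itg_norm.
  - apply: aeW => x; apply: cvgM; first exact: ca.
    by apply: cvgMl; exact: cb.
  - apply: aeW => x n; rewrite !normrM mulrA ler_piMl// mulr_ile1//.
  move=> _; rewrite (_ : (fun n => _) = (fun=> 0)) => [h|].
    by rewrite -(cvg_lim _ h)// lim_cst.
  apply/funext => n; rewrite -[RHS](hf _ _ (ba n) (bb n)).
  by apply: eq_Rintegral => x _; ring.
have RE : (measurable : set (set M)) = <<s rays >> by exact: RGenOInfty.measurableE.
have mray A : rays A -> measurable (A : set M) by move=> [x ->]; exact: measurable_itv.
have s1 A B : measurable (A : set M) -> rays B -> \int[mu]_x (\1_A x.1 * (\1_B x.2 * f x)) = 0.
  move=> mA rB.
  have fB : itg mu (fun x : T2 => \1_B x.2 * f x).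
    by apply: (itg_indic_mul (p := snd)) => //; exact: mray.
  apply: (zero_on_sigma (p := (fst : T2 -> M)) fB _ rays_setI RE) => //.
  - have := hgood (fun=> 1) \1_B gT; have [y BE] := rB; rewrite {1 2}BE.
    move=> /(_ (gray _) (meas_cst _) (meas_indic _)); rewrite -BE => <-; last exact: mray.
    by apply: eq_Rintegral => x _; rewrite mul1r.
  - move=> C rC; have [y BE] := rB; have [z CE] := rC; rewrite BE CE.
    by apply: hgood; [exact: gray|exact: gray|apply: meas_indic..]; exact: measurable_itv.
have s1T A : measurable (A : set M) -> \int[mu]_x (\1_A x.1 * f x) = 0.
  move=> mA.
  apply: (zero_on_sigma (p := (fst : T2 -> M)) fi _ rays_setI RE) => //.
  - have := hgood (fun=> 1) (fun=> 1) gT gT (meas_cst _) (meas_cst _) => <-.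
    by apply: eq_Rintegral => x _; rewrite !mul1r.
  - move=> C rC; have [z CE] := rC; have := hgood \1_C (fun=> 1); rewrite {1 2}CE => /(_ (gray _) gT (meas_indic _) (meas_cst _)).
    rewrite -CE => <-; last exact: mray.
    by apply: eq_Rintegral => x _; rewrite !mul1r.
have s2 A B : measurable (A : set M) -> measurable (B : set M) -> \int[mu]_x (\1_A x.1 * (\1_B x.2 * f x)) = 0.
  move=> mA mB.
  have fA : itg mu (fun x : T2 => \1_A x.1 * f x).
    by apply: (itg_indic_mul (p := fst)) => //; exact: measurable_fst.
  have := zero_on_sigma (p := (snd : T2 -> M)) fA _ rays_setI RE (s1T A mA) _ mB.
  move=> h; rewrite -[RHS]h.
  - by apply: eq_Rintegral => x _; ring.
  - exact: measurable_snd.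
  - move=> C rC; rewrite -[RHS](s1 A C mA rC).
    by apply: eq_Rintegral => x _; ring.
have s3 S : measurable (S : set T2) -> \int[mu]_x (\1_S x * f x) = 0.
  move=> mS.
  pose G : set (set T2) := [set A `*` B | A in measurable & B in measurable].
  apply: (@zero_on_sigma _ T2 R mu _ T2 f id G) => //.
  - move=> _ _ [A mA [B mB <-]] [A' mA' [B' mB' <-]].
    exists (A `&` A'); first exact: measurableI.
    by exists (B `&` B'); [exact: measurableI|rewrite setXI].
  - exact: measurable_prod_measurableType.
  - have := s1T setT measurableT => <-.
    by apply: eq_Rintegral => x _; rewrite indicT mul1r.
  - move=> _ [A mA [B mB <-]]; rewrite -[RHS](s2 A B mA mB).
    apply: eq_Rintegral => x _; rewrite mulrA; congr (_ * _); rewrite !indicE -natrM mulnb.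
    congr (_%:R); congr nat_of_bool; apply/idP/andP => [/set_mem[h1 h2]|[/set_mem h1 /set_mem h2]].
      by split; apply/mem_set.
    exact/mem_set.
have : ae_eq mu setT (EFin \o f) (cst 0%E).
  apply: integral_ae_eq => //.
  move=> E _ mE; rewrite integral0; have := s3 E mE => h.
  rewrite integral_mkcond.
  rewrite (_ : (fun x => _) = EFin \o (fun x => \1_E x * f x)).
    rewrite -IE ?h//; apply: (itg_indic_mul (p := id)) => //.
  apply/funext => x; rewrite patchE /= indicE; case: ifPn => _; by rewrite ?mul1r ?mul0r.
by apply: filterS => x /= /(_ I) [].
Qed.

End Fundamental_lemma.

Section Weak.
Context {R : realType}.
Local Notation M := (measurableTypeR R).
Local Notation T2 := (M * M)%type.
Local Notation R2 := (R * R)%type.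
Local Notation lam := (@lebesgue_measure R).
Local Notation mu := (leb2 R).

(** Rational open rectangles form a countable base, which links the topology of the plane to its
    product sigma-algebra. *)
Lemma open2_measurable (U : set R2) : open U -> measurable (U : set T2).
Proof.
move=> oU.
pose B (q : (rat * rat) * (rat * rat)) : set T2 :=
  `]ratr q.1.1, ratr q.1.2[%classic `*` `]ratr q.2.1, ratr q.2.2[%classic.
pose F q := if `[< B q `<=` U >] then B q else set0.
have -> : (U : set T2) = \bigcup_q F q.
  apply/seteqP; split=> [x Ux|x [q _]]; last first.
    by rewrite /F; case: asboolP => // BU /BU.
  have : nbhs x U by exact: open_nbhs_nbhs.
  move=> /nbhs_ballP[e /= e0 eU].
  have l1 (t : R) : t - e < t by rewrite ltrBlDr ltrDl.
  have l2 (t : R) : t < t + e by rewrite ltrDl.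
  have [q1 h1] := rat_in_itvoo (l1 x.1); have [q2 h2] := rat_in_itvoo (l2 x.1).
  have [q3 h3] := rat_in_itvoo (l1 x.2); have [q4 h4] := rat_in_itvoo (l2 x.2).
  move: h1 h2 h3 h4; rewrite !in_itv/= => /andP[a1 a2] /andP[a3 a4] /andP[a5 a6] /andP[a7 a8].
  exists ((q1, q2), (q3, q4)) => //; rewrite /F; case: asboolP => [_|nB].
    by split; rewrite /= in_itv/=; apply/andP.
  exfalso; apply: nB => z [] /=; rewrite !in_itv/= => /andP[b1 b2] /andP[b3 b4].
  apply: eU; split; rewrite /ball/= /ball_/= ltr_norml; apply/andP; split; lra.
apply: countable_bigcupT_measurable => [|q]; first exact: countableP.
rewrite /F; case: asboolP => _ //; apply: measurableX; exact: measurable_itv.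
Qed.

Lemma cont2_meas (f : R2 -> R) : continuous f -> @meas _ T2 R f.
Proof.
move=> cf; apply: (measurability _ (RGenOInfty.measurableE R)).
move=> _ [_ [x ->] <-]; rewrite setTI; apply: open2_measurable.
by have /continuousP := cf; apply; exact: interval_open.
Qed.

Lemma compact2_measurable (K : set R2) : compact K -> measurable (K : set T2).
Proof.
move=> cK; rewrite -[K]setCK; apply: measurableC; apply: open2_measurable.
apply: closed_openC; apply: compact_closed => //; exact: (@norm_hausdorff R (R * R)%type).
Qed.

Definition sq (K : R) : set R2 := `[- K, K]%classic `*` `[- K, K]%classic.
Lemma sqP K (x : R2) : sq K x <-> `|x.1| <= K /\ `|x.2| <= K.
Proof. by rewrite /sq /= !in_itv/= !ler_norml. Qed.

Lemma sq_measurable K : measurable (sq K : set T2).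
Proof. by apply: measurableX; exact: measurable_itv. Qed.

Lemma sq_ind_meas K : @meas _ T2 R (\1_(sq K)).
Proof. by apply: meas_indic; exact: sq_measurable. Qed.

Lemma sq_compact K : compact (sq K).
Proof. by apply: compact_setX; exact: segment_compact. Qed.

Lemma compact_sub_sq (A : set R2) : compact A -> exists K, A `<=` sq K.
Proof.
move=> cA; have [N [_ hN]] := compact_bounded cA.
have hM' := hN (N + 1) (ltac:(by rewrite ltrDl)).
exists (N + 1) => x /hM' /=; rewrite prod_normE ge_max => /andP[h1 h2].
exact/sqP.
Qed.

Lemma sq_mu K : (mu (sq K) < +oo)%E.
Proof.
rewrite [X in (X < _)%E](product_measure1E lam lam (measurable_itv `[- K, K]) (measurable_itv `[- K, K])).
have h : (lam `[(- K)%R, K] < +oo)%E.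
  by rewrite lebesgue_measure_itv/=; case: ifP => // _; rewrite -EFinB ltry.
by rewrite lte_mul_pinfty// ge0_fin_numE.
Qed.

Definition locint (u : R2 -> R) := @meas _ T2 R u /\
  forall K : R, itg mu (fun x => \1_(sq K) x * u x).

Lemma ind_mul_eq (U : Type) (A : set U) (u : U -> R) : (fun x => \1_A x * u x) = u \_ A.
Proof. by apply/funext => x; rewrite patchE indicE; case: ifPn => _; rewrite ?mul1r ?mul0r. Qed.

Lemma itg_on_ind (A : set T2) (u : T2 -> R) : measurable A ->
  mu.-integrable A (EFin \o u) <-> itg mu (fun x => \1_A x * u x).
Proof.
move=> mA; rewrite (integrable_mkcond _ mA) /itg ind_mul_eq.
by rewrite restrict_EFin.
Qed.

Lemma locintP u : locally_integrable2 u <-> locint u.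
Proof.
split=> [hu|[mu_ hu] K cK].
  have hK K : itg mu (fun x => \1_(sq K) x * u x).
    by apply/(itg_on_ind _ (sq_measurable K)); apply: hu; exact: sq_compact.
  split; last exact: hK.
  apply: (@measurable_fun_cvg _ T2 R setT (fun (n : nat) x => \1_(sq n%:R) x * u x) u).
    by move=> n; exact: itg_meas (hK n%:R).
  move=> x _; apply: cvg_near_cst; near=> n; rewrite indicE mem_set ?mul1r//.
  apply/sqP; split; near: n; exact: nbhs_infty_ger.
have mK := compact2_measurable cK; apply/(itg_on_ind _ mK).
have [L KL] := compact_sub_sq cK.
apply: (@itg_le _ _ _ mu _ (fun x => `|\1_(sq L) x * u x|)).
- by apply: measM => //; exact: meas_indic.
- by apply: itg_norm.
- move=> x; rewrite !normrM ler_wpM2r// !indicE.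
  have [Kx|Kx] := pselect (K x); last by rewrite (memNset Kx) normr0.
  by rewrite !mem_set//; exact: KL.
Unshelve. all: by end_near. Qed.

Lemma locintD u v : locint u -> locint v -> locint (fun x => u x + v x).
Proof.
move=> [mu_ hu] [mv hv]; split; first exact: measD.
by move=> K; under eq_fun do rewrite mulrDr; exact: itgD.
Qed.

Lemma locintZ c u : locint u -> locint (fun x => c * u x).
Proof.
move=> [mu_ hu]; split; first by apply: measM => //; exact: meas_cst.
by move=> K; under eq_fun do rewrite mulrCA; exact: itgZ.
Qed.

Lemma locintB u v : locint u -> locint v -> locint (fun x => u x - v x).
Proof.
move=> hu /(locintZ (-1)) hv; have := locintD hu hv.
by under eq_fun do rewrite mulN1r.
Qed.

Lemma locint_le u v : @meas _ T2 R u -> locint v -> (forall x, `|u x| <= `|v x|) -> locint u.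
Proof.
move=> mu_ [mv hv] uv; split => // K.
apply: (@itg_le _ _ _ mu _ (fun x => `|\1_(sq K) x * v x|)).
- by apply: measM => //; exact: sq_ind_meas.
- exact: itg_norm.
- by move=> x; rewrite !normrM ler_wpM2l.
Qed.

Lemma locint_ae u v : locint u -> @meas _ T2 R v -> {ae mu, forall x, u x = v x} -> locint v.
Proof.
move=> [mu_ hu] mv uv; split => // K; apply: (itg_ae (hu K)).
  by apply: measM => //; exact: sq_ind_meas.
by apply: (aeS uv) => x ->.
Qed.

Lemma sqi_sq K : sqi mu (\1_(sq K)).
Proof.
split; first exact: sq_ind_meas.
rewrite (_ : (fun x => _) = \1_(sq K)); last first.
  by apply/funext => x; rewrite indicE; case: (_ \in _); rewrite ?expr1n ?expr0n.
apply: itg_ge0P; [by move=> x; rewrite indicE|exact: sq_ind_meas|].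
by rewrite integral_indic ?setIT//; [exact: sq_mu|exact: sq_measurable].
Qed.

Lemma sqi_locint u : sqi mu u -> locint u.
Proof. by move=> su; split; [exact: su.1|move=> K; exact: (sqi_itgM (sqi_sq K) su)]. Qed.

Lemma test_bdd phi : test_function phi -> exists K N : R,
  [/\ @meas _ T2 R phi, 0 <= N & forall x, `|phi x| <= N * \1_(sq K) x].
Proof.
move=> /testP[sp [K hK]].
have cf : compact (phi @` sq K).
  apply: continuous_compact; last exact: sq_compact.
  by apply: continuous_subspaceT; exact: smooth_cont.
have [N [_ hN]] := compact_bounded cf.
have hN' := hN (`|N| + 1) (ltac:(by rewrite (le_lt_trans (ler_norm N))// ltrDl)).
exists K, (`|N| + 1); split.
- by apply: cont2_meas; exact: smooth_cont.
- by rewrite addr_ge0.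
- move=> x; rewrite indicE; have [xK|xK] := pselect (sq K x).
    by rewrite mem_set// mulr1; apply: hN'; exists x.
  rewrite memNset// mulr0; rewrite hK ?normr0//.
  have [x1|x1] := ltP K `|x.1|; first by left.
  have [x2|x2] := ltP K `|x.2|; first by right.
  by exfalso; apply: xK; apply/sqP.
Qed.

Lemma itg_test u phi : locint u -> test_function phi -> itg mu (fun x => u x * phi x).
Proof.
move=> [mu_ hu] /test_bdd[K [N [mp N0 hN]]].
apply: (@itg_le _ _ _ mu _ (fun x => N * `|\1_(sq K) x * u x|)).
- exact: measM.
- by apply: itgZ; exact: itg_norm.
- move=> x; rewrite normrM mulrC normrM mulrA ler_wpM2r// (le_trans (hN x))//.
  by rewrite ler_wpM2l// ler_norm.
Qed.

Lemma test_der (e : R2) phi : test_function phi -> test_function ('D_e phi).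
Proof.
move=> /testP[sp [K hK]]; apply/testP.
have [sdp dp] := smooth_der e sp; split => //; exists K => x xK.
have : is_derive x e phi 0.
  have h0 : is_derive x e (fun=> 0 : R) 0 by exact: is_derive_cst.
  have nz : \forall y \near x, 0 = phi y.
    have : open [set y : R2 | K < `|y.1| \/ K < `|y.2|].
      rewrite (_ : [set _ | _] = ((fun y : R2 => `|y.1|) @^-1` `]K, +oo[%classic) `|`
          ((fun y : R2 => `|y.2|) @^-1` `]K, +oo[%classic)); last first.
        by apply/seteqP; split=> y /=; rewrite !in_itv/= !andbT.
      apply: openU; apply: open_comp => [y _|]; try exact: interval_open.
        by apply: (@continuous_comp _ _ _ fst (fun t : R => `|t|)); [exact: cvg_fst|exact: norm_continuous].
      by apply: (@continuous_comp _ _ _ snd (fun t : R => `|t|)); [exact: cvg_snd|exact: norm_continuous].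
    move=> oS; have : nbhs x [set y : R2 | K < `|y.1| \/ K < `|y.2|].
      by apply: open_nbhs_nbhs.
    by apply: filterS => y /= /hK ->.
  case: h0 => d0 v0; apply: DeriveDef; first exact: (near_eq_derivable nz d0).
  by rewrite -v0; exact/esym/near_eq_derive.
by case.
Qed.

(** Multiplying by a bump that is positive on a large square reduces to the integrable case; the
    squares exhaust the plane. *)
Lemma FL_loc f : locint f ->
  (forall a b : R -> R, bump a -> bump b -> \int[mu]_x (f x * (a x.1 * b x.2)) = 0) ->
  {ae mu, forall x, f x = 0}.
Proof.
move=> lf hf.
pose chi (n : nat) := @box R 1 (- n%:R) n%:R.
have bchi n : bump (chi n) by exact: bump_box.
have h n : {ae mu, forall x, f x * (chi n x.1 * chi n x.2) = 0}.
  apply: FL_int; first by apply: itg_test => //; exact: test_tens.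
  move=> a b ba bb.
  rewrite -[RHS](hf _ _ (bumpMl (bchi n).1 ba) (bumpMl (bchi n).1 bb)).
  by apply: eq_Rintegral => x _; ring.
have chi_gt (n : nat) (t : R) : `|t| < n%:R -> 0 < chi n t.
  rewrite ltr_norml => /andP[t1 t2]; rewrite /chi /box !mul1r mulN1r.
  by rewrite mulr_gt0// flat1E ?expR_gt0//; lra.
apply: (aeS (ae_foralln h)) => x hx.
have [n hn] : exists n : nat, `|x.1| < n%:R /\ `|x.2| < n%:R.
  near \oo => n; exists n; split; near: n; exact: nbhs_infty_gtr.
have /eqP := hx n; rewrite mulf_eq0 => /orP[/eqP//|/eqP c0].
by have := mulr_gt0 (chi_gt n _ hn.1) (chi_gt n _ hn.2); rewrite c0 ltxx.
Unshelve. all: by end_near. Qed.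

Definition wd (e : R2) (u w : R2 -> R) := [/\ locint u, locint w &
  forall phi, test_function phi ->
    \int[mu]_x (u x * 'D_e phi x) = - \int[mu]_x (w x * phi x)].

Lemma wdP e u w : is_weak_derive e u w <-> wd e u w.
Proof.
by split=> -[/locintP h1 /locintP h2 h3]; split.
Qed.

Lemma FL_test f : locint f ->
  (forall phi, test_function phi -> \int[mu]_x (f x * phi x) = 0) -> {ae mu, forall x, f x = 0}.
Proof. by move=> lf hf; apply: FL_loc => // a b ba bb; apply: hf; exact: test_tens. Qed.

Lemma wd_unique e u u' w w' : wd e u w -> wd e u' w' -> {ae mu, forall x, u x = u' x} ->
  {ae mu, forall x, w x = w' x}.
Proof.
move=> [lu lw hw] [lu' lw' hw'] uu'.
have : {ae mu, forall x, w x - w' x = 0}.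
  apply: FL_test; first exact: locintB.
  move=> phi tp; under eq_Rintegral do rewrite mulrBl.
  rewrite IB; [|exact: itg_test..]; apply/eqP; rewrite subr_eq0 -eqr_opp -hw// -hw'//; apply/eqP.
  have td := test_der e tp.
  apply: I_ae; [apply: itg_meas; exact: (itg_test lu td)|apply: itg_meas; exact: (itg_test lu' td)|].
  by apply: (aeS uu') => x ->.
by move=> h; apply: (aeS h) => x /eqP; rewrite subr_eq0 => /eqP.
Qed.

Lemma wd_ae e u u' w w' : wd e u w -> @meas _ T2 R u' -> @meas _ T2 R w' ->
  {ae mu, forall x, u x = u' x} -> {ae mu, forall x, w x = w' x} -> wd e u' w'.
Proof.
move=> [lu lw hw] mu' mw' uu' ww'; have lu' := locint_ae lu mu' uu'; have lw' := locint_ae lw mw' ww'.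
split => // phi tp; have td := test_der e tp.
rewrite (_ : \int[mu]_x (u' x * _) = \int[mu]_x (u x * 'D_e phi x)).
  rewrite hw//; congr (- _); apply: I_ae; [apply: itg_meas; exact: (itg_test lw tp)|apply: itg_meas; exact: (itg_test lw' tp)|].
  by apply: (aeS ww') => x ->.
apply: I_ae; [apply: itg_meas; exact: (itg_test lu' td)|apply: itg_meas; exact: (itg_test lu td)|].
by apply: (aeS uu') => x ->.
Qed.

Lemma wd_lin e c u w u' w' : wd e u w -> wd e u' w' ->
  wd e (fun x => c * u x + u' x) (fun x => c * w x + w' x).
Proof.
move=> [lu lw hw] [lu' lw' hw']; split; [by apply: locintD => //; exact: locintZ..|].
move=> phi tp; have td := test_der e tp.
have E f g psi : locint f -> locint g -> test_function psi ->
   \int[mu]_x ((c * f x + g x) * psi x) = c * \int[mu]_x (f x * psi x) + \int[mu]_x (g x * psi x).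
  move=> lf lg tpsi; rewrite -IZ; last exact: itg_test.
  rewrite -ID; [|by apply: itgZ; exact: itg_test|exact: itg_test].
  by apply: eq_Rintegral => x _; ring.
by rewrite !E// hw// hw'//; ring.
Qed.

Lemma fub0 (f : T2 -> R) : itg mu f ->
  {ae lam, forall y, \int[lam]_x f (x, y) = 0} -> \int[mu]_x f x = 0.
Proof.
move=> fi h0; have ae1 := ae_integrable2 fi.
have mG := measurable_fubini_G fi.
rewrite /Rintegral -[X in fine X]/(\int[lam \x lam]_x (EFin \o f) x)%E -(integral21_prod_meas1 fi).
rewrite (_ : (\int[_]_x _)%E = 0%E)//.
rewrite (_ : (\int[lam]_y fubini_G lam (EFin \o f) y)%E = (\int[lam]_y (cst 0%E y))%E); last first.
  apply: ae_eq_integral => //; apply: filterS2 h0 ae1 => y h0 h1 _ /=.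
  by rewrite /fubini_G; have := @IE _ M R lam (fun x => f (x, y)) h1; rewrite h0 => <-.
by rewrite integral0.
Qed.

End Weak.

(** * Weak derivatives as absolute continuity on horizontal lines *)

Section ACL.
Context {R : realType}.
Local Notation M := (measurableTypeR R).
Local Notation T2 := (M * M)%type.
Local Notation R2 := (R * R)%type.
Local Notation lam := (@lebesgue_measure R).
Local Notation mu := (leb2 R).

Lemma J_supp (f : M -> R) (K : R) : (forall x, K < `|x| -> f x = 0) ->
  \int[lam]_x f x = J f (- K) K.
Proof.
move=> fK; rewrite /J [RHS]Rintegral_mkcond; apply: eq_Rintegral => x _.
rewrite patchE; case: ifPn => // /negP xK; apply: fK; rewrite ltNge; apply/negP => h; apply: xK.
by apply/mem_set; rewrite /= in_itv/= -ler_norml.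
Qed.

Lemma itgon_T (f : M -> R) (K : R) : (forall x, K < `|x| -> f x = 0) ->
  itgon f (- K) K -> itg lam f.
Proof.
have mI : measurable (`[- K, K]%classic : set M) by exact: measurable_itv.
move=> fK; rewrite /itgon (integrable_mkcond _ mI) restrict_EFin.
rewrite (_ : f \_ _ = f)//; apply/funext => x.
rewrite patchE; case: ifPn => // /negP xK; apply/esym/fK; rewrite ltNge; apply/negP => h; apply: xK.
by apply/mem_set; rewrite /= in_itv/= -ler_norml.
Qed.

Lemma itgon_loc (f : M -> R) (a b : R) : itg lam f -> itgon f a b.
Proof. by apply: integrableS => //; exact: measurable_itv. Qed.

Lemma bump_itgon (f : R -> R) a b : bump f -> itgon f a b.
Proof.
move=> bf; apply: continuous_compact_integrable; first exact: segment_compact.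
by apply: continuous_subspaceT; exact: smooth1_cont bf.1.
Qed.

Lemma bump_itg (f : R -> R) : bump f -> itg lam f.
Proof. by move=> bf; have [_ [K hK]] := bf; apply: (itgon_T hK); exact: bump_itgon. Qed.

(** A vanishing mean makes the primitive zero to the right of the support as well. A bump of mean
    zero is thus the derivative of a bump, the form in which a weak derivative can be tested. *)
Lemma bump_primitive (f : R -> R) : bump f -> \int[lam]_x f x = 0 ->
  exists F, bump F /\ forall x, is_derive x (1 : R) F (f x).
Proof.
move=> bf If0; have [sf [K hK]] := bf.
have fi := bump_itg bf.
pose F (x : R) : R := \int[lam]_(t in [set` `]-oo, x]]) f t.
have dF (x : R) : is_derive x (1 : R) F (f x).
  have [] := @continuous_FTC1 R f -oo%O x (x + 1).
  - by rewrite ltrDl.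
  - by apply: integrableS fi => //; exact: measurable_itv.
  - by rewrite ltNyr.
  - exact: smooth1_cont.
  - by move=> d1; rewrite derive1E => d2; apply: DeriveDef.
exists F; split => //; split; first exact: (smooth1_primitive sf).
exists K => x Kx; rewrite /F Rintegral_mkcond.
have [x0|x0] := leP 0 x.
  rewrite -[RHS]If0; apply: eq_Rintegral => t _; rewrite patchE; case: ifPn => // /negP tx.
  have xt : x < t.
    rewrite ltNge; apply/negP => h; apply: tx; apply/mem_set; by rewrite /= in_itv.
  rewrite hK//; move: Kx; rewrite (ger0_norm x0) => Kx.
  by rewrite (lt_le_trans Kx)// (le_trans (ltW xt))// ler_norm.
rewrite -[RHS](@I0 _ _ _ lam); apply: eq_Rintegral => t _; rewrite patchE; case: ifPn => // /set_mem /=.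
rewrite in_itv/= => tx; rewrite hK//; move: Kx; rewrite (ltr0_norm x0) => Kx.
by have := ler_norm (- t); rewrite normrN; lra.
Qed.

Lemma bump_one : exists eta : R -> R, bump eta /\ \int[lam]_x eta x = 1.
Proof.
pose b := @box R 1 (- 1) 1; have bb : bump b by exact: bump_box.
have b0 x : 0 <= b x by have /andP[] := box_bound 1 (- 1 : R) 1 x.
have Ib : 0 < \int[lam]_x b x.
  rewrite lt_neqAle eq_sym; apply/andP; split; last exact: I_ge0.
  apply/eqP => I0.
  have := I_eq0_ae (bump_itg bb) b0 I0 => -[N [mN N0 bN]].
  have : (lam `](-1)%R, 1%R[ <= lam N)%E.
    apply: le_measure; [by rewrite inE; exact: measurable_itv|by rewrite inE|].
    move=> x /=; rewrite in_itv/= => /andP[x1 x2]; apply: bN => /= bx.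
    have : 0 < b x by rewrite /b /box !mul1r mulN1r mulr_gt0// flat1E ?expR_gt0//; lra.
    by rewrite bx ltxx.
  rewrite N0 lebesgue_measure_itv/= lte_fin ifT; last by lra.
  by rewrite -EFinB lee_fin; lra.
exists (fun x => (\int[lam]_x b x)^-1 * b x); split; first exact: (bumpMl (smooth1_cst _) bb).
by rewrite IZ ?mulVf ?lt0r_neq0//; exact: bump_itg.
Qed.

(* Integrating against [step x] gives the oriented integral from 0 to x. *)
Definition step (x s : R) : R := (s <= x)%R%:R - (s <= 0)%R%:R.

Lemma step_bound x s : `|step x s| <= \1_(`[- `|x|, `|x|]%classic) s.
Proof.
rewrite /step indicE; have [/set_mem/=|] := boolP (s \in _).
  by move=> _; case: (s <= x); case: (s <= 0); rewrite ?subrr ?normr0 ?subr0 ?sub0r ?normrN ?normr1.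
move=> /negP ns.
have : ~ (- `|x| <= s <= `|x|) by move=> h; apply: ns; apply/mem_set; rewrite /= in_itv.
rewrite -ler_norml => /negP; rewrite -ltNge => xs.
have [s0|s0] := leP s 0.
  rewrite (ler0_norm s0) in xs.
  have -> : s <= x by have := ler_norm (- x); rewrite normrN; lra.
  by rewrite subrr normr0.
rewrite (gtr0_norm s0) in xs.
have -> : (s <= x) = false by apply/negbTE; rewrite -ltNge; have := ler_norm x; lra.
by rewrite subrr normr0.
Qed.

Lemma meas_le_pair d (T : measurableType d) (f g : T -> R) : meas f -> meas g ->
  meas (fun x => (f x <= g x)%R%:R : R).
Proof.
move=> mf mg.
rewrite (_ : (fun x => _) = (fun x => if (f x <= g x)%R then 1 else 0)); last first.
  by apply/funext => x; case: (_ <= _).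
apply: measurable_fun_ifT; [exact: measurable_fun_ler|exact: meas_cst|exact: meas_cst].
Qed.

Lemma step_meas d (T : measurableType d) (f g : T -> R) : meas f -> meas g ->
  meas (fun x => step (f x) (g x)).
Proof.
move=> mf mg; apply: measB; apply: meas_le_pair => //; exact: meas_cst.
Qed.

Lemma meas_param d d' (X : measurableType d) (Y : measurableType d')
   (m : {sigma_finite_measure set Y -> \bar R}) (F : X * Y -> R) :
  meas F -> meas (fun x => \int[m]_y F (x, y)).
Proof.
move=> mF; rewrite /Rintegral.
have mF' : measurable_fun setT (EFin \o F) by exact/measurable_EFinP.
apply: (@measurableT_comp _ _ _ _ _ _ (@fine R)); first exact: fine_measurable.
rewrite (_ : (fun x => _) = (fun x => fubini_F m (EFin \o F)^\+ x - fubini_F m (EFin \o F)^\- x)%E).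
  apply: emeasurable_funB; apply: measurable_fun_fubini_tonelli_F => //.
  - exact: measurable_funepos.
  - exact: measurable_funeneg.
apply/funext => x; rewrite /fubini_F (integralE m setT (fun y => (F (x, y))%:E)).
by congr (_ - _)%E; apply: eq_integral => y _; rewrite ?funeposE ?funenegE.
Qed.

(** The primitive of [w] along horizontal lines that vanishes for [x.1 = 0]. Writing it as one
    integral over the whole line makes its joint measurability an instance of the measurability of
    integrals depending on a parameter. *)
Definition prim (w : R2 -> R) (x : R2) : R := \int[lam]_s (step x.1 s * w (s, x.2)).

Lemma prim_meas w : @meas _ T2 R w -> @meas _ T2 R (prim w).
Proof.
move=> mw; rewrite /prim.
apply: (@meas_param _ _ T2 M lam (fun z : T2 * M => step z.1.1 z.2 * w (z.2, z.1.2))).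
have m1 : @meas _ (T2 * M)%type R (fun z : T2 * M => z.1.1).
  by apply: (measurableT_comp measurable_fst); exact: measurable_fst.
have m2 : @meas _ (T2 * M)%type R (fun z : T2 * M => z.2) by exact: measurable_snd.
have m3 : @meas _ (T2 * M)%type R (fun z : T2 * M => z.1.2).
  by apply: (measurableT_comp measurable_snd); exact: measurable_fst.
apply: measM; first exact: step_meas.
by apply: (measurableT_comp mw); apply: measurable_fun_pair.
Qed.

Lemma slice_meas (f : R2 -> R) (y : R) : @meas _ T2 R f -> @meas _ M R (fun x => f (x, y)).
Proof.
move=> mf; apply: (measurableT_comp mf); exact: (@pair2_measurable _ _ M M y).
Qed.

Lemma slice_loc1 w : locint w -> {ae lam, forall y, loc1 (fun x => w (x, y))}.
Proof.
move=> [mw hw].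
have h n := ae_integrable2 (hw n%:R).
apply: (aeS (ae_foralln h)) => y hy; split; first exact: slice_meas.
move=> a b.
have [n [n1 n2 n3]] : exists n : nat, [/\ `|y| <= n%:R, `|a| <= n%:R & `|b| <= n%:R].
  near \oo => n; exists n; split; near: n; exact: nbhs_infty_ger.
have : itgon (fun x => \1_(sq n%:R) (x, y) * w (x, y)) a b by apply: itgon_loc; exact: hy.
apply: eq_integrable; first exact: measurable_itv.
move=> x /set_mem/=; rewrite in_itv/= => /andP[ax xb].
rewrite /= indicE mem_set ?mul1r//; apply/sqP; split => //=.
by rewrite ler_norml; move: n2 n3; rewrite !ler_norml => /andP[a1 _] /andP[_ b1]; lra.
Unshelve. all: by end_near. Qed.

Lemma prim_ac (w : R2 -> R) (y : R) : @meas _ T2 R w -> loc1 (fun x => w (x, y)) ->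
  ac (fun x => prim w (x, y)) (fun x => w (x, y)).
Proof.
move=> mw [mwy hw]; split => //.
  by apply: slice_meas; exact: prim_meas.
have isx (x : R) : itg lam (fun s => step x s * w (s, y)).
  apply: (@itg_le _ _ _ lam _ (fun s => `|\1_(`[- `|x|, `|x|]%classic) s * w (s, y)|)).
  - apply: measM => //; apply: step_meas; [exact: meas_cst|exact: measurable_id].
  - have mI : measurable (`[- `|x|, `|x|]%classic : set M) by exact: measurable_itv.
    apply: itg_norm; have := hw (- `|x|) `|x|; rewrite /itgon (integrable_mkcond _ mI).
    by rewrite restrict_EFin /itg ind_mul_eq.
  - move=> s; rewrite !normrM ler_wpM2r// (le_trans (step_bound x s))// ler_norm//.
move=> a b ab; rewrite /prim /= -IB//.
rewrite /J [RHS]Rintegral_mkcond.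
have -> : \int[lam]_x ((fun x => w (x, y)) \_ `[a, b]) x = \int[lam]_x ((fun x => w (x, y)) \_ `]a, b]) x.
  rewrite -!Rintegral_mkcond -(@Rintegral_itv_obnd_cbnd _ a (BRight b))//.
  by apply: integrableS (hw a b) => // x /=; rewrite !in_itv/= => /andP[/ltW -> ->].
apply: eq_Rintegral => s _; rewrite patchE -mulrBl /step.
have [/set_mem/=|/negP ns] := boolP (s \in _).
  rewrite in_itv/= => /andP[as_ sb]; rewrite sb (_ : (s <= a) = false) ?sub0r; first by rewrite /= mulr1n; ring.
  by apply/negbTE; rewrite -ltNge.
have [sa|sa] := leP s a; first by rewrite (le_trans sa ab) subrr mul0r.
rewrite (_ : (s <= b) = false) ?subrr ?mul0r//.
apply/negbTE/negP => sb; apply: ns; apply/mem_set; by rewrite /= in_itv/= sa.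
Qed.

(** On a square, [|prim w|] is at most the integral [W] of [|w|] over the horizontal slice of the
    square, which does not depend on the first coordinate and is integrable by Tonelli. *)
Lemma prim_locint w : locint w -> locint (prim w).
Proof.
move=> lw; have [mw hw] := lw; split; first exact: prim_meas.
move=> K; have [K0|K0] := ltP K 0.
  rewrite (_ : (fun x => _) = (fun=> 0)); first exact: itg0.
  apply/funext => x; rewrite indicE memNset ?mul0r// => /sqP[h _].
  by have := le_lt_trans h K0; rewrite ltNge normr_ge0.
pose W (y : R) : \bar R := (\int[lam]_s `|\1_(sq K) (s, y) * w (s, y)|%:E)%E.
have mabs : measurable_fun setT (fun x : T2 => `|\1_(sq K) x * w x|%:E).
  by apply/measurable_EFinP/meas_norm; exact: itg_meas (hw K).
have mW : measurable_fun setT W.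
  by apply: (@measurable_fun_fubini_tonelli_G _ _ M M R lam (fun x : T2 => `|\1_(sq K) x * w x|%:E)).
have W0 y : (0 <= W y)%E by apply: integral_ge0 => s _; rewrite lee_fin.
have mp := prim_meas mw.
apply: itgP; first by apply: measM => //; exact: sq_ind_meas.
have IW : (\int[lam]_y W y < +oo)%E.
  have h0 (x : T2) : (0 <= `|\1_(sq K) x * w x|%:E)%E by rewrite lee_fin.
  have h := @fubini_tonelli2 _ _ M M R lam lam (fun x : T2 => `|\1_(sq K) x * w x|%:E) mabs h0.
  by rewrite -[X in (X < _)%E]h; exact: itg_lt (hw K).
apply: (@le_lt_trans _ _ (\int[mu]_x ((\1_(`[- K, K]%classic) x.1)%:E * W x.2))%E).
  apply: ge0_le_integral => //.
  - by apply/measurable_EFinP/meas_norm/measM => //; exact: sq_ind_meas.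
  - apply: emeasurable_funM; last by apply: (measurableT_comp mW); exact: measurable_snd.
    by apply/measurable_EFinP; apply: (meas_fst (a := \1_(`[- K, K]%classic))); apply: meas_indic; exact: measurable_itv.
  - move=> [x y] _ /=.
    rewrite indicE; have [/set_mem xK|_] := boolP ((x, y) \in sq K); last first.
      by rewrite mul0r normr0 mule_ge0// lee_fin indicE.
    have /sqP[/= xK1 yK] := xK.
    rewrite mul1r indicE mem_set/= ?mul1e; last by rewrite /= in_itv/= -ler_norml.
    rewrite /prim /=.
    have mi : @meas _ M R (fun s => step x s * w (s, y)).
      by apply: measM; [apply: step_meas; [exact: meas_cst|exact: measurable_id]|exact: slice_meas].
    apply: (@le_trans _ _ `|\int[lam]_s (step x s * w (s, y))%:E|%E).
      rewrite /Rintegral; case: (\int[lam]_s _)%E => [r| |] //=; by rewrite ?normr0 ?leey.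
    apply: (le_trans (le_abse_integral _ _ _)) => //; first exact/measurable_EFinP.
    apply: ge0_le_integral => //.
    + by apply/measurable_EFinP/meas_norm.
    + apply/measurable_EFinP/meas_norm.
      by apply: (slice_meas (f := fun x => \1_(sq K) x * w x)); exact: itg_meas (hw K).
    + move=> s _; rewrite lee_fin !normrM ler_wpM2r//.
      rewrite (le_trans (step_bound x s))// (le_trans _ (ler_norm _))//.
      rewrite !indicE; have [/set_mem/=|//] := boolP (s \in _).
      rewrite in_itv/= -ler_norml => sx; rewrite mem_set//; apply/sqP; split => //=.
      exact: le_trans sx xK1.
have mIe : measurable_fun setT (fun x : M => (\1_(`[- K, K]%classic) x)%:E : \bar R).
  by apply/measurable_EFinP; apply: meas_indic; exact: measurable_itv.
have m2 : measurable_fun setT (fun x : T2 => (\1_(`[- K, K]%classic) x.1)%:E * W x.2)%E.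
  apply: emeasurable_funM; last by apply: (measurableT_comp mW); exact: measurable_snd.
  by apply: (measurableT_comp mIe); exact: measurable_fst.
have p2 (x : T2) : (0 <= (\1_(`[- K, K]%classic) x.1)%:E * W x.2)%E.
  by rewrite mule_ge0// lee_fin indicE.
have h := @fubini_tonelli2 _ _ M M R lam lam _ m2 p2.
rewrite [X in (X < _)%E]h.
rewrite [X in (X < _)%E](_ : _ = (\int[lam]_y (lam `[(- K)%R, K] * W y))%E); last first.
  apply: eq_integral => y _; rewrite /fubini_G/= ge0_integralZr//.
  by rewrite integral_indic ?setIT//; exact: measurable_itv.
rewrite ge0_integralZl//.
rewrite lte_mul_pinfty//.
by rewrite ge0_fin_numE// lebesgue_measure_itv/=; case: ifP => // _; rewrite -EFinB ltry.
Qed.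

Lemma aeA (P : R2 -> Prop) : {ae mu, forall x, P x} ->
  {ae lam, forall y, {ae lam, forall x, P (x, y)}}.
Proof.
move=> [N [mN N0 PN]].
have mI : measurable_fun setT (fun x : T2 => (\1_N x)%:E : \bar R).
  by apply/measurable_EFinP; exact: meas_indic.
have p2 (x : T2) : (0 <= (\1_N x)%:E :> \bar R)%E by rewrite lee_fin indicE.
have h := @fubini_tonelli2 _ _ M M R lam lam _ mI p2.
have IN0 : (\int[lam \x lam]_z (\1_N z)%:E = 0)%E by rewrite integral_indic// setIT.
have mG : measurable_fun setT (fubini_G lam (fun x : T2 => (\1_N x)%:E : \bar R)).
  exact: measurable_fun_fubini_tonelli_G.
have G0 y : (0 <= fubini_G lam (fun x : T2 => (\1_N x)%:E : \bar R) y)%E by apply: integral_ge0.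
have : ae_eq lam setT (fubini_G lam (fun x : T2 => (\1_N x)%:E : \bar R)) (cst 0%E).
  apply/ae_eq_integral_abs => //; rewrite -[RHS]IN0 h.
  by apply: eq_integral => y _; rewrite gee0_abs.
move=> h2; apply: (aeS h2) => y /= /(_ I); rewrite /fubini_G => hy.
have mNy : measurable ((fun x : M => (x, y)) @^-1` N).
  by rewrite -[X in measurable X]setTI; apply: (pair2_measurable (y : M)).
exists ((fun x : M => (x, y)) @^-1` N); split => //.
  have E : (\int[lam]_x (\1_((fun x : M => (x, y)) @^-1` N) x : R)%:E = lam ((fun x : M => (x, y)) @^-1` N))%E.
    by rewrite integral_indic// setIT.
  rewrite -E -[RHS]hy; apply: eq_integral => x _; rewrite !indicE; congr ((nat_of_bool _)%:R%:E).
by move=> x /= nP; apply: PN.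
Qed.

(** The ACL property of Sobolev functions: absolute continuity on almost every line, here
    horizontal, for a representative of [u] and with density [w]. Vertical lines are reached by
    exchanging the coordinates. *)
Definition acl1 (u w : R2 -> R) := exists f : R2 -> R, [/\ @meas _ T2 R f,
  {ae mu, forall x, u x = f x} &
  {ae lam, forall y, ac (fun x => f (x, y)) (fun x => w (x, y))}].

Lemma is_derive_slice1 (phi : R2 -> R) (y : R) : smooth phi ->
  forall x : R, is_derive x (1 : R) (fun x : R => phi (x, y)) ('D_(axis1 : R2) phi (x, y)).
Proof.
move=> sp x; have [_ /(_ (x, y))[d1 d2]] := smooth_der (axis1 : R2) sp.
have E : (fun h : R => h^-1 *: ((phi \o shift (x, y)) (h *: (axis1 : R2)) - phi (x, y))) =
  (fun h : R => h^-1 *: (((fun x : R => phi (x, y)) \o shift x) (h *: (1 : R)) - phi (x, y))).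
  apply/funext => h /=; congr (_ *: (phi _ - _)).
  by rewrite /axis1; congr (_, _) => /=; rewrite scaler0 add0r.
by apply: DeriveDef; [move: d1; rewrite /derivable E|move: d2; rewrite /derive E].
Qed.

Lemma slice1_cont (phi : R2 -> R) (y : R) : continuous phi -> continuous (fun x : R => phi (x, y)).
Proof.
move=> cp x; apply: (@continuous_comp _ _ _ (fun x : R => (x, y)) phi); last exact: cp.
by apply: (@cvg_pair _ _ _ _ (nbhs x) (nbhs y) _ _ _ (fun z : R => z) (fun=> y)); [exact: cvg_id|exact: cvg_cst].
Qed.

Lemma ac_test0 (f g : M -> R) (phi dphi : R -> R) (K : R) : ac f g ->
  (forall x, is_derive x (1 : R) phi (dphi x)) -> continuous dphi ->
  (forall x, K < `|x| -> phi x = 0) -> (forall x, K < `|x| -> dphi x = 0) ->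
  \int[lam]_x (f x * dphi x + phi x * g x) = 0.
Proof.
move=> fg dp cd p0 dp0.
pose L := `|K| + 1.
have KL : K < L by rewrite /L (le_lt_trans (ler_norm K))// ltrDl.
have L0 : 0 <= L by rewrite /L addr_ge0.
have ap := ac_prod fg (ac_C1 dp cd).
have [_ _ /(_ (- L) L)] := ap.
rewrite ge0_cp// => /(_ isT).
have -> : phi L = 0 by apply: p0; rewrite ger0_norm.
have -> : phi (- L) = 0 by apply: p0; rewrite normrN ger0_norm.
rewrite !mulr0 subrr => h; rewrite [RHS]h; apply: J_supp => x Lx.
by rewrite p0 ?dp0 ?mul0r ?mulr0 ?addr0// (lt_trans KL).
Qed.

Lemma itgD_test (u w : R2 -> R) (e : R2) phi : locint u -> locint w -> test_function phi ->
  (\int[mu]_x (u x * 'D_e phi x) = - \int[mu]_x (w x * phi x)) <->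
  \int[mu]_x (u x * 'D_e phi x + w x * phi x) = 0.
Proof.
move=> lu lw tp; rewrite ID; [|apply: itg_test => //; exact: test_der|exact: itg_test].
by split=> [->|/eqP]; [rewrite addrC subrr|rewrite addr_eq0 => /eqP].
Qed.

(** Fubini reduces the claim to integration by parts on a line, that is, to the product rule for
    absolutely continuous functions against a test function vanishing at both ends. *)
Lemma acl1_wd u w : locint u -> locint w -> acl1 u w -> wd axis1 u w.
Proof.
move=> lu lw [f [mf uf hf]].
have lf := locint_ae lu mf uf.
suff [_ _ h] : wd axis1 f w.
  split => // phi tp; rewrite -h//; have td := test_der axis1 tp.
  apply: I_ae; [apply: itg_meas; exact: (itg_test lu td)|apply: itg_meas; exact: (itg_test lf td)|].
  by apply: (aeS uf) => x ->.
split => // phi tp; apply/itgD_test => //; have td := test_der axis1 tp.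
apply: fub0; first by apply: itgD; exact: itg_test.
apply: (aeS hf) => y hy.
have /testP[sp [K hK]] := tp; have /testP[sd [L hL]] := td.
rewrite -[RHS](@ac_test0 _ _ (fun x => phi (x, y)) (fun x => 'D_axis1 phi (x, y)) (Num.max K L) hy).
- by apply: eq_Rintegral => x _; rewrite (mulrC (w _)).
- exact: is_derive_slice1.
- by apply: (@slice1_cont ('D_axis1 phi)); exact: smooth_cont.
- by move=> x; rewrite gt_max => /andP[h _]; apply: hK; left.
- by move=> x; rewrite gt_max => /andP[_ h]; apply: hL; left.
Qed.

Lemma itg_tensor (a b : M -> R) : itg lam a -> itg lam b -> itg mu (fun x : T2 => a x.1 * b x.2).
Proof.
move=> ia ib; have ma := itg_meas ia; have mb := itg_meas ib.
have mab : @meas _ T2 R (fun x : T2 => a x.1 * b x.2) by apply: measM; [exact: meas_fst|exact: meas_snd].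
apply: itgP => //.
have m2 : measurable_fun setT (fun x : T2 => `|a x.1 * b x.2|%:E) by apply/measurable_EFinP/meas_norm.
have p2 (x : T2) : (0 <= `|a x.1 * b x.2|%:E)%E by rewrite lee_fin.
have h := @fubini_tonelli2 _ _ M M R lam lam _ m2 p2.
have mna : measurable_fun setT (fun x : M => `|a x|%:E) by apply/measurable_EFinP/meas_norm.
have mnb : measurable_fun setT (fun x : M => `|b x|%:E) by apply/measurable_EFinP/meas_norm.
rewrite [X in (X < _)%E]h.
rewrite [X in (X < _)%E](_ : _ = (\int[lam]_y ((\int[lam]_x `|a x|%:E) * `|b y|%:E))%E); last first.
  apply: eq_integral => y _; rewrite /fubini_G/=.
  under eq_integral do rewrite normrM EFinM.
  by rewrite ge0_integralZr.
have fa := itg_lt ia; have fb := itg_lt ib.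
rewrite ge0_integralZl//; last by apply: integral_ge0.
rewrite lte_mul_pinfty//; first by apply: integral_ge0.
by rewrite ge0_fin_numE//; apply: integral_ge0.
Qed.

Lemma itg_ind1 (K : R) : itg lam (\1_(`[- K, K]%classic) : M -> R).
Proof.
apply: itg_ge0P; [by move=> x; rewrite indicE|by apply: meas_indic; exact: measurable_itv|].
have h : (lam `[(- K)%R, K] < +oo)%E.
  by rewrite lebesgue_measure_itv/=; case: ifP => // _; rewrite -EFinB ltry.
rewrite integral_indic ?setIT//; exact: measurable_itv.
Qed.

Lemma sq_indE K (x : R2) : \1_(sq K) x = \1_(`[- K, K]%classic) x.1 * \1_(`[- K, K]%classic) x.2 :> R.
Proof.
rewrite !indicE -natrM mulnb; congr (_%:R); congr nat_of_bool.
apply/idP/andP => [/set_mem[h1 h2]|[/set_mem h1 /set_mem h2]]; first by split; apply/mem_set.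
exact/mem_set.
Qed.

Lemma itg_marginal (g : R2 -> R) : itg mu g -> itg lam (fun y : M => \int[lam]_s g (s, y)).
Proof.
move=> gi; have mg := itg_meas gi.
have mc : @meas _ M R (fun y : M => \int[lam]_s g (s, y)).
  apply: (@meas_param _ _ M M lam (fun z : M * M => g (z.2, z.1))).
  by apply: (measurableT_comp mg); exact: measurable_swap.
apply: itgP => //.
have m2 : measurable_fun setT (fun x : T2 => `|g x|%:E) by apply/measurable_EFinP/meas_norm.
have p2 (x : T2) : (0 <= `|g x|%:E)%E by rewrite lee_fin.
have h := @fubini_tonelli2 _ _ M M R lam lam _ m2 p2.
apply: (@le_lt_trans _ _ (\int[lam]_y fubini_G lam (fun x : T2 => `|g x|%:E) y)%E); last first.
  by rewrite -[X in (X < _)%E]h; exact: itg_lt gi.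
apply: ge0_le_integral => //.
- by apply/measurable_EFinP/meas_norm.
- exact: measurable_fun_fubini_tonelli_G.
- move=> y _; rewrite /fubini_G.
  apply: (@le_trans _ _ `|\int[lam]_s (g (s, y))%:E|%E).
    rewrite /Rintegral; case: (\int[lam]_s _)%E => [r| |] //=; by rewrite ?normr0 ?leey.
  apply: le_abse_integral => //; apply/measurable_EFinP; exact: slice_meas.
Qed.

(** The difference [h] of [u] and the primitive of [w] has zero weak derivative along the first
    axis. Subtracting from a bump its mean times a fixed bump [eta] of integral 1 leaves a
    derivative, to which [h] is orthogonal; hence [h] equals its [eta]-average [c], a function of
    the second coordinate alone. *)
Lemma acl1_of_wd (u w : R2 -> R) : wd axis1 u w -> acl1 u w.
Proof.
move=> [lu lw hw]; have [mu_ _] := lu; have [mw _] := lw.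
have aw := slice_loc1 lw.
pose V := prim w; have lV : locint V by exact: prim_locint.
have mV := lV.1.
have acV : {ae lam, forall y, ac (fun x => V (x, y)) (fun x => w (x, y))}.
  by apply: (aeS aw) => y hy; exact: prim_ac.
have [_ _ hV] : wd axis1 V w.
  by apply: acl1_wd => //; exists V; split => //; exact: aeW.
pose h x := u x - V x; have lh : locint h by exact: locintB.
have h1 psi dpsi chi : bump psi -> bump chi -> bump dpsi ->
    (forall x, is_derive x (1 : R) psi (dpsi x)) ->
    \int[mu]_x (h x * (dpsi x.1 * chi x.2)) = 0.
  move=> bp bc bdp dp.
  have tp : test_function (fun x : R2 => psi x.1 * chi x.2) by exact: test_tens.
  have tdp : test_function (fun x : R2 => dpsi x.1 * chi x.2) by exact: test_tens.
  have [dchi [_ dc]] := bump_der bc.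
  have E (f : R2 -> R) : \int[mu]_x (f x * (dpsi x.1 * chi x.2)) =
      \int[mu]_x (f x * 'D_axis1 (fun x : R2 => psi x.1 * chi x.2) x).
    apply: eq_Rintegral => x _; congr (_ * _); have [_ ->] := is_derive_tens x (axis1 : R2) dp dc.
    by rewrite /axis1/= mul1r mul0r addr0.
  under eq_Rintegral do rewrite mulrBl.
  rewrite IB; [|exact: itg_test..].
  by rewrite !E hw// hV// subrr.
have [eta [be Ie]] := bump_one.
pose c (y : R) : R := \int[lam]_s (h (s, y) * eta s).
have mh : @meas _ T2 R h := lh.1.
have meta : @meas _ M R eta by exact: bump_meas.
have mc : @meas _ M R c.
  apply: (@meas_param _ _ M M lam (fun z : M * M => h (z.2, z.1) * eta z.2)).
  apply: measM; first by apply: (measurableT_comp mh); exact: measurable_swap.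
  exact: meas_snd.
have mc2 : @meas _ T2 R (fun x : T2 => c x.2) by exact: meas_snd.
have lc : locint (fun x : R2 => c x.2).
  split => // K; have [K0|K0] := ltP K 0.
    rewrite (_ : (fun x => _) = (fun=> 0)); first exact: itg0.
    apply/funext => x; rewrite indicE memNset ?mul0r// => /sqP[h' _].
    by have := le_lt_trans h' K0; rewrite ltNge normr_ge0.
  have [Ke hKe] := be.2; have [Me hMe] := bump_bounded be.
  have [_ hh] := lh.
  have gi : itg mu (fun x : R2 => \1_(`[- K, K]%classic) x.2 * (h x * eta x.1)).
    apply: (@itg_le _ _ _ mu _ (fun x => Me * `|\1_(sq (Num.max K Ke)) x * h x|)).
    - apply: measM; first by apply: (meas_snd (a := \1_(`[- K, K]%classic))); apply: meas_indic; exact: measurable_itv.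
      by apply: measM => //; exact: meas_fst.
    - by apply: itgZ; apply: itg_norm; exact: hh.
    - move=> x; rewrite indicE; have [/set_mem/=|_] := boolP (x.2 \in _); last first.
        by rewrite mul0r normr0 mulr_ge0// (le_trans _ (hMe 0)).
      rewrite in_itv/= -ler_norml => x2K; rewrite mul1r.
      have [x1|/hKe ->] := leP `|x.1| Ke; last by rewrite mulr0 normr0 mulr_ge0// (le_trans _ (hMe 0)).
      rewrite indicE mem_set ?mul1r; last by apply/sqP; rewrite !le_max x1 x2K orbT.
      by rewrite normrM mulrC ler_wpM2r.
  have := itg_tensor (itg_ind1 K) (itg_marginal gi).
  rewrite /itg; apply: eq_integrable => // x _ /=; congr EFin.
  rewrite sq_indE -mulrA; congr (_ * _); rewrite /c -[RHS]/(_ * _).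
  have [->|->] : \1_(`[- K, K]%classic) x.2 = 0 :> R \/ \1_(`[- K, K]%classic) x.2 = 1 :> R.
    by rewrite indicE; case: (_ \in _); [right|left].
    by rewrite mul0r; under eq_Rintegral do rewrite mul0r; rewrite I0.
  transitivity (\int[lam]_s (h (s, x.2) * eta s)); last by rewrite [RHS]mul1r.
  by apply: eq_Rintegral => s _; exact: mul1r.
exists (fun x => c x.2 + V x); split.
- exact: measD.
- have : {ae mu, forall x, h x - c x.2 = 0}.
    apply: FL_loc; first exact: locintB.
    move=> psi chi bp bc.
    pose I := \int[lam]_x psi x.
    have bz : bump (fun x => (- I) * eta x + psi x) by exact: bump_lin.
    have Iz : \int[lam]_x ((- I) * eta x + psi x) = 0.
      rewrite ID; [|by apply: itgZ; exact: bump_itg|exact: bump_itg].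
      by rewrite IZ ?Ie; [rewrite mulr1 addrC subrr|exact: bump_itg].
    have [F [bF dF]] := bump_primitive bz Iz.
    have e1 := h1 _ _ _ bF bc bz dF.
    have t1 : test_function (fun x : R2 => psi x.1 * chi x.2) by exact: test_tens.
    have t2 : test_function (fun x : R2 => eta x.1 * chi x.2) by exact: test_tens.
    have e2 : \int[mu]_x (I * (h x * (eta x.1 * chi x.2)) - c x.2 * (psi x.1 * chi x.2)) = 0.
      apply: fub0.
        by apply: itgB; [apply: itgZ; exact: itg_test|exact: itg_test].
      have i1 := ae_integrable2 (itg_test lh t2).
      apply: (aeS (slice_loc1 lh)) => y hy /=.
      have ih : itg lam (fun s => h (s, y) * eta s).
        have [Ke hKe] := be.2.
        apply: (@itgon_T _ Ke) => [x /hKe ->|]; first by rewrite mulr0.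
        have [Me hMe] := bump_bounded be.
        have := @itgonM _ eta (fun x => h (x, y)) (- Ke) Ke Me meta hy.1 (hy.2 _ _) (fun x _ => hMe x).
        by apply: eq_integrable => // x _ /=; rewrite mulrC.
      transitivity (\int[lam]_x ((I * chi y) * (h (x, y) * eta x) - (c y * chi y) * psi x)).
        by apply: eq_Rintegral => x _; ring.
      rewrite IB; [|exact: itgZ|by apply: itgZ; exact: bump_itg].
      by rewrite !IZ//; [rewrite -/(c y) -/I; ring|exact: bump_itg].
    have e3 : \int[mu]_x (h x * ((- I * eta x.1 + psi x.1) * chi x.2) + (I * (h x * (eta x.1 * chi x.2)) - c x.2 * (psi x.1 * chi x.2))) = 0.
      rewrite ID ?e1 ?e2 ?addr0//; last first.
        by apply: itgB; [apply: itgZ; exact: itg_test|exact: itg_test].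
      apply: itg_test => //; exact: (test_tens bz bc).
    by rewrite -[RHS]e3; apply: eq_Rintegral => x _; ring.
  by move=> h0; apply: (aeS h0) => x; rewrite /h => /eqP; rewrite subr_eq0 => /eqP <-; rewrite subrK.
- apply: (aeS acV) => y [mVy l1 hy]; split => //.
    exact: (@measD _ M R (fun=> c y) _ (meas_cst _) mVy).
  by move=> a b ab /=; rewrite -hy//; ring.
Qed.

End ACL.

(** * Calculus of weak derivatives *)

Section WeakCalculus.
Context {R : realType}.
Local Notation M := (measurableTypeR R).
Local Notation T2 := (M * M)%type.
Local Notation R2 := (R * R)%type.
Local Notation mu := (leb2 R).

Lemma is_derive_lt (g : R -> R) (x d : R) :
  (forall e, 0 < e -> \forall h \near (0 : R), `|g (h + x) - g x - h * d| <= e * `|h|) ->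
  is_derive x (1 : R) g d.
Proof.
move=> hg.
have cv : (fun h => h^-1 *: ((g \o shift x) (h *: (1 : R)) - g x)) @ 0^' --> (d : R).
  apply/cvgrPdist_le => e e0; have := hg e e0; move=> hge; near=> h.
  have h0 : h != 0 by near: h; exact: nbhs_dnbhs_neq.
  rewrite /= [_ *: 1]mulr1 -[_ *: _]/(_ * _) distrC.
  have -> : h^-1 * (g (h + x) - g x) - d = h^-1 * (g (h + x) - g x - h * d).
    by rewrite [RHS]mulrBr mulrA mulVf// mul1r.
  rewrite normrM normfV ler_pdivrMl ?normr_gt0// [leRHS]mulrC.
  by near: h; exact: nbhs_dnbhs.
by apply: DeriveDef; [apply/cvg_ex; exists d|exact/cvg_lim].
Unshelve. all: by end_near. Qed.

Lemma mvt_norm (f df : R -> R) (a b : R) : (forall x, is_derive x (1 : R) f (df x)) ->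
  exists2 c, `|c - a| <= `|b - a| & f b - f a = df c * (b - a).
Proof.
move=> dfE.
have cf : continuous f.
  by move=> x; apply: differentiable_continuous; apply/derivable1_diffP; have [] := dfE x.
have [ab|ba] := leP a b.
  have [|c] := MVT_segment (df := df) ab (fun x _ => dfE x).
    exact: continuous_subspaceT.
  rewrite in_itv/= => /andP[ac cb] h; exists c => //.
  by rewrite !ger0_norm ?subr_ge0// lerB.
have [|c] := MVT_segment (df := df) (ltW ba) (fun x _ => dfE x).
  exact: continuous_subspaceT.
rewrite in_itv/= => /andP[bc ca] h; exists c; last by move: h; lra.
by rewrite !ler0_norm ?subr_le0// ?(ltW ba)//; lra.
Qed.

Lemma is_derive_slice2 (phi : R2 -> R) (x : R) : smooth phi ->
  forall y : R, is_derive y (1 : R) (fun y : R => phi (x, y)) ('D_(axis2 : R2) phi (x, y)).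
Proof.
move=> sp y; have [_ /(_ (x, y))[d1 d2]] := smooth_der (axis2 : R2) sp.
have E : (fun h : R => h^-1 *: ((phi \o shift (x, y)) (h *: (axis2 : R2)) - phi (x, y))) =
  (fun h : R => h^-1 *: (((fun y : R => phi (x, y)) \o shift y) (h *: (1 : R)) - phi (x, y))).
  apply/funext => h /=; congr (_ *: (phi _ - _)).
  by rewrite /axis2; congr (_, _) => /=; rewrite scaler0 add0r.
by apply: DeriveDef; [move: d1; rewrite /derivable E|move: d2; rewrite /derive E].
Qed.

(** Continuity of the partial derivatives gives linearity in the direction: the increment is split
    into a horizontal and a vertical step, and the mean value theorem is applied to each. *)
Lemma derive_dir (phi : R2 -> R) (a b : R) (x : R2) : smooth phi ->
  'D_(a, b) phi x = a * 'D_axis1 phi x + b * 'D_axis2 phi x.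
Proof.
move=> sp; have [s1 _] := smooth_der (axis1 : R2) sp; have [s2 _] := smooth_der (axis2 : R2) sp.
apply: (@derive_val R R2 R x ((a, b) : R2) phi); apply: is_derive_line; apply: is_derive_lt => e e0.
have c1 : {for x, continuous ('D_axis1 phi)} by exact: (smooth_cont s1).
have c2 : {for x, continuous ('D_axis2 phi)} by exact: (smooth_cont s2).
pose N := `|a| + `|b| + 1; have N0 : 0 < N by rewrite ltr_wpDl// addr_ge0.
have eN : 0 < e / N by rewrite divr_gt0.
have /cvgrPdist_le/(_ _ eN) n1 := c1; have /cvgrPdist_le/(_ _ eN) n2 := c2.
have /nbhs_ballP[d d0 hd] : nbhs x [set t : R2 | `|'D_axis1 phi x - 'D_axis1 phi t| <= e / N /\
   `|'D_axis2 phi x - 'D_axis2 phi t| <= e / N].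
  by apply: filterS2 n1 n2 => t t1 t2; exact: (conj t1 t2).
have dN : 0 < d / N by rewrite divr_gt0.
near=> h.
have hsmall : `|h| < d / N.
  by near: h; apply: (@nbhs0_lt R R).
have hd' (t : R2) : `|t.1 - x.1| <= `|h| * N -> `|t.2 - x.2| <= `|h| * N -> ball x d t.
  move=> h1 h2; rewrite /ball/= /prod_ball /ball/=; split.
    by rewrite distrC (le_lt_trans h1)// -ltr_pdivlMr.
  by rewrite distrC (le_lt_trans h2)// -ltr_pdivlMr.
rewrite addr0 scale0r add0r.
have [c1' hc1 e1] := mvt_norm x.1 (h * a + x.1) (fun t => is_derive_slice1 x.2 sp t).
have [c2' hc2 e2] := mvt_norm x.2 (h * b + x.2) (fun t => is_derive_slice2 (h * a + x.1) sp t).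
rewrite addrK in hc1 e1; rewrite addrK in hc2 e2.
have [_ b1] : _ /\ _ := conj I (hd (c1', x.2)).
have [_ b2] : _ /\ _ := conj I (hd (h * a + x.1, c2')).
have aN : `|h * a| <= `|h| * N.
  by rewrite normrM ler_wpM2l// /N -addrA lerDl addr_ge0.
have bN : `|h * b| <= `|h| * N.
  by rewrite normrM ler_wpM2l// /N addrAC lerDr addr_ge0.
have [b1' _] : `|'D_axis1 phi x - 'D_axis1 phi (c1', x.2)| <= e / N /\ `|'D_axis2 phi x - 'D_axis2 phi (c1', x.2)| <= e / N.
  apply: b1; apply: hd' => /=; first exact: le_trans hc1 aN.
  by rewrite subrr normr0 mulr_ge0// ltW.
have [_ b2'] : `|'D_axis1 phi x - 'D_axis1 phi (h * a + x.1, c2')| <= e / N /\ `|'D_axis2 phi x - 'D_axis2 phi (h * a + x.1, c2')| <= e / N.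
  apply: b2; apply: hd' => /=; first by rewrite addrK.
  exact: le_trans hc2 bN.
have -> : phi (h *: ((a, b) : R2) + x) - phi x - h * (a * 'D_axis1 phi x + b * 'D_axis2 phi x) =
   - (h * a) * ('D_axis1 phi x - 'D_axis1 phi (c1', x.2)) -
    (h * b) * ('D_axis2 phi x - 'D_axis2 phi (h * a + x.1, c2')).
  have -> : phi (h *: ((a, b) : R2) + x) = phi (h * a + x.1, h * b + x.2).
    by congr phi; rewrite [LHS]surjective_pairing.
  have -> : phi x = phi (x.1, x.2) by rewrite -surjective_pairing.
  move: e1 e2; move: ('D_axis1 phi x) ('D_axis2 phi x) ('D_axis1 phi _) ('D_axis2 phi _) (phi _) (phi _) (phi _).
  by clear => *; lra.
apply: (le_trans (ler_normB _ _)); rewrite !normrM normrN normrM.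
apply: (@le_trans _ _ (`|h| * `|a| * (e / N) + `|h| * `|b| * (e / N))).
  by rewrite lerD// ?ler_wpM2l ?mulr_ge0// -normrM.
have -> : `|h| * `|a| * (e / N) + `|h| * `|b| * (e / N) = e * `|h| * ((`|a| + `|b|) / N) by ring.
rewrite -[leRHS]mulr1 ler_wpM2l ?mulr_ge0 ?(ltW e0)// ler_pdivrMr// mul1r /N lerDl.
exact: ler01.
Unshelve. all: by end_near. Qed.

Lemma wd_dir (c s : R) u w w' : wd axis1 u w -> wd axis2 u w' ->
  wd ((c, s) : R2) u (fun x => c * w x + s * w' x).
Proof.
move=> [lu lw hw] [_ lw' hw']; split => //; first by apply: locintD; exact: locintZ.
move=> phi tp; have [sp _] := tp.
have t1 := test_der (axis1 : R2) tp; have t2 := test_der (axis2 : R2) tp.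
have i1 := itg_test lu t1; have i2 := itg_test lu t2.
have i3 := itg_test lw tp; have i4 := itg_test lw' tp.
transitivity (\int[mu]_x (c * (u x * 'D_axis1 phi x) + s * (u x * 'D_axis2 phi x))).
  by apply: eq_Rintegral => x _; rewrite (derive_dir _ _ _ sp); ring.
have hwp := hw phi tp; have hwp' := hw' phi tp.
apply: (etrans (ID (itgZ c i1) (itgZ s i2))).
rewrite (IZ c i1).
rewrite (IZ s i2).
rewrite hwp hwp'.
transitivity (- \int[mu]_x (c * (w x * phi x) + s * (w' x * phi x))); last first.
  by congr (- _); apply: eq_Rintegral => x _; ring.
by rewrite (ID (itgZ c i3) (itgZ s i4)) (IZ _ i3) (IZ _ i4); ring.
Qed.

(** Measure-preserving affine isomorphisms of the plane: [B] is the inverse of [A] and [L] its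
    linear part. The swap of coordinates, translations and rotations are the instances. *)
Definition aiso (A B L : R2 -> R2) := [/\ [/\ @mpres _ T2 R mu A, @mpres _ T2 R mu B,
  cancel A B & cancel B A], continuous A, continuous B &
  forall h x e, A (h *: e + x) = h *: L e + A x].

Lemma cont_sq (A : R2 -> R2) K : continuous A -> exists K', forall x, sq K x -> sq K' (A x).
Proof.
move=> cA; have : compact (A @` sq K).
  apply: continuous_compact; last exact: sq_compact.
  exact: continuous_subspaceT.
by move=> /compact_sub_sq[K' h]; exists K' => x xK; apply: h; exists x.
Qed.

Lemma locint_comp (A : R2 -> R2) u : @mpres _ T2 R mu A -> continuous A -> locint u ->
  locint (fun x => u (A x)).
Proof.
move=> mA cA [mu_ hu]; split; first exact: (mp_meas mA mu_).
move=> K; have [K' hK'] := cont_sq K cA.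
have := itg_indic_mul (p := id : T2 -> T2) (@measurable_id _ T2 setT) (sq_measurable K) (mp_itg mA (hu K')).
rewrite /itg; apply: eq_integrable => // x _ /=; congr EFin.
rewrite /comp mulrA; congr (_ * _); rewrite !indicE.
have [/set_mem xK|_] := boolP (x \in sq K); last by rewrite mul0r.
by rewrite mul1r mem_set//; exact: hK'.
Qed.

Lemma aiso_inv_lin (A B L : R2 -> R2) e h x : aiso A B L -> B (h *: L e + x) = h *: e + B x.
Proof.
by move=> [[_ _ AB BA] _ _ hA]; rewrite -[in LHS](BA x) -hA AB.
Qed.

(** Change of variables moves [A] onto the test function as [phi \o B], whose derivative along [L e]
    is that of [phi] along [e]. *)
Lemma wd_comp (A B L : R2 -> R2) e u w : aiso A B L -> wd (L e) u w ->
  wd e (fun x => u (A x)) (fun x => w (A x)).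
Proof.
move=> ai [lu lw hw]; have [[mA mB AB BA] cA cB hA] := ai.
split; [exact: locint_comp..|move=> phi tp].
have sp := tp.1; have /testP[_ [K hK]] := tp.
have dB x : is_derive x (L e) (phi \o B) ('D_e phi (B x)).
  apply: is_derive_line; have [_ dg] := smooth_der e sp.
  have := is_derive_lineP (dg (B x)).
  by under [X in is_derive _ _ X _]eq_fun do rewrite -(aiso_inv_lin _ _ _ ai).
have tB : test_function (phi \o B).
  apply/testP; split.
    have [] := @smooth_affine _ (fun f => B (f + A 0)) B phi sp cB => //.
    move=> h x f.
    have Lf : L (B (f + A 0)) = f.
      have := hA 1 0 (B (f + A 0)); rewrite scale1r addr0 BA scale1r => /eqP.
      by rewrite (inj_eq (addIr _)) => /eqP <-.
    by rewrite -[in LHS]Lf (aiso_inv_lin _ _ _ ai).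
  have [K' hK'] := cont_sq K cA.
  exists K' => y hy; apply: hK.
  have [|/negP h] := boolP ((`|(B y).1| <= K) && (`|(B y).2| <= K)); last first.
    by move: h; move/negP; rewrite negb_and -!ltNge => /orP[]; [left|right].
  move=> /andP[b1 b2]; have : sq K (B y) by apply/sqP.
  move=> /hK'; rewrite BA => /sqP[y1 y2].
  by case: hy => h; [move: y1|move: y2]; rewrite leNgt h.
have td := test_der e tp.
have E (f g : R2 -> R) : @meas _ T2 R f -> itg mu (fun x => f (A x) * g x) ->
     \int[mu]_x (f (A x) * g x) = \int[mu]_x (f x * g (B x)).
  move=> mf i; rewrite -(mp_I mB i); apply: eq_Rintegral => x _ /=.
  by rewrite BA.
have lu' := locint_comp mA cA lu; have lw' := locint_comp mA cA lw.
rewrite (E u _ lu.1 (itg_test lu' td)) (E w _ lw.1 (itg_test lw' tp)).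
rewrite -(hw _ tB); apply: eq_Rintegral => x _; congr (_ * _).
by apply/esym; apply: (@derive_val R R2 R x (L e) (phi \o B)); exact: dB.
Qed.

Lemma cont_pair (f g : R2 -> R) : continuous f -> continuous g ->
  continuous (fun x : R2 => (f x, g x) : R2).
Proof. by move=> cf cg x; exact: (@cvg_pair _ _ _ (nbhs x) (nbhs (f x)) (nbhs (g x)) _ _ _ f g (cf x) (cg x)). Qed.

Lemma cont_lin2 (a b c : R) : continuous (fun x : R2 => a * x.1 + b * x.2 + c).
Proof.
move=> x; apply: cvgD; last exact: cvg_cst.
by apply: cvgD; apply: cvgM; (exact: cvg_cst || exact: cvg_fst || exact: cvg_snd).
Qed.

Definition swp (x : R2) : R2 := (x.2, x.1).

Lemma swp_cont : continuous swp.
Proof. by apply: cont_pair => x; (exact: cvg_fst || exact: cvg_snd). Qed.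

Lemma aiso_swp : aiso swp swp swp.
Proof.
split; [|exact: swp_cont|exact: swp_cont|by move=> h x e].
by split; [exact: mpres_swap|exact: mpres_swap|case|case].
Qed.

Lemma wd_swp1 u w : wd axis2 u w -> wd axis1 (fun x => u (swp x)) (fun x => w (swp x)).
Proof. by move=> h; apply: (wd_comp aiso_swp). Qed.

Lemma wd_swp2 u w : wd axis1 u w -> wd axis2 (fun x => u (swp x)) (fun x => w (swp x)).
Proof. by move=> h; apply: (wd_comp aiso_swp). Qed.

Lemma swpK : involutive swp. Proof. by case. Qed.

Definition trl (a : R2) (x : R2) : R2 := (x.1 + a.1, x.2 + a.2).

Lemma aiso_trl a : aiso (trl a) (trl (- a)) id.
Proof.
have ct b : continuous (trl b).
  apply: cont_pair => x; apply: cvgD; (exact: cvg_cst || exact: cvg_fst || exact: cvg_snd).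
split; [|exact: ct|exact: ct|].
- split; [exact: mpres_translate|exact: mpres_translate| |] => -[x y]; rewrite /trl /=.
    by rewrite !addrK.
  by rewrite !subrK.
- move=> h x e; rewrite /trl /=.
  by rewrite [RHS]surjective_pairing /= !addrA.
Qed.

Lemma wd_trl a e u w : wd e u w -> wd e (fun x => u (trl a x)) (fun x => w (trl a x)).
Proof. exact: (wd_comp (aiso_trl a)). Qed.

Lemma aiso_rot (c s : R) : c ^+ 2 + s ^+ 2 = 1 -> aiso (rot c s) (rot c (- s)) (rot c s).
Proof.
move=> h; have h' : c ^+ 2 + (- s) ^+ 2 = 1 by rewrite sqrrN.
have cr t : continuous (rot c t).
  apply: cont_pair => x.
    by have := @cont_lin2 c (- t) 0 x; rewrite /continuous_at addr0 mulNr; under eq_fun do rewrite addr0 mulNr.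
  by have := @cont_lin2 t c 0 x; rewrite /continuous_at addr0; under eq_fun do rewrite addr0.
split; [|exact: cr|exact: cr|].
- split; [exact: mpres_rot|exact: mpres_rot| |] => x; rewrite rot_comp -[RHS]rot10; congr (rot _ _ x); rewrite -?h; ring.
- move=> k x e; rewrite /rot [RHS]surjective_pairing /=; congr (_, _).
    by rewrite -![_ *: _]/(_ * _); ring.
  by rewrite -![_ *: _]/(_ * _); ring.
Qed.

Lemma wd_rot1 (c s : R) u a b : c ^+ 2 + s ^+ 2 = 1 -> wd axis1 u a -> wd axis2 u b ->
  wd axis1 (fun x => u (rot c s x)) (fun x => c * a (rot c s x) + s * b (rot c s x)).
Proof.
move=> h ha hb; apply: (wd_comp (aiso_rot h) (w := fun x => c * a x + s * b x)).
rewrite (_ : rot c s axis1 = (c, s)); first exact: wd_dir.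
by rewrite /rot /axis1 /=; congr (_, _); ring.
Qed.

Lemma wd_rot2 (c s : R) u a b : c ^+ 2 + s ^+ 2 = 1 -> wd axis1 u a -> wd axis2 u b ->
  wd axis2 (fun x => u (rot c s x)) (fun x => - s * a (rot c s x) + c * b (rot c s x)).
Proof.
move=> h ha hb; apply: (wd_comp (aiso_rot h) (w := fun x => - s * a x + c * b x)).
rewrite (_ : rot c s axis2 = (- s, c)); first exact: wd_dir.
by rewrite /rot /axis2 /=; congr (_, _); ring.
Qed.

End WeakCalculus.

(** * Chain rule, product rule and positive part for weak derivatives *)

Section ChainRules.
Context {R : realType}.
Local Notation M := (measurableTypeR R).
Local Notation T2 := (M * M)%type.
Local Notation R2 := (R * R)%type.
Local Notation lam := (@lebesgue_measure R).
Local Notation mu := (leb2 R).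

Lemma J_small (g : M -> R) (a e : R) : loc1 g -> 0 < e ->
  exists2 b, a < b & J (fun x => `|g x|) a b <= e.
Proof.
move=> [mg gi] e0; pose C := J (fun x => `|g x|) a (a + 1).
have gn b : itgon (fun x => `|g x|) a b by exact: itgon_norm.
have C0 : 0 <= C by exact: J_ge0.
have H n : exists2 b, a < b & J (fun x => `|g x|) a b <= C / 2 ^+ n.
  elim: n => [|n [b ab hb]]; first by exists (a + 1); rewrite ?ltrDl// expr0 divr1.
  have [m /andP[am mb] hm] := J_mid (ltW ab) (fun x => normr_ge0 (g x)) (gn b).
  have [am'|] := ltP a m.
    by exists m => //; rewrite hm exprSr invfM mulrA ler_pM2r// invr_gt0.
  move=> ma; have E : m = a by apply/le_anti; rewrite ma am.
  have z : J (fun x => `|g x|) a b = 0 by move: hm; rewrite E J_pt; lra.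
  by exists b => //; rewrite z divr_ge0// exprn_ge0.
have [n hn] : exists n, C / 2 ^+ n <= e.
  have : (fun n => C * (2^-1 : R) ^+ n) @ \oo --> C * 0.
    by apply: cvgM; [exact: cvg_cst|apply: cvg_expr; rewrite ger0_norm ?invf_lt1 ?invr_ge0// ltr1n].
  rewrite mulr0 => /cvgrPdist_le/(_ e e0)[n _ /(_ n (leqnn n))].
  rewrite sub0r normrN exprVn => h; exists n; exact: le_trans (ler_norm _) h.
by have [b ab hb] := H n; exists b => //; exact: le_trans hb hn.
Qed.

Lemma ae_itv (P : R -> Prop) (a b : R) : a < b -> {ae lam, forall x, P x} ->
  exists2 x, a <= x <= b & P x.
Proof.
move=> ab [N [mN N0 hN]]; apply: contrapT => h.
have : (lam `[a, b] <= lam N)%E.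
  have mI : measurable (`[a, b]%classic : set M) by exact: measurable_itv.
  apply: (@le_measure _ _ _ lam `[a, b]%classic N); rewrite ?inE//.
  by move=> x /=; rewrite in_itv/= => xab; apply: hN => /= Px; apply: h; exists x.
by rewrite N0 lebesgue_measure_itv/= lte_fin ab -EFinB lee_fin subr_le0 leNgt ab.
Qed.

(** An absolutely continuous function varies little on short intervals, so a closed constraint that
    holds almost everywhere holds at every point. *)
Lemma ac_range (f g : M -> R) (S : set R) : ac f g -> closed S ->
  {ae lam, forall x, S (f x)} -> forall x, S (f x).
Proof.
move=> acf cS aS x; have [_ lg _] := acf; apply: contrapT => nS.
have /nbhs_ballP[e e0 he] : nbhs (f x) (~` S) by apply: open_nbhs_nbhs; split => //; rewrite openC.
have e2 : 0 < e / 2 by rewrite divr_gt0.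
have [b xb hb] := J_small x lg e2.
have [y yab Sy] := ae_itv xb aS.
apply: (he (f y)) => //; rewrite /ball/= distrC.
have h := ac_var acf yab; apply: (le_lt_trans h); apply: (le_lt_trans hb).
by rewrite ltr_pdivrMr// ltr_pMr// ltr1n.
Qed.

Definition axis (e : R2) := e = axis1 \/ e = axis2.

(** The chain rule is applied on lines to the absolutely continuous representative. Regularity of
    [F] is asked on a closed set [S] containing the values of [u], with a view to the reciprocal and
    the logarithm, which are regular on a half-line. *)
Lemma wd1_chain (S : set R) (F dF : R -> R) (L : R) u w : closed S -> 0 <= L ->
  (forall s t, S s -> S t -> `|F t - F s - dF s * (t - s)| <= L * (t - s) ^+ 2) ->
  (forall s t, S s -> S t -> `|dF t - dF s| <= L * `|t - s|) ->
  @meas _ M R F -> @meas _ M R dF ->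
  (forall x, S (u x)) -> wd axis1 u w -> locint (fun x => F (u x)) ->
  locint (fun x => dF (u x) * w x) -> wd axis1 (fun x => F (u x)) (fun x => dF (u x) * w x).
Proof.
move=> cS L0 hF hdF mF mdF Su hw lF ldF; have [_ lw _] := hw.
have [f [mf uf hf]] := acl1_of_wd hw.
have mFf : @meas _ T2 R (fun x => F (f x)) by exact: (measurableT_comp mF).
have mdFf : @meas _ T2 R (fun x => dF (f x)) by exact: (measurableT_comp mdF).
have mdFw : @meas _ T2 R (fun x => dF (f x) * w x) := measM mdFf lw.1.
have eF : {ae mu, forall x, F (u x) = F (f x)} by apply: (aeS uf) => x ->.
have edF : {ae mu, forall x, dF (u x) * w x = dF (f x) * w x} by apply: (aeS uf) => x ->.
have lFf := locint_ae lF mFf eF; have ldFf := locint_ae ldF mdFw edF.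
have eF' : {ae mu, forall x, F (f x) = F (u x)} by apply: (aeS uf) => x ->.
have edF' : {ae mu, forall x, dF (f x) * w x = dF (u x) * w x} by apply: (aeS uf) => x ->.
apply: (wd_ae _ lF.1 ldF.1 eF' edF'); apply: acl1_wd => //.
exists (fun x => F (f x)); split; [exact: mFf|exact: aeW|].
have aS : {ae lam, forall y, {ae lam, forall x, S (f (x, y))}}.
  by apply: (@aeA R (fun x => S (f x))); apply: (aeS uf) => x <-.
apply: (aeS2 hf aS) => y acy Sy.
apply: (ac_chain (S := S) acy L0 _ _ _ hF hdF); first exact: (ac_range acy cS).
- exact: (slice_meas y mFf).
- exact: (slice_meas y mdFf).
Qed.

Lemma locint_swp (u : R2 -> R) : locint u -> locint (fun x => u (swp x)).
Proof. by apply: locint_comp; [exact: mpres_swap|exact: swp_cont]. Qed.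

Lemma wd_swpE (u w : R2 -> R) : wd axis1 (fun x => u (swp x)) (fun x => w (swp x)) -> wd axis2 u w.
Proof.
move=> /wd_swp2; rewrite (_ : (fun x => _) = u); last by apply/funext => x; rewrite swpK.
by rewrite (_ : (fun x => _) = w)//; apply/funext => x; rewrite swpK.
Qed.

Lemma wd_chain (S : set R) (F dF : R -> R) (L : R) e u w : axis e -> closed S -> 0 <= L ->
  (forall s t, S s -> S t -> `|F t - F s - dF s * (t - s)| <= L * (t - s) ^+ 2) ->
  (forall s t, S s -> S t -> `|dF t - dF s| <= L * `|t - s|) ->
  @meas _ M R F -> @meas _ M R dF ->
  (forall x, S (u x)) -> wd e u w -> locint (fun x => F (u x)) ->
  locint (fun x => dF (u x) * w x) -> wd e (fun x => F (u x)) (fun x => dF (u x) * w x).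
Proof.
move=> [->|->] cS L0 hF hdF mF mdF Su hw lF ldF.
  exact: (wd1_chain cS L0 hF hdF).
apply: wd_swpE; apply: (wd1_chain cS L0 hF hdF) => //; first exact: wd_swp1.
- exact: (locint_swp lF).
- exact: (locint_swp ldF).
Qed.

Lemma wd1_prod (u w u' w' : R2 -> R) : wd axis1 u w -> wd axis1 u' w' ->
  locint (fun x => u x * u' x) -> locint (fun x => u x * w' x + u' x * w x) ->
  wd axis1 (fun x => u x * u' x) (fun x => u x * w' x + u' x * w x).
Proof.
move=> hw hw' l1 l2; have [_ lw _] := hw; have [_ lw' _] := hw'.
have [f [mf uf hf]] := acl1_of_wd hw; have [f' [mf' uf' hf']] := acl1_of_wd hw'.
have m1 : @meas _ T2 R (fun x => f x * f' x) := measM mf mf'.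
have m2 : @meas _ T2 R (fun x => f x * w' x + f' x * w x) := measD (measM mf lw'.1) (measM mf' lw.1).
have e1 : {ae mu, forall x, u x * u' x = f x * f' x} by apply: (aeS2 uf uf') => x -> ->.
have e2 : {ae mu, forall x, u x * w' x + u' x * w x = f x * w' x + f' x * w x}.
  by apply: (aeS2 uf uf') => x -> ->.
have e1' : {ae mu, forall x, f x * f' x = u x * u' x} by apply: (aeS2 uf uf') => x -> ->.
have e2' : {ae mu, forall x, f x * w' x + f' x * w x = u x * w' x + u' x * w x}.
  by apply: (aeS2 uf uf') => x -> ->.
apply: (wd_ae _ l1.1 l2.1 e1' e2'); apply: acl1_wd.
- exact: (locint_ae l1 m1 e1).
- exact: (locint_ae l2 m2 e2).
exists (fun x => f x * f' x); split; [exact: m1|exact: aeW|].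
by apply: (aeS2 hf hf') => y a1 a2; exact: ac_prod.
Qed.

Lemma wd_prod (e : R2) (u w u' w' : R2 -> R) : axis e -> wd e u w -> wd e u' w' ->
  locint (fun x => u x * u' x) -> locint (fun x => u x * w' x + u' x * w x) ->
  wd e (fun x => u x * u' x) (fun x => u x * w' x + u' x * w x).
Proof.
move=> [->|->] hw hw' l1 l2; first exact: wd1_prod.
apply: wd_swpE; apply: (wd1_prod (wd_swp1 hw) (wd_swp1 hw')).
- exact: (locint_swp l1).
- exact: (locint_swp l2).
Qed.

Lemma wd_domlim (e : R2) (u_ w_ : nat -> R2 -> R) (u w U W : R2 -> R) : (forall n, wd e (u_ n) (w_ n)) ->
  locint U -> locint W -> @meas _ T2 R u -> @meas _ T2 R w ->
  (forall n x, `|u_ n x| <= `|U x|) -> (forall n x, `|w_ n x| <= `|W x|) ->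
  (forall x, u_ ^~ x @ \oo --> u x) -> (forall x, w_ ^~ x @ \oo --> w x) -> wd e u w.
Proof.
move=> hw lU lW mu_ mw bu bw cu cw.
have bnd (f_ : nat -> R2 -> R) f (F : R2 -> R) : (forall n x, `|f_ n x| <= `|F x|) ->
    (forall x, f_ ^~ x @ \oo --> f x) -> forall x, `|f x| <= `|F x|.
  move=> bf cf x; have h : (fun n => `|f_ n x|) @ \oo --> `|f x| by apply: cvg_norm; exact: cf.
  rewrite -(cvg_lim (@Rhausdorff R) h); apply: limr_le; first by apply/cvg_ex; exists `|f x|.
  exact: nearW.
have lu : locint u by apply: (locint_le mu_ lU); exact: (bnd _ _ _ bu cu).
have lw : locint w by apply: (locint_le mw lW); exact: (bnd _ _ _ bw cw).
have lim (f_ : nat -> R2 -> R) f F psi : locint F -> @meas _ T2 R f -> (forall n, locint (f_ n)) ->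
   (forall n x, `|f_ n x| <= `|F x|) -> (forall x, f_ ^~ x @ \oo --> f x) -> test_function psi ->
   (fun n => \int[mu]_x (f_ n x * psi x)) @ \oo --> \int[mu]_x (f x * psi x).
  move=> lF mf lf bf cf tp; have [K [N [mp _ _]]] := test_bdd tp.
  have [] := @itg_DCT _ _ R mu (fun n x => f_ n x * psi x) (fun x => f x * psi x) (fun x => `|F x * psi x|) => //.
  - by move=> n; exact: measM (lf n).1 mp.
  - exact: measM mf mp.
  - by apply: itg_norm; exact: itg_test.
  - by apply: aeW => x; apply: cvgM; [exact: cf|exact: cvg_cst].
  - by apply: aeW => x n; rewrite !normrM ler_wpM2r.
split => // phi tp; have td := test_der e tp.
have c1 := lim _ _ _ _ lU mu_ (fun n => let: And3 a _ _ := hw n in a) bu cu td.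
have c2 := lim _ _ _ _ lW mw (fun n => let: And3 _ a _ := hw n in a) bw cw tp.
have E : (fun n => \int[mu]_x (u_ n x * 'D_e phi x)) = (fun n => - \int[mu]_x (w_ n x * phi x)).
  by apply/funext => n; have [_ _ ->] := hw n.
by rewrite E in c1; apply: (cvg_unique _ c1); [exact: Rhausdorff|exact: cvgN].
Qed.

Lemma wd_L2lim e (u_ w_ : nat -> R2 -> R) u w : (forall n, wd e (u_ n) (w_ n)) ->
  (forall n, sqi mu (u_ n)) -> (forall n, sqi mu (w_ n)) -> sqi mu u -> sqi mu w ->
  (fun n => n2 mu (fun x => u_ n x - u x)) @ \oo --> (0 : R) ->
  (fun n => n2 mu (fun x => w_ n x - w x)) @ \oo --> (0 : R) -> wd e u w.
Proof.
move=> hw su_ sw_ su sw cu cw; split; [exact: sqi_locint..|move=> phi tp].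
have lim (f_ : nat -> R2 -> R) f psi : (forall n, sqi mu (f_ n)) -> sqi mu f ->
   (fun n => n2 mu (fun x => f_ n x - f x)) @ \oo --> (0 : R) -> test_function psi ->
   (fun n => \int[mu]_x (f_ n x * psi x)) @ \oo --> \int[mu]_x (f x * psi x).
  move=> sf_ sf cf tpsi; have sp : sqi mu psi.
    have [K [N [mp N0 hp]]] := test_bdd tpsi.
    apply: (sqi_le mp (sqiZ N (sqi_sq K))) => x.
    by rewrite (le_trans (hp x))// ler_norm.
  apply/cvgrPdist_le => eps e0.
  have d0 : 0 < eps ^+ 2 / (n2 mu psi + 1).
    by rewrite divr_gt0 ?exprn_gt0// ltr_wpDl// n2_ge0.
  have /cvgrPdist_le/(_ _ d0)[N _ hN] := cf; exists N => // n /hN /=.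
  rewrite sub0r normrN ger0_norm ?n2_ge0// => h.
  rewrite distrC -(IB (sqi_itgM (sf_ n) sp) (sqi_itgM sf sp)).
  rewrite -(@ler_pXn2r _ 2)// ?nnegrE ?(ltW e0)//.
  rewrite real_normK ?num_real//.
  have -> : \int[mu]_x (f_ n x * psi x - f x * psi x) = \int[mu]_x ((f_ n x - f x) * psi x).
    by apply: eq_Rintegral => x _; ring.
  apply: (le_trans (CS (sqiB (sf_ n) sf) sp)).
  apply: (@le_trans _ _ (eps ^+ 2 / (n2 mu psi + 1) * n2 mu psi)); first by rewrite ler_wpM2r// n2_ge0.
  rewrite -mulrA ger_pMr ?exprn_gt0// mulrC ler_pdivrMr; first by rewrite mul1r lerDl.
  by rewrite ltr_wpDl// n2_ge0.
have td := test_der e tp.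
have c1 := lim _ _ _ su_ su cu td.
have c2 := lim _ _ _ sw_ sw cw tp.
have E : (fun n => \int[mu]_x (u_ n x * 'D_e phi x)) = (fun n => - \int[mu]_x (w_ n x * phi x)).
  by apply/funext => n; have [_ _ ->] := hw n.
by rewrite E in c1; apply: (cvg_unique _ c1); [exact: Rhausdorff|exact: cvgN].
Qed.

Definition pos (t : R) : R := Num.max t 0.

(** A C^1 substitute for the positive part, quadratic on [0, 1] and of slope 1 beyond; [dhub] is its
    derivative. *)
Definition hub (t : R) : R := if t <= 0 then 0 else if t <= 1 then t ^+ 2 / 2 else t - 2^-1.
Definition dhub (t : R) : R := if t <= 0 then 0 else if t <= 1 then t else 1.

Lemma hub_quad s t : `|hub t - hub s - dhub s * (t - s)| <= (t - s) ^+ 2.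
Proof.
rewrite /hub /dhub ler_norml; have tsq := sqr_ge0 (t - s).
have [t0|t0] := leP t 0; have [s0|s0] := leP s 0.
- by apply/andP; split; nra.
- have [s1|s1] := leP s 1; first by apply/andP; split; nra.
  by have := mulr_ge0 (ltW (_ : 0 < s - 1)) (ltW (_ : 0 < s + 1 - 2 * t)); rewrite !subr_gt0 => /(_ s1) h; apply/andP; split; nra.
- by have [t1|t1] := leP t 1; apply/andP; split; nra.
- have [t1|t1] := leP t 1; have [s1|s1] := leP s 1.
  + by apply/andP; split; nra.
  + by apply/andP; split; nra.
  + by apply/andP; split; nra.
  + by apply/andP; split; nra.
Qed.

Lemma dhub_lip s t : `|dhub t - dhub s| <= `|t - s|.
Proof.
rewrite /dhub.
have [t0|t0] := leP t 0; have [s0|s0] := leP s 0; [|have [s1|s1] := leP s 1|have [t1|t1] := leP t 1|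
 have [s1|s1] := leP s 1; have [t1|t1] := leP t 1]; rewrite ler_norml;
 have [ts|ts] := leP 0 (t - s); (rewrite (ger0_norm ts) || rewrite (ltr0_norm ts)); apply/andP; split; lra.
Qed.

Lemma hub_bound t : `|hub t| <= `|t|.
Proof.
rewrite /hub; have [t0|t0] := leP t 0; first by rewrite normr0.
by rewrite (gtr0_norm t0) ler_norml; have [t1|t1] := leP t 1; apply/andP; split; nra.
Qed.

Lemma dhub_bound t : `|dhub t| <= 1.
Proof.
rewrite /dhub; have [t0|t0] := leP t 0; first by rewrite normr0.
by have [t1|t1] := leP t 1; rewrite ?normr1// gtr0_norm.
Qed.

Lemma lip_cont (F : R -> R) (L : R) : 0 <= L -> (forall s t, `|F t - F s| <= L * `|t - s|) -> continuous F.
Proof.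
move=> L0 hF x; apply/cvgrPdist_le => e e0.
have d0 : 0 < e / (L + 1) by rewrite divr_gt0// ltr_wpDl.
near=> t; rewrite distrC; apply: (le_trans (hF _ _)).
apply: (@le_trans _ _ (L * (e / (L + 1)))).
  rewrite ler_wpM2l// distrC; near: t; exact: (@cvgr_dist_le _ _ _ _ _ id x _ cvg_id).
by rewrite mulrCA ger_pMr// ler_pdivrMr ?ltr_wpDl// mul1r lerDl.
Unshelve. all: by end_near. Qed.

Lemma hub_lip s t : `|hub t - hub s| <= `|t - s|.
Proof.
rewrite /hub.
have [t0|t0] := leP t 0; have [s0|s0] := leP s 0; [|have [s1|s1] := leP s 1|have [t1|t1] := leP t 1|
 have [s1|s1] := leP s 1; have [t1|t1] := leP t 1]; rewrite ler_norml;
 have [ts|ts] := leP 0 (t - s); (rewrite (ger0_norm ts) || rewrite (ltr0_norm ts)); apply/andP; split; nra.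
Qed.

Lemma ind_gt0_meas (u : T2 -> R) : meas u -> meas (fun x => (0 < u x)%R%:R : R).
Proof.
move=> m; have h := meas_le_pair m (meas_cst 0).
rewrite (_ : (fun x => _) = (fun x => 1 - (u x <= 0)%R%:R)).
  by apply: measB; [exact: meas_cst|exact: h].
by apply/funext => x; case: leP => _; rewrite ?subrr ?subr0.
Qed.

(** The rescaled functions [hub (N * t) / N] converge to the positive part, while their derivatives,
    bounded by 1, converge to the indicator of t > 0. The value 0 of these derivatives at t = 0 is
    what puts the strict inequality in the formula. *)
Lemma wd_pos e u w : axis e -> wd e u w ->
  wd e (fun x => pos (u x)) (fun x => (0 < u x)%R%:R * w x).
Proof.
move=> ae hw; have [lu lw _] := hw.
pose N (n : nat) : R := n.+1%:R; have N0 n : 0 < N n by rewrite ltr0n.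
pose F n t := (N n)^-1 * hub (N n * t); pose dF n t := dhub (N n * t).
have bF n t : `|F n t| <= `|t|.
  rewrite /F normrM (ger0_norm (_ : 0 <= (N n)^-1)) ?invr_ge0 ?(ltW (N0 n))//.
  by rewrite (ler_pdivrMl _ _ (N0 n)) (le_trans (hub_bound _))// normrM (ger0_norm (ltW (N0 n))).
have bdF n t : `|dF n t| <= 1 by exact: dhub_bound.
have mN n : @meas _ M R (fun t : R => N n * t) by apply: measM; [exact: meas_cst|exact: measurable_id].
have mF n : @meas _ M R (F n).
  apply: measM; first exact: meas_cst.
  by apply: (meas_cont (F := hub)) => //; apply: (@lip_cont _ 1) => // s t; rewrite mul1r hub_lip.
have mdF n : @meas _ M R (dF n).
  by apply: (meas_cont (F := dhub)) => //; apply: (@lip_cont _ 1) => // s t; rewrite mul1r dhub_lip.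
have mFu n : @meas _ T2 R (fun x => F n (u x)) by exact: (measurableT_comp (mF n) lu.1).
have mdFu n : @meas _ T2 R (fun x => dF n (u x) * w x).
  by apply: measM lw.1; exact: (measurableT_comp (mdF n) lu.1).
have bdFw n x : `|dF n (u x) * w x| <= `|w x| by rewrite normrM ler_piMl.
have hwn n : wd e (fun x => F n (u x)) (fun x => dF n (u x) * w x).
  apply: (@wd_chain setT (F n) (dF n) (N n) e u w ae).
  - exact: closedT.
  - exact: ltW.
  - move=> s t _ _; rewrite /F /dF.
    have -> : (N n)^-1 * hub (N n * t) - (N n)^-1 * hub (N n * s) - dhub (N n * s) * (t - s) =
       (N n)^-1 * (hub (N n * t) - hub (N n * s) - dhub (N n * s) * (N n * t - N n * s)).
      by field; rewrite gt_eqF.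
    rewrite normrM (ger0_norm (_ : 0 <= (N n)^-1)) ?invr_ge0 ?(ltW (N0 n))//.
    rewrite (ler_pdivrMl _ _ (N0 n)).
    by apply: (le_trans (hub_quad _ _)); rewrite le_eqVlt; apply/orP; left; apply/eqP; ring.
  - move=> s t _ _; apply: (le_trans (dhub_lip _ _)).
    by rewrite -mulrBr normrM (ger0_norm (ltW (N0 n))).
  - exact: mF.
  - exact: mdF.
  - by [].
  - exact: hw.
  - exact: (locint_le (mFu n) lu).
  - exact: (locint_le (mdFu n) lw).
have evN (t : R) : 0 < t -> \forall n \near \oo, 1 < N n * t.
  move=> t0; near=> n; rewrite -ltr_pdivrMr// /N -natr1.
  rewrite ltr_wpDr//; near: n; exact: nbhs_infty_gtr.
apply: (@wd_domlim e (fun n x => F n (u x)) (fun n x => dF n (u x) * w x) _ _ u w hwn lu lw).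
- by apply: meas_max; [exact: lu.1|exact: meas_cst].
- by apply: measM lw.1; apply: ind_gt0_meas; exact: lu.1.
- by [].
- by [].
- move=> x; rewrite /F /pos; have [u0|u0] := leP (u x) 0.
    rewrite (_ : (fun n => _) = (fun=> 0)); first exact: cvg_cst.
    by apply/funext => n; rewrite /hub pmulr_rle0// u0 mulr0.
  apply: (@cvg_trans _ ((fun n => u x - 2^-1 * (N n)^-1) @ \oo)).
    apply: near_eq_cvg; have := evN _ u0; apply: filterS => n hn.
    rewrite /hub leNgt mulr_gt0// leNgt hn /=.
    by field; rewrite gt_eqF.
  have h : (fun n => u x - 2^-1 * (N n)^-1) @ \oo --> u x - 2^-1 * 0.
    by apply: cvgB; [exact: cvg_cst|apply: cvgM; [exact: cvg_cst|exact: cvg_harmonic]].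
  by rewrite mulr0 subr0 in h.
- move=> x; apply: cvgM; last exact: cvg_cst.
  rewrite /dF; have [u0|u0] := leP (u x) 0.
    rewrite (_ : (fun n => _) = (fun=> 0)); first exact: cvg_cst.
    by apply/funext => n; rewrite /dhub pmulr_rle0// u0.
  apply: (@cvg_trans _ ((fun=> 1 : R) @ \oo)); last exact: cvg_cst.
  apply: near_eq_cvg; have := evN _ u0; apply: filterS => n hn.
  by rewrite /dhub leNgt mulr_gt0// leNgt hn.
Unshelve. all: by end_near. Qed.

End ChainRules.

(** * The Hilbert space H *)

HB.lock Definition d1 {R : realType} (u : R * R -> R) : R * R -> R := weak_derive axis1 u.
HB.lock Definition d2 {R : realType} (u : R * R -> R) : R * R -> R := weak_derive axis2 u.
HB.lock Definition dt {R : realType} (u : R * R -> R) : R * R -> R := dtheta u.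
HB.lock Definition ip {R : realType} (l : R) (u v : R * R -> R) : R := innerH l u v.

Section HilbertSpace.
Context {R : realType}.
Local Notation M := (measurableTypeR R).
Local Notation T2 := (M * M)%type.
Local Notation R2 := (R * R)%type.
Local Notation mu := (leb2 R).
Implicit Types (u v w a b : R2 -> R).

Lemma Lfun2P u : u \in Lfun mu 2%:E <-> sqi mu u.
Proof.
split=> [h|[mu_ iu]].
  split; last exact: Lfun2_integrable_sqr.
  by move: h; rewrite inE => /andP[+ _]; rewrite inE.
rewrite inE; apply/andP; split; rewrite inE//=; rewrite /finite_norm.
rewrite (@lty_poweRy _ _ 2)// powR_Lnorm//.
apply: le_lt_trans (itg_lt iu); rewrite le_eqVlt; apply/orP; left; apply/eqP.
by apply: eq_integral => x _ /=; rewrite powR_mulrn// normrX.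
Qed.

Local Notation W1 := (@weak_derive R axis1).
Local Notation W2 := (@weak_derive R axis2).
(** The angular derivative built from candidates [a] and [b] for the two partial derivatives, before
    these are known to agree with the chosen ones. *)
Definition TH a b : R2 -> R := fun x => x.1 * b x - x.2 * a x.

Lemma meas_TH a b : @meas _ T2 R a -> @meas _ T2 R b -> @meas _ T2 R (TH a b).
Proof.
by move=> ma mb; apply: (@measB _ T2 R (fun x => x.1 * b x) (fun x => x.2 * a x));
  apply: measM => //; [exact: (meas_fst (a := id) (@measurable_id _ M setT))|exact: (meas_snd (a := id) (@measurable_id _ M setT))].
Qed.

Lemma wd_get e u w : wd e u w -> wd e u (weak_derive e u).
Proof. by move=> /wdP h; apply/wdP; rewrite /weak_derive; apply: getPex; exists w. Qed.

Lemma Hspace_def u : Hspace u <-> exists a b,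
  [/\ sqi mu u, wd axis1 u a, wd axis2 u b & [/\ sqi mu a, sqi mu b & sqi mu (TH a b)]].
Proof.
split=> [[[/Lfun2P su hu] hth]|[a [b [su wa wb [sa sb sth]]]]].
  have get e : e \in [:: axis1; axis2] -> wd e u (weak_derive e u) /\ sqi mu (weak_derive e u).
    move=> /hu[w /wdP hw /Lfun2P sw]; have hg := wd_get hw; split => //.
    by have [_ [mg _] _] := hg; apply: (sqi_ae sw mg); exact: (wd_unique hw hg (aeW _ _)).
  have [|w1 s1] := get axis1; first by rewrite inE eqxx.
  have [|w2 s2] := get axis2; first by rewrite !inE eqxx orbT.
  exists (W1 u), (W2 u); split => //; split => //.
  have m : @meas _ T2 R (TH (W1 u) (W2 u)) by apply: meas_TH; [exact: s1.1|exact: s2.1].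
  split => //; apply: itg_ge0P; [by move=> x; exact: sqr_ge0|exact: measX|].
  apply: le_lt_trans hth; rewrite le_eqVlt; apply/orP; left; apply/eqP.
  by apply: eq_integral => x _; rewrite real_normK ?num_real.
split; last first.
  have g1 := wd_get wa; have g2 := wd_get wb.
  have e1 := wd_unique g1 wa (aeW _ (fun x => erefl)).
  have e2 := wd_unique g2 wb (aeW _ (fun x => erefl)).
  have [_ [m1 _] _] := g1; have [_ [m2 _] _] := g2.
  have m : @meas _ T2 R (dtheta u) := meas_TH m1 m2.
  have [] : sqi mu (dtheta u).
    by apply: (sqi_ae sth m); apply: (aeS2 e1 e2) => x h1 h2; rewrite /dtheta h1 h2.
  move=> _ /itg_lt; apply: le_lt_trans; rewrite le_eqVlt; apply/orP; left; apply/eqP.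
  by apply: eq_integral => x _; rewrite normrX.
split; first exact/Lfun2P.
move=> e; rewrite !inE => /orP[/eqP ->|/eqP ->].
  by exists a; [exact/wdP|exact/Lfun2P].
by exists b; [exact/wdP|exact/Lfun2P].
Qed.

Lemma dtE u : dt u = TH (d1 u) (d2 u).
Proof. by rewrite dt.unlock d1.unlock d2.unlock. Qed.
Lemma d1E u : d1 u = W1 u. Proof. by rewrite d1.unlock. Qed.
Lemma d2E u : d2 u = W2 u. Proof. by rewrite d2.unlock. Qed.
Lemma dtxE u x : dt u x = x.1 * d2 u x - x.2 * d1 u x. Proof. by rewrite dtE. Qed.
Lemma n2I (f : R2 -> R) : n2 mu f = \int[mu]_x (f x * f x).
Proof. by apply: eq_Rintegral => x _; rewrite expr2. Qed.
Lemma ip_def l u v : ip l u v = \int[mu]_x (d1 u x * d1 v x + d2 u x * d2 v x +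
  (l ^+ 2)^-1 * (dt u x * dt v x) + u x * v x).
Proof. by rewrite !unlock. Qed.

(** Weak derivatives are unique up to null sets, so exhibiting square-integrable candidates both
    proves membership in H and identifies the chosen derivatives almost everywhere. The later
    computations in H rest on this rule. *)
Lemma HI u a b : sqi mu u -> wd axis1 u a -> wd axis2 u b -> sqi mu a -> sqi mu b ->
  sqi mu (TH a b) -> [/\ Hspace u, {ae mu, forall x, d1 u x = a x},
    {ae mu, forall x, d2 u x = b x} & {ae mu, forall x, dt u x = TH a b x}].
Proof.
move=> su wa wb sa sb sth.
have e1 := wd_unique (wd_get wa) wa (aeW _ (fun x => erefl)).
have e2 := wd_unique (wd_get wb) wb (aeW _ (fun x => erefl)).
rewrite -d1E in e1; rewrite -d2E in e2.
split => //; first by apply/Hspace_def; exists a, b.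
by apply: (aeS2 e1 e2) => x h1 h2; rewrite dtxE h1 h2.
Qed.

Lemma HE u : Hspace u -> [/\ sqi mu u, wd axis1 u (d1 u), wd axis2 u (d2 u) &
  [/\ sqi mu (d1 u), sqi mu (d2 u) & sqi mu (dt u)]].
Proof.
move=> /Hspace_def[a [b [su wa wb [sa sb sth]]]].
have g1 := wd_get wa; have g2 := wd_get wb.
rewrite -d1E in g1; rewrite -d2E in g2.
have e1 := wd_unique wa g1 (aeW _ (fun x => erefl)).
have e2 := wd_unique wb g2 (aeW _ (fun x => erefl)).
have [_ [m1 _] _] := g1; have [_ [m2 _] _] := g2.
split => //; split; [exact: (sqi_ae sa m1 e1)|exact: (sqi_ae sb m2 e2)|].
rewrite dtE; apply: (sqi_ae sth (meas_TH m1 m2)).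
by apply: (aeS2 e1 e2) => x h1 h2; rewrite /TH h1 h2.
Qed.

Lemma H_sqi u : Hspace u -> sqi mu u. Proof. by case/HE. Qed.
Lemma H_d1 u : Hspace u -> sqi mu (d1 u). Proof. by case/HE => _ _ _ []. Qed.
Lemma H_d2 u : Hspace u -> sqi mu (d2 u). Proof. by case/HE => _ _ _ []. Qed.
Lemma H_dth u : Hspace u -> sqi mu (dt u). Proof. by case/HE => _ _ _ []. Qed.
Lemma H_wd1 u : Hspace u -> wd axis1 u (d1 u). Proof. by case/HE. Qed.
Lemma H_wd2 u : Hspace u -> wd axis2 u (d2 u). Proof. by case/HE. Qed.

Lemma ipE l u v : Hspace u -> Hspace v -> ip l u v =
  \int[mu]_x (d1 u x * d1 v x) + \int[mu]_x (d2 u x * d2 v x) +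
  (l ^+ 2)^-1 * \int[mu]_x (dt u x * dt v x) + \int[mu]_x (u x * v x).
Proof.
move=> hu hv; rewrite ip_def.
have i1 := sqi_itgM (H_d1 hu) (H_d1 hv); have i2 := sqi_itgM (H_d2 hu) (H_d2 hv).
have i3 := sqi_itgM (H_dth hu) (H_dth hv); have i4 := sqi_itgM (H_sqi hu) (H_sqi hv).
by rewrite (ID (itgD (itgD i1 i2) (itgZ _ i3)) i4) (ID (itgD i1 i2) (itgZ _ i3)) (ID i1 i2) (IZ _ i3).
Qed.

(* Since [0^-1 = 0], [Q 0] is the H^1 norm squared, that is the limit of [Q l] as [l] tends to infinity. *)
Definition Q (l : R) u : R := ip l u u.

Lemma QE l u : Hspace u -> Q l u = n2 mu (d1 u) + n2 mu (d2 u) + (l ^+ 2)^-1 * n2 mu (dt u) + n2 mu u.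
Proof.
by move=> hu; rewrite /Q ipE// !n2I.
Qed.

Lemma Q_ge0 l u : Hspace u -> 0 <= Q l u.
Proof.
by move=> hu; rewrite QE// !addr_ge0 ?n2_ge0// mulr_ge0 ?invr_ge0 ?sqr_ge0 ?n2_ge0.
Qed.

Lemma Q_parts l u : Hspace u -> [/\ n2 mu u <= Q l u, n2 mu (d1 u) <= Q l u, n2 mu (d2 u) <= Q l u,
  n2 mu (d1 u) + n2 mu (d2 u) + n2 mu u <= Q l u & (l ^+ 2)^-1 * n2 mu (dt u) <= Q l u].
Proof.
move=> hu; rewrite QE//.
have h3 : 0 <= (l ^+ 2)^-1 * n2 mu (dt u) by rewrite mulr_ge0 ?invr_ge0 ?sqr_ge0 ?n2_ge0.
move: (n2_ge0 mu u) (n2_ge0 mu (d1 u)) (n2_ge0 mu (d2 u)) h3.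
move: (n2 mu u) (n2 mu (d1 u)) (n2 mu (d2 u)) (_ * n2 mu _) => p1 p2 p3 p4 *; split; lra.
Qed.

Lemma ipC l u v : ip l u v = ip l v u.
Proof.
rewrite !ip_def; apply: eq_Rintegral => x _.
by rewrite (mulrC (d1 u x)) (mulrC (d2 u x)) (mulrC (dt u x)) (mulrC (u x)).
Qed.

Lemma H_lin (c : R) u v : Hspace u -> Hspace v -> [/\ Hspace (fun x => c * u x + v x),
  {ae mu, forall x, d1 (fun x => c * u x + v x) x = c * d1 u x + d1 v x},
  {ae mu, forall x, d2 (fun x => c * u x + v x) x = c * d2 u x + d2 v x} &
  {ae mu, forall x, dt (fun x => c * u x + v x) x = c * dt u x + dt v x}].
Proof.
move=> hu hv.
have E : TH (fun x => c * d1 u x + d1 v x) (fun x => c * d2 u x + d2 v x) = (fun x => c * dt u x + dt v x).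
  by apply/funext => x; rewrite /TH !dtxE; ring.
have := @HI (fun x => c * u x + v x) (fun x => c * d1 u x + d1 v x) (fun x => c * d2 u x + d2 v x).
rewrite E; apply.
- exact: sqiD (sqiZ c (H_sqi hu)) (H_sqi hv).
- exact: wd_lin (H_wd1 hu) (H_wd1 hv).
- exact: wd_lin (H_wd2 hu) (H_wd2 hv).
- exact: sqiD (sqiZ c (H_d1 hu)) (H_d1 hv).
- exact: sqiD (sqiZ c (H_d2 hu)) (H_d2 hv).
- exact: sqiD (sqiZ c (H_dth hu)) (H_dth hv).
Qed.

Lemma I_lin3 (f g h k : R2 -> R) c : sqi mu f -> sqi mu g -> sqi mu h -> @meas _ T2 R k ->
  {ae mu, forall x, k x = c * f x + g x} ->
  \int[mu]_x (k x * h x) = c * \int[mu]_x (f x * h x) + \int[mu]_x (g x * h x).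
Proof.
move=> sf sg sh mk ek.
rewrite -(IZ _ (sqi_itgM sf sh)) -(ID (itgZ c (sqi_itgM sf sh)) (sqi_itgM sg sh)).
apply: I_ae.
- exact: measM mk sh.1.
- exact: itg_meas (itgD (itgZ c (sqi_itgM sf sh)) (sqi_itgM sg sh)).
- by apply: (aeS ek) => x ->; ring.
Qed.

Lemma ip_lin l c u v z : Hspace u -> Hspace v -> Hspace z ->
  ip l (fun x => c * u x + v x) z = c * ip l u z + ip l v z.
Proof.
move=> hu hv hz; have [hl e1 e2 e3] := H_lin c hu hv.
rewrite (ipE _ hl hz) (ipE _ hu hz) (ipE _ hv hz).
rewrite (I_lin3 (H_d1 hu) (H_d1 hv) (H_d1 hz) (H_d1 hl).1 e1).
rewrite (I_lin3 (H_d2 hu) (H_d2 hv) (H_d2 hz) (H_d2 hl).1 e2).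
rewrite (I_lin3 (H_dth hu) (H_dth hv) (H_dth hz) (H_dth hl).1 e3).
rewrite (I_lin3 (H_sqi hu) (H_sqi hv) (H_sqi hz) (H_sqi hl).1 (aeW _ (fun x => erefl))).
ring.
Qed.

Lemma H_ext u v : (forall x, u x = v x) -> Hspace u -> Hspace v.
Proof. by move=> /funext ->. Qed.

Lemma H_ae u v : Hspace u -> @meas _ T2 R v -> {ae mu, forall x, u x = v x} ->
  [/\ Hspace v, {ae mu, forall x, d1 v x = d1 u x}, {ae mu, forall x, d2 v x = d2 u x} &
  {ae mu, forall x, dt v x = dt u x}].
Proof.
move=> hu mv uv.
rewrite (dtE u); apply: (@HI v (d1 u) (d2 u)).
- exact: (sqi_ae (H_sqi hu) mv uv).
- exact: (wd_ae (H_wd1 hu) mv (H_d1 hu).1 uv (aeW _ (fun x => erefl))).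
- exact: (wd_ae (H_wd2 hu) mv (H_d2 hu).1 uv (aeW _ (fun x => erefl))).
- exact: H_d1.
- exact: H_d2.
- by rewrite -dtE; exact: H_dth.
Qed.

Lemma ip_ae l u v z : Hspace u -> @meas _ T2 R v -> {ae mu, forall x, u x = v x} -> Hspace z ->
  ip l u z = ip l v z.
Proof.
move=> hu mv uv hz; have [hv e1 e2 e3] := H_ae hu mv uv.
rewrite (ipE _ hu hz) (ipE _ hv hz); congr (_ + _ + _ * _ + _); apply: I_ae.
- exact: measM (H_d1 hu).1 (H_d1 hz).1.
- exact: measM (H_d1 hv).1 (H_d1 hz).1.
- by apply: (aeS e1) => x ->.
- exact: measM (H_d2 hu).1 (H_d2 hz).1.
- exact: measM (H_d2 hv).1 (H_d2 hz).1.
- by apply: (aeS e2) => x ->.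
- exact: measM (H_dth hu).1 (H_dth hz).1.
- exact: measM (H_dth hv).1 (H_dth hz).1.
- by apply: (aeS e3) => x ->.
- exact: measM (H_sqi hu).1 (H_sqi hz).1.
- exact: measM (H_sqi hv).1 (H_sqi hz).1.
- by apply: (aeS uv) => x ->.
Qed.

Lemma Q_ae l u v : Hspace u -> @meas _ T2 R v -> {ae mu, forall x, u x = v x} -> Q l u = Q l v.
Proof.
move=> hu mv uv; have [hv _ _ _] := H_ae hu mv uv.
by rewrite /Q (ip_ae _ hu mv uv hu) ipC (ip_ae _ hu mv uv hv).
Qed.

Lemma H0 : Hspace (fun=> 0 : R).
Proof.
have l0 : locint (fun=> 0 : R) := sqi_locint (sqi0 mu).
have wd0 e : wd e (fun=> 0 : R) (fun=> 0).
  split => // phi tp; under eq_Rintegral do rewrite mul0r.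
  by rewrite I0; under eq_Rintegral do rewrite mul0r; rewrite I0 oppr0.
have [] := HI (sqi0 mu) (wd0 _) (wd0 _) (sqi0 mu) (sqi0 mu) => //.
by rewrite /TH; under eq_fun do rewrite !mulr0 subr0; exact: sqi0.
Qed.

Lemma HZ c u : Hspace u -> Hspace (fun x => c * u x).
Proof.
by move=> hu; have [h _ _ _] := H_lin c hu H0; apply: H_ext h => x; rewrite addr0.
Qed.

Lemma HD u v : Hspace u -> Hspace v -> Hspace (fun x => u x + v x).
Proof.
by move=> hu hv; have [h _ _ _] := H_lin 1 hu hv; apply: H_ext h => x; rewrite mul1r.
Qed.

Lemma HB u v : Hspace u -> Hspace v -> Hspace (fun x => u x - v x).
Proof.
by move=> hu hv; have [h _ _ _] := H_lin (-1) hv hu; apply: H_ext h => x; rewrite mulN1r addrC.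
Qed.

Lemma HN u : Hspace u -> Hspace (fun x => - u x).
Proof. by move=> hu; apply: H_ext (HZ (-1) hu) => x; rewrite mulN1r. Qed.

Lemma ipZ l c u z : Hspace u -> Hspace z -> ip l (fun x => c * u x) z = c * ip l u z.
Proof.
move=> hu hz.
have z0 : ip l (fun=> 0 : R) z = 0.
  have := ip_lin l 1 H0 H0 hz; under [X in ip l X]eq_fun do rewrite mulr0 addr0.
  by rewrite mul1r => h; lra.
have := ip_lin l c hu H0 hz; under [X in ip l X]eq_fun do rewrite addr0.
by rewrite z0 addr0.
Qed.

Lemma ipD l u v z : Hspace u -> Hspace v -> Hspace z ->
  ip l (fun x => u x + v x) z = ip l u z + ip l v z.
Proof.
move=> hu hv hz; have := ip_lin l 1 hu hv hz.
by under [X in ip l X]eq_fun do rewrite mul1r; rewrite mul1r.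
Qed.

Lemma ipB l u v z : Hspace u -> Hspace v -> Hspace z ->
  ip l (fun x => u x - v x) z = ip l u z - ip l v z.
Proof.
move=> hu hv hz; have := ip_lin l (-1) hv hu hz.
under [X in ip l X]eq_fun do rewrite mulN1r addrC.
by move=> ->; rewrite mulN1r addrC.
Qed.

Lemma QZ l c u : Hspace u -> Q l (fun x => c * u x) = c ^+ 2 * Q l u.
Proof.
move=> hu; have hc := HZ c hu.
by rewrite /Q ipZ// ipC ipZ// mulrA expr2.
Qed.

Lemma QD l u v : Hspace u -> Hspace v ->
  Q l (fun x => u x + v x) = Q l u + 2 * ip l u v + Q l v.
Proof.
move=> hu hv; have hs := HD hu hv.
rewrite /Q (ipD _ hu hv hs) (ipC l u) (ipC l v) (ipD _ hu hv hu) (ipD _ hu hv hv) (ipC l v u).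
by move: (ip l u u) (ip l u v) (ip l v v) => a b c; ring.
Qed.

Lemma QB l u v : Hspace u -> Hspace v ->
  Q l (fun x => u x - v x) = Q l u - 2 * ip l u v + Q l v.
Proof.
move=> hu hv; have hs := HB hu hv.
rewrite /Q (ipB _ hu hv hs) (ipC l u) (ipC l v) (ipB _ hu hv hu) (ipB _ hu hv hv) (ipC l v u).
by move: (ip l u u) (ip l u v) (ip l v v) => a b c; ring.
Qed.

Lemma QBC l u v : Hspace u -> Hspace v -> Q l (fun x => u x - v x) = Q l (fun x => v x - u x).
Proof. by move=> hu hv; rewrite (QB _ hu hv) (QB _ hv hu) (ipC l v u) addrAC [RHS]addrAC (addrC (Q l u)). Qed.

Lemma QD_le l u v : Hspace u -> Hspace v -> Q l (fun x => u x + v x) <= 2 * Q l u + 2 * Q l v.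
Proof. by move=> hu hv; have := Q_ge0 l (HB hu hv); rewrite (QB _ hu hv) (QD _ hu hv); move: (Q l u) (Q l v) (ip l u v) => *; lra. Qed.

Lemma QB_le l u v : Hspace u -> Hspace v -> Q l (fun x => u x - v x) <= 2 * Q l u + 2 * Q l v.
Proof. by move=> hu hv; have := Q_ge0 l (HD hu hv); rewrite (QB _ hu hv) (QD _ hu hv); move: (Q l u) (Q l v) (ip l u v) => *; lra. Qed.

Lemma pos_norm (t : R) : `|t| = pos t + pos (- t).
Proof.
rewrite /pos; have [h|h] := leP 0 t.
  by rewrite ger0_norm// (max_idPr _) ?oppr_le0// addr0.
by rewrite ltr0_norm// add0r (max_idPl _)// oppr_ge0 ltW.
Qed.

Lemma pos_ge0 (t : R) : 0 <= pos t.
Proof. by rewrite /pos le_max lexx orbT. Qed.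

Lemma pos_le (t : R) : `|pos t| <= `|t|.
Proof. by rewrite (ger0_norm (pos_ge0 t)) (pos_norm t) lerDl pos_ge0. Qed.

Lemma H_wd_pos u : Hspace u -> [/\ Hspace (fun x => pos (u x)),
  {ae mu, forall x, d1 (fun x => pos (u x)) x = (0 < u x)%R%:R * d1 u x},
  {ae mu, forall x, d2 (fun x => pos (u x)) x = (0 < u x)%R%:R * d2 u x} &
  {ae mu, forall x, dt (fun x => pos (u x)) x = (0 < u x)%R%:R * dt u x}].
Proof.
move=> hu; have mu_ := (H_sqi hu).1; have mi : @meas _ T2 R (fun x => (0 < u x)%R%:R : R) := ind_gt0_meas mu_.
have bi (x : T2) : `|(0 < u x)%R%:R : R| <= 1 by case: ltP => _; rewrite ?normr1 ?normr0.
have E : TH (fun x => (0 < u x)%R%:R * d1 u x) (fun x => (0 < u x)%R%:R * d2 u x) = (fun x => (0 < u x)%R%:R * dt u x).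
  by apply/funext => x; rewrite /TH !dtxE; ring.
have := @HI (fun x => pos (u x)) (fun x => (0 < u x)%R%:R * d1 u x) (fun x => (0 < u x)%R%:R * d2 u x).
rewrite E; apply.
- apply: (sqi_le _ (H_sqi hu)); first by apply: meas_max; [exact: mu_|exact: meas_cst].
  by move=> x; exact: pos_le.
- by apply: wd_pos; [left|exact: H_wd1].
- by apply: wd_pos; [right|exact: H_wd2].
- exact: (sqiMb mi bi (H_d1 hu)).
- exact: (sqiMb mi bi (H_d2 hu)).
- exact: (sqiMb mi bi (H_dth hu)).
Qed.

Lemma HP u : Hspace u -> Hspace (fun x => pos (u x)). Proof. by case/H_wd_pos. Qed.

Lemma pos_neg (t : R) : t = pos t - pos (- t).
Proof. by rewrite /pos; case: (leP t 0); case: (leP (- t) 0); lra. Qed.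

(** Up to null sets the derivatives of the two parts live on {u > 0} and {u < 0}, so every product
    in the inner product vanishes almost everywhere. *)
Lemma ip_pos_neg l u : Hspace u -> ip l (fun x => pos (u x)) (fun x => pos (- u x)) = 0.
Proof.
move=> hu; have [hp p1 p2 p3] := H_wd_pos hu; have [hn n1 n2 n3] := H_wd_pos (HN hu).
have z (f g d1 d2 : R2 -> R) : sqi mu f -> sqi mu g ->
    {ae mu, forall x, f x = (0 < u x)%R%:R * d1 x} -> {ae mu, forall x, g x = (0 < - u x)%R%:R * d2 x} ->
    \int[mu]_x (f x * g x) = 0.
  move=> sf sg ef eg; rewrite -[RHS](I0 mu); apply: I_ae.
  - exact: measM sf.1 sg.1.
  - exact: meas_cst.
  - by apply: (aeS2 ef eg) => x -> ->; rewrite oppr_gt0; case: (ltgtP (u x) 0) => _ /=; rewrite ?mul0r ?mulr0.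
rewrite ipE// (z _ _ _ _ (H_d1 hp) (H_d1 hn) p1 n1) (z _ _ _ _ (H_d2 hp) (H_d2 hn) p2 n2).
rewrite (z _ _ _ _ (H_dth hp) (H_dth hn) p3 n3).
rewrite (z _ _ u (fun x => - u x) (H_sqi hp) (H_sqi hn)); first by ring.
- by apply: aeW => x; rewrite /pos; case: leP; rewrite ?mul0r ?mul1r.
- by apply: aeW => x; rewrite /pos; case: leP; rewrite ?mul0r ?mul1r.
Qed.

Lemma Q_pos_neg l u : Hspace u -> Q l u = Q l (fun x => pos (u x)) + Q l (fun x => pos (- u x)).
Proof.
move=> hu; have := QB l (HP hu) (HP (HN hu)); rewrite ip_pos_neg//.
by under [X in Q l X]eq_fun do rewrite -pos_neg; move=> ->; ring.
Qed.

Lemma H_rot (c s : R) u : c ^+ 2 + s ^+ 2 = 1 -> Hspace u -> [/\ Hspace (fun x => u (rot c s x)),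
  {ae mu, forall x, d1 (fun x => u (rot c s x)) x = c * d1 u (rot c s x) + s * d2 u (rot c s x)},
  {ae mu, forall x, d2 (fun x => u (rot c s x)) x = - s * d1 u (rot c s x) + c * d2 u (rot c s x)} &
  {ae mu, forall x, dt (fun x => u (rot c s x)) x = dt u (rot c s x)}].
Proof.
move=> h hu; have mr := mpres_rot h.
have E : TH (fun x => c * d1 u (rot c s x) + s * d2 u (rot c s x)) (fun x => - s * d1 u (rot c s x) + c * d2 u (rot c s x))
   = (fun x => dt u (rot c s x)).
  by apply/funext => x; rewrite /TH !dtxE /rot /=; ring.
have := @HI (fun x => u (rot c s x)) (fun x => c * d1 u (rot c s x) + s * d2 u (rot c s x))
  (fun x => - s * d1 u (rot c s x) + c * d2 u (rot c s x)).
rewrite E; apply.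
- exact: (mp_sqi mr (H_sqi hu)).
- exact: wd_rot1 (H_wd1 hu) (H_wd2 hu).
- exact: wd_rot2 (H_wd1 hu) (H_wd2 hu).
- exact: sqiD (sqiZ c (mp_sqi mr (H_d1 hu))) (sqiZ s (mp_sqi mr (H_d2 hu))).
- exact: sqiD (sqiZ (- s) (mp_sqi mr (H_d1 hu))) (sqiZ c (mp_sqi mr (H_d2 hu))).
- exact: (mp_sqi mr (H_dth hu)).
Qed.

(** Rotations act on the gradient by an orthogonal matrix and commute with the angular derivative,
    so the cross terms of the two gradient components cancel. *)
Lemma Q_rot l (c s : R) u : c ^+ 2 + s ^+ 2 = 1 -> Hspace u -> Q l (fun x => u (rot c s x)) = Q l u.
Proof.
move=> h hu; have [hr e1 e2 e3] := H_rot h hu; have mr := mpres_rot h.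
have s1 := mp_sqi mr (H_d1 hu); have s2 := mp_sqi mr (H_d2 hu).
rewrite !QE//.
rewrite (n2_ae (H_d1 hr).1 (sqiD (sqiZ c s1) (sqiZ s s2)).1 e1).
rewrite (n2_ae (H_d2 hr).1 (sqiD (sqiZ (- s) s1) (sqiZ c s2)).1 e2).
rewrite (n2_ae (H_dth hr).1 (mp_sqi mr (H_dth hu)).1 e3).
rewrite (mp_n2 mr (H_dth hu)) (mp_n2 mr (H_sqi hu)).
congr (_ + _ + _).
rewrite (n2E (sqiZ c s1) (sqiZ s s2)) (n2E (sqiZ (- s) s1) (sqiZ c s2)).
rewrite !n2Z//.
rewrite -(mp_n2 mr (H_d1 hu)) -(mp_n2 mr (H_d2 hu)).
have i := sqi_itgM s1 s2.
have -> : \int[mu]_x (c * (d1 u \o rot c s) x * (s * (d2 u \o rot c s) x)) =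
   (c * s) * \int[mu]_x ((d1 u \o rot c s) x * (d2 u \o rot c s) x).
  by rewrite -IZ//; apply: eq_Rintegral => x _; ring.
have -> : \int[mu]_x (- s * (d1 u \o rot c s) x * (c * (d2 u \o rot c s) x)) =
   (- s * c) * \int[mu]_x ((d1 u \o rot c s) x * (d2 u \o rot c s) x).
  by rewrite -IZ//; apply: eq_Rintegral => x _; ring.
have hs : s ^+ 2 = 1 - c ^+ 2 by lra.
by rewrite sqrrN hs; ring.
Qed.

End HilbertSpace.

(** * Completeness of H and the rotation flow *)

Section FubiniReal.
Context {R : realType} {e1 e2 : measure_display} {X : measurableType e1} {Y : measurableType e2}.
Variables (m1 : {sigma_finite_measure set X -> \bar R}) (m2 : {sigma_finite_measure set Y -> \bar R}).
Implicit Types F : X * Y -> R.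

Lemma itg_prod F (g : Y -> R) : meas F -> (forall y, itg m1 (fun x => F (x, y))) ->
  itg m2 g -> (forall y, \int[m1]_x `|F (x, y)| <= g y) -> itg (m1 \x m2)%E F.
Proof.
move=> mF i1 ig hg; apply: itgP => //.
have m : measurable_fun setT (fun z : X * Y => `|F z|%:E) by apply/measurable_EFinP; exact: meas_norm.
have p z : (0 <= `|F z|%:E)%E by rewrite lee_fin.
have h := @fubini_tonelli2 _ _ X Y R m1 m2 (fun z => `|F z|%:E) m p.
rewrite [X in (X < _)%E]h.
apply: le_lt_trans (itg_lt ig); apply: ge0_le_integral => //.
- by move=> y _; apply: integral_ge0.
- exact: measurable_fun_fubini_tonelli_G.
- by apply/measurable_EFinP; apply: meas_norm; exact: itg_meas ig.
- move=> y _; rewrite /fubini_G -(IE (itg_norm (i1 y))) lee_fin.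
  exact: le_trans (hg y) (ler_norm _).
Qed.

Lemma FubR F : itg (m1 \x m2)%E F -> [/\ {ae m1, forall x, itg m2 (fun y => F (x, y))},
  {ae m2, forall y, itg m1 (fun x => F (x, y))},
  itg m1 (fun x => \int[m2]_y F (x, y)), itg m2 (fun y => \int[m1]_x F (x, y)) &
  \int[m1]_x \int[m2]_y F (x, y) = \int[m2]_y \int[m1]_x F (x, y)].
Proof.
move=> iF; have mF := itg_meas iF.
have a1 := ae_integrable1 iF; have a2 := ae_integrable2 iF.
have mx : meas (fun x => \int[m2]_y F (x, y)) by exact: meas_param.
have my : meas (fun y => \int[m1]_x F (x, y)).
  apply: (@meas_param _ _ _ Y X m1 (fun z => F (z.2, z.1))).
  by apply: (measurableT_comp mF); exact: measurable_swap.
have i1 := integrable_fubini_F iF.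
have i2 : itg m2 (fun y => \int[m1]_x F (x, y)).
  apply: itgP => //.
  have m : measurable_fun setT (fun z : X * Y => `|F z|%:E) by apply/measurable_EFinP; exact: meas_norm.
  have p z : (0 <= `|F z|%:E)%E by rewrite lee_fin.
  have h := @fubini_tonelli2 _ _ X Y R m1 m2 (fun z => `|F z|%:E) m p.
  apply: (@le_lt_trans _ _ (\int[m2]_y fubini_G m1 (fun z => `|F z|%:E) y)%E); last first.
    by rewrite -[X in (X < _)%E]h; exact: itg_lt iF.
  apply: ae_ge0_le_integral => //.
  - by apply/measurable_EFinP; exact: meas_norm.
  - by move=> y _; apply: integral_ge0.
  - exact: measurable_fun_fubini_tonelli_G.
  - apply: (aeS a2) => y iy _; rewrite /fubini_G -(IE (itg_norm iy)) lee_fin.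
    exact: le_normr_Rintegral.
have E1 : {ae m1, forall x, (\int[m2]_y F (x, y))%:E = fubini_F m2 (EFin \o F) x}.
  by apply: (aeS a1) => x h; rewrite IE.
have E2 : {ae m2, forall y, (\int[m1]_x F (x, y))%:E = fubini_G m1 (EFin \o F) y}.
  by apply: (aeS a2) => x h; rewrite IE.
split => //.
- apply: itgP => //.
  have m : measurable_fun setT (fun z : X * Y => `|F z|%:E) by apply/measurable_EFinP; exact: meas_norm.
  have p z : (0 <= `|F z|%:E)%E by rewrite lee_fin.
  have h := @fubini_tonelli1 _ _ X Y R m1 m2 (fun z => `|F z|%:E) m p.
  apply: (@le_lt_trans _ _ (\int[m1]_x fubini_F m2 (fun z => `|F z|%:E) x)%E); last first.
    by rewrite -[X in (X < _)%E]h; exact: itg_lt iF.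
  apply: ae_ge0_le_integral => //.
  - by apply/measurable_EFinP; exact: meas_norm.
  - by move=> x _; apply: integral_ge0.
  - exact: measurable_fun_fubini_tonelli_F.
  - apply: (aeS a1) => x ix _; rewrite /fubini_F -(IE (itg_norm ix)) lee_fin.
    exact: le_normr_Rintegral.
- rewrite /Rintegral; congr fine.
  transitivity (\int[m1]_x fubini_F m2 (EFin \o F) x)%E.
    apply: ae_eq_integral => //; [exact/measurable_EFinP|exact: (measurable_int _ i1)|].
    by apply: (aeS E1) => x /= -> .
  rewrite (integral12_prod_meas1 iF) -(integral21_prod_meas1 iF).
  apply/esym; apply: ae_eq_integral => //; [exact/measurable_EFinP|exact: (measurable_fubini_G iF)|].
  by apply: (aeS E2) => x /= -> .
Qed.

End FubiniReal.

Lemma itg_le_ae d (T : measurableType d) (R : realType) (m : {measure set T -> \bar R}) (f g : T -> R) :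
  meas f -> itg m g -> {ae m, forall x, `|f x| <= g x} -> itg m f.
Proof.
move=> mf ig fg; apply: itgP => //; apply: le_lt_trans (itg_lt ig).
apply: ae_ge0_le_integral => //.
- by apply/measurable_EFinP; exact: meas_norm.
- by apply/measurable_EFinP; apply: meas_norm; exact: itg_meas ig.
- by apply: (aeS fg) => x h _; rewrite lee_fin (le_trans h)// ler_norm.
Qed.

Section Completeness.
Context {R : realType}.
Local Notation M := (measurableTypeR R).
Local Notation T2 := (M * M)%type.
Local Notation R2 := (R * R)%type.
Local Notation lam := (@lebesgue_measure R).
Local Notation mu := (leb2 R).
Implicit Types (u v w a b : R2 -> R).

Lemma leb2_sf : sigma_finite setT (leb2 R).
Proof.
exists (fun n : nat => sq n%:R : set T2).
  apply/seteqP; split => // x _; exists (Num.truncn (Num.max `|x.1| `|x.2|)).+1 => //.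
  have h : Num.max `|x.1| `|x.2| < (Num.truncn (Num.max `|x.1| `|x.2|)).+1%:R by rewrite truncnS_gt.
  by apply/sqP; move: h; rewrite gt_max => /andP[/ltW ? /ltW ?].
by move=> n; split; [exact: sq_measurable|exact: sq_mu].
Qed.

Definition leb2s : {sigma_finite_measure set T2 -> \bar R} :=
  HB.pack (Measure.sort (leb2 R)) (Measure_isSigmaFinite.Build _ _ _ (leb2 R) leb2_sf) (Measure.class (leb2 R)).

Lemma HB_der u v : Hspace u -> Hspace v -> [/\ Hspace (fun x => u x - v x),
  {ae mu, forall x, d1 (fun x => u x - v x) x = d1 u x - d1 v x},
  {ae mu, forall x, d2 (fun x => u x - v x) x = d2 u x - d2 v x} &
  {ae mu, forall x, dt (fun x => u x - v x) x = dt u x - dt v x}].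
Proof.
move=> hu hv; have [h] := H_lin (-1) hv hu.
have -> : (fun x : R2 => -1 * v x + u x) = (fun x => u x - v x) by apply/funext => x; rewrite mulN1r addrC.
move=> a1 a2 a3; split; first exact: HB.
- by apply: (aeS a1) => x ->; rewrite mulN1r addrC.
- by apply: (aeS a2) => x ->; rewrite mulN1r addrC.
- by apply: (aeS a3) => x ->; rewrite mulN1r addrC.
Qed.

Lemma QBE l u v : Hspace u -> Hspace v -> Q l (fun x => u x - v x) =
  n2 mu (fun x => d1 u x - d1 v x) + n2 mu (fun x => d2 u x - d2 v x) +
  (l ^+ 2)^-1 * n2 mu (fun x => dt u x - dt v x) + n2 mu (fun x => u x - v x).
Proof.
move=> hu hv; have [hs a1 a2 a3] := HB_der hu hv.
rewrite (QE _ hs) (n2_ae (H_d1 hs).1 (sqiB (H_d1 hu) (H_d1 hv)).1 a1).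
rewrite (n2_ae (H_d2 hs).1 (sqiB (H_d2 hu) (H_d2 hv)).1 a2).
by rewrite (n2_ae (H_dth hs).1 (sqiB (H_dth hu) (H_dth hv)).1 a3).
Qed.

Lemma cvg0_le (f : nat -> R) : (forall n, 0 <= f n) ->
  (forall e, 0 < e -> exists N, forall n, (N <= n)%N -> f n <= e) -> f @ \oo --> (0 : R).
Proof.
move=> f0 h; apply/cvgrPdist_le => e e0; have [N hN] := h e e0.
by exists N => // n /= /hN; rewrite sub0r normrN ger0_norm.
Qed.

Lemma TH_sq (K : R) a b x : 0 <= K -> `|\1_(sq K) x * TH a b x| <= K * (`|a x| + `|b x|).
Proof.
move=> K0; rewrite indicE; have [/set_mem/sqP[h1 h2]|_] := boolP (x \in sq K); last first.
  by rewrite mul0r normr0 mulr_ge0// addr_ge0.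
rewrite mul1r /TH; apply: (le_trans (ler_normB _ _)); rewrite !normrM mulrDr addrC.
by apply: lerD; exact: ler_wpM2r.
Qed.

Lemma sqi_TH (K : R) a b : 0 <= K -> sqi mu a -> sqi mu b ->
  sqi mu (fun x => \1_(sq K) x * TH a b x) /\
  n2 mu (fun x => \1_(sq K) x * TH a b x) <= K ^+ 2 * (2 * n2 mu a + 2 * n2 mu b).
Proof.
move=> K0 sa sb; have sK : sqi mu (fun x => K * (`|a x| + `|b x|)) := sqiZ K (sqiD (sqi_norm sa) (sqi_norm sb)).
have mT : @meas _ T2 R (fun x => \1_(sq K) x * TH a b x) := measM (sq_ind_meas K) (meas_TH sa.1 sb.1).
have le x : `|\1_(sq K) x * TH a b x| <= `|K * (`|a x| + `|b x|)|.
  exact: le_trans (TH_sq a b x K0) (ler_norm _).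
split; first exact: (sqi_le mT sK le).
apply: (le_trans (n2_le mT sK le)); rewrite (n2Z _ (sqiD (sqi_norm sa) (sqi_norm sb))).
rewrite ler_wpM2l ?sqr_ge0//; apply: (le_trans (n2D_le (sqi_norm sa) (sqi_norm sb))).
have E f : n2 mu (fun x => `|f x|) = n2 mu f.
  by apply: eq_Rintegral => x _; rewrite real_normK ?num_real.
by rewrite !E.
Qed.

(** Function, gradient and angular derivative converge separately in L2, and weak derivatives pass
    to such limits. The limit [t] of the angular derivatives must still be identified with [TH a b],
    whose unbounded weights are handled on one square at a time. *)
Lemma H_complete l (u_ : nat -> R2 -> R) : 0 < l -> (forall n, Hspace (u_ n)) ->
  (forall e, 0 < e -> exists N, forall n m, (N <= n)%N -> (N <= m)%N ->
     Q l (fun x => u_ n x - u_ m x) <= e) ->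
  exists2 u, Hspace u & forall e, 0 < e -> exists N, forall n, (N <= n)%N ->
     Q l (fun x => u_ n x - u x) <= e.
Proof.
move=> l0 hu hc; have l2 : 0 < l ^+ 2 by rewrite exprn_gt0.
have part (f : nat -> R2 -> R) (k : R) : 0 < k -> (forall n, sqi mu (f n)) ->
    (forall n m, k * n2 mu (fun x => f n x - f m x) <= Q l (fun x => u_ n x - u_ m x)) ->
    exists2 g, sqi mu g & forall e, 0 < e -> exists N, forall n, (N <= n)%N -> n2 mu (fun x => f n x - g x) <= e.
  move=> k0 sf hf; apply: L2_complete => // e e0.
  have [N hN] := hc (k * e) (mulr_gt0 k0 e0); exists N => n m Nn Nm.
  by rewrite -(ler_pM2l k0); apply: le_trans (hf n m) (hN _ _ Nn Nm).
have QQ n m := QBE l (hu n) (hu m).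
have g0 (f : R2 -> R) := n2_ge0 mu f.
have li : 0 <= (l ^+ 2)^-1 by rewrite invr_ge0 ltW.
have [u su cu] : exists2 g, sqi mu g & forall e, 0 < e -> exists N, forall n, (N <= n)%N -> n2 mu (fun x => u_ n x - g x) <= e.
  apply: (@part u_ 1) => // [n|n m]; first exact: H_sqi.
  by rewrite QQ mul1r lerDr !addr_ge0// mulr_ge0.
have [a sa ca] : exists2 g, sqi mu g & forall e, 0 < e -> exists N, forall n, (N <= n)%N -> n2 mu (fun x => d1 (u_ n) x - g x) <= e.
  apply: (@part (fun n => d1 (u_ n)) 1) => // [n|n m]; first exact: H_d1.
  by rewrite QQ mul1r -!addrA lerDl !addr_ge0// mulr_ge0.
have [b sb cb] : exists2 g, sqi mu g & forall e, 0 < e -> exists N, forall n, (N <= n)%N -> n2 mu (fun x => d2 (u_ n) x - g x) <= e.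
  apply: (@part (fun n => d2 (u_ n)) 1) => // [n|n m]; first exact: H_d2.
  by rewrite QQ mul1r -!addrA addrCA lerDl !addr_ge0// mulr_ge0.
have [t st ct] : exists2 g, sqi mu g & forall e, 0 < e -> exists N, forall n, (N <= n)%N -> n2 mu (fun x => dt (u_ n) x - g x) <= e.
  apply: (@part (fun n => dt (u_ n)) (l ^+ 2)^-1) => // [|n|n m]; [by rewrite invr_gt0|exact: H_dth|].
  by rewrite QQ addrAC lerDr !addr_ge0.
have wa : wd axis1 u a.
  apply: (wd_L2lim (fun n => H_wd1 (hu n)) (fun n => H_sqi (hu n)) (fun n => H_d1 (hu n)) su sa).
    exact: cvg0_le.
  exact: cvg0_le.
have wb : wd axis2 u b.
  apply: (wd_L2lim (fun n => H_wd2 (hu n)) (fun n => H_sqi (hu n)) (fun n => H_d2 (hu n)) su sb).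
    exact: cvg0_le.
  exact: cvg0_le.
have tE : {ae mu, forall x, t x = TH a b x}.
  have hK (K : nat) : {ae mu, forall x, \1_(sq K%:R) x * (t x - TH a b x) = 0}.
    have K0 : 0 <= K%:R :> R by exact: ler0n.
    have bI (x : T2) : `|\1_(sq K%:R) x : R| <= 1 by exact: indic_le1.
    have s1 := sqiMb (sq_ind_meas K%:R) bI st.
    have s2 := (sqi_TH K0 sa sb).1.
    have E1 : (fun x => \1_(sq K%:R) x * (t x - TH a b x)) =
       (fun x => \1_(sq K%:R) x * t x - \1_(sq K%:R) x * TH a b x) by apply/funext => x; rewrite mulrBr.
    have sf : sqi mu (fun x => \1_(sq K%:R) x * (t x - TH a b x)) by rewrite E1; exact: sqiB.
    apply: (n2_eq0 sf); apply/eqP; rewrite eq_le n2_ge0 andbT; apply/ler_addgt0Pr => e e0.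
    rewrite add0r.
    pose C : R := 2 + K%:R ^+ 2 * 8; have C0 : 0 < C by rewrite ltr_wpDr// mulr_ge0// sqr_ge0.
    have eC : 0 < e / C by rewrite divr_gt0.
    have [N1 h1] := ca _ eC; have [N2 h2] := cb _ eC; have [N3 h3] := ct _ eC.
    pose n := maxn N1 (maxn N2 N3).
    have {}h1 := h1 n (leq_maxl _ _).
    have {}h2 : n2 mu (fun x => d2 (u_ n) x - b x) <= e / C by apply: h2; rewrite /n maxnCA leq_maxl.
    have {}h3 : n2 mu (fun x => dt (u_ n) x - t x) <= e / C by apply: h3; rewrite /n maxnA leq_maxr.
    have sA := sqiB (H_d1 (hu n)) sa; have sB := sqiB (H_d2 (hu n)) sb; have sT := sqiB (H_dth (hu n)) st.
    have [s3 n3] := sqi_TH K0 sA sB.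
    have sT1 := sqiMb (sq_ind_meas K%:R) bI sT.
    have E2 : (fun x => \1_(sq K%:R) x * (t x - TH a b x)) =
       (fun x => \1_(sq K%:R) x * TH (fun x => d1 (u_ n) x - a x) (fun x => d2 (u_ n) x - b x) x -
          \1_(sq K%:R) x * (dt (u_ n) x - t x)).
      by apply/funext => x; rewrite -mulrBr; congr (_ * _); rewrite dtxE /TH; ring.
    have h4 : n2 mu (fun x => \1_(sq K%:R) x * (dt (u_ n) x - t x)) <= e / C.
      apply: le_trans h3; apply: (n2_le sT1.1 sT) => x; rewrite normrM ler_piMl//.
    rewrite E2; apply: (le_trans (n2D_le s3 (sqiN sT1))); rewrite n2N.
    apply: (@le_trans _ _ (2 * (K%:R ^+ 2 * (2 * (e / C) + 2 * (e / C))) + 2 * (e / C))).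
      apply: lerD; last by rewrite ler_pM2l.
      rewrite ler_pM2l//; apply: (le_trans n3); rewrite ler_wpM2l ?sqr_ge0//.
      by apply: lerD; rewrite ler_pM2l.
    rewrite le_eqVlt; apply/orP; left; apply/eqP.
    by rewrite /C; field; rewrite -/C gt_eqF.
  apply: (aeS (ae_foralln hK)) => x hx.
  have [n hn] : exists n : nat, sq n%:R x.
    exists (Num.truncn (Num.max `|x.1| `|x.2|)).+1.
    have h' : Num.max `|x.1| `|x.2| < (Num.truncn (Num.max `|x.1| `|x.2|)).+1%:R by rewrite truncnS_gt.
    by apply/sqP; move: h'; rewrite gt_max => /andP[/ltW ? /ltW ?].
  by have := hx n; rewrite indicE mem_set// mul1r => /eqP; rewrite subr_eq0 => /eqP.
have sth : sqi mu (TH a b) := sqi_ae st (meas_TH sa.1 sb.1) tE.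
have [hH e1 e2 e3] := HI su wa wb sa sb sth.
exists u => // e e0.
pose C : R := 3 + (l ^+ 2)^-1; have C0 : 0 < C by rewrite ltr_wpDr.
have eC : 0 < e / C by rewrite divr_gt0.
have [N1 h1] := ca _ eC; have [N2 h2] := cb _ eC; have [N3 h3] := ct _ eC; have [N4 h4] := cu _ eC.
exists (maxn (maxn N1 N2) (maxn N3 N4)) => n; rewrite !geq_max => /andP[/andP[n1 n2'] /andP[n3 n4]].
rewrite (QBE _ (hu n) hH).
have sub (f g g' : R2 -> R) : sqi mu f -> sqi mu g -> sqi mu g' -> {ae mu, forall x, g x = g' x} ->
    n2 mu (fun x => f x - g x) = n2 mu (fun x => f x - g' x).
  move=> sf sg sg' gg; apply: n2_ae; [exact: (sqiB sf sg).1|exact: (sqiB sf sg').1|].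
  by apply: (aeS gg) => x ->.
have e3' : {ae mu, forall x, dt u x = t x} by apply: (aeS2 e3 tE) => x -> ->.
rewrite (sub _ _ _ (H_d1 (hu n)) (H_d1 hH) sa e1) (sub _ _ _ (H_d2 (hu n)) (H_d2 hH) sb e2).
rewrite (sub _ _ _ (H_dth (hu n)) (H_dth hH) st e3').
apply: (@le_trans _ _ (e / C + e / C + (l ^+ 2)^-1 * (e / C) + e / C)).
  apply: lerD (h4 n n4); apply: lerD; first exact: lerD (h1 n n1) (h2 n n2').
  by apply: ler_wpM2l (h3 n n3); rewrite invr_ge0 sqr_ge0.
rewrite le_eqVlt; apply/orP; left; apply/eqP.
have -> : e / C + e / C + (l ^+ 2)^-1 * (e / C) + e / C = e / C * C by rewrite /C; ring.
by rewrite divfK// gt_eqF.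
Qed.

Lemma test_sqi psi : test_function psi -> sqi mu psi.
Proof.
move=> tp; have [K [N [mp N0 hp]]] := test_bdd tp.
apply: (sqi_le mp (sqiZ N (sqi_sq K))) => x.
by rewrite (le_trans (hp x))// ler_norm.
Qed.

Definition rotc (s : R) : R2 -> R2 := rot (cos s) (sin s).

Lemma rotcD s t x : rotc s (rotc t x) = rotc (s + t) x.
Proof. by rewrite /rotc rot_comp cosD sinD addrC (addrC (sin s * _)) -?(addrC (sin s * _)); congr rot; ring. Qed.

Lemma rotcK s : cancel (rotc s) (rotc (- s)).
Proof. by move=> x; rewrite rotcD addNr /rotc cos0 sin0 rot10. Qed.

Lemma rotc_mp s : @mpres _ T2 R mu (rotc s).
Proof. by apply: mpres_rot; exact: cos2Dsin2. Qed.

Lemma rotc_meas : measurable_fun setT (fun z : M * T2 => rotc z.1 z.2 : T2).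
Proof.
have mc : @meas _ (M * T2)%type R (fun z => cos z.1).
  by apply: (meas_cont (F := cos)); [exact: continuous_cos|exact: measurable_fst].
have ms : @meas _ (M * T2)%type R (fun z => sin z.1).
  by apply: (meas_cont (F := sin)); [exact: continuous_sin|exact: measurable_fst].
have m1 : @meas _ (M * T2)%type R (fun z => z.2.1) by apply: measurableT_comp; [exact: measurable_fst|exact: measurable_snd].
have m2 : @meas _ (M * T2)%type R (fun z => z.2.2) by apply: measurableT_comp; [exact: measurable_snd|exact: measurable_snd].
apply/prod_measurable_funP; split.
  exact: (measB (measM mc m1) (measM ms m2)).
exact: (measD (measM ms m1) (measM mc m2)).
Qed.

(** * Integration along the rotation flow *)

Section flow.
Variables (phi : R) (phi0 : 0 <= phi).
Let I (s : R) : R := \1_(`[0, phi]%classic) s.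

Let mI : @meas _ M R I. Proof. by apply: meas_indic; exact: measurable_itv. Qed.

Let I01 s : I s = 0 \/ I s = 1.
Proof. by rewrite /I indicE; case: (_ \in _); [right|left]. Qed.

Let lamI : lam `[0, phi]%classic = phi%:E.
Proof.
rewrite lebesgue_measure_itv/= lte_fin; case: ltP => [_|h]; first by rewrite sube0.
by congr (_%:E); apply/le_anti; rewrite phi0 h.
Qed.

Let iI : @itg _ M R lam I.
Proof.
have p x : 0 <= I x by case: (I01 x) => ->.
apply: (@itg_ge0P _ M R lam I p mI); rewrite (_ : (\int[lam]_x (I x)%:E)%E = phi%:E) ?ltry//.
by rewrite integral_indic ?setIT ?lamI//; exact: measurable_itv.
Qed.

Let II : \int[lam]_s I s = phi.
Proof.
rewrite /Rintegral (_ : (\int[lam]_x (I x)%:E)%E = phi%:E)//.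
by rewrite integral_indic ?setIT ?lamI//; exact: measurable_itv.
Qed.

(** The integral of [h] along the arc of opening [phi] that starts at [x]. *)
Let g (h : R2 -> R) (x : R2) : R := \int[lam]_s (I s * h (rotc s x)).

(** Cauchy-Schwarz on the interval of angles gives one factor [phi], and integrating the bound [C]
    over it after Fubini gives the other. *)
Lemma slice_avg (K : R2 * R -> R) (C : R) : @meas _ (T2 * M)%type R K ->
  (forall s, sqi mu (fun x => K (x, s))) -> (forall s, n2 mu (fun x => K (x, s)) <= C) ->
  sqi mu (fun x => \int[lam]_s (I s * K (x, s))) /\
  n2 mu (fun x => \int[lam]_s (I s * K (x, s))) <= phi ^+ 2 * C.
Proof.
move=> mK sK hK; pose H (z : T2 * M) := I z.2 * K z.
have mH : @meas _ (T2 * M)%type R H.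
  by apply: measM mK; apply: measurableT_comp; [exact: mI|exact: measurable_snd].
have iF : itg (leb2s \x lam)%E (fun z : T2 * M => H z ^+ 2).
  apply: (@itg_prod _ _ _ T2 M leb2s lam _ (fun s => C * I s)).
  - exact: measX.
  - move=> s; rewrite /H /=; have [->|->] := I01 s.
      by under eq_fun do rewrite mul0r expr0n; exact: itg0.
    by under eq_fun do rewrite mul1r; exact: (sK s).2.
  - exact: (@itgZ _ M R lam _ I iI).
  - move=> s; rewrite /H /=; have [->|->] := I01 s.
      by under eq_Rintegral do rewrite mul0r expr0n normr0; rewrite I0 mulr0.
    by under eq_Rintegral do rewrite mul1r ger0_norm ?sqr_ge0//; rewrite mulr1; exact: hK.
have [a1 a2 i1 i2 E] := FubR iF.
pose gK (x : R2) := \int[lam]_s (I s * K (x, s)).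
have mg : @meas _ T2 R gK by exact: (@meas_param _ _ _ T2 M lam H mH).
have le : {ae mu, forall x, `|gK x ^+ 2| <= phi * \int[lam]_s (H (x, s) ^+ 2)}.
  apply: (aeS a1) => x hx; rewrite ger0_norm ?sqr_ge0//.
  have sH : sqi lam (fun s : M => H (x, s)).
    split => //; apply: measurableT_comp; first exact: mH.
    exact: (@pair1_measurable _ _ T2 M x).
  have sI : sqi lam I.
    split => //; have -> : (fun x : M => I x ^+ 2) = I.
      by apply/funext => s; case: (I01 s) => ->; rewrite ?expr0n ?expr1n.
    exact: iI.
  have := CS sI sH.
  rewrite (_ : n2 lam I = phi); last first.
    by rewrite -II; apply: eq_Rintegral => s _; case: (I01 s) => ->; rewrite ?expr0n ?expr1n.
  move=> hCS; apply: le_trans hCS; rewrite le_eqVlt; apply/orP; left; apply/eqP; congr (_ ^+ 2).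
  by apply: eq_Rintegral => s _; rewrite /H/=; case: (I01 s) => ->; rewrite ?mul0r ?mul1r.
have sg : sqi mu gK.
  by split; [exact: mg|exact: (itg_le_ae (@measX _ T2 R _ 2 mg) (itgZ phi i1) le)].
split => //.
apply: (@le_trans _ _ (\int[mu]_x (phi * \int[lam]_s (H (x, s) ^+ 2)))).
  apply: (I_le_ae sg.2 (itgZ phi i1)).
  by apply: (aeS le) => x hx; apply: le_trans hx; exact: ler_norm.
rewrite (IZ phi i1) expr2 -mulrA ler_wpM2l// E.
apply: (@le_trans _ _ (\int[lam]_s (C * I s))); last by rewrite IZ// II mulrC.
apply: I_le => //; first exact: (@itgZ _ M R lam _ I iI).
move=> s; rewrite /H /=; case: (I01 s) => ->.
  by under eq_Rintegral do rewrite mul0r expr0n; rewrite I0 mulr0.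
by under eq_Rintegral do rewrite mul1r; rewrite mulr1; exact: hK.
Qed.

Lemma flow_avg h : sqi mu h -> sqi mu (g h) /\ n2 mu (g h) <= phi ^+ 2 * n2 mu h.
Proof.
move=> sh; apply: (@slice_avg (fun z => h (rotc z.2 z.1)) (n2 mu h)).
- apply: measurableT_comp; first exact: sh.1.
  by have := measurableT_comp rotc_meas (@measurable_swap _ _ T2 M).
- by move=> s; exact: mp_sqi (rotc_mp s) sh.
- by move=> s /=; rewrite -(mp_n2 (rotc_mp s) sh).
Qed.

(** The weights of the angular derivative are absorbed into the bumps: [x.1 * a x.1] and
    [x.2 * b x.2] are bumps again, so this is integration by parts along each axis. *)
Lemma wd_tens_dt u (a b a' b' : R -> R) : Hspace u -> bump a -> bump b ->
  (forall t, is_derive t (1 : R) a (a' t)) -> (forall t, is_derive t (1 : R) b (b' t)) ->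
  \int[mu]_x (u x * (x.1 * (a x.1 * b' x.2) - x.2 * (a' x.1 * b x.2))) =
  - \int[mu]_x (dt u x * (a x.1 * b x.2)).
Proof.
move=> hu ba bb da db.
have ba1 : bump (fun x : R => x * a x) by apply: bumpMl => //; exact: smooth1_id.
have bb1 : bump (fun x : R => x * b x) by apply: bumpMl => //; exact: smooth1_id.
have da1 (t : R) : is_derive t (1 : R) (fun x : R => x * a x) (t * a' t + a t).
  by have := is_deriveM (is_derive_id t 1) (da t); rewrite -![_ *: _]/(_ * _) mulr1.
have db1 (t : R) : is_derive t (1 : R) (fun x : R => x * b x) (t * b' t + b t).
  by have := is_deriveM (is_derive_id t 1) (db t); rewrite -![_ *: _]/(_ * _) mulr1.
have t1 := test_tens ba1 bb; have t2 := test_tens ba bb1.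
have [lu l2 /(_ _ t1) h2] := H_wd2 hu; have [_ l1 /(_ _ t2) h1] := H_wd1 hu.
have td1 := test_der (axis2 : R2) t1; have td2 := test_der (axis1 : R2) t2.
have E1 (x : R2) : 'D_axis2 (fun x : R2 => x.1 * a x.1 * b x.2) x = x.1 * (a x.1 * b' x.2).
  by have [_ ->] := is_derive_tens x (axis2 : R2) da1 db; rewrite /axis2/=; ring.
have E2 (x : R2) : 'D_axis1 (fun x : R2 => a x.1 * (x.2 * b x.2)) x = x.2 * (a' x.1 * b x.2).
  by have [_ ->] := is_derive_tens x (axis1 : R2) da db1; rewrite /axis1/=; ring.
transitivity (\int[mu]_x (u x * 'D_axis2 (fun x : R2 => x.1 * a x.1 * b x.2) x -
    u x * 'D_axis1 (fun x : R2 => a x.1 * (x.2 * b x.2)) x)).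
  by apply: eq_Rintegral => x _; rewrite E1 E2; ring.
rewrite (IB (itg_test lu td1) (itg_test lu td2)) h1 h2 opprK addrC -[LHS]opprK opprB.
rewrite -(IB (itg_test l2 t1) (itg_test l1 t2)); congr (- _).
by apply: eq_Rintegral => x _; rewrite dtxE; ring.
Qed.

Lemma rotcE (s : R) x : rotc s x = (cos s * x.1 - sin s * x.2, sin s * x.1 + cos s * x.2).
Proof. by []. Qed.

Lemma rotc_der (a b a' b' : R -> R) (x : R2) (s : R) :
  (forall t, is_derive t (1 : R) a (a' t)) -> (forall t, is_derive t (1 : R) b (b' t)) ->
  is_derive s (1 : R) (fun s => a (rotc (- s) x).1 * b (rotc (- s) x).2)
   (- ((rotc (- s) x).1 * (a (rotc (- s) x).1 * b' (rotc (- s) x).2) -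
      (rotc (- s) x).2 * (a' (rotc (- s) x).1 * b (rotc (- s) x).2))).
Proof.
move=> da db.
pose y1 (s : R) : R := x.1 * cos s + x.2 * sin s.
pose y2 (s : R) : R := - x.1 * sin s + x.2 * cos s.
have E1 (t : R) : (rotc (- t) x).1 = y1 t by rewrite rotcE/= cosN sinN /y1; ring.
have E2 (t : R) : (rotc (- t) x).2 = y2 t by rewrite rotcE/= cosN sinN /y2; ring.
have lc (p q : R) (f k : R -> R) (df dg : R) : is_derive s (1 : R) f df -> is_derive s (1 : R) k dg ->
    is_derive s (1 : R) (fun t => p * f t + q * k t) (p * df + q * dg).
  move=> hf hg; exact: (is_deriveD (is_deriveZ p hf) (is_deriveZ q hg)).
have D1 : is_derive s (1 : R) y1 (y2 s).
  have := lc x.1 x.2 _ _ _ _ (is_derive_cos s) (is_derive_sin s).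
  by rewrite mulrN -mulNr.
have D2 : is_derive s (1 : R) y2 (- y1 s).
  have := lc (- x.1) x.2 _ _ _ _ (is_derive_sin s) (is_derive_cos s).
  by rewrite mulrN mulNr -opprD.
have := is_deriveM (is_derive1_comp (da (y1 s)) D1) (is_derive1_comp (db (y2 s)) D2).
rewrite -![_ *: _]/(_ * _) /comp => h.
under eq_fun do rewrite E1 E2.
rewrite E1 E2; apply: is_derive_eq h _; ring.
Qed.

(** The fundamental theorem of calculus along rotations, proved in weak form. Tested against a
    tensor product, the rotation is moved onto the smooth factor, where the classical theorem
    applies; for each angle an integration by parts brings the angular derivative back to [u], and
    Fubini exchanges angle and plane. *)
Lemma flow_id u : Hspace u -> {ae mu, forall x, u (rotc phi x) - u x = g (dt u) x}.
Proof.
move=> hu; have sh := H_dth hu; have su := H_sqi hu.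
have [sg _] := flow_avg sh.
have sr := mp_sqi (rotc_mp phi) su.
suff : {ae mu, forall x, u (rotc phi x) - u x - g (dt u) x = 0}.
  by move=> h; apply: (aeS h) => x /eqP; rewrite subr_eq0 => /eqP.
apply: FL_loc; first by apply: sqi_locint; exact: sqiB (sqiB sr su) sg.
move=> a b ba bb; have [a' [ba' da]] := bump_der ba; have [b' [bb' db]] := bump_der bb.
pose psi (x : R2) := a x.1 * b x.2.
pose dpsi (x : R2) := x.1 * (a x.1 * b' x.2) - x.2 * (a' x.1 * b x.2).
have sp : sqi mu psi by apply: test_sqi; exact: test_tens.
have sd : sqi mu dpsi.
  have ba1 : bump (fun x : R => x * a x) by apply: bumpMl => //; exact: smooth1_id.
  have bb1 : bump (fun x : R => x * b x) by apply: bumpMl => //; exact: smooth1_id.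
  have h := sqiB (test_sqi (test_tens ba1 bb')) (test_sqi (test_tens ba' bb1)).
  rewrite (_ : dpsi = (fun x : T2 => x.1 * a x.1 * b' x.2 - a' x.1 * (x.2 * b x.2)))//.
  by apply/funext => x; rewrite /dpsi; ring.
have cpsi : continuous dpsi.
  have c1 : continuous (fun x : R2 => x.1) by move=> x; exact: cvg_fst.
  have c2 : continuous (fun x : R2 => x.2) by move=> x; exact: cvg_snd.
  have cc (f : R -> R) (q : R2 -> R) : bump f -> continuous q -> continuous (fun x => f (q x)).
    by move=> bf cq x; apply: continuous_comp; [exact: cq|exact: smooth1_cont bf.1 _].
  have cm (f k : R2 -> R) : continuous f -> continuous k -> continuous (fun x => f x * k x).
    by move=> cf ck x; exact: cvgM (cf x) (ck x).
  have k1 := cm _ _ c1 (cm _ _ (cc _ _ ba c1) (cc _ _ bb' c2)).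
  have k2 := cm _ _ c2 (cm _ _ (cc _ _ ba' c1) (cc _ _ bb c2)).
  by move=> x; exact: cvgB (k1 x) (k2 x).
have ftc (x : R2) : itg lam (fun s : M => I s * dpsi (rotc (- s) x)) /\
   psi (rotc (- phi) x) - psi x = - \int[lam]_s (I s * dpsi (rotc (- s) x)).
  have cr : continuous (fun s : R => rotc (- s) x).
    have cN : continuous (fun s : R => - s) by move=> s; apply: cvgN; exact: cvg_id.
    have cc (f : R -> R) : continuous f -> continuous (fun s => f (- s)).
      by move=> cf s; apply: continuous_comp; [exact: cN|exact: cf].
    have h1 : continuous (fun s : R => cos (- s) * x.1 - sin (- s) * x.2).
      by move=> s; apply: cvgB; apply: cvgM; [apply: cc; exact: continuous_cos|exact: cvg_cst|apply: cc; exact: continuous_sin|exact: cvg_cst].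
    have h2 : continuous (fun s : R => sin (- s) * x.1 + cos (- s) * x.2).
      by move=> s; apply: cvgD; apply: cvgM; [apply: cc; exact: continuous_sin|exact: cvg_cst|apply: cc; exact: continuous_cos|exact: cvg_cst].
    by move=> s; exact: (@cvg_pair _ _ _ (nbhs s) _ _ _ _ _ _ _ (h1 s) (h2 s)).
  have acx : ac (fun s : R => psi (rotc (- s) x)) (fun s => - dpsi (rotc (- s) x)).
    apply: ac_C1; first by move=> s; exact: rotc_der.
    have cd : continuous (fun s : R => dpsi (rotc (- s) x)).
      by move=> s; exact: (continuous_comp (cr s) (cpsi _)).
    by move=> s; apply: cvgN; exact: cd.
  have [_ lg E] := acx.
  have ig : itg lam (fun s : M => I s * dpsi (rotc (- s) x)).
    have [mg' /(_ 0 phi)] := lg; rewrite /itgon => h.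
    have mI' : measurable (`[0, phi]%classic : set M) by exact: measurable_itv.
    have := (integrable_mkcond (EFin \o (fun s : M => - dpsi (rotc (- s) x))) mI').1 h.
    rewrite restrict_EFin -ind_mul_eq => h'.
    have := itgN h'; rewrite /itg; apply: eq_integrable => // s _ /=.
    by rewrite mulrN opprK.
  split => //; have := E 0 phi phi0.
  rewrite (_ : rotc (- 0) x = x); last by rewrite oppr0 /rotc cos0 sin0 rot10.
  move=> ->; rewrite /J Rintegral_mkcond -ind_mul_eq -(IN ig).
  by apply: eq_Rintegral => s _; rewrite -/(I s) mulrN.
have bd (f k : R2 -> R) : sqi mu f -> sqi mu k -> \int[mu]_x `|f x * k x| <= n2 mu f + n2 mu k.
  move=> sf sk; rewrite -(ID sf.2 sk.2); apply: I_le.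
  - by apply: itg_norm; exact: sqi_itgM.
  - exact: itgD sf.2 sk.2.
  - move=> x; rewrite normrM -(real_normK (num_real (f x))) -(real_normK (num_real (k x))).
    by have := sqr_ge0 (`|f x| - `|k x|); have := normr_ge0 (f x); have := normr_ge0 (k x); nra.
have key (F : R2 * R -> R) (C : R) : @meas _ (T2 * M)%type R F ->
   (forall s, itg mu (fun x => F (x, s))) -> (forall s, \int[mu]_x `|F (x, s)| <= C) ->
   itg (leb2s \x lam)%E (fun z : T2 * M => I z.2 * F z).
  move=> mF iF bF; apply: (@itg_prod _ _ _ T2 M leb2s lam _ (fun s => C * I s)).
  - by apply: measM mF; apply: measurableT_comp; [exact: mI|exact: measurable_snd].
  - by move=> s; exact: (itgZ (I s) (iF s)).
  - exact: (@itgZ _ M R lam _ I iI).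
  - move=> s /=; have [->|->] := I01 s.
      by under eq_Rintegral do rewrite mul0r normr0; rewrite I0 mulr0.
    by under eq_Rintegral do rewrite mul1r; rewrite mulr1.
have mrN : measurable_fun setT (fun z : T2 * M => rotc (- z.2) z.1 : T2).
  have m1 : measurable_fun setT (fun z : T2 * M => (- z.2, z.1) : M * T2).
    apply/prod_measurable_funP; split; last exact: measurable_fst.
    by apply: measN; exact: measurable_snd.
  by have := measurableT_comp rotc_meas m1.
have mrP : measurable_fun setT (fun z : T2 * M => rotc z.2 z.1 : T2).
  by have := measurableT_comp rotc_meas (@measurable_swap _ _ T2 M).
have iA : itg (leb2s \x lam)%E (fun z : T2 * M => I z.2 * (u z.1 * dpsi (rotc (- z.2) z.1))).
  apply: (key (fun z => u z.1 * dpsi (rotc (- z.2) z.1)) (n2 mu u + n2 mu dpsi)).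
  - apply: measM; first by apply: measurableT_comp; [exact: su.1|exact: measurable_fst].
    by apply: measurableT_comp; [exact: sd.1|exact: mrN].
  - by move=> s; exact: sqi_itgM su (mp_sqi (rotc_mp (- s)) sd).
  - by move=> s /=; rewrite -(mp_n2 (rotc_mp (- s)) sd); exact: bd su (mp_sqi (rotc_mp (- s)) sd).
have iB : itg (leb2s \x lam)%E (fun z : T2 * M => I z.2 * (dt u (rotc z.2 z.1) * psi z.1)).
  apply: (key (fun z => dt u (rotc z.2 z.1) * psi z.1) (n2 mu (dt u) + n2 mu psi)).
  - apply: measM; last by apply: measurableT_comp; [exact: sp.1|exact: measurable_fst].
    by apply: measurableT_comp; [exact: sh.1|exact: mrP].
  - by move=> s; exact: sqi_itgM (mp_sqi (rotc_mp s) sh) sp.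
  - by move=> s /=; rewrite -(mp_n2 (rotc_mp s) sh); exact: bd (mp_sqi (rotc_mp s) sh) sp.
have [_ _ iA1 _ EA] := FubR iA; have [aB _ iB1 _ EB] := FubR iB.
have slice (s : R) : \int[mu]_x (u x * dpsi (rotc (- s) x)) = - \int[mu]_x (dt u (rotc s x) * psi x).
  have [hs _ _ e3] := H_rot (cos2Dsin2 s) hu.
  rewrite -(mp_I (rotc_mp s) (sqi_itgM su (mp_sqi (rotc_mp (- s)) sd))).
  transitivity (\int[mu]_x (u (rotc s x) * dpsi x)).
    by apply: eq_Rintegral => x _ /=; rewrite rotcK.
  rewrite (wd_tens_dt hs ba bb da db); congr (- _); apply: I_ae.
  - exact: measM (H_dth hs).1 sp.1.
  - exact: measM (mp_sqi (rotc_mp s) sh).1 sp.1.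
  - by apply: (aeS e3) => x ->.
have L1 : \int[mu]_x ((u (rotc phi x) - u x) * psi x) = - \int[mu]_x \int[lam]_s (I s * (u x * dpsi (rotc (- s) x))).
  transitivity (\int[mu]_x (u (rotc phi x) * psi x - u x * psi x)).
    by apply: eq_Rintegral => x _; ring.
  rewrite (IB (sqi_itgM sr sp) (sqi_itgM su sp)).
  have spr := mp_sqi (rotc_mp (- phi)) sp.
  have -> : \int[mu]_x (u (rotc phi x) * psi x) = \int[mu]_x (u x * psi (rotc (- phi) x)).
    rewrite -(mp_I (rotc_mp phi) (sqi_itgM su spr)).
    by apply: eq_Rintegral => x _ /=; rewrite rotcK.
  rewrite -(IB (sqi_itgM su spr) (sqi_itgM su sp)) -(IN iA1); apply: eq_Rintegral => x _ /=.
  have [ig E] := ftc x; rewrite -mulrBr E mulrN -(IZ _ ig); congr (- _).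
  by apply: eq_Rintegral => s _; ring.
have L2 : \int[mu]_x (g (dt u) x * psi x) = \int[mu]_x \int[lam]_s (I s * (dt u (rotc s x) * psi x)).
  apply: I_ae; [exact: measM sg.1 sp.1|exact: itg_meas iB1|].
  apply: (aeS aB) => x hx /=.
  (* Where [psi] vanishes both sides are zero; elsewhere division by [psi x] gives the integrability
     in [s] that allows [psi x] to leave the integral. *)
  have [p0|p0] := eqVneq (psi x) 0.
    by rewrite p0 mulr0; under eq_Rintegral do rewrite !mulr0; rewrite I0.
  have hx' : itg lam (fun s : M => I s * dt u (rotc s x)).
    have := itgZ (psi x)^-1 hx; rewrite /itg; apply: eq_integrable => // s _ /=; congr EFin.
    by field.
  rewrite mulrC -(IZ _ hx'); apply: eq_Rintegral => s _; ring.
transitivity (\int[mu]_x ((u (rotc phi x) - u x) * psi x) - \int[mu]_x (g (dt u) x * psi x)).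
  rewrite -(IB (sqi_itgM (sqiB sr su) sp) (sqi_itgM sg sp)).
  by apply: eq_Rintegral => x _; rewrite -mulrBl.
rewrite L1 L2 EB EA -opprD -[RHS]oppr0; congr (- _).
rewrite -(ID _ _); last 2 first.
- by have [_ _ _ h _] := FubR iA.
- by have [_ _ _ h _] := FubR iB.
rewrite -[RHS](I0 lam); apply: eq_Rintegral => s _ /=.
have i1 := sqi_itgM su (mp_sqi (rotc_mp (- s)) sd); have i2 := sqi_itgM (mp_sqi (rotc_mp s) sh) sp.
by rewrite (IZ _ i1) (IZ _ i2) [X in _ * X + _]slice mulrN addNr.
Qed.

Lemma flow_bound u : Hspace u -> n2 mu (fun x => u (rotc phi x) - u x) <= phi ^+ 2 * n2 mu (dt u).
Proof.
move=> hu; have sh := H_dth hu; have su := H_sqi hu; have [sg hg] := flow_avg sh.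
apply: le_trans hg; rewrite le_eqVlt; apply/orP; left; apply/eqP.
apply: n2_ae; [exact: (sqiB (mp_sqi (rotc_mp phi) su) su).1|exact: sg.1|exact: flow_id].
Qed.

(** The null set in the hypothesis depends on the angle. Averaging the difference
    [h (rotc s x) - h x], whose norm is zero for every [s], gives one null set for the whole arc. *)
Lemma flow_inv h : sqi mu h -> (forall s, {ae mu, forall x, h (rotc s x) = h x}) ->
  {ae mu, forall x, g h x = phi * h x}.
Proof.
move=> sh hs.
have mh : @meas _ (T2 * M)%type R (fun z => h (rotc z.2 z.1)).
  apply: measurableT_comp; first exact: sh.1.
  by have := measurableT_comp rotc_meas (@measurable_swap _ _ T2 M).
have mh' : @meas _ (T2 * M)%type R (fun z => h z.1).
  by apply: measurableT_comp; [exact: sh.1|exact: measurable_fst].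
have z (s : R) : n2 mu (fun x => h (rotc s x) - h x) <= 0.
  rewrite (_ : n2 _ _ = n2 mu (fun=> 0 : R)); last first.
    apply: n2_ae; [exact: (sqiB (mp_sqi (rotc_mp s) sh) sh).1|exact: meas_cst|].
    by apply: (aeS (hs s)) => x ->; rewrite subrr.
  by rewrite /n2; under eq_Rintegral do rewrite expr0n; rewrite I0.
have [sK] := @slice_avg (fun z => h (rotc z.2 z.1) - h z.1) 0 (measB mh mh')
  (fun s => sqiB (mp_sqi (rotc_mp s) sh) sh) z.
rewrite mulr0 => le0; have /(n2_eq0 sK) a0 : n2 mu (fun x => \int[lam]_s (I s * (h (rotc s x) - h x))) = 0.
  by apply/le_anti; rewrite le0 n2_ge0.
have iF : itg (leb2s \x lam)%E (fun z : T2 * M => (I z.2 * h (rotc z.2 z.1)) ^+ 2).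
  apply: (@itg_prod _ _ _ T2 M leb2s lam _ (fun s => n2 mu h * I s)).
  - apply: measX; apply: measM mh; by apply: measurableT_comp; [exact: mI|exact: measurable_snd].
  - move=> s /=; have [->|->] := I01 s.
      by under eq_fun do rewrite mul0r expr0n; exact: itg0.
    by under eq_fun do rewrite mul1r; exact: (mp_sqi (rotc_mp s) sh).2.
  - exact: (@itgZ _ M R lam _ I iI).
  - move=> s /=; have [->|->] := I01 s.
      by under eq_Rintegral do rewrite mul0r expr0n normr0; rewrite I0 mulr0.
    under eq_Rintegral do rewrite mul1r ger0_norm ?sqr_ge0//.
    by rewrite mulr1 -(mp_n2 (rotc_mp s) sh).
have [a1 _ _ _ _] := FubR iF.
apply: (aeS2 a0 a1) => x hx ix.
have sH : sqi lam (fun s : M => I s * h (rotc s x)).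
  split => //; apply: measM mI _.
  have := measurableT_comp mh (@pair1_measurable _ _ T2 M x); exact.
have sI : sqi lam I.
  split => //; have -> : (fun x : M => I x ^+ 2) = I.
    by apply/funext => s; case: (I01 s) => ->; rewrite ?expr0n ?expr1n.
  exact: iI.
have iH : itg lam (fun s : M => I s * h (rotc s x)).
  have := sqi_itgM sI sH; rewrite /itg; apply: eq_integrable => // s _ /=.
  by case: (I01 s) => ->; rewrite ?mul0r ?mul1r.
rewrite /g -[LHS]subr0 -[in LHS]hx mulrC -II -(IZ _ iI) -(IB iH); last first.
  by have := itgB iH (itgZ (h x) iI); rewrite /itg; apply: eq_integrable => // s _ /=; congr EFin; ring.
by apply: eq_Rintegral => s _; ring.
Qed.

End flow.

(** Along an arc of opening 1 the integral of the invariant function [dt u] is [dt u] itself, while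
    it also equals the increment of [u], which is zero. *)
Lemma inv_dt0 u : Hspace u -> (forall s, {ae mu, forall x, u (rotc s x) = u x}) ->
  {ae mu, forall x, dt u x = 0}.
Proof.
move=> hu us; have sh := H_dth hu.
have hs s : {ae mu, forall x, dt u (rotc s x) = dt u x}.
  have [hr _ _ e3] := H_rot (cos2Dsin2 s) hu.
  have us' : {ae mu, forall x, u x = u (rot (cos s) (sin s) x)} by apply: (aeS (us s)).
  have [_ _ _ e4] := H_ae hu (H_sqi hr).1 us'.
  by apply: (aeS2 e3 e4) => x <- ->.
have a1 := flow_inv ler01 sh hs; have a2 := flow_id ler01 hu.
have a3 : {ae mu, forall x, u (rotc 1 x) - u x = dt u x}.
  by apply: (aeS2 a1 a2) => x + ->; rewrite mul1r => ->.
by apply: (aeS2 a3 (us 1)) => x <- ->; rewrite subrr.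
Qed.

Lemma rotc_norm s (x : R2) : (rotc s x).1 ^+ 2 + (rotc s x).2 ^+ 2 = x.1 ^+ 2 + x.2 ^+ 2.
Proof.
rewrite rotcE /=; transitivity ((cos s ^+ 2 + sin s ^+ 2) * (x.1 ^+ 2 + x.2 ^+ 2)); first by ring.
by rewrite cos2Dsin2 mul1r.
Qed.

Lemma radial_inv u : radial u -> forall s, {ae mu, forall x, u (rotc s x) = u x}.
Proof.
move=> [g hg] s; have hg' := mp_ae (rotc_mp s) hg.
by apply: (aeS2 hg hg') => x -> ->; rewrite rotc_norm.
Qed.

End Completeness.

(** * Sobolev and Poincare inequalities on square cells *)

Section Cells.
Context {R : realType}.
Local Notation M := (measurableTypeR R).
Local Notation T2 := (M * M)%type.
Local Notation R2 := (R * R)%type.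
Local Notation lam := (@lebesgue_measure R).
Local Notation mu := (leb2 R).
Implicit Types (u v : R2 -> R).

(** A converse of slicing null sets. It concerns measurable sets, hence the formulation by an
    inequality for a measurable [f]. *)
Lemma aeA_rev (f : R2 -> R) : @meas _ T2 R f ->
  {ae lam, forall y, {ae lam, forall x, f (x, y) <= 0}} -> {ae mu, forall x, f x <= 0}.
Proof.
move=> mf h; pose g (x : T2) : R := 1 - (f x <= 0)%R%:R.
have mg : @meas _ T2 R g.
  by apply: measB; [exact: meas_cst|exact: (meas_le_pair mf (meas_cst 0))].
have g0 x : 0 <= g x by rewrite /g; case: (f x <= 0); rewrite ?subrr ?subr0.
have p2 (x : T2) : (0 <= (g x)%:E)%E by rewrite lee_fin.
have m2 : measurable_fun setT (fun x : T2 => (g x)%:E) by apply/measurable_EFinP.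
have T := @fubini_tonelli2 _ _ M M R lam lam _ m2 p2.
have z : (\int[lam \x lam]_z (g z)%:E = 0)%E.
  rewrite T -[RHS](integral0 lam setT); apply: ae_eq_integral => //.
    exact: measurable_fun_fubini_tonelli_G.
  apply: (aeS h) => y hy _; rewrite /fubini_G.
  rewrite -[RHS](integral0 lam setT); apply: ae_eq_integral => //.
    by apply/measurable_EFinP; exact: (slice_meas y mg).
  by apply: (aeS hy) => x hx _; rewrite /g hx subrr.
have ig : itg mu g.
  by apply: (itg_ge0P g0 mg); rewrite [X in (X < _)%E]z.
have := I_eq0_ae ig g0; rewrite (_ : \int[mu]_x g x = 0); last by rewrite /Rintegral [X in fine X]z.
by move=> /(_ erefl) h0; apply: (aeS h0) => x; rewrite /g; case: (f x <= 0) => //; rewrite subr0 => /eqP; rewrite oner_eq0.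
Qed.

Definition ii (a h x : R) : R := \1_(`[a, a + h]%classic) x.
(** Indicator of the closed square of side [h] with lower left corner [z]. *)
Definition cel (h : R) (z x : R2) : R := ii z.1 h x.1 * ii z.2 h x.2.

Lemma ii01 a h x : ii a h x = 0 \/ ii a h x = 1.
Proof. by rewrite /ii indicE; case: (_ \in _); [right|left]. Qed.

Lemma iiP a h x : ii a h x = (a <= x <= a + h)%R%:R.
Proof.
rewrite /ii indicE; congr (nat_of_bool _)%:R; apply/idP/idP => [/set_mem|hx].
  by rewrite /= in_itv.
by apply/mem_set; rewrite /= in_itv.
Qed.

Lemma ii_meas a h : @meas _ M R (ii a h).
Proof. by apply: meas_indic; exact: measurable_itv. Qed.

Lemma cel01 h z x : cel h z x = 0 \/ cel h z x = 1.
Proof. by rewrite /cel; case: (ii01 z.1 h x.1) => ->; case: (ii01 z.2 h x.2) => ->; rewrite ?mul0r ?mulr0 ?mulr1; auto. Qed.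

Lemma cel_ge0 h z x : 0 <= cel h z x.
Proof. by case: (cel01 h z x) => ->. Qed.

Lemma cel_le1 h z x : cel h z x <= 1.
Proof. by case: (cel01 h z x) => ->. Qed.

Lemma cel_norm h z x : `|cel h z x| <= 1.
Proof. by case: (cel01 h z x) => ->; rewrite ?normr0 ?normr1. Qed.

Lemma cel_sq h z x : cel h z x ^+ 2 = cel h z x.
Proof. by case: (cel01 h z x) => ->; rewrite ?expr0n ?expr1n. Qed.

Lemma cel_meas h z : @meas _ T2 R (cel h z).
Proof. by apply: measM; [apply: meas_fst|apply: meas_snd]; exact: ii_meas. Qed.

Lemma itg_cel h z f : itg mu f -> itg mu (fun x => cel h z x * f x).
Proof. by move=> hf; apply: itgMb hf; [exact: cel_meas|exact: cel_norm]. Qed.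

Lemma sqi_cel h z f : sqi mu f -> sqi mu (fun x => cel h z x * f x).
Proof. by move=> hf; apply: sqiMb hf; [exact: cel_meas|exact: cel_norm]. Qed.

Lemma ii_itg a h : 0 <= h -> itg lam (ii a h) /\ \int[lam]_x ii a h x = h.
Proof.
move=> h0; have mI : measurable (`[a, a + h]%classic : set M) by exact: measurable_itv.
have l : (lam `[a, (a + h)%R] = h%:E)%E.
  rewrite lebesgue_measure_itv/= lte_fin; case: ltP => [_|ha].
    by rewrite -EFinB; congr (_%:E); ring.
  by congr (_%:E); move: ha h0; lra.
have e : (\int[lam]_x (ii a h x)%:E = h%:E)%E by rewrite integral_indic// setIT.
split; last by rewrite /Rintegral e.
apply: (@itg_ge0P _ M R lam) => [x||]; [by case: (ii01 a h x) => ->|exact: ii_meas|].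
by rewrite e ltry.
Qed.

Lemma fub21 f : itg mu f -> \int[mu]_x f x = \int[lam]_y \int[lam]_x f (x, y).
Proof.
move=> iF; have a2 := ae_integrable2 iF.
have E2 : {ae lam, forall y, (\int[lam]_x f (x, y))%:E = fubini_G lam (EFin \o f) y}.
  by apply: (aeS a2) => x h; rewrite IE.
have my : @meas _ M R (fun y : M => \int[lam]_x f (x, y)).
  apply: (@meas_param _ _ _ M M lam (fun z => f (z.2, z.1))).
  by apply: (measurableT_comp (itg_meas iF)); exact: measurable_swap.
rewrite /Rintegral -[X in fine X]/(\int[lam \x lam]_x (EFin \o f) x)%E -(integral21_prod_meas1 iF).
congr fine; apply/esym; apply: ae_eq_integral => //; [exact/measurable_EFinP|exact: (measurable_fubini_G iF)|].
by apply: (aeS E2) => x /= -> .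
Qed.

Lemma I_tens (a b : M -> R) : itg lam a -> itg lam b ->
  \int[mu]_x (a x.1 * b x.2) = (\int[lam]_x a x) * (\int[lam]_y b y).
Proof.
move=> ia ib; rewrite (fub21 (itg_tensor ia ib)) /= mulrC -[RHS]mulrC.
transitivity (\int[lam]_y ((\int[lam]_x a x) * b y)); last by rewrite IZ.
by apply: eq_Rintegral => y _; rewrite mulrC -IZ//; apply: eq_Rintegral => x _; rewrite mulrC.
Qed.

Lemma cel_itg h z : 0 <= h -> itg mu (cel h z) /\ \int[mu]_x cel h z x = h ^+ 2.
Proof.
move=> h0; have [i1 e1] := ii_itg z.1 h0; have [i2 e2] := ii_itg z.2 h0.
by split; [exact: (itg_tensor i1 i2)|rewrite (I_tens i1 i2) e1 e2 expr2].
Qed.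

Lemma J_ii g (a h : R) : J g a (a + h) = \int[lam]_x (ii a h x * g x).
Proof. by rewrite /J Rintegral_mkcond -ind_mul_eq. Qed.

Lemma ac_pow (f g : M -> R) k : ac f g -> ac (fun x => f x ^+ k.+1) (fun x => k.+1%:R * f x ^+ k * g x).
Proof.
move=> hf; elim: k => [|k IH].
  move: hf; congr ac; apply/funext => x; rewrite ?expr1//.
  by rewrite expr0 mulr1 mul1r.
have := ac_prod hf IH; congr ac; apply/funext => x.
by rewrite !exprS -(natr1 k.+1); ring.
Qed.

(** The value at [x] differs from that at any [t] of the interval by at most the integral of [|G|];
    averaging over [t] gives the sup bound for W^{1,1} on an interval. *)
Lemma ac_sup (F G : M -> R) (a h x : R) : ac F G -> 0 <= h -> a <= x <= a + h ->
  h * `|F x| <= \int[lam]_t (ii a h t * (`|F t| + h * `|G t|)).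
Proof.
move=> acF h0 xa; have [mF [mG iG] E] := acF.
have iF c d : itgon F c d.
  have i1 : itgon (fun=> `|F c| + J (fun x => `|G x|) c d) c d.
    rewrite /itgon; apply: continuous_compact_integrable; first exact: segment_compact.
    by apply: continuous_subspaceT => y; exact: cvg_cst.
  by apply: (itgon_le mF i1) => y yc; exact: (ac_bound acF yc).
have iFn := itgon_norm (iF a (a + h)); have iGn := itgon_norm (iG a (a + h)).
rewrite -J_ii.
have bnd t : a <= t <= a + h -> `|F x| <= `|F t| + J (fun s => `|G s|) a (a + h).
  move=> ta; have w1 c d : a <= c -> c <= d -> d <= a + h -> `|F d - F c| <= J (fun s => `|G s|) a (a + h).
    move=> ac' cd da; apply: (@le_trans _ _ (J (fun s => `|G s|) c d)).
      by apply: ac_var acF _; rewrite cd lexx.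
    have gn y y' : itgon (fun s => `|G s|) y y' by exact: itgon_norm.
    rewrite (J_cat (le_trans ac' cd) da (gn _ _)) (J_cat ac' cd (gn _ _)) -addrA addrCA lerDl.
    by rewrite addr_ge0// J_ge0.
  have [xt|tx] := leP x t.
    have := w1 x t; have /andP[h1 h2] := xa; have /andP[h3 h4] := ta => /(_ h1 xt h4) hw.
    by rewrite -lerBlDl; apply: le_trans hw; rewrite distrC; exact: lerB_dist.
  have := w1 t x; have /andP[h1 h2] := xa; have /andP[h3 h4] := ta => /(_ h3 (ltW tx) h2) hw.
  by rewrite -lerBlDl; apply: le_trans hw; exact: lerB_dist.
have cst c : itgon (fun=> c) a (a + h) /\ J (fun=> c) a (a + h) = h * c.
  have [i1 e1] := ii_itg a h0; split.
    rewrite /itgon; apply: continuous_compact_integrable; first exact: segment_compact.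
    by apply: continuous_subspaceT => y; exact: cvg_cst.
  rewrite J_ii; transitivity (\int[lam]_t (c * ii a h t)); last by rewrite IZ// e1 mulrC.
  by apply: eq_Rintegral => t _; rewrite mulrC.
have [ic ec] := cst `|F x|; have [ic' ec'] := cst (J (fun s => `|G s|) a (a + h)).
rewrite (JD iFn (itgonZ h iGn)) (JZ _ iGn) -ec -ec' -(JD iFn ic').
by apply: J_le => //; exact: itgonD.
Qed.

(** The Gagliardo-Nirenberg device: in the cell [|U|] is bounded by a function [al] of the second
    coordinate and by a function [be] of the first, so [U^2] is bounded by their product, which
    integrates to the product of the integrals. *)
Lemma cell_product (U : R2 -> R) (A B : R2 -> R) (z : R2) : @meas _ T2 R U ->
  itg mu (fun x => cel 1 z x * A x) -> itg mu (fun x => cel 1 z x * B x) ->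
  {ae lam, forall y, {ae lam, forall x, ii z.1 1 x * `|U (x, y)| <= \int[lam]_t (ii z.1 1 t * A (t, y))}} ->
  {ae lam, forall x, {ae lam, forall y, ii z.2 1 y * `|U (x, y)| <= \int[lam]_t (ii z.2 1 t * B (x, t))}} ->
  itg mu (fun x => cel 1 z x * U x ^+ 2) /\
  \int[mu]_x (cel 1 z x * U x ^+ 2) <= (\int[mu]_x (cel 1 z x * A x)) * (\int[mu]_x (cel 1 z x * B x)).
Proof.
move=> mU iA iB hA hB.
pose al (y : R) := ii z.2 1 y * \int[lam]_t (ii z.1 1 t * A (t, y)).
pose be (x : R) := ii z.1 1 x * \int[lam]_t (ii z.2 1 t * B (x, t)).
have EA : (fun y => \int[lam]_t (cel 1 z (t, y) * A (t, y))) = al.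
  apply/funext => y; rewrite /al /cel /=; case: (ii01 z.2 1 y) => ->.
    by rewrite mul0r; under eq_Rintegral do rewrite mulr0 mul0r; rewrite I0.
  by rewrite mul1r; apply: eq_Rintegral => t _; rewrite mulr1.
have EB : (fun x => \int[lam]_t (cel 1 z (x, t) * B (x, t))) = be.
  apply/funext => x; rewrite /be /cel /=; case: (ii01 z.1 1 x) => ->.
    by rewrite mul0r; under eq_Rintegral do rewrite !mul0r; rewrite I0.
  by rewrite mul1r; apply: eq_Rintegral => t _; rewrite mul1r.
have [_ _ _ i1 _] := @FubR _ _ _ M M lam lam _ iA; have [_ _ i2 _ e2] := @FubR _ _ _ M M lam lam _ iB.
have ia : itg lam al by rewrite -EA.
have ib : itg lam be by rewrite -EB.
have ma : @meas _ T2 R (fun x => al x.2) by exact: (meas_snd (itg_meas ia)).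
have mb : @meas _ T2 R (fun x => be x.1) by exact: (meas_fst (itg_meas ib)).
have mcU : @meas _ T2 R (fun x => cel 1 z x * `|U x|) := measM (cel_meas 1 z) (meas_norm mU).
have aA : {ae mu, forall x, cel 1 z x * `|U x| - al x.2 <= 0}.
  apply: (aeA_rev (measB mcU ma)); apply: (aeS hA) => y hy; apply: (aeS hy) => x hx.
  rewrite subr_le0 /al /cel /= mulrAC mulrC; case: (ii01 z.2 1 y) => ->; first by rewrite !mul0r.
  by rewrite !mul1r.
have aB : {ae mu, forall x, cel 1 z x * `|U x| - be x.1 <= 0}.
  have := @aeA_rev (fun x => cel 1 z (swp x) * `|U (swp x)| - be (swp x).1).
  have msw : measurable_fun setT (swp : T2 -> T2) by exact: measurable_swap.
  have m : @meas _ T2 R (fun x => cel 1 z (swp x) * `|U (swp x)| - be (swp x).1).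
    by have := measurableT_comp (measB mcU mb) msw; exact.
  move=> /(_ m); have h : {ae lam, forall y, {ae lam, forall x, cel 1 z (swp (x, y)) * `|U (swp (x, y))| - be (swp (x, y)).1 <= 0}}.
    apply: (aeS hB) => x hx; apply: (aeS hx) => y hy.
    rewrite subr_le0 /be /cel /= -mulrA; case: (ii01 z.1 1 x) => ->; first by rewrite !mul0r.
    by rewrite !mul1r.
  move=> /(_ h) h'; have := mp_ae (@mpres_swap R) h'.
  by move=> h2; apply: (aeS h2) => -[p q].
have le : {ae mu, forall x, `|cel 1 z x * U x ^+ 2| <= be x.1 * al x.2}.
  apply: (aeS2 aA aB) => x; rewrite !subr_le0 => h1 h2.
  have -> : `|cel 1 z x * U x ^+ 2| = (cel 1 z x * `|U x|) * (cel 1 z x * `|U x|).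
    case: (cel01 1 z x) => ->; first by rewrite !mul0r normr0.
    by rewrite !mul1r normrX expr2.
  by rewrite ler_pM ?mulr_ge0 ?cel_ge0.
have it := itg_tensor ib ia.
have mU2 : @meas _ T2 R (fun x => cel 1 z x * U x ^+ 2) := measM (cel_meas 1 z) (measX 2 mU).
have i : itg mu (fun x => cel 1 z x * U x ^+ 2) by exact: (itg_le_ae mU2 it le).
split; first exact: i.
have E1 : \int[mu]_x (cel 1 z x * B x) = \int[lam]_x be x.
  transitivity (\int[lam]_x \int[lam]_y (cel 1 z (x, y) * B (x, y))).
    by rewrite (fub21 iB); exact: (esym e2).
  by apply: eq_Rintegral => x _; exact: (congr1 (@^~ x) EB).
have E2 : \int[mu]_x (cel 1 z x * A x) = \int[lam]_y al y.
  rewrite (fub21 iA); apply: eq_Rintegral => y _; exact: (congr1 (@^~ y) EA).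
rewrite E1 E2; clear E1 E2 EA EB e2.
rewrite mulrC -(I_tens ib ia); apply: (I_le_ae i it).
by apply: (aeS le) => x hx; apply: le_trans hx; exact: ler_norm.
Qed.

(** For [c] a partial derivative of [u], this is the sum of the moduli of [u^(k+1)] and of its
    derivative. *)
Definition powt (k : nat) (u c : R2 -> R) (x : R2) : R :=
  `|u x| ^+ k.+1 + k.+1%:R * `|u x| ^+ k * `|c x|.

Lemma slice_pow (u a : R2 -> R) (k : nat) (s : R) : wd axis1 u a ->
  {ae lam, forall y, {ae lam, forall x, ii s 1 x * `|u (x, y) ^+ k.+1| <= \int[lam]_t (ii s 1 t * powt k u a (t, y))}}.
Proof.
move=> wa; have [su sa _] := wa.
have K0 : 0 <= k.+1%:R :> R by exact: ler0n.
have [f [mf uf hf]] := acl1_of_wd wa.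
apply: (aeS2 (aeA uf) hf) => y uy acy.
have E : \int[lam]_t (ii s 1 t * powt k u a (t, y)) =
    \int[lam]_t (ii s 1 t * (`|f (t, y) ^+ k.+1| + 1 * `|k.+1%:R * f (t, y) ^+ k * a (t, y)|)).
  have mP : @meas _ T2 R (powt k u a).
    apply: measD; first by apply: measX; exact: meas_norm su.1.
    by apply: measM; [apply: measM; [exact: meas_cst|apply: measX; exact: meas_norm su.1]|exact: meas_norm sa.1].
  have mPf : @meas _ T2 R (fun x => `|f x ^+ k.+1| + 1 * `|k.+1%:R * f x ^+ k * a x|).
    apply: measD; first by apply: meas_norm; exact: measX.
    apply: measM; first exact: meas_cst.
    by apply: meas_norm; apply: measM sa.1; apply: measM; [exact: meas_cst|exact: measX].
  apply: I_ae.
  - exact: measM (ii_meas _ _) (slice_meas y mP).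
  - exact: measM (ii_meas _ _) (slice_meas y mPf).
  - by apply: (aeS uy) => t ut; rewrite /powt ut mul1r !normrM !normrX (ger0_norm K0).
apply: (aeS uy) => x ux; rewrite E ux; case: (ii01 s 1 x) => hx; rewrite hx.
  rewrite mul0r; apply: I_ge0 => t; rewrite mulr_ge0 ?addr_ge0 ?mul1r//.
apply: (ac_sup (ac_pow k acy)); first exact: ler01.
by move: hx; rewrite iiP; case: (_ <= _ <= _) => // /eqP; rewrite eq_sym oner_eq0.
Qed.

(** The product bound for [U = u^(k+1)]: both factors contain [|u|^k] times [|u| + (k+1) |c|], so
    Cauchy-Schwarz extracts the integral of [u^(2k)] and leaves the local H^1 norm. Each application
    raises the exponent by two on a cell. *)
Lemma cell_pow (u a b : R2 -> R) (k : nat) (z : R2) : sqi mu u -> sqi mu a -> sqi mu b ->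
  wd axis1 u a -> wd axis2 u b -> itg mu (fun x => cel 1 z x * (u x ^+ k) ^+ 2) ->
  itg mu (fun x => cel 1 z x * (u x ^+ k.+1) ^+ 2) /\
  \int[mu]_x (cel 1 z x * (u x ^+ k.+1) ^+ 2) <= 2 * k.+1%:R ^+ 2 *
    (\int[mu]_x (cel 1 z x * (u x ^+ k) ^+ 2)) * (\int[mu]_x (cel 1 z x * (u x ^+ 2 + a x ^+ 2 + b x ^+ 2))).
Proof.
move=> su sa sb wa wb iX.
pose K : R := k.+1%:R; have K1 : 1 <= K by rewrite ler1n.
have K0 : 0 <= K by exact: le_trans K1.
have sX : sqi mu (fun x => cel 1 z x * `|u x| ^+ k).
  split; first by apply: measM; [exact: cel_meas|apply: measX; exact: (meas_norm su.1)].
  move: iX; rewrite /itg; apply: eq_integrable => // x _ /=; congr EFin.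
  by rewrite exprMn cel_sq -normrX real_normK ?num_real.
have nX : n2 mu (fun x => cel 1 z x * `|u x| ^+ k) = \int[mu]_x (cel 1 z x * (u x ^+ k) ^+ 2).
  by apply: eq_Rintegral => x _; rewrite exprMn cel_sq -normrX real_normK ?num_real.
set X := \int[mu]_x _ in nX *; have X0 : 0 <= X by rewrite -nX n2_ge0.
pose P (c : R2 -> R) := powt k u c.
have PE c (x : R2) : cel 1 z x * P c x = (cel 1 z x * `|u x| ^+ k) * (cel 1 z x * (`|u x| + K * `|c x|)).
  by rewrite mulrACA -expr2 cel_sq /P /powt -/K exprSr; ring.
have sY c : sqi mu c -> sqi mu (fun x => cel 1 z x * (`|u x| + K * `|c x|)).
  by move=> sc; apply: sqi_cel; exact: sqiD (sqi_norm su) (sqiZ K (sqi_norm sc)).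
have iP c : sqi mu c -> itg mu (fun x => cel 1 z x * P c x).
  move=> sc; have := sqi_itgM sX (sY c sc); rewrite /itg.
  by apply: eq_integrable => // x _ /=; rewrite PE.
have icel c : sqi mu c -> itg mu (fun x => cel 1 z x * c x ^+ 2) by move=> sc; apply: itg_cel; exact: sc.2.
have bP c : sqi mu c -> (\int[mu]_x (cel 1 z x * P c x)) ^+ 2 <=
    X * (2 * K ^+ 2 * (\int[mu]_x (cel 1 z x * u x ^+ 2) + \int[mu]_x (cel 1 z x * c x ^+ 2))).
  move=> sc; have := CS sX (sY c sc); rewrite nX => h.
  have -> : \int[mu]_x (cel 1 z x * P c x) = \int[mu]_x ((cel 1 z x * `|u x| ^+ k) * (cel 1 z x * (`|u x| + K * `|c x|))).
    by apply: eq_Rintegral => x _; rewrite PE.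
  apply: (le_trans h); rewrite ler_wpM2l// -(ID (icel _ su) (icel _ sc)) -IZ; last exact: itgD (icel _ su) (icel _ sc).
  apply: I_le; first exact: (sY c sc).2.
    by apply: itgZ; exact: itgD (icel _ su) (icel _ sc).
  move=> x; case: (cel01 1 z x) => ->; first by rewrite !mul0r addr0 mulr0 expr0n.
  rewrite !mul1r -(real_normK (num_real (u x))) -(real_normK (num_real (c x))).
  have := normr_ge0 (u x); have := normr_ge0 (c x); move: `|u x| `|c x| => p q p0 q0.
  have h1 : p ^+ 2 <= K ^+ 2 * p ^+ 2 by rewrite ler_peMl ?sqr_ge0// exprn_ege1.
  have h2 := sqr_ge0 (p - K * q); rewrite sqrrD exprMn mulrDr.
  move: h2; rewrite sqrrB exprMn.
  move: h1; lra.
have mU : @meas _ T2 R (fun x => u x ^+ k.+1) := measX _ su.1.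
have [i le] := cell_product mU (iP a sa) (iP b sb) (slice_pow k z.1 wa) (slice_pow k z.2 (wd_swp1 wb)).
split => //; apply: (le_trans le).
have Pg c : 0 <= \int[mu]_x (cel 1 z x * P c x).
  by apply: I_ge0 => x; rewrite mulr_ge0 ?cel_ge0// /P /powt addr_ge0 ?exprn_ge0// !mulr_ge0 ?exprn_ge0.
have hab := bP a sa; have hbb := bP b sb.
have -> : \int[mu]_x (cel 1 z x * (u x ^+ 2 + a x ^+ 2 + b x ^+ 2)) =
   \int[mu]_x (cel 1 z x * u x ^+ 2) + \int[mu]_x (cel 1 z x * a x ^+ 2) + \int[mu]_x (cel 1 z x * b x ^+ 2).
  rewrite -(ID (icel _ su) (icel _ sa)) -(ID (itgD (icel _ su) (icel _ sa)) (icel _ sb)).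
  by apply: eq_Rintegral => x _; ring.
have sg c : 0 <= \int[mu]_x (cel 1 z x * c x ^+ 2).
  by apply: I_ge0 => x; rewrite mulr_ge0 ?cel_ge0// sqr_ge0.
move: (sg u) (sg a) (sg b) hab hbb (Pg a) (Pg b); rewrite -/K -[2 * K ^+ 2 * X * _]mulrA.
move: (\int[mu]_x (cel 1 z x * u x ^+ 2)) (\int[mu]_x (cel 1 z x * a x ^+ 2)) (\int[mu]_x (cel 1 z x * b x ^+ 2)).
move: (\int[mu]_x (cel 1 z x * P a x)) (\int[mu]_x (cel 1 z x * P b x)) => p q r1 r2 r3 h1 h2 h3 hp hq p0 q0.
have h4 := sqr_ge0 (p - q).
have h5 : 0 <= X * (K ^+ 2 * (r2 + r3)) by rewrite mulr_ge0// mulr_ge0 ?sqr_ge0// addr_ge0.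
by move: hp hq h4 h5; clear; lra.
Qed.

Lemma cel2_meas : @meas _ (T2 * T2)%type R (fun t => cel 1 t.2 t.1).
Proof.
have p1 : @meas _ (T2 * T2)%type R (fun t => t.1.1) by apply: measurableT_comp; [exact: measurable_fst|exact: measurable_fst].
have p2 : @meas _ (T2 * T2)%type R (fun t => t.1.2) by apply: measurableT_comp; [exact: measurable_snd|exact: measurable_fst].
have q1 : @meas _ (T2 * T2)%type R (fun t => t.2.1) by apply: measurableT_comp; [exact: measurable_fst|exact: measurable_snd].
have q2 : @meas _ (T2 * T2)%type R (fun t => t.2.2) by apply: measurableT_comp; [exact: measurable_snd|exact: measurable_snd].
rewrite (_ : (fun t : T2 * T2 => cel 1 t.2 t.1) = (fun t => ((t.2.1 <= t.1.1)%R%:R * (t.1.1 <= t.2.1 + 1)%R%:R) *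
    ((t.2.2 <= t.1.2)%R%:R * (t.1.2 <= t.2.2 + 1)%R%:R))); last first.
  by apply/funext => t; rewrite /cel !iiP -!natrM !mulnb.
have h (a b : T2 * T2 -> R) : meas a -> meas b -> meas (fun t => (a t <= b t)%R%:R * (b t <= a t + 1)%R%:R : R).
  move=> ma mb; apply: measM; first exact: meas_le_pair.
  by apply: (meas_le_pair mb); apply: (measD ma); exact: meas_cst.
by apply: measM; exact: h.
Qed.

(* Cells with a free corner are averaged over all translates, in place of a tiling of the plane. *)
Lemma cel_dual (x : R2) : itg mu (fun z => cel 1 z x) /\ \int[mu]_z cel 1 z x = 1.
Proof.
have [ic ec] := @cel_itg 1 (x.1 - 1, x.2 - 1) ler01.
have E : (fun z => cel 1 z x) = cel 1 (x.1 - 1, x.2 - 1).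
  apply/funext => z; rewrite /cel !iiP/= !subrK.
  by congr ((nat_of_bool _)%:R * (nat_of_bool _)%:R); rewrite andbC lerBlDr.
by rewrite E ec expr1n.
Qed.

Lemma cel_avg_itg (N : R2 -> R) : itg mu N -> (forall x, 0 <= N x) ->
  itg mu (fun z => \int[mu]_x (cel 1 z x * N x)) /\
  \int[mu]_z \int[mu]_x (cel 1 z x * N x) = \int[mu]_x N x.
Proof.
move=> iN N0; pose F (t : R2 * R2) := cel 1 t.1 t.2 * N t.2.
have mF : @meas _ (T2 * T2)%type R F.
  apply: measM; last by apply: measurableT_comp; [exact: itg_meas iN|exact: measurable_snd].
  by have := measurableT_comp cel2_meas (@measurable_swap _ _ T2 T2); exact.
have iz x : itg mu (fun z => F (z, x)).
  have [ic _] := cel_dual x; have := itgZ (N x) ic; rewrite /itg; apply: eq_integrable => // z _ /=.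
  by rewrite /F/= mulrC.
have ez x : \int[mu]_z F (z, x) = N x.
  have [ic ec] := cel_dual x; rewrite -[RHS]mulr1 -ec -IZ//.
  by apply: eq_Rintegral => z _; rewrite /F/= mulrC.
have iF : itg (leb2s \x leb2s)%E F.
  apply: (@itg_prod _ _ _ T2 T2 leb2s leb2s F N mF iz iN) => x.
  rewrite -[leRHS]ez le_eqVlt; apply/orP; left; apply/eqP.
  by apply: eq_Rintegral => z _; rewrite /F/= ger0_norm// mulr_ge0 ?cel_ge0.
have [_ _ i1 i2 E] := FubR iF.
split; first exact: i1.
transitivity (\int[mu]_x \int[mu]_z F (z, x)); first exact: E.
by apply: eq_Rintegral => x _.
Qed.

Lemma cel_avg (f g : R2 -> R) : @meas _ T2 R f -> (forall x, 0 <= f x) -> 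
  itg mu g -> (forall z, itg mu (fun x => cel 1 z x * f x)) ->
  (forall z, \int[mu]_x (cel 1 z x * f x) <= g z) -> itg mu f /\ \int[mu]_x f x <= \int[mu]_x g x.
Proof.
move=> mf f0 ig icf le.
pose F (t : R2 * R2) := cel 1 t.2 t.1 * f t.1.
have mF : @meas _ (T2 * T2)%type R F.
  apply: (measM cel2_meas); by apply: measurableT_comp; [exact: mf|exact: measurable_fst].
have iF : itg (leb2s \x leb2s)%E F.
  apply: (@itg_prod _ _ _ T2 T2 leb2s leb2s F g mF icf ig) => z.
  apply: le_trans (le z); rewrite le_eqVlt; apply/orP; left; apply/eqP.
  by apply: eq_Rintegral => x _; rewrite /F/= ger0_norm// mulr_ge0 ?cel_ge0.
have [_ _ i1 i2 E] := FubR iF.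
have E1 x : \int[mu]_z F (x, z) = f x.
  have [ic ec] := cel_dual x; rewrite -[RHS]mulr1 -ec -IZ//.
  by apply: eq_Rintegral => z _; rewrite /F/= mulrC.
have E1' : (fun x => \int[mu]_z F (x, z)) = f by apply/funext => x; exact: E1.
have i1' : itg mu f by rewrite -E1'; exact: i1.
split; first exact: i1'.
rewrite -(cel_avg_itg i1' f0).2.
apply: I_le => //; exact: (cel_avg_itg i1' f0).1.
Qed.

Lemma cel_pow_itg (u a b : R2 -> R) : sqi mu u -> sqi mu a -> sqi mu b -> wd axis1 u a -> wd axis2 u b ->
  forall k z, itg mu (fun x => cel 1 z x * (u x ^+ k.+1) ^+ 2).
Proof.
move=> su sa sb wa wb; elim=> [|k IH] z.
  by under eq_fun do rewrite expr1; apply: itg_cel; exact: su.2.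
by have [] := cell_pow su sa sb wa wb (IH z).
Qed.

(** Of the two factors on a cell one is averaged over all cells and the other is bounded by its
    supremum [S]. Smallness on every cell thus becomes smallness of the global integral, which the
    compactness proof exploits. *)
Lemma sobolev_step (u a b : R2 -> R) (k : nat) (S : R) : sqi mu u -> sqi mu a -> sqi mu b -> wd axis1 u a -> wd axis2 u b ->
  (forall z, \int[mu]_x (cel 1 z x * (u x ^+ k.+1) ^+ 2) <= S) ->
  itg mu (fun x => (u x ^+ k.+2) ^+ 2) /\
  \int[mu]_x (u x ^+ k.+2) ^+ 2 <= 2 * k.+2%:R ^+ 2 * S * (n2 mu u + n2 mu a + n2 mu b).
Proof.
move=> su sa sb wa wb hS.
pose N (x : R2) := u x ^+ 2 + a x ^+ 2 + b x ^+ 2.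
have iN : itg mu N := itgD (itgD su.2 sa.2) sb.2.
have N0 (x : R2) : 0 <= N x by rewrite !addr_ge0 ?sqr_ge0.
have S0 : 0 <= S.
  apply: le_trans (hS 0); apply: I_ge0 => x; by rewrite mulr_ge0 ?cel_ge0 ?sqr_ge0.
have [iA eA] := cel_avg_itg iN N0.
have := @cel_avg (fun x => (u x ^+ k.+2) ^+ 2) (fun z => 2 * k.+2%:R ^+ 2 * S * \int[mu]_x (cel 1 z x * N x)).
rewrite (IZ _ iA) eA (_ : \int[mu]_x N x = n2 mu u + n2 mu a + n2 mu b); last first.
  by rewrite (ID (itgD su.2 sa.2) sb.2) (ID su.2 sa.2).
apply.
- exact: measX (measX _ su.1).
- by move=> x; exact: sqr_ge0.
- exact: itgZ.
- move=> z; exact: (cel_pow_itg su sa sb wa wb k.+1 z).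
- move=> z; have [_ le] := cell_pow su sa sb wa wb (cel_pow_itg su sa sb wa wb k z).
  apply: (le_trans le); apply: ler_wpM2r.
    by apply: I_ge0 => x; rewrite mulr_ge0 ?cel_ge0//; exact: N0.
  by rewrite ler_wpM2l ?mulr_ge0 ?sqr_ge0.
Qed.

(** Bounding the cell integrals by the global one turns the previous step into an induction on the
    power. Every exponent p > 2 is later reached by interpolation between even ones. *)
Lemma sobolev_even (k : nat) : exists2 C : R, 0 <= C & forall (u a b : R2 -> R), sqi mu u -> sqi mu a -> sqi mu b ->
  wd axis1 u a -> wd axis2 u b -> itg mu (fun x => (u x ^+ k.+1) ^+ 2) /\
  \int[mu]_x (u x ^+ k.+1) ^+ 2 <= C * (n2 mu u + n2 mu a + n2 mu b) ^+ k.+1.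
Proof.
elim: k => [|k [C C0 IH]].
  exists 1 => // u a b su sa sb _ _; under eq_fun do rewrite expr1; split; first exact: su.2.
  by rewrite mul1r expr1 -addrA lerDl addr_ge0 ?n2_ge0.
exists (2 * k.+2%:R ^+ 2 * C); first by rewrite !mulr_ge0.
move=> u a b su sa sb wa wb; have [iu hu] := IH u a b su sa sb wa wb.
set N := n2 mu u + n2 mu a + n2 mu b in hu *.
have [|i le] := @sobolev_step u a b k (C * N ^+ k.+1) su sa sb wa wb.
  move=> z; apply: le_trans hu; apply: I_le => //; first exact: itg_cel.
  by move=> x; rewrite ler_piMl ?sqr_ge0 ?cel_le1.
split => //; apply: (le_trans le); rewrite -/N le_eqVlt; apply/orP; left; apply/eqP.
by rewrite [N ^+ k.+2]exprSr !mulrA.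
Qed.

End Cells.

Lemma ae_and d (T : measurableType d) (R : realType) (m : {measure set T -> \bar R}) (P Q : T -> Prop) :
  {ae m, forall x, P x} -> {ae m, forall x, Q x} -> {ae m, forall x, P x /\ Q x}.
Proof. by move=> hP hQ; apply: (aeS2 hP hQ). Qed.

(** * The Poincare inequality on a square *)

Section Poincare.
Context {R : realType}.
Local Notation M := (measurableTypeR R).
Local Notation R2 := (R * R)%type.
Local Notation lam := (@lebesgue_measure R).
Local Notation mu := (leb2 R).

Lemma ii_in (a h x : R) : ii a h x = 1 -> a <= x <= a + h.
Proof. by rewrite iiP; case: (_ <= _ <= _) => // /eqP; rewrite eq_sym oner_eq0. Qed.

Lemma ac_osc (F G : M -> R) (a h x x' : R) : ac F G -> 0 <= h -> a <= x <= a + h -> a <= x' <= a + h ->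
  itg lam (fun t : M => ii a h t * G t ^+ 2) ->
  (F x - F x') ^+ 2 <= h * \int[lam]_t (ii a h t * G t ^+ 2).
Proof.
move=> acF h0 xa xa' iG2; have [mF [mG iG] E] := acF.
have gn y y' : itgon (fun s => `|G s|) y y' by exact: itgon_norm.
have w1 c d : a <= c -> c <= d -> d <= a + h -> `|F d - F c| <= J (fun s => `|G s|) a (a + h).
  move=> ac' cd da; apply: (@le_trans _ _ (J (fun s => `|G s|) c d)).
    by apply: ac_var acF _; rewrite cd lexx.
  rewrite (J_cat (le_trans ac' cd) da (gn _ _)) (J_cat ac' cd (gn _ _)) -addrA addrCA lerDl.
  by rewrite addr_ge0// J_ge0.
have le : `|F x - F x'| <= J (fun s => `|G s|) a (a + h).
  have /andP[h1 h2] := xa; have /andP[h3 h4] := xa'.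
  by have [xx|/ltW xx] := leP x x'; [rewrite distrC|]; apply: w1.
have sI : sqi lam (ii a h).
  split; first exact: ii_meas.
  have [i _] := ii_itg a h0; move: i; rewrite /itg; apply: eq_integrable => // t _ /=.
  by case: (ii01 a h t) => ->; rewrite ?expr0n ?expr1n.
have sG : sqi lam (fun t : M => ii a h t * `|G t|).
  split; first by apply: measM; [exact: ii_meas|exact: meas_norm].
  move: iG2; rewrite /itg; apply: eq_integrable => // t _ /=.
  by case: (ii01 a h t) => ->; rewrite ?mul0r ?mul1r ?expr0n// real_normK ?num_real.
have := CS sI sG.
have -> : n2 lam (ii a h) = h.
  have [_ e] := ii_itg a h0; rewrite -[RHS]e; apply: eq_Rintegral => t _.
  by case: (ii01 a h t) => ->; rewrite ?expr0n ?expr1n.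
have -> : n2 lam (fun t : M => ii a h t * `|G t|) = \int[lam]_t (ii a h t * G t ^+ 2).
  apply: eq_Rintegral => t _.
  by case: (ii01 a h t) => ->; rewrite ?mul0r ?mul1r ?expr0n// real_normK ?num_real.
apply: le_trans; rewrite -(real_normK (num_real (F x - F x'))).
rewrite (_ : \int[lam]_t (ii a h t * (ii a h t * `|G t|)) = J (fun s => `|G s|) a (a + h)); last first.
  by rewrite J_ii; apply: eq_Rintegral => t _; case: (ii01 a h t) => ->; rewrite ?mul0r ?mul1r.
by rewrite ler_pXn2r// nnegrE// J_ge0.
Qed.

Lemma cel_mean (u : R2 -> R) (h : R) (z : R2) (c : R) : sqi mu u -> 0 < h ->
  let m := \int[mu]_x (cel h z x * u x) / h ^+ 2 in
  [/\ itg mu (fun x => cel h z x * (u x - c) ^+ 2),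
      \int[mu]_x (cel h z x * (u x - c) ^+ 2) =
        \int[mu]_x (cel h z x * u x ^+ 2) - 2 * c * \int[mu]_x (cel h z x * u x) + c ^+ 2 * h ^+ 2 &
      \int[mu]_x (cel h z x * (u x - m) ^+ 2) <= \int[mu]_x (cel h z x * (u x - c) ^+ 2)].
Proof.
move=> su h0 m; have [ic ec] := cel_itg z (ltW h0).
have i2 : itg mu (fun x => cel h z x * u x ^+ 2) by apply: itg_cel; exact: su.2.
have sc : sqi mu (cel h z).
  split; first exact: cel_meas.
  by move: ic; rewrite /itg; apply: eq_integrable => // x _ /=; rewrite cel_sq.
have i1 := sqi_itgM sc su.
have E k : (fun x => cel h z x * (u x - k) ^+ 2) = (fun x => cel h z x * u x ^+ 2 - (2 * k) * (cel h z x * u x) + k ^+ 2 * cel h z x).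
  by apply/funext => x; ring.
have iE k : itg mu (fun x => cel h z x * (u x - k) ^+ 2).
  by rewrite E; exact: itgD (itgB i2 (itgZ _ i1)) (itgZ _ ic).
have eE k : \int[mu]_x (cel h z x * (u x - k) ^+ 2) =
        \int[mu]_x (cel h z x * u x ^+ 2) - 2 * k * \int[mu]_x (cel h z x * u x) + k ^+ 2 * h ^+ 2.
  by rewrite E (ID (itgB i2 (itgZ _ i1)) (itgZ _ ic)) (IB i2 (itgZ _ i1)) (IZ _ i1) (IZ _ ic) ec.
split => //; rewrite !eE.
have h2 : 0 < h ^+ 2 by rewrite exprn_gt0.
have Em : \int[mu]_x (cel h z x * u x) = m * h ^+ 2 by rewrite /m divfK// gt_eqF.
rewrite Em; have := mulr_ge0 (sqr_ge0 (m - c)) (ltW h2).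
move: (h ^+ 2) (\int[mu]_x (cel h z x * u x ^+ 2)) => H U; clear => *; nra.
Qed.

(** Fix a column [x']. Each point of the cell is joined to the point of ordinate [z.2] on that
    column by a horizontal and then a vertical segment, and the oscillation along each is controlled
    by Cauchy-Schwarz. Passing to the mean only lowers the left side, and averaging over [x'] gives
    the constant 2 h^2. *)
Lemma poincare (u a b : R2 -> R) (h : R) (z : R2) : sqi mu u -> sqi mu a -> sqi mu b ->
  wd axis1 u a -> wd axis2 u b -> 0 < h ->
  \int[mu]_x (cel h z x * (u x - \int[mu]_x (cel h z x * u x) / h ^+ 2) ^+ 2) <=
  2 * h ^+ 2 * (\int[mu]_x (cel h z x * a x ^+ 2) + \int[mu]_x (cel h z x * b x ^+ 2)).
Proof.
move=> su sa sb wa wb h0; have hw := ltW h0.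
set m := _ / _; set V := \int[mu]_x _.
have [f1 [mf1 uf1 hf1]] := acl1_of_wd wa.
have [f2' [mf2' uf2' hf2']] := acl1_of_wd (wd_swp1 wb).
pose f2 x := f2' (swp x).
have uf2 : {ae mu, forall x, u x = f2 x}.
  have := mp_ae (@mpres_swap R) uf2' => h'; apply: (aeS h') => -[p q]; rewrite /f2 /swp /= => ->.
  by [].
have ia := sa.2; have ib := sb.2.
have ica : itg mu (fun x => cel h z x * a x ^+ 2) by apply: itg_cel.
have icb : itg mu (fun x => cel h z x * b x ^+ 2) by apply: itg_cel.
have [_ aia _ iA _] := @FubR _ _ _ M M lam lam _ ica.
have [aib _ iB _ eB] := @FubR _ _ _ M M lam lam _ icb.
have [_ aia2 _ _ _] := @FubR _ _ _ M M lam lam _ ia.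
have [aib1 _ _ _ _] := @FubR _ _ _ M M lam lam _ ib.
pose al (y : R) := \int[lam]_t (ii z.1 h t * a (t, y) ^+ 2).
pose be (x : R) := \int[lam]_t (ii z.2 h t * b (x, t) ^+ 2).
have EA : (fun y => \int[lam]_t (cel h z (t, y) * a (t, y) ^+ 2)) = (fun y => ii z.2 h y * al y).
  apply/funext => y; rewrite /al /cel /=; case: (ii01 z.2 h y) => ->.
    by rewrite mul0r; under eq_Rintegral do rewrite mulr0 mul0r; rewrite I0.
  by rewrite mul1r; apply: eq_Rintegral => t _; rewrite mulr1.
have EB : (fun x => \int[lam]_t (cel h z (x, t) * b (x, t) ^+ 2)) = (fun x => ii z.1 h x * be x).
  apply/funext => x; rewrite /be /cel /=; case: (ii01 z.1 h x) => ->.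
    by rewrite mul0r; under eq_Rintegral do rewrite !mul0r; rewrite I0.
  by rewrite mul1r; apply: eq_Rintegral => t _; rewrite mul1r.
have ial : itg lam (fun y : M => ii z.2 h y * al y) by rewrite -EA; exact: iA.
have ibe : itg lam (fun x : M => ii z.1 h x * be x) by rewrite -EB; exact: iB.
have Ia : \int[mu]_x (cel h z x * a x ^+ 2) = \int[lam]_y (ii z.2 h y * al y).
  by rewrite (fub21 ica); apply: eq_Rintegral => y _; exact: (congr1 (@^~ y) EA).
have Ib : \int[mu]_x (cel h z x * b x ^+ 2) = \int[lam]_x (ii z.1 h x * be x).
  transitivity (\int[lam]_x \int[lam]_y (cel h z (x, y) * b (x, y) ^+ 2)).
    by rewrite (fub21 icb); exact: (esym eB).
  by apply: eq_Rintegral => x _; exact: (congr1 (@^~ x) EB).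
have [ii1 ei1] := ii_itg z.1 hw; have [ii2 ei2] := ii_itg z.2 hw.
have itii (s : R) g : itg lam g -> itg lam (fun t : M => ii s h t * g t).
  by move=> ig; apply: itgMb ig; [exact: ii_meas|move=> t; case: (ii01 s h t) => ->; rewrite ?normr0 ?normr1].
have uf1s := aeA uf1.
have uf1t : {ae lam, forall x, {ae lam, forall y, u (x, y) = f1 (x, y)}}.
  have h' := mp_ae (@mpres_swap R) uf1; exact: (@aeA R (fun x => u (x.2, x.1) = f1 (x.2, x.1)) h').
have uf2t : {ae lam, forall x, {ae lam, forall y, u (x, y) = f2 (x, y)}}.
  have h' := mp_ae (@mpres_swap R) uf2; exact: (@aeA R (fun x => u (x.2, x.1) = f2 (x.2, x.1)) h').
have key : {ae lam, forall x', ii z.1 h x' * V <= ii z.1 h x' * (2 * h ^+ 2 * \int[mu]_x (cel h z x * a x ^+ 2)) + 2 * h ^+ 3 * (ii z.1 h x' * be x')}.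
  apply: (aeS2 uf2t (ae_and uf1t (ae_and hf2' aib1))).
  move=> x' ux2 [ux1 [ac2 ib2]]; case: (ii01 z.1 h x') => hx'; rewrite hx'; first by rewrite !mul0r mulr0 addr0 lexx.
  rewrite !mul1r.
  have xin := ii_in hx'.
  pose c := f2 (x', z.2).
  have [_ _ _ mean] := And4 I I I (let: And3 _ _ q := cel_mean z c su h0 in q).
  apply: (le_trans mean).
  have iB' := itii z.2 _ ib2.
  have bpt : {ae mu, forall x, cel h z x * (u x - c) ^+ 2 - ii z.1 h x.1 * (2 * h * (ii z.2 h x.2 * al x.2) + 2 * h * be x' * ii z.2 h x.2) <= 0}.
    apply: aeA_rev.
      apply: measB; first by apply: (measM (cel_meas h z)); apply: measX; apply: measB; [exact: su.1|exact: meas_cst].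
      apply: measM; first by apply: meas_fst; exact: ii_meas.
      apply: measD; first by apply: measM; [exact: meas_cst|exact: (meas_snd (itg_meas ial))].
      by apply: measM; [exact: meas_cst|apply: meas_snd; exact: ii_meas].
    apply: (aeS2 uf1s (ae_and (ae_and ux1 ux2) (ae_and hf1 aia2))).
    move=> y uy [[e1 e2] [ac1 ia1]]; apply: (aeS uy) => x ux.
    rewrite subr_le0 /cel /=; case: (ii01 z.1 h x) => hx; rewrite hx; first by rewrite !mul0r lexx.
    rewrite !mul1r; case: (ii01 z.2 h y) => hy; rewrite hy; first by rewrite !mul0r !mulr0 addr0 lexx.
    rewrite !mul1r mulr1.
    have o1 := ac_osc ac1 hw (ii_in hx) xin (itii z.1 _ ia1).
    have zin : z.2 <= z.2 <= z.2 + h by rewrite lexx lerDl.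
    have o2 := ac_osc ac2 hw (ii_in hy) zin iB'.
    rewrite -/(al y) in o1; rewrite -/(be x') in o2.
    have -> : u (x, y) - c = (f1 (x, y) - f1 (x', y)) + (f2 (x', y) - f2 (x', z.2)).
      by rewrite ux -e1 -e2 /c; ring.
    move: (f1 (x, y) - f1 (x', y)) (f2 (x', y) - f2 (x', z.2)) o1 o2 => p q.
    rewrite -!mulrA; move: (h * al y) (h * be x') => A B o1 o2.
    by have := sqr_ge0 (p - q); clear -o1 o2; nra.
  pose k (y : R) := 2 * h * (ii z.2 h y * al y) + 2 * h * be x' * ii z.2 h y.
  have ik : itg lam k := itgD (itgZ _ ial) (itgZ _ ii2).
  have ek : \int[lam]_y k y = 2 * h * \int[mu]_x (cel h z x * a x ^+ 2) + 2 * h * be x' * h.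
    by rewrite (ID (itgZ _ ial) (itgZ _ ii2)) (IZ _ ial) (IZ _ ii2) ei2 -Ia.
  apply: (@le_trans _ _ (\int[mu]_x (ii z.1 h x.1 * k x.2))).
    apply: I_le_ae; [by case: (cel_mean z c su h0)|exact: itg_tensor ii1 ik|].
    by apply: (aeS bpt) => x; rewrite subr_le0.
  rewrite (I_tens ii1 ik) ei1 ek le_eqVlt; apply/orP; left; apply/eqP.
  by ring.
have kk : {ae lam, forall x', V * ii z.1 h x' <= (2 * h ^+ 2 * \int[mu]_x (cel h z x * a x ^+ 2)) * ii z.1 h x' + 2 * h ^+ 3 * (ii z.1 h x' * be x')}.
  by apply: (aeS key) => x'; rewrite mulrC [_ * ii z.1 h x']mulrC.
have := I_le_ae (itgZ V ii1) (itgD (itgZ _ ii1) (itgZ (2 * h ^+ 3) ibe)) kk.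
rewrite (ID (itgZ _ ii1) (itgZ _ ibe)) !(IZ _ ii1) (IZ _ ibe) ei1 -Ib.
move: (\int[mu]_x (cel h z x * a x ^+ 2)) (\int[mu]_x (cel h z x * b x ^+ 2)) => A B hV.
rewrite -(ler_pM2r h0); apply: (le_trans hV); rewrite le_eqVlt; apply/orP; left; apply/eqP.
by ring.
Qed.

End Poincare.

Lemma I_sum d (T : measurableType d) (R : realType) (m : {measure set T -> \bar R})
  (I : Type) (r : seq I) (F : I -> T -> R) : (forall i, itg m (F i)) ->
  itg m (fun x => \sum_(i <- r) F i x) /\
  \int[m]_x (\sum_(i <- r) F i x) = \sum_(i <- r) \int[m]_x F i x.
Proof.
move=> iF; elim: r => [|i r [IH1 IH2]].
  split; first by under eq_fun do rewrite big_nil; exact: itg0.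
  by under eq_Rintegral do rewrite big_nil; rewrite I0 big_nil.
split; first by under eq_fun do rewrite big_cons; exact: itgD.
by under eq_Rintegral do rewrite big_cons; rewrite (ID (iF i) IH1) IH2 big_cons.
Qed.

(** * Subdivision of cells and cells far from the origin *)

Section CellsAtInfinity.
Context {R : realType}.
Local Notation M := (measurableTypeR R).
Local Notation R2 := (R * R)%type.
Local Notation lam := (@lebesgue_measure R).
Local Notation mu := (leb2 R).

Lemma ae_fst (P : R -> Prop) : {ae lam, forall x, P x} -> {ae mu, forall x, P x.1}.
Proof.
move=> [N [mN N0 hN]]; exists (N `*` setT); split.
- exact: measurableX.
- transitivity (lam N * lam setT)%E; first exact: (product_measure1E lam lam mN (@measurableT _ M)).
  by rewrite N0 mul0e.
- by move=> x /= h; split => //; apply: hN.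
Qed.

Lemma ae_snd (P : R -> Prop) : {ae lam, forall x, P x} -> {ae mu, forall x, P x.2}.
Proof. by move=> /ae_fst h; have := mp_ae (@mpres_swap R) h. Qed.

Lemma ae_neq (c : R) : {ae lam, forall x, x <> c}.
Proof.
exists [set c]; split; [exact: measurable_set1|exact: lebesgue_measure_set1|].
by move=> x /= /contrapT.
Qed.

Lemma ii_split (a h x : R) : 0 <= h -> x <> a + h -> ii a (h + h) x = ii a h x + ii (a + h) h x.
Proof.
move=> h0 /eqP xa; rewrite !iiP -natrD; congr (_%:R); rewrite addrA.
have [h1|h1] := ltP x (a + h).
  by rewrite (ltW h1) /= addn0 (le_trans (ltW h1)) ?lerDl// andbT.
have h2 : a + h < x by rewrite lt_neqAle eq_sym xa.
have -> : (x <= a + h) = false by apply/negbTE; rewrite -ltNge.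
have -> : a <= x by apply: le_trans h1; rewrite lerDl.
by rewrite /= add0n.
Qed.

Lemma cel_split (h : R) (z : R2) : 0 <= h -> {ae mu, forall x, cel (h + h) z x =
  cel h z x + cel h (z.1 + h, z.2) x + cel h (z.1, z.2 + h) x + cel h (z.1 + h, z.2 + h) x}.
Proof.
move=> h0; have a1 := ae_fst (ae_neq (z.1 + h)); have a2 := ae_snd (ae_neq (z.2 + h)).
by apply: (aeS2 a1 a2) => x x1 x2; rewrite /cel /= !ii_split//; ring.
Qed.

(** Repeated quartering; neighbouring quarters overlap on null segments. One list of cells serves
    every integrand. *)
Lemma cel_grid (m : nat) (h : R) (z : R2) : 0 <= h -> exists L : seq R2, forall f, itg mu f ->
  \int[mu]_x (cel (h * 2 ^+ m) z x * f x) = \sum_(c <- L) \int[mu]_x (cel h c x * f x).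
Proof.
move=> h0; elim: m z => [|m IH] z.
  by exists [:: z] => f _; rewrite big_seq1 expr0 mulr1.
pose k := h * 2 ^+ m; have k0 : 0 <= k by rewrite mulr_ge0// exprn_ge0.
have [L1 h1] := IH z; have [L2 h2] := IH (z.1 + k, z.2).
have [L3 h3] := IH (z.1, z.2 + k); have [L4 h4] := IH (z.1 + k, z.2 + k).
exists (L1 ++ L2 ++ L3 ++ L4) => f fi; rewrite !big_cat/= -h1// -h2// -h3// -h4//.
rewrite -/k (_ : h * 2 ^+ m.+1 = k + k); last by rewrite /k exprSr; ring.
have i c := itg_cel k c fi.
rewrite !addrA -(ID (i _) (i _)) -(ID (itgD (i _) (i _)) (i _)) -(ID (itgD (itgD (i _) (i _)) (i _)) (i _)).
apply: I_ae.
- exact: itg_meas (itg_cel _ _ fi).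
- exact: itg_meas (itgD (itgD (itgD (i _) (i _)) (i _)) (i _)).
- by apply: (aeS (cel_split z k0)) => x ->; ring.
Qed.

Lemma sum_disj (N : nat) (b : 'I_N -> R) : (forall j, b j = 0 \/ b j = 1) ->
  (forall j k, b j = 1 -> b k = 1 -> j = k) -> \sum_j b j <= 1.
Proof.
move=> b01 bd; have [[j bj]|h] := pselect (exists j, b j = 1).
  rewrite (bigD1 j)//= bj big1 ?addr0// => k kj.
  by case: (b01 k) => // bk; move: kj; rewrite (bd k j bk bj) eqxx.
rewrite big1// => j _; case: (b01 j) => // bj; by exfalso; apply: h; exists j.
Qed.

Lemma sum_avg (n : nat) (X e C : R) (Y : 'I_n -> R) : (forall j, X <= 2 * Y j + e / 2) ->
  \sum_j Y j <= C -> n%:R * X <= 2 * C + n%:R * (e / 2).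
Proof.
move=> h hC; have : \sum_(j < n) X <= \sum_(j < n) (2 * Y j + e / 2) by apply: ler_sum.
rewrite big_split/= -mulr_sumr !sumr_const card_ord -(mulr_natl X) -(mulr_natl (e / 2)) => h'; apply: (le_trans h').
by rewrite lerD2r ler_pM2l.
Qed.

(** The squared length of the chord of angle [s] on the circle through [x]. *)
Lemma rotc_dist (s : R) (x : R2) : ((rotc s x).1 - x.1) ^+ 2 + ((rotc s x).2 - x.2) ^+ 2 =
  2 * (1 - cos s) * (x.1 ^+ 2 + x.2 ^+ 2).
Proof.
have := rotc_norm s x; rewrite rotcE /= => h.
transitivity (((cos s * x.1 - sin s * x.2) ^+ 2 + (sin s * x.1 + cos s * x.2) ^+ 2) +
   (x.1 ^+ 2 + x.2 ^+ 2) - 2 * cos s * (x.1 ^+ 2 + x.2 ^+ 2)); first by ring.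
by rewrite h; ring.
Qed.

Lemma cel_in (h : R) (z x : R2) : cel h z x = 1 -> (z.1 <= x.1 <= z.1 + h) /\ (z.2 <= x.2 <= z.2 + h).
Proof.
rewrite /cel => hx; case: (ii01 z.1 h x.1) => e1; first by move: hx => /eqP; rewrite e1 mul0r eq_sym oner_eq0.
case: (ii01 z.2 h x.2) => e2; first by move: hx => /eqP; rewrite e2 mulr0 eq_sym oner_eq0.
by split; apply: ii_in.
Qed.

(* Far from the origin a cell has many pairwise disjoint rotated copies, and the flow bound makes the integrals
   over these copies comparable. *)
Lemma far_cells (l C e : R) : 0 < l -> 0 <= C -> 0 < e -> exists2 r : R, 0 <= r & forall u, Hspace u -> Q l u <= C ->
  forall z : R2, r < `|z.1| \/ r < `|z.2| -> \int[mu]_x (cel 1 z x * u x ^+ 2) <= e.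
Proof.
move=> l0 C0 e0.
have [N hN] : exists N : nat, 4 * C <= e * N.+1%:R.
  exists (Num.truncn (4 * C / e)); rewrite [leRHS]mulrC -ler_pdivrMr//; apply: ltW; exact: truncnS_gt.
have N0 : 0 < N.+1%:R :> R by rewrite ltr0n.
pose B : R := 4 * (N.+1%:R ^+ 2 * l ^+ 2 * C) + e.
have P0 : 0 <= 4 * (N.+1%:R ^+ 2 * l ^+ 2 * C).
  exact: (mulr_ge0 (ler0n _ 4) (mulr_ge0 (mulr_ge0 (sqr_ge0 _) (sqr_ge0 _)) C0)).
have B0 : 0 < B by rewrite ltr_wpDl.
(* The step angle: N + 1 steps stay within angle 1, where the cosine is decreasing, and the entry
   [e / B] makes the flow error over the total angle at most e / 2. *)
pose d := Num.min (N.+1%:R^-1) (Num.min 1 (e / B)).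
have d0 : 0 < d by rewrite !lt_min invr_gt0 N0 ltr01 divr_gt0.
have dN : N.+1%:R * d <= 1 by rewrite -ler_pdivlMl// mulr1 ge_min lexx.
have d1 : d <= 1 by rewrite !ge_min lexx !orbT.
have dB : d * B <= e by rewrite -ler_pdivlMr// !ge_min lexx !orbT.
have dd : 2 * ((N.+1%:R * d) ^+ 2 * (l ^+ 2 * C)) <= e / 2.
  have h1 : d ^+ 2 <= d by rewrite expr2 ler_piMr// ltW.
  rewrite exprMn; have : d ^+ 2 * (4 * (N.+1%:R ^+ 2 * l ^+ 2 * C)) <= e.
    apply: le_trans dB; apply: (@le_trans _ _ (d * (4 * (N.+1%:R ^+ 2 * l ^+ 2 * C)))).
      by rewrite ler_wpM2r.
    by rewrite ler_pM2l// /B lerDl ltW.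
  by move: (N.+1%:R ^+ 2) (d ^+ 2) (l ^+ 2) => A1 A2 A3; lra.
have cd : cos d < 1.
  by rewrite -(cos0 R) ltr_cos// in_itv/= ?lexx ?pi_ge0// (ltW d0) (le_trans d1)// (le_trans _ (pi_ge2 R))// ler1n.
pose g := 1 - cos d; have g0 : 0 < g by rewrite subr_gt0.
(* At this distance a rotation by at least [d] moves a point by more than the diagonal of a unit
   cell, whose square is 2, so the rotated cells are disjoint. *)
pose r := g^-1 + 2; have r0 : 0 <= r by rewrite addr_ge0// invr_ge0 ltW.
exists r => // u hu uC z hz.
have su := H_sqi hu.
pose b (x : R2) (j : 'I_N.+1) := cel 1 z (rotc (- (j%:R * d)) x).
have bd (x : R2) (j' k' : 'I_N.+1) : b x j' = 1 -> b x k' = 1 -> j' = k'.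
  have wl (j k : 'I_N.+1) : (j < k)%N -> b x j = 1 -> b x k = 1 -> False.
    move=> jk bj bk.
    pose y := rotc (- (k%:R * d)) x; pose s := (k%:R - j%:R) * d.
    have Ey : rotc (- (j%:R * d)) x = rotc s y.
      by rewrite /y rotcD; congr (rotc _ x); rewrite /s; ring.
    rewrite /b Ey in bj; rewrite /b -/y in bk.
    have [/andP[a1 a2] /andP[a3 a4]] := cel_in bj; have [/andP[c1 c2] /andP[c3 c4]] := cel_in bk.
    have := rotc_dist s y.
    have s1 : d <= s by rewrite /s ler_peMl ?(ltW d0)// -natrB 1?ltnW// ler1n subn_gt0.
    have s2 : s <= 1.
      apply: le_trans dN; rewrite /s ler_wpM2r ?(ltW d0)//.
      apply: (@le_trans _ _ k%:R); first by rewrite gerBl.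
      by rewrite ler_nat ltnW.
    have s3 : cos s <= cos d.
      rewrite leNgt ltr_cos -?leNgt// in_itv/=; apply/andP; split.
      - exact: le_trans (ltW d0) s1.
      - by rewrite (le_trans s2)// (le_trans _ (pi_ge2 R))// ler1n.
      - exact: ltW.
      - by rewrite (le_trans d1)// (le_trans _ (pi_ge2 R))// ler1n.
    have L : ((rotc s y).1 - y.1) ^+ 2 + ((rotc s y).2 - y.2) ^+ 2 <= 2.
      have h (p q c : R) : c <= p <= c + 1 -> c <= q <= c + 1 -> (p - q) ^+ 2 <= 1.
        move=> /andP[p1 p2] /andP[q1 q2]; have : (p - q) ^+ 2 <= 1 ^+ 2.
          by rewrite -real_normK ?num_real// lerXn2r ?nnegrE// ler_norml; move: p1 p2 q1 q2; clear => *; apply/andP; split; lra.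
        by rewrite expr1n.
      by rewrite (_ : 2 = 1 + 1)//; apply: lerD; apply: h; apply/andP; split; eassumption.
    have Y : g^-1 + 1 < y.1 ^+ 2 + y.2 ^+ 2.
      have gi : 0 < g^-1 by rewrite invr_gt0.
      have h (p q : R) : r < `|p| -> p <= q <= p + 1 -> g^-1 + 1 < q ^+ 2.
        move=> rp /andP[q1 q2]; have : g^-1 + 1 < `|q|.
          have : `|p| <= `|q| + 1.
            have -> : p = q + (p - q) by ring.
            by rewrite (le_trans (ler_normD _ _))// lerD2l ler_norml; move: q1 q2; clear => *; apply/andP; split; lra.
          by move: rp; rewrite /r; clear => *; lra.
        rewrite -(real_normK (num_real q)) expr2; move: `|q| => t ht.
        by apply: (lt_trans ht); move: gi ht; clear => gi ht; rewrite ltr_pMr; lra.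
      case: hz => hz.
        by have := h _ _ hz (introT andP (conj c1 c2)); have := sqr_ge0 y.2; clear => *; lra.
      by have := h _ _ hz (introT andP (conj c3 c4)); have := sqr_ge0 y.1; clear; lra.
    move=> E; rewrite E in L; move: L; apply/negP; rewrite -ltNge.
    have g1 : g <= 1 - cos s by rewrite lerD2l lerN2.
    have : g * (y.1 ^+ 2 + y.2 ^+ 2) <= (1 - cos s) * (y.1 ^+ 2 + y.2 ^+ 2).
      by rewrite ler_wpM2r// addr_ge0 ?sqr_ge0.
    have : 1 + g < g * (y.1 ^+ 2 + y.2 ^+ 2).
      by rewrite -(ltr_pM2l g0) mulrDr mulfV ?gt_eqF// mulr1 in Y.
    by rewrite -mulrA; move: g0; move: (1 - cos s) (y.1 ^+ 2 + y.2 ^+ 2); clear => *; lra.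
  move=> bj bk; apply/val_inj/eqP; rewrite eqn_leq; apply/andP; split; rewrite leqNgt; apply/negP => jk.
    exact: (wl k' j').
  exact: (wl j' k').
have cu (j : 'I_N.+1) : itg mu (fun x => b x j * u x ^+ 2).
  apply: itgMb su.2; last by move=> x; exact: cel_norm.
  exact: mp_meas (rotc_mp _) (cel_meas 1 z).
have step (j : 'I_N.+1) : \int[mu]_x (cel 1 z x * u x ^+ 2) <= 2 * \int[mu]_x (b x j * u x ^+ 2) + e / 2.
  pose s := j%:R * d; have s0 : 0 <= s by rewrite mulr_ge0 ?(ltW d0).
  have sr := mp_sqi (rotc_mp s) su.
  have -> : \int[mu]_x (b x j * u x ^+ 2) = \int[mu]_x (cel 1 z x * u (rotc s x) ^+ 2).
    rewrite -(mp_I (rotc_mp s) (cu j)); apply: eq_Rintegral => x _ /=.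
    by rewrite /b -/s rotcK.
  have sB := sqiB sr su.
  have fb := flow_bound s0 hu.
  apply: (@le_trans _ _ (2 * \int[mu]_x (cel 1 z x * u (rotc s x) ^+ 2) + 2 * n2 mu (fun x => u (rotc s x) - u x))).
    have i1 : itg mu (fun x => cel 1 z x * u (rotc s x) ^+ 2) by apply: itg_cel; exact: sr.2.
    rewrite -(IZ _ i1) -(IZ _ sB.2) -(ID (itgZ _ i1) (itgZ _ sB.2)); apply: I_le.
    - by apply: itg_cel; exact: su.2.
    - exact: itgD (itgZ _ i1) (itgZ _ sB.2).
    - move=> x; case: (cel01 1 z x) => ->; first by rewrite !mul0r mulr0 add0r mulr_ge0 ?sqr_ge0.
      rewrite /= !mul1r; move: (u x) (u (rotc s x)) => p q; have := sqr_ge0 (q + (q - p)); clear => *; nra.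
  rewrite lerD2l; apply: le_trans dd; rewrite ler_pM2l//; apply: (le_trans fb).
  apply: ler_pM; rewrite ?sqr_ge0 ?n2_ge0//.
    rewrite lerXn2r ?nnegrE ?mulr_ge0 ?(ltW d0)// /s ler_wpM2r ?(ltW d0)// ler_nat.
    exact: ltnW.
  have [_ _ _ _ h] := Q_parts l hu; have l2 : 0 < l ^+ 2 by rewrite exprn_gt0.
  by rewrite -ler_pdivrMl//; exact: le_trans h uC.
have sumle : \sum_(j < N.+1) \int[mu]_x (b x j * u x ^+ 2) <= C.
  have [h _ _ _ _] := Q_parts l hu; apply: le_trans uC; apply: le_trans h.
  have [iS es] := I_sum (index_enum 'I_N.+1) cu; rewrite -es; apply: I_le => //; first exact: su.2.
  move=> x; rewrite -mulr_suml ler_piMl ?sqr_ge0//; apply: sum_disj => [j|].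
    exact: cel01.
  exact: bd.
have h := sum_avg step sumle.
by rewrite -(ler_pM2l N0); move: hN h; clear; lra.
Qed.

End CellsAtInfinity.

(** * Compactness in L^p *)

HB.lock Definition Pf {R : realType} (p : R) (u : R * R -> R) : R := \int[leb2 R]_x (`|u x| `^ p).

Section Interpolation.
Context {R : realType}.
Local Notation M := (measurableTypeR R).
Local Notation T2 := (M * M)%type.
Local Notation mu := (leb2 R).

Lemma powRS (s a b : R) : 0 < s -> s `^ (a + b) = s `^ a * s `^ b.
Proof. by move=> s0; rewrite powRD// (gt_eqF s0) implybT. Qed.

(** Three regimes: for [|t|] below [eta] the quadratic term dominates and above [T] the one of
    exponent 2(K+1), both with the small factor [d]; in between the quartic term does, with a large
    constant. The quartic integral is the one that the cell estimate makes small. *)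
Lemma pow_interp (p : R) (K : nat) (d : R) : 2 < p -> p < (2 * K.+1)%:R -> 0 < d ->
  exists2 C : R, 0 <= C & forall t : R, `|t| `^ p <= d * t ^+ 2 + d * (t ^+ K.+1) ^+ 2 + C * (t ^+ 2) ^+ 2.
Proof.
move=> p2 pq d0; set q : R := (2 * K.+1)%:R in pq *.
(* Chosen so that [eta^(p - 2) = d] and [T^(p - q) = d]. *)
pose eta := d `^ (p - 2)^-1; pose T := d `^ (- (q - p)^-1).
have eta0 : 0 < eta by exact: powR_gt0.
have T0 : 0 < T by exact: powR_gt0.
have etaE : eta `^ (p - 2) = d by rewrite -powRrM mulVf ?powRr1 ?ltW// subr_eq0 gt_eqF.
have TE : T `^ (q - p) = d^-1.
  by rewrite -powRrM mulNr mulVf ?subr_eq0 ?gt_eqF// powR_inv1// ltW.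
exists (T `^ p / eta ^+ 4); first by rewrite divr_ge0 ?powR_ge0 ?exprn_ge0// ltW.
move=> t; set s := `|t|; have s0 : 0 <= s by exact: normr_ge0.
have -> : t ^+ 2 = s ^+ 2 by rewrite real_normK ?num_real.
have -> : (t ^+ K.+1) ^+ 2 = s ^+ (2 * K.+1).
  by rewrite -exprM mulnC exprM -(real_normK (num_real t)) -exprM.
have c0 : 0 <= T `^ p / eta ^+ 4 * (s ^+ 2) ^+ 2.
  by rewrite mulr_ge0 ?sqr_ge0// divr_ge0 ?powR_ge0 ?exprn_ge0// ltW.
have d1 : 0 <= d * s ^+ 2 by rewrite mulr_ge0 ?(ltW d0) ?sqr_ge0.
have d2 : 0 <= d * s ^+ (2 * K.+1) by rewrite mulr_ge0 ?(ltW d0) ?exprn_ge0.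
have [sp|s0'] := ltP 0 s; last first.
  have sE : s = 0 by apply/le_anti; rewrite s0 s0'.
  have -> : s `^ p = 0 by rewrite sE powR0 ?gt_eqF ?(lt_trans _ p2).
  by rewrite !addr_ge0.
have [se|es] := leP s eta.
  rewrite -addrA ler_wpDr ?addr_ge0//.
  have -> : p = 2%:R + (p - 2) by rewrite addrC subrK.
  rewrite powRS// powR_mulrn// mulrC ler_wpM2r ?sqr_ge0// -etaE.
  by apply: ge0_ler_powR; rewrite ?nnegrE ?subr_ge0 ?(ltW p2) ?(ltW eta0).
have [Ts|sT] := leP T s.
  rewrite addrAC ler_wpDl// ?addr_ge0//.
  have -> : p = q - (q - p) by ring.
  rewrite powRS// powRN powR_mulrn// mulrC ler_wpM2r ?exprn_ge0//.
  rewrite -[leRHS]invrK lef_pV2 ?posrE ?invr_gt0 ?powR_gt0//.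
  rewrite -TE; apply: ge0_ler_powR; rewrite ?nnegrE ?subr_ge0 ?(ltW pq) ?(ltW T0)//.
rewrite ler_wpDl ?addr_ge0// -exprM mulrAC ler_pdivlMr ?exprn_gt0//.
apply: ler_pM; rewrite ?powR_ge0 ?exprn_ge0 ?(ltW eta0)//.
  by apply: ge0_ler_powR; rewrite ?nnegrE ?(ltW T0) ?(ltW sT)// ltW// (lt_trans _ p2).
by rewrite lerXn2r ?nnegrE ?(ltW eta0) ?(ltW es).
Qed.

Lemma nat_gt (p : R) : exists K : nat, p < (2 * K.+1)%:R.
Proof.
exists (Num.truncn p); apply: (lt_le_trans (truncnS_gt p)).
by rewrite ler_nat leq_pmull.
Qed.

Variable p : R.
Hypothesis p2 : 2 < p.
Let p0 : 0 < p. Proof. exact: lt_trans p2. Qed.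

Lemma PfE u : Pf p u = \int[mu]_x (`|u x| `^ p). Proof. by rewrite unlock. Qed.

Lemma Pf_ge0 u : 0 <= Pf p u.
Proof. by rewrite PfE; apply: I_ge0 => x; exact: powR_ge0. Qed.

(** The constant is independent of [l], because [Q l] dominates the squared H^1 norm for every
    [l]. *)
Lemma H_even k : exists2 C : R, 0 <= C & forall l u, Hspace u ->
  itg mu (fun x => (u x ^+ k.+1) ^+ 2) /\ \int[mu]_x (u x ^+ k.+1) ^+ 2 <= C * Q l u ^+ k.+1.
Proof.
have [C C0 h] := @sobolev_even R k; exists C => // l u hu.
have [i le] := h _ _ _ (H_sqi hu) (H_d1 hu) (H_d2 hu) (H_wd1 hu) (H_wd2 hu).
split => //; apply: (le_trans le); rewrite ler_wpM2l//.
rewrite lerXn2r ?nnegrE ?Q_ge0// ?addr_ge0 ?n2_ge0//.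
have [_ _ _ h4 _] := Q_parts l hu; apply: le_trans h4.
by rewrite -addrA addrC.
Qed.

Lemma meas_pow u : @meas _ T2 R u -> @meas _ T2 R (fun x => `|u x| `^ p).
Proof. by move=> mu_; apply: meas_powR; exact: meas_norm. Qed.

Lemma P_bound (d : R) : 0 < d -> exists k : nat, exists2 A : R, 0 <= A & exists2 C : R, 0 <= C & forall l u, Hspace u ->
  itg mu (fun x => `|u x| `^ p) /\
  Pf p u <= d * (Q l u + A * Q l u ^+ k.+1) + C * \int[mu]_x (u x ^+ 2) ^+ 2.
Proof.
move=> d0; have [K pK] := nat_gt p; have [C C0 hC] := pow_interp p2 pK d0.
have [A A0 hA] := H_even K; have [B B0 hB] := H_even 1.
exists K, A => //; exists C => // l u hu.
have [iK eK] := hA l u hu; have [i4 _] := hB l u hu; have i2 := (H_sqi hu).2.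
have i : itg mu (fun x => d * u x ^+ 2 + d * (u x ^+ K.+1) ^+ 2 + C * (u x ^+ 2) ^+ 2).
  exact: itgD (itgD (itgZ d i2) (itgZ d iK)) (itgZ C i4).
have iP : itg mu (fun x => `|u x| `^ p).
  apply: (itg_le (meas_pow (H_sqi hu).1) i) => x.
  by rewrite ger0_norm ?powR_ge0.
split => //; rewrite PfE; apply: (le_trans (I_le iP i (fun x => hC (u x)))).
rewrite (ID (itgD (itgZ d i2) (itgZ d iK)) (itgZ C i4)) (ID (itgZ d i2) (itgZ d iK)) (IZ d i2) (IZ d iK) (IZ C i4).
rewrite lerD2r -mulrDr ler_pM2l// lerD//.
by have [h _ _ _ _] := Q_parts l hu.
Qed.

Lemma P_itg u : Hspace u -> itg mu (fun x => `|u x| `^ p).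
Proof.
by move=> hu; have [k [A _ [C _ h]]] := P_bound ltr01; have [] := h 1 u hu.
Qed.

Lemma PfZ c u : 0 <= c -> Hspace u -> Pf p (fun x => c * u x) = c `^ p * Pf p u.
Proof.
move=> c0 hu; rewrite !PfE -(IZ _ (P_itg hu)); apply: eq_Rintegral => x _.
by rewrite normrM powRM// (ger0_norm c0).
Qed.

Lemma Pf_ae u v : Hspace u -> @meas _ T2 R v -> {ae mu, forall x, u x = v x} -> Pf p u = Pf p v.
Proof.
move=> hu mv uv; rewrite !PfE; apply: I_ae; [exact: meas_pow (H_sqi hu).1|exact: meas_pow|].
by apply: (aeS uv) => x ->.
Qed.

Lemma PfN u : Pf p (fun x => - u x) = Pf p u.
Proof. by rewrite !PfE; apply: eq_Rintegral => x _; rewrite normrN. Qed.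

Lemma Pf_eq0 u : Hspace u -> Pf p u = 0 -> {ae mu, forall x, u x = 0}.
Proof.
move=> hu; rewrite PfE => h; have := I_eq0_ae (P_itg hu) (fun x => powR_ge0 _ _) h.
by move=> h'; apply: (aeS h') => x /eqP; rewrite powR_eq0 normr_eq0 => /andP[/eqP].
Qed.

(** By homogeneity the case [Q l u = 1] decides; as for even powers the constant does not depend on
    [l]. *)
Lemma P_sobolev : exists2 S : R, 0 < S & forall l u, Hspace u -> Pf p u <= S * Q l u `^ (p / 2).
Proof.
have [k [A A0 [C C0 h]]] := P_bound ltr01; have [B B0 hB] := H_even 1.
pose S := (1 + A) + C * B + 1; have S0 : 0 < S by rewrite ltr_wpDl// addr_ge0 ?mulr_ge0 ?addr_ge0.
exists S => // l u hu; have q0 := Q_ge0 l hu.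
have [Q0|Qp] := leP (Q l u) 0.
  have QE0 : Q l u = 0 by apply/le_anti; rewrite Q0 q0.
  have [_ h1] := h l u hu; have [_ h2] := hB l u hu.
  move: h1 h2; rewrite QE0 !exprS !mul0r !mulr0 addr0 mulr0 add0r => h1 h2.
  rewrite powR0 ?mulr0 ?gt_eqF ?divr_gt0//; apply: (le_trans h1).
  have -> : \int[mu]_x (u x ^+ 2) ^+ 2 = 0.
    by apply/le_anti; rewrite h2 I_ge0// => x; exact: sqr_ge0.
  by rewrite mulr0.
pose r := Num.sqrt (Q l u); have r0 : 0 < r by rewrite sqrtr_gt0.
have hv := HZ r^-1 hu; have [_ h1] := h l _ hv; have [_ h2] := hB l _ hv.
have E : Q l (fun x => r^-1 * u x) = 1 by rewrite QZ// exprVn sqr_sqrtr// mulVf// gt_eqF.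
have le : Pf p (fun x => r^-1 * u x) <= S.
  move: h1 h2; rewrite E !expr1n !mulr1 mul1r => h1 h2.
  apply: (le_trans h1); rewrite /S -!addrA lerD2l lerD2l; apply: (@le_trans _ _ (C * B)); last by rewrite lerDl.
  by rewrite ler_wpM2l.
have r1 : 0 <= r^-1 by rewrite invr_ge0 ltW.
move: le; rewrite (PfZ r1 hu) => le.
have -> : Q l u `^ (p / 2) = r `^ p.
  by rewrite /r -powR12_sqrt// -powRrM; congr (_ `^ _); rewrite mulrC.
rewrite -ler_pdivrMr ?powR_gt0// mulrC.
have <- // : r^-1 `^ p = (r `^ p)^-1.
by rewrite -(powR_inv1 (ltW r0)) -powRrM mulN1r powRN.
Qed.

(** From [Q <= P <= S * Q^(p/2)] a nonzero function has [Q] bounded below. This keeps both nodal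
    parts from vanishing in the limit of a minimising sequence. *)
Lemma P_lower : exists2 c : R, 0 < c & forall l u, Hspace u -> 0 < Pf p u -> Q l u <= Pf p u -> c <= Pf p u.
Proof.
have [S S0 hS] := P_sobolev.
pose c := S^-1 `^ (p / 2 - 1)^-1.
have e0 : 0 < p / 2 - 1 by move: p2; lra.
exists c; first by apply: powR_gt0; rewrite invr_gt0.
move=> l u hu P0 QP; apply: (le_trans _ QP) => //; have h := hS l u hu.
have q0 : 0 < Q l u.
  rewrite lt_neqAle Q_ge0// andbT eq_sym; apply/eqP => z; move: h; rewrite z powR0 ?mulr0 ?gt_eqF ?divr_gt0//.
  by rewrite leNgt P0.
have h2 : 1 <= S * Q l u `^ (p / 2 - 1).
  rewrite -(ler_pM2l q0) mulr1 mulrCA -[X in _ * (X * _)]powRr1 ?(ltW q0)// -powRS// addrC subrK.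
  exact: le_trans QP h.
have -> : Q l u = (Q l u `^ (p / 2 - 1)) `^ (p / 2 - 1)^-1.
  by rewrite -powRrM mulfV ?gt_eqF// powRr1 ?(ltW q0).
apply: ge0_ler_powR; rewrite ?nnegrE ?invr_ge0 ?(ltW e0) ?(ltW S0) ?powR_ge0//.
by rewrite -(ler_pM2l S0) mulfV ?gt_eqF.
Qed.

End Interpolation.

(** * Precompactness of bounded sequences *)

Section Compactness.
Context {R : realType}.
Local Notation R2 := (R * R)%type.
Local Notation mu := (leb2 R).

(** The limit is the supremum of the levels that the sequence exceeds on a set of [U]. An
    ultrafilter gives all cell averages their limits at once, before any subsequence is chosen. *)
Lemma ultra_lim (U : set_system nat) (x : nat -> R) (B : R) : UltraFilter U ->
  (forall n, `|x n| <= B) -> exists r, forall e, 0 < e -> U [set n | `|x n - r| <= e].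
Proof.
move=> uU xB; have pU : ProperFilter U by exact: ultra_proper.
pose S := [set t : R | U [set n | t <= x n]].
have SB : ubound S B.
  move=> t St; have [n /= tn] := filter_ex St.
  by apply: (le_trans tn); apply: le_trans (xB n); exact: ler_norm.
have S0 : S (- B).
  have E : [set n : nat | - B <= x n] = setT.
    by apply/seteqP; split => // n _ /=; have := xB n; rewrite ler_norml => /andP[].
  by rewrite /S /= E; exact: filterT.
have hs : has_sup S by split; [exists (- B)|exists B].
exists (sup S) => e e0.
have [t St lt] : exists2 t, S t & sup S - e < t by apply: sup_adherent.
have nS : ~ S (sup S + e).
  move=> /(ub_le_sup hs.2); rewrite gerDl => /(lt_le_trans e0); by rewrite ltxx.
have [//|h] := in_ultra_setVsetC [set n | sup S + e <= x n] uU.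
apply: filterS2 St h => n /= tn /negP; rewrite -ltNge => nh.
by rewrite ler_norml; apply/andP; split; lra.
Qed.

Lemma ultra_list (U : set_system nat) (T : eqType) (L : seq T) (A : T -> set nat) : UltraFilter U ->
  (forall c, U (A c)) -> U [set n | forall c, c \in L -> A c n].
Proof.
move=> uU hA; have pU : ProperFilter U by exact: ultra_proper.
elim: L => [|c L IH].
  by apply: filterS filterT => n _ c; rewrite in_nil.
apply: filterS2 (hA c) IH => n /= h1 h2 d; rewrite inE => /orP[/eqP ->//|]; exact: h2.
Qed.

Lemma small_pow2 (X e : R) : 0 <= X -> 0 < e -> exists m : nat, X / (2 ^+ m) ^+ 2 <= e.
Proof.
move=> X0 e0; exists (Num.truncn (X / e)).+1.
have m1 := truncnS_gt (X / e); move: m1; set m := (Num.truncn (X / e)).+1 => m1.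
have h2 : m%:R <= 2 ^+ m :> R by rewrite -natrX ler_nat ltnW// ltn_expl.
have p0 : 0 < 2 ^+ m :> R by rewrite exprn_gt0.
rewrite ler_pdivrMr ?exprn_gt0// mulrC -ler_pdivrMr//.
apply: (le_trans (ltW m1)); apply: (le_trans h2).
have k1 : 1 <= 2 ^+ m :> R by rewrite exprn_ege1// ler1n.
by rewrite [leRHS]expr2 (ler_peMl (ltW p0)).
Qed.

(** Rellich's theorem on a square: it is cut into cells of side H / 2^m, on which the Poincare
    inequality bounds the squared deviation from the mean by the square of the side times the
    gradient term, while the finitely many means converge along the ultrafilter. *)
Lemma local_compact (U : set_system nat) (u_ : nat -> R2 -> R) (l C : R) : UltraFilter U ->
  (forall n, Hspace (u_ n)) -> (forall n, Q l (u_ n) <= C) ->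
  forall (H : R) (z : R2) (e : R), 0 < H -> 0 < e -> exists A, U A /\ forall n m, A n -> A m ->
    \int[mu]_x (cel H z x * (u_ n x - u_ m x) ^+ 2) <= e.
Proof.
move=> uU hu uC H z e H0 e0; have pU : ProperFilter U by exact: ultra_proper.
have C0 : 0 <= C by exact: le_trans (Q_ge0 l (hu 0%N)) (uC 0%N).
have e2 : 0 < e / 2 by rewrite divr_gt0.
(* 8 H^2 C is 2 H^2 times 4 C: the Poincare constant times the bound on [Q l] of a difference. *)
have X0 : 0 <= 8 * H ^+ 2 * C := mulr_ge0 (mulr_ge0 (ler0n _ 8) (sqr_ge0 H)) C0.
have [m hm] := small_pow2 X0 e2.
have p0 : 0 < 2 ^+ m :> R by rewrite exprn_gt0.
pose h := H / 2 ^+ m; have h0 : 0 < h by rewrite divr_gt0.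
have [L hL] := cel_grid m z (ltW h0); rewrite /h divfK ?gt_eqF// -/h in hL.
pose K : R := 8 * (size L)%:R + 1; have K0 : 0 < K by rewrite ltr_wpDl// mulr_ge0.
(* Tolerance on the cell integrals: the mean contributes at most 4 d^2 / h^2 on each cell, in total
   at most e / 2. *)
pose d := Num.min 1 (e * h ^+ 2 / K).
have h2 : 0 < h ^+ 2 by rewrite exprn_gt0.
have d0 : 0 < d by rewrite lt_min ltr01 divr_gt0 ?mulr_gt0.
have dd : (size L)%:R * (4 * d ^+ 2 / h ^+ 2) <= e / 2.
  have d1 : d ^+ 2 <= d by rewrite expr2 ler_piMr ?(ltW d0)// ge_min lexx.
  have d2 : d * K <= e * h ^+ 2 by rewrite -ler_pdivlMr// ge_min lexx orbT.
  rewrite mulrA ler_pdivrMr// mulrC -mulrA.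
  have s0 : 0 <= (size L)%:R :> R by exact: ler0n.
  have h3 : d ^+ 2 * (size L)%:R <= d * (size L)%:R by rewrite ler_wpM2r.
  move: d2 h3; rewrite /K; move: (size L)%:R (d ^+ 2) (h ^+ 2) => s dq hq; nra.
have sc c : sqi mu (cel h c).
  split; first exact: cel_meas.
  have [i _] := cel_itg c (ltW h0); move: i; rewrite /itg; apply: eq_integrable => // x _ /=.
  by rewrite cel_sq.
pose Mc (c : R2) (n : nat) := \int[mu]_x (cel h c x * u_ n x).
have bM c n : `|Mc c n| <= h ^+ 2 + C.
  have su := H_sqi (hu n); have [q _ _ _ _] := Q_parts l (hu n).
  have := CS (sc c) su; rewrite (_ : n2 mu (cel h c) = h ^+ 2); last first.
    have [_ E] := cel_itg c (ltW h0); rewrite -[RHS]E.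
    by apply: eq_Rintegral => x _; rewrite cel_sq.
  rewrite -/(Mc c n) => hcs.
  have : `|Mc c n| ^+ 2 <= h ^+ 2 * C.
    rewrite real_normK ?num_real//; apply: (le_trans hcs); rewrite ler_wpM2l ?(ltW h2)//.
    exact: le_trans q (uC n).
  have := normr_ge0 (Mc c n); move: `|Mc c n| (h ^+ 2) h2 => a hq hq0 a0 ha.
  rewrite leNgt; apply/negP => lt; have : (hq + C) ^+ 2 < a ^+ 2.
    by rewrite ltrXn2r// ?nnegrE ?addr_ge0 ?(ltW hq0).
  nra.
have rc c : {r | forall e, 0 < e -> U [set n | `|Mc c n - r| <= e]}.
  by apply: cid; exact: ultra_lim (bM c).
pose A c := [set n | `|Mc c n - sval (rc c)| <= d].
exists [set n | forall c, c \in L -> A c n]; split.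
  by apply: ultra_list => c; exact: (svalP (rc c) d d0).
move=> n k An Ak.
have hw := HB (hu n) (hu k); have sw := H_sqi hw.
set w := (fun x => u_ n x - u_ k x) in hw sw.
have Qw : Q l w <= 4 * C.
  have := QB_le l (hu n) (hu k); have := uC n; have := uC k; rewrite -/w; clear => *; lra.
have sd1 := H_d1 hw; have sd2 := H_d2 hw.
have ih f (c : R2) : sqi mu f -> itg mu (fun x => cel h c x * f x ^+ 2) by move=> sf; apply: itg_cel; exact: sf.2.
rewrite (hL _ sw.2).
have cellb c : c \in L -> \int[mu]_x (cel h c x * w x ^+ 2) <=
    2 * h ^+ 2 * (\int[mu]_x (cel h c x * d1 w x ^+ 2) + \int[mu]_x (cel h c x * d2 w x ^+ 2)) + 4 * d ^+ 2 / h ^+ 2.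
  move=> cL; have P := poincare c sw sd1 sd2 (H_wd1 hw) (H_wd2 hw) h0.
  have [_ E _] := cel_mean c (\int[mu]_x (cel h c x * w x) / h ^+ 2) sw h0.
  rewrite E in P.
  have Mw : `|\int[mu]_x (cel h c x * w x)| <= 2 * d.
    have -> : \int[mu]_x (cel h c x * w x) = Mc c n - Mc c k.
      rewrite /Mc -(IB (sqi_itgM (sc c) (H_sqi (hu n))) (sqi_itgM (sc c) (H_sqi (hu k)))).
      by apply: eq_Rintegral => x _; rewrite mulrBr.
    have := An c cL; have := Ak c cL; rewrite /A /= !ler_norml => /andP[a1 a2] /andP[a3 a4].
    by move: a1 a2 a3 a4; clear => *; apply/andP; split; lra.
  have M2 : (\int[mu]_x (cel h c x * w x)) ^+ 2 <= 4 * d ^+ 2.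
    rewrite -(real_normK (num_real (\int[mu]_x _))).
    have -> : 4 * d ^+ 2 = (2 * d) ^+ 2 by ring.
    by rewrite lerXn2r ?nnegrE ?mulr_ge0 ?(ltW d0).
  move: P M2; set V := \int[mu]_x (cel h c x * w x ^+ 2).
  move: (\int[mu]_x (cel h c x * w x)) => m0.
  have -> : V - 2 * (m0 / h ^+ 2) * m0 + (m0 / h ^+ 2) ^+ 2 * h ^+ 2 = V - m0 ^+ 2 / h ^+ 2.
    by field; rewrite gt_eqF.
  move=> P M2; rewrite -lerBlDr; apply: le_trans P; rewrite lerD2l lerN2.
  by rewrite ler_pM2r// invr_gt0.
apply: (@le_trans _ _ (\sum_(c <- L) (2 * h ^+ 2 * (\int[mu]_x (cel h c x * d1 w x ^+ 2) + \int[mu]_x (cel h c x * d2 w x ^+ 2)) + 4 * d ^+ 2 / h ^+ 2))).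
  rewrite !big_seq; apply: ler_sum => c cL; exact: cellb.
rewrite big_split/= -mulr_sumr big_split/= -(hL _ sd1.2) -(hL _ sd2.2).
rewrite big_const_seq count_predT iter_addr_0 -(mulr_natl (4 * d ^+ 2 / h ^+ 2)).
rewrite [leRHS]splitr; apply: lerD => //.
have le f : sqi mu f -> \int[mu]_x (cel H z x * f x ^+ 2) <= n2 mu f.
  move=> sf; apply: I_le; [by apply: itg_cel; exact: sf.2|exact: sf.2|].
  by move=> x; rewrite ler_piMl ?sqr_ge0 ?cel_le1.
have [_ _ _ q _] := Q_parts l hw.
have qq : \int[mu]_x (cel H z x * d1 w x ^+ 2) + \int[mu]_x (cel H z x * d2 w x ^+ 2) <= 4 * C.
  have := le _ sd1; have := le _ sd2; have := n2_ge0 mu w; move: q Qw.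
  move: (n2 mu w) (n2 mu (d1 w)) (n2 mu (d2 w)) (Q l w) (\int[mu]_x _) (\int[mu]_x _); clear => *; lra.
apply: (@le_trans _ _ (2 * h ^+ 2 * (4 * C))).
  by rewrite ler_pM2l// mulr_gt0.
apply: le_trans hm; rewrite le_eqVlt; apply/orP; left; apply/eqP.
by rewrite /h; field; rewrite gt_eqF.
Qed.

(** Unit cells near the origin lie in one large square, where local compactness applies; the others
    carry little mass by the rotation argument. Together they give smallness uniform in the cell. *)
Lemma cells_small (U : set_system nat) (u_ : nat -> R2 -> R) (l C : R) : UltraFilter U -> 0 < l ->
  (forall n, Hspace (u_ n)) -> (forall n, Q l (u_ n) <= C) ->
  forall e, 0 < e -> exists A, U A /\ forall n m, A n -> A m -> forall z,
    \int[mu]_x (cel 1 z x * (u_ n x - u_ m x) ^+ 2) <= e.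
Proof.
move=> uU l0 hu uC e e0.
have C0 : 0 <= C by exact: le_trans (Q_ge0 l (hu 0%N)) (uC 0%N).
have [r r0 hr] := @far_cells R l (4 * C) e l0 (mulr_ge0 (ler0n _ 4) C0) e0.
have H0 : 0 < r + r + 1 by rewrite ltr_wpDl// addr_ge0.
have [A [UA hA]] := local_compact uU hu uC (- r, - r) H0 e0.
exists A; split => // n k An Ak z.
have hw := HB (hu n) (hu k); have sw := H_sqi hw.
have Qw : Q l (fun x => u_ n x - u_ k x) <= 4 * C.
  have := QB_le l (hu n) (hu k); have := uC n; have := uC k; clear; lra.
have [zr|zr] := ltP r (Num.max `|z.1| `|z.2|).
  by apply: (hr _ hw Qw); move: zr; rewrite lt_max => /orP[]; [left|right].
move: zr; rewrite ge_max !ler_norml => /andP[/andP[z1 z2] /andP[z3 z4]].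
apply: le_trans (hA n k An Ak); apply: I_le; [by apply: itg_cel; exact: sw.2..|].
move=> x; apply: ler_wpM2r; first exact: sqr_ge0.
case: (cel01 1 z x) => e1; rewrite e1; first exact: cel_ge0.
have [/andP[a1 a2] /andP[a3 a4]] := cel_in e1.
have -> : cel (r + r + 1) (- r, - r) x = 1; last by [].
by rewrite /cel !iiP/=; do 2 rewrite (_ : (_ <= _ <= _) = true) ?mulr1//; apply/andP; split; lra.
Qed.

(** Interpolation leaves the quartic integral, which the Sobolev step bounds through the supremum
    over unit cells. Indices are then drawn from the sets of the ultrafilter; [n <= phi n] is what
    is retained of a subsequence. *)
Lemma compact_Lp (p l C : R) (u_ : nat -> R2 -> R) : 2 < p -> 0 < l ->
  (forall n, Hspace (u_ n)) -> (forall n, Q l (u_ n) <= C) ->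
  exists phi : nat -> nat, (forall n, n <= phi n)%N /\ forall e, 0 < e -> exists N, forall n m, (N <= n)%N -> (N <= m)%N ->
    Pf p (fun x => u_ (phi n) x - u_ (phi m) x) <= e.
Proof.
move=> p2 l0 hu uC.
have C0 : 0 <= C by exact: le_trans (Q_ge0 l (hu 0%N)) (uC 0%N).
have [U [uU hU]] := @ultraFilterLemma nat \oo _.
have pU : ProperFilter U by exact: ultra_proper.
have Pe e : 0 < e -> exists A, U A /\ forall n m, A n -> A m -> Pf p (fun x => u_ n x - u_ m x) <= e.
  move=> e0.
  have [K pK] := nat_gt p; have [A0 A00 hA0] := @H_even R K.
  pose B := 4 * C + A0 * (4 * C) ^+ K.+1 + 1.
  have B0 : 0 < B by rewrite ltr_wpDl// addr_ge0 ?mulr_ge0 ?exprn_ge0 ?mulr_ge0.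
  have d0 : 0 < e / 2 / B by rewrite !divr_gt0.
  have [D D0 hD] := pow_interp p2 pK d0.
  (* In the step from power 1 to power 2 the constant is 2 * 2^2 = 8, and 4 C bounds [Q l] of a
     difference. *)
  pose S := e / 2 / (D * (8 * (4 * C)) + 1).
  have D1 : 0 < D * (8 * (4 * C)) + 1 by rewrite ltr_wpDl// !mulr_ge0.
  have S0 : 0 < S by rewrite !divr_gt0.
  have [A [UA hA]] := cells_small uU l0 hu uC S0.
  exists A; split => // n k An Ak.
  have hw := HB (hu n) (hu k); have sw := H_sqi hw.
  set w := (fun x => u_ n x - u_ k x) in hw sw *.
  have Qw : Q l w <= 4 * C.
    have := QB_le l (hu n) (hu k); have := uC n; have := uC k; rewrite -/w; clear => *; lra.
  have q0 := Q_ge0 l hw.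
  have hc z : \int[mu]_x (cel 1 z x * (w x ^+ 1) ^+ 2) <= S.
    by under eq_Rintegral do rewrite expr1; exact: hA.
  have [i4 le4] := sobolev_step (H_sqi hw) (H_d1 hw) (H_d2 hw) (H_wd1 hw) (H_wd2 hw) hc.
  have [iK leK] := hA0 l w hw.
  have i2 := sw.2.
  have iB := itgD (itgD (itgZ (e / 2 / B) i2) (itgZ (e / 2 / B) iK)) (itgZ D i4).
  rewrite PfE; apply: (le_trans (I_le (P_itg p2 hw) iB (fun x => hD (w x)))).
  rewrite (ID (itgD (itgZ _ i2) (itgZ _ iK)) (itgZ D i4)) (ID (itgZ _ i2) (itgZ _ iK)) !(IZ _ i2) (IZ _ iK) (IZ D i4).
  have [n1 _ _ n3 _] := Q_parts l hw.
  rewrite [leRHS]splitr; apply: lerD.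
    rewrite -mulrDr [leRHS](_ : e / 2 = e / 2 / B * B); last by rewrite divfK// gt_eqF.
    rewrite ler_pM2l//.
    rewrite /B; apply: (@le_trans _ _ (4 * C + A0 * (4 * C) ^+ K.+1)); last by rewrite lerDl.
    apply: lerD; first exact: le_trans n1 Qw.
    by apply: (le_trans leK); rewrite ler_wpM2l// lerXn2r ?nnegrE ?mulr_ge0.
  apply: (@le_trans _ _ (D * (8 * S * (4 * C)))).
    rewrite ler_wpM2l//; apply: (le_trans le4).
    rewrite (_ : 2 * 2%:R ^+ 2 = 8 :> R); last by ring.
    apply: ler_wpM2l; first by rewrite mulr_ge0 ?(ltW S0).
    apply: le_trans Qw; apply: le_trans n3; by rewrite -addrA addrC.
  have -> : D * (8 * S * (4 * C)) = S * (D * (8 * (4 * C))) by ring.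
  rewrite /S -mulrA ler_piMr ?(ltW (divr_gt0 e0 _))// mulrC ler_pdivrMr// mul1r lerDl.
  exact: ler01.
have PA k : {A : set nat | U A /\ forall n m, A n -> A m -> Pf p (fun x => u_ n x - u_ m x) <= k.+1%:R^-1}.
  by apply: cid; apply: Pe; rewrite invr_gt0.
have UI k : U [set n | (k <= n)%N /\ forall j, (j <= k)%N -> sval (PA j) n].
  have U1 : U [set n | (k <= n)%N] by apply: hU; exists k.
  have U2 : U [set n | forall j, j \in iota 0 k.+1 -> sval (PA j) n].
    by apply: ultra_list => j; exact: (svalP (PA j)).1.
  apply: filterS2 U1 U2 => n /= h1 h2; split => // j jk; apply: h2.
  by rewrite -[_ :: _]/(iota 0 k.+1) mem_iota.
have phi k : {n | (k <= n)%N /\ forall j, (j <= k)%N -> sval (PA j) n}.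
  by apply: cid; exact: (filter_ex (UI k)).
exists (fun k => sval (phi k)); split; first by move=> n; exact: (svalP (phi n)).1.
move=> e e0; exists (Num.truncn e^-1) => n m Nn Nm.
have h := (svalP (PA (Num.truncn e^-1))).2 _ _ ((svalP (phi n)).2 _ Nn) ((svalP (phi m)).2 _ Nm).
apply: (le_trans h); rewrite -[leRHS]invrK lef_pV2 ?posrE ?invr_gt0//.
by apply: ltW; exact: truncnS_gt.
Qed.

End Compactness.

(** * Convexity of the L^p functional and weak limits *)

Section Convexity.
Context {R : realType}.
Local Notation R2 := (R * R)%type.

Lemma powR_conv (p a x y : R) : 1 <= p -> 0 <= a -> a <= 1 -> 0 <= x -> 0 <= y ->
  (a * x + (1 - a) * y) `^ p <= a * x `^ p + (1 - a) * y `^ p.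
Proof.
move=> p1 a0 a1 x0 y0.
have := @convex_powR R p p1 (Itv01 a0 a1) x y; rewrite !convRE/=.
by apply; rewrite inE/= in_itv/= andbT.
Qed.

Variable p : R.
Hypothesis p2 : 2 < p.
Let p1 : 1 <= p. Proof. by move: p2; lra. Qed.
Let p0 : 0 < p. Proof. by move: p2; lra. Qed.

Lemma powR_mono (x y : R) : 0 <= x -> x <= y -> x `^ p <= y `^ p.
Proof. by move=> x0 xy; apply: ge0_ler_powR; rewrite ?nnegrE ?(ltW p0)// (le_trans x0). Qed.

Lemma pow_mid (s t : R) : `|(s + t) / 2| `^ p <= (`|s| `^ p + `|t| `^ p) / 2.
Proof.
have h : `|(s + t) / 2| <= 2^-1 * `|s| + (1 - 2^-1) * `|t|.
  rewrite normrM (ger0_norm (_ : 0 <= 2^-1)) ?invr_ge0//.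
  by have := ler_normD s t; lra.
apply: (le_trans (powR_mono (normr_ge0 _) h)).
have := @powR_conv p 2^-1 `|s| `|t| p1; rewrite invr_ge0 ler0n => /(_ isT) h2.
apply: (le_trans (h2 _ (normr_ge0 _) (normr_ge0 _))); first by rewrite invf_le1// ler1n.
by rewrite le_eqVlt; apply/orP; left; apply/eqP; field.
Qed.

(** Convexity applied to [s + t = a * (s / a) + (1 - a) * (t / (1 - a))], with the weight [a]
    determined by [a^(1 - p) = 1 + eta]. *)
Lemma pow_tri (eta : R) : 0 < eta -> exists2 C : R, 0 <= C & forall s t : R,
  `|s + t| `^ p <= (1 + eta) * `|s| `^ p + C * `|t| `^ p.
Proof.
move=> e0; have b0 : 0 < p - 1 by move: p2; lra.
have e1 : 1 < 1 + eta by rewrite ltrDl.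
have e10 : 0 < 1 + eta by exact: lt_trans ltr01 e1.
pose a := (1 + eta) `^ (- (p - 1)^-1).
have a0 : 0 < a by exact: powR_gt0.
have a1 : a < 1.
  rewrite ltNge; apply/negP => ha; have := ler_powR ha (ltW b0).
  rewrite powRr0 /a -powRrM mulNr mulVf ?gt_eqF// powR_inv1 ?(ltW e10)// => /(le_lt_trans) h.
  by have : 1 < 1 :> R; [apply: h; rewrite invf_lt1|rewrite ltxx].
have aE : a * (a^-1) `^ p = 1 + eta.
  rewrite -powR_inv1 ?(ltW a0)// -powRrM mulN1r -[X in X * _]powRr1 ?(ltW a0)// -powRS//.
  rewrite /a -powRrM (_ : - (p - 1)^-1 * (1 - p) = 1) ?powRr1 ?(ltW e10)//.
  by field; rewrite gt_eqF.
have t0 : 0 < 1 - a by rewrite subr_gt0.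
exists ((1 - a) * ((1 - a)^-1) `^ p); first by rewrite mulr_ge0 ?powR_ge0 ?(ltW t0).
move=> s t.
have h : `|s + t| <= a * (a^-1 * `|s|) + (1 - a) * ((1 - a)^-1 * `|t|).
  by rewrite !mulrA !mulfV ?gt_eqF// !mul1r ler_normD.
apply: (le_trans (powR_mono (normr_ge0 _) h)).
have ai : 0 <= a^-1 by rewrite invr_ge0 ltW.
have ti : 0 <= (1 - a)^-1 by rewrite invr_ge0 ltW.
apply: (le_trans (powR_conv p1 (ltW a0) (ltW a1) (mulr_ge0 ai (normr_ge0 s)) (mulr_ge0 ti (normr_ge0 t)))).
by rewrite !powRM// !mulrA aE.
Qed.

Lemma P_tri (eta : R) : 0 < eta -> exists2 C : R, 0 <= C & forall u v : R2 -> R, Hspace u -> Hspace v ->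
  Pf p (fun x => u x + v x) <= (1 + eta) * Pf p u + C * Pf p v.
Proof.
move=> e0; have [C C0 h] := pow_tri e0; exists C => // u v hu hv.
have iu := P_itg p2 hu; have iv := P_itg p2 hv; have iw := P_itg p2 (HD hu hv).
by rewrite !PfE -(IZ _ iu) -(IZ _ iv) -(ID (itgZ _ iu) (itgZ _ iv)); apply: I_le => //; exact: itgD (itgZ _ iu) (itgZ _ iv).
Qed.

Lemma P_mid (u v : R2 -> R) : Hspace u -> Hspace v ->
  Pf p (fun x => 2^-1 * (u x + v x)) <= (Pf p u + Pf p v) / 2.
Proof.
move=> hu hv; have iu := P_itg p2 hu; have iv := P_itg p2 hv.
rewrite !PfE mulrC -(ID iu iv) -(IZ _ (itgD iu iv)); apply: I_le.
- exact: (P_itg p2 (HZ 2^-1 (HD hu hv))).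
- exact: itgZ (itgD iu iv).
- by move=> x; rewrite mulrC [leRHS]mulrC; exact: pow_mid.
Qed.

Lemma P_mono (u v : R2 -> R) : Hspace u -> Hspace v -> (forall x, `|u x| <= `|v x|) -> Pf p u <= Pf p v.
Proof.
move=> hu hv uv; rewrite !PfE; apply: I_le; [exact: P_itg|exact: P_itg|].
by move=> x; exact: powR_mono.
Qed.

Lemma P_small (e : R) : 0 < e -> exists2 d : R, 0 < d & forall l u, Hspace u -> Q l u <= d -> Pf p u <= e.
Proof.
move=> e0; have [S S0 hS] := @P_sobolev R p p2.
have ph : 0 < p / 2 by rewrite divr_gt0.
exists ((e / S) `^ (p / 2)^-1); first by apply: powR_gt0; rewrite divr_gt0.
move=> l u hu ud; apply: (le_trans (hS l u hu)).
rewrite mulrC -ler_pdivlMr//.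
apply: (@le_trans _ _ (((e / S) `^ (p / 2)^-1) `^ (p / 2))).
  by apply: ge0_ler_powR; rewrite ?nnegrE ?(ltW ph) ?Q_ge0 ?powR_ge0.
by rewrite -powRrM mulVf ?gt_eqF// powRr1// ltW// divr_gt0.
Qed.

(** Expansion of [Q l (eta * u - v) >= 0], divided by [eta]. *)
Lemma Q_young l (eta : R) u v : 0 < eta -> Hspace u -> Hspace v ->
  Q l (fun x => u x + v x) <= (1 + eta) * Q l u + (1 + eta^-1) * Q l v.
Proof.
move=> e0 hu hv; have hz := HZ eta hu.
have := Q_ge0 l (HB hz hv); rewrite (QB _ hz hv) (QZ _ _ hu) (ipZ _ _ hu hv) (QD _ hu hv).
move: (Q l u) (Q l v) (ip l u v) => a b c h.
have : 0 <= eta^-1 * (eta ^+ 2 * a - 2 * (eta * c) + b) by rewrite mulr_ge0// invr_ge0 ltW.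
have -> : eta^-1 * (eta ^+ 2 * a - 2 * (eta * c) + b) = eta * a - 2 * c + eta^-1 * b.
  by field; rewrite gt_eqF.
by lra.
Qed.

(* Replaces weak compactness: nearly [Q]-minimal points of the convex sets of functions that are Pf-close to the tail
   of the sequence form a [Q]-Cauchy sequence by the parallelogram identity. *)
Lemma mazur l C (v_ : nat -> R2 -> R) : 0 < l -> (forall n, Hspace (v_ n)) -> (forall n, Q l (v_ n) <= C) ->
  (forall e, 0 < e -> exists N, forall n m, (N <= n)%N -> (N <= m)%N -> Pf p (fun x => v_ n x - v_ m x) <= e) ->
  exists z, [/\ Hspace z, Q l z <= C & forall e, 0 < e -> exists N, forall n, (N <= n)%N ->
     Pf p (fun x => v_ n x - z x) <= e].
Proof.
move=> l0 hv vC vc.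
pose e_ (k : nat) : R := k.+1%:R^-1.
have e0 k : 0 < e_ k by rewrite invr_gt0.
have emono k m : (k <= m)%N -> e_ m <= e_ k by move=> km; rewrite lef_pV2 ?posrE// ler_nat.
pose K (k : nat) (w : R2 -> R) := Hspace w /\ exists N, forall m, (N <= m)%N -> Pf p (fun x => w x - v_ m x) <= e_ k.
have Kmono k m w : (k <= m)%N -> K m w -> K k w.
  move=> km [hw [N hN]]; split => //; exists N => j /hN h; exact: le_trans h (emono _ _ km).
have Kmid k u w : K k u -> K k w -> K k (fun x => 2^-1 * (u x + w x)).
  move=> [hu [N1 h1]] [hw [N2 h2]]; split; first exact: HZ (HD hu hw).
  exists (maxn N1 N2) => m; rewrite geq_max => /andP[m1 m2].
  have E : (fun x => 2^-1 * (u x + w x) - v_ m x) = (fun x => 2^-1 * ((u x - v_ m x) + (w x - v_ m x))).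
    by apply/funext => x; field.
  rewrite E; apply: (le_trans (P_mid (HB hu (hv m)) (HB hw (hv m)))).
  by have := h1 m m1; have := h2 m m2; lra.
have Kv k : exists w, K k w /\ Q l w <= C.
  have [N hN] := vc _ (e0 k); exists (v_ N); split => //; split => //.
  by exists N => m Nm; exact: hN.
pose S k := [set t : R | exists2 w, K k w & t = Q l w].
have Slb k : lbound (S k) 0 by move=> t [w [hw _] ->]; exact: Q_ge0.
have Shi k : has_inf (S k).
  by split; [have [w [Kw _]] := Kv k; exists (Q l w); exists w|exists 0; exact: Slb].
pose d k := inf (S k).
have dC k : d k <= C.
  have [w [Kw wC]] := Kv k; apply: le_trans wC; apply: ge_inf; first exact: (Shi k).2.
  by exists w.
have dle k w : K k w -> d k <= Q l w.
  by move=> Kw; apply: ge_inf; [exact: (Shi k).2|exists w].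
have dmono k m : (k <= m)%N -> d k <= d m.
  move=> km; apply: lb_le_inf; first exact: (Shi m).1.
  by move=> t [w Kw ->]; apply: dle; exact: Kmono km Kw.
have Y k : {w | K k w /\ Q l w <= d k + e_ k}.
  apply: cid; have [t [w Kw ->] lt] := inf_adherent (e0 k) (Shi k).
  by exists w; split => //; exact: ltW.
pose y k := sval (Y k).
have Ky k : K k (y k) := (svalP (Y k)).1.
have yd k : Q l (y k) <= d k + e_ k := (svalP (Y k)).2.
have hy k : Hspace (y k) := (Ky k).1.
(* The midpoint lies in the set of the smaller index, so its [Q] is at least [d n]; the
   parallelogram identity turns the two near-minimality bounds into closeness. *)
have par n m : (n <= m)%N -> Q l (fun x => y n x - y m x) <= 2 * (d m - d n) + 4 * e_ n.
  move=> nm; have Km := Kmid _ _ _ (Ky n) (Kmono _ _ _ nm (Ky m)).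
  have h := dle _ _ Km; rewrite (QZ _ _ (HD (hy n) (hy m))) in h.
  have := emono _ _ nm; have := yd n; have := yd m.
  move: h; rewrite (QB _ (hy n) (hy m)) (QD _ (hy n) (hy m)).
  move: (Q l (y n)) (Q l (y m)) (ip l (y n) (y m)) => a b c; lra.
pose D := sup (range d).
have hD : has_sup (range d) by split; [exists (d 0%N); exists 0%N|exists C => _ [k _ <-]].
have dD k : d k <= D by apply: ub_le_sup; [exact: hD.2|exists k].
have esmall e : 0 < e -> exists N, forall n, (N <= n)%N -> e_ n <= e.
  move=> ee; exists (Num.truncn e^-1) => n Nn; apply: (le_trans (emono _ _ Nn)).
  by rewrite -[leRHS]invrK lef_pV2 ?posrE ?invr_gt0// ltW// truncnS_gt.
have cau e : 0 < e -> exists N, forall n m, (N <= n)%N -> (N <= m)%N -> Q l (fun x => y n x - y m x) <= e.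
  move=> ee; have e4 : 0 < e / 4 by rewrite divr_gt0.
  have e8 : 0 < e / 8 by rewrite divr_gt0.
  have [_ [k _ <-] hk] := sup_adherent e4 hD; have [N hN] := esmall _ e8.
  have main n m : (k <= n)%N -> (N <= n)%N -> (n <= m)%N -> Q l (fun x => y n x - y m x) <= e.
    move=> kn Nn nm; apply: (le_trans (par _ _ nm)).
    have := hN n Nn; have := dmono _ _ kn; have := dD m; move: hk; rewrite -/D; clear; lra.
  exists (maxn k N) => n m; rewrite !geq_max => /andP[kn Nn] /andP[km Nm].
  have [nm|/ltnW mn] := leqP n m; first exact: main.
  by rewrite (QBC _ (hy n) (hy m)); exact: main.
have [z hz zc] := H_complete l0 hy cau.
exists z; split => //.
- apply/ler_addgt0Pr => e ee.
  have C0 : 0 <= C by exact: le_trans (Q_ge0 l (hv 0%N)) (vC 0%N).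
  pose eta := Num.min 1 (e / (3 * (C + 1))).
  have C1 : 0 < 3 * (C + 1) by rewrite mulr_gt0// ltr_wpDl.
  have eta0 : 0 < eta by rewrite lt_min ltr01 divr_gt0.
  have eta1 : eta <= 1 by rewrite ge_min lexx.
  have etaC : eta * (3 * (C + 1)) <= e by rewrite -ler_pdivlMr// ge_min lexx orbT.
  have e6 : 0 < e / 6 by rewrite divr_gt0.
  have e3 : 0 < e / 3 / (1 + eta^-1) by rewrite !divr_gt0// ltr_wpDr// invr_ge0 (ltW eta0).
  have [N1 h1] := esmall _ e6; have [N2 h2] := zc _ e3.
  pose n := maxn N1 N2; have {}h1 := h1 n (leq_maxl _ _); have {}h2 := h2 n (leq_maxr _ _).
  have := Q_young l eta0 (hy n) (HB hz (hy n)).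
  have -> : (fun x => y n x + (z x - y n x)) = z by apply/funext => x; ring.
  move=> h; apply: (le_trans h).
  rewrite (QBC _ hz (hy n)); have i0 : 0 < 1 + eta^-1 by rewrite ltr_wpDr// invr_ge0 ltW.
  rewrite ler_pdivlMr// mulrC in h2.
  have q1 : Q l (y n) <= C + e / 6 by have := yd n; have := dC n; lra.
  have : (1 + eta) * Q l (y n) <= (1 + eta) * (C + e / 6) by rewrite ler_pM2l// ltr_wpDl// ltW.
  move: h2 etaC eta1; nra.
- move=> e ee.
  have [A A0 hA] := P_tri ltr01.
  have e2 : 0 < e / 2 by rewrite divr_gt0.
  have e4 : 0 < e / 4 by rewrite divr_gt0.
  have eA : 0 < e / 2 / (A + 1) by rewrite !divr_gt0// ltr_wpDl.
  have [dd dd0 hd] := P_small eA.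
  have [N1 h1] := esmall _ e4; have [N2 h2] := zc _ dd0.
  pose k := maxn N1 N2; have {}h1 := h1 k (leq_maxl _ _); have {}h2 := h2 k (leq_maxr _ _).
  have [_ [N hN]] := Ky k; exists N => n Nn.
  have E : (fun x => v_ n x - z x) = (fun x => (v_ n x - y k x) + (y k x - z x)) by apply/funext => x; ring.
  rewrite E; apply: (le_trans (hA _ _ (HB (hv n) (hy k)) (HB (hy k) hz))).
  have p1' : Pf p (fun x => v_ n x - y k x) <= e / 4.
    rewrite -PfN; under [X in Pf p X]eq_fun do rewrite opprB.
    exact: le_trans (hN n Nn) h1.
  have p2' := hd _ _ (HB (hy k) hz) h2; rewrite ler_pdivlMr ?ltr_wpDl// in p2'.
  by have := Pf_ge0 p (fun x => y k x - z x); move: p1' p2'; move: (Pf p _) (Pf p _) => a b; clear; nra.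
Qed.

End Convexity.

(** * Minimisation over the nodal Nehari set *)

Section Cutoff.
Context {R : realType}.
Local Notation M := (measurableTypeR R).
Local Notation T2 := (M * M)%type.
Local Notation R2 := (R * R)%type.
Local Notation mu := (leb2 R).

Definition rsq (x : R2) : R := x.1 ^+ 2 + x.2 ^+ 2.
(** A radial cutoff, squared so that it is C^1 across the circle of radius [k]. Its angular
    derivative vanishes, so multiplication by it commutes with [dt]. *)
Definition eta (k : R) (x : R2) : R := pos (1 - rsq x / k ^+ 2) ^+ 2.
(** The scalar factor of the gradient: the gradient of [eta k] at [x] is [eta' k x] times [x]. *)
Definition eta' (k : R) (x : R2) : R := - 4 / k ^+ 2 * pos (1 - rsq x / k ^+ 2).

Lemma rsq_ge0 x : 0 <= rsq x. Proof. by rewrite addr_ge0// sqr_ge0. Qed.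

Lemma meas_x1 : @meas _ T2 R (fun x => x.1).
Proof. exact: (meas_fst (a := id) (@measurable_id _ M setT)). Qed.
Lemma meas_x2 : @meas _ T2 R (fun x => x.2).
Proof. exact: (meas_snd (a := id) (@measurable_id _ M setT)). Qed.
Lemma meas_rsq : @meas _ T2 R rsq.
Proof. by apply: measD; [exact: measX meas_x1|exact: measX meas_x2]. Qed.

Lemma locint_bdd (f : R2 -> R) : @meas _ T2 R f ->
  (forall K, exists N, forall x, sq K x -> `|f x| <= N) -> locint f.
Proof.
move=> mf h; split => // K; have [N hN] := h K.
have [mi ii2] := sqi_sq K.
have ii1 : itg mu (\1_(sq K)).
  rewrite (_ : \1_(sq K) = fun x => \1_(sq K) x ^+ 2)//.
  by apply/funext => x; rewrite indicE; case: (x \in sq K); rewrite ?expr1n ?expr0n.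
have mm : @meas _ T2 R (fun x => \1_(sq K) x * f x) := measM mi mf.
apply: (itg_le mm (itgZ N ii1)) => x; rewrite indicE; case: (boolP (x \in sq K)) => [/set_mem xK|_].
  by rewrite mul1r mulr1; exact: hN.
by rewrite mul0r normr0 mulr0.
Qed.

Lemma rsq_sq K x : sq K x -> rsq x <= 2 * K ^+ 2.
Proof.
move=> /sqP[a b]; have K0 : 0 <= K by exact: le_trans a.
have : x.1 ^+ 2 <= K ^+ 2 by rewrite -(real_normK (num_real x.1)) lerXn2r// nnegrE.
have : x.2 ^+ 2 <= K ^+ 2 by rewrite -(real_normK (num_real x.2)) lerXn2r// nnegrE.
rewrite /rsq; lra.
Qed.

Lemma pos_cases (t : R) : (0 <= t /\ pos t = t) \/ (t <= 0 /\ pos t = 0).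
Proof.
rewrite /pos; have [h|h] := leP t 0; [right|left]; split => //; exact: ltW.
Qed.

Lemma locint_quad (c d : R) : locint (fun x : R2 => c - rsq x / d).
Proof.
apply: locint_bdd.
  by apply: measB; [exact: meas_cst|apply: measM; [exact: meas_rsq|exact: meas_cst]].
move=> K; exists (`|c| + 2 * K ^+ 2 * `|d^-1|) => x /rsq_sq h.
rewrite (le_trans (ler_normB _ _))// lerD2l normrM (ger0_norm (rsq_ge0 x)) ler_wpM2r//.
Qed.

Lemma locint_x1 (c : R) : locint (fun x : R2 => c * x.1).
Proof.
apply: locint_bdd; first by apply: measM; [exact: meas_cst|exact: meas_x1].
by move=> K; exists (`|c| * K) => x /sqP[a _]; rewrite normrM ler_wpM2l.
Qed.

Lemma wd1_quad (c d : R) : wd axis1 (fun x : R2 => c - rsq x / d) (fun x => - 2 / d * x.1).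
Proof.
apply: acl1_wd; [exact: locint_quad|exact: locint_x1|].
exists (fun x : R2 => c - rsq x / d); split; [exact: (locint_quad c d).1|exact: aeW|].
apply: aeW => y; apply: ac_C1 => [x|]; last by move=> x /=; apply: (@continuousM _ R (fun=> - 2 / d) id); [exact: cst_continuous|exact: id].
rewrite /rsq/=; apply: is_derive_eq; rewrite /GRing.scale/=; ring.
Qed.

Lemma wd_quad (c d : R) : wd axis1 (fun x : R2 => c - rsq x / d) (fun x => - 2 / d * x.1) /\
  wd axis2 (fun x : R2 => c - rsq x / d) (fun x => - 2 / d * x.2).
Proof.
split; first exact: wd1_quad.
apply: wd_swpE; have := wd1_quad c d.
by rewrite (_ : (fun x : R2 => c - rsq x / d) = (fun x => c - rsq (swp x) / d))//; apply/funext => x; rewrite /rsq /swp/= [x.2 ^+ 2 + _]addrC.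
Qed.

Lemma meas_pos d (T : measurableType d) (f : T -> R) : meas f -> meas (fun x => pos (f x)).
Proof. by move=> mf; apply: meas_max => //; exact: meas_cst. Qed.

Variable k : R.
Hypothesis k0 : 0 < k.

Lemma eta_range x : 0 <= pos (1 - rsq x / k ^+ 2) <= 1.
Proof.
have h : 0 <= rsq x / k ^+ 2 by rewrite divr_ge0 ?rsq_ge0// sqr_ge0.
by case: (pos_cases (1 - rsq x / k ^+ 2)) => -[h1 ->]; lra.
Qed.

Lemma eta_ge0 x : 0 <= eta k x. Proof. exact: sqr_ge0. Qed.
Lemma eta_le1 x : eta k x <= 1.
Proof. by have /andP[a b] := eta_range x; rewrite /eta expr_le1. Qed.

Lemma eta_out x : ~ sq k x -> pos (1 - rsq x / k ^+ 2) = 0.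
Proof.
move=> nx; case: (pos_cases (1 - rsq x / k ^+ 2)) => -[h1] // _; exfalso; apply: nx.
rewrite subr_ge0 ler_pdivrMr ?exprn_gt0// mul1r /rsq in h1.
have a := sqr_ge0 x.1; have b := sqr_ge0 x.2.
by apply/sqP; split; rewrite -(@ler_pXn2r _ 2)// ?nnegrE ?(ltW k0)// real_normK ?num_real//; lra.
Qed.

Lemma eta'_le x : `|eta' k x| * `|x.1| <= 4 / k /\ `|eta' k x| * `|x.2| <= 4 / k.
Proof.
have /andP[a b] := eta_range x.
have main t : sq k x -> `|t| <= k -> `|eta' k x| * `|t| <= 4 / k.
  move=> _ tk; rewrite /eta' !normrM normrN (ger0_norm a) (ger0_norm (_ : 0 <= 4))//.
  rewrite (ger0_norm (_ : 0 <= (k ^+ 2)^-1)) ?invr_ge0 ?sqr_ge0//.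
  have -> : 4 / k = 4 / k ^+ 2 * 1 * k by field; rewrite gt_eqF.
  apply: ler_pM => //; first by rewrite !mulr_ge0// invr_ge0 sqr_ge0.
  by apply: ler_wpM2l => //; rewrite divr_ge0// sqr_ge0.
have k4 : 0 <= 4 / k by rewrite divr_ge0// ltW.
have [sx|nx] := pselect (sq k x); first by have [x1 x2] := (sqP _ _).1 sx; split; exact: main.
by rewrite /eta' (eta_out nx) !mulr0 normr0 !mul0r.
Qed.

Lemma sqi_bdd (f : R2 -> R) (K N : R) : @meas _ T2 R f -> (forall x, `|f x| <= N) -> (forall x, ~ sq K x -> f x = 0) -> sqi mu f.
Proof.
move=> mf fN f0; have s1 := sqiZ N (sqi_sq K); apply: (sqi_le mf s1) => x.
rewrite indicE; case: (boolP (x \in sq K)) => [xK|/negP xK].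
  by rewrite mulr1 (le_trans (fN x))// ler_norm.
by rewrite mulr0 f0// => h; apply: xK; exact: mem_set.
Qed.

Lemma meas_eta : @meas _ T2 R (eta k) /\ @meas _ T2 R (eta' k).
Proof.
have m1 : @meas _ T2 R (fun x => pos (1 - rsq x / k ^+ 2)) by apply: meas_pos; exact: (locint_quad 1 (k ^+ 2)).1.
by split; [exact: measX m1|apply: measM => //; exact: meas_cst].
Qed.

Lemma wd_eta : wd axis1 (eta k) (fun x => eta' k x * x.1) /\ wd axis2 (eta k) (fun x => eta' k x * x.2).
Proof.
have [w1 w2] := wd_quad 1 (k ^+ 2); have [me me'] := meas_eta.
have le : locint (eta k).
  apply: locint_bdd => // K; exists 1 => x _; rewrite ger0_norm ?eta_ge0//; exact: eta_le1.
have mx1 := meas_x1; have mx2 := meas_x2.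
have le1 : locint (fun x : R2 => eta' k x * x.1).
  apply: locint_bdd => [|K]; first exact: measM.
  by exists (4 / k) => x _; rewrite normrM; exact: (eta'_le x).1.
have le2 : locint (fun x : R2 => eta' k x * x.2).
  apply: locint_bdd => [|K]; first exact: measM.
  by exists (4 / k) => x _; rewrite normrM; exact: (eta'_le x).2.
have F1 (s t : R) : `|pos t ^+ 2 - pos s ^+ 2 - 2 * pos s * (t - s)| <= 2 * (t - s) ^+ 2.
  have h (a b : R) : 0 <= a -> 0 <= b -> 0 <= a * b by exact: mulr_ge0.
  have sq := sqr_ge0 (t - s); rewrite ler_norml; apply/andP.
  case: (pos_cases s) => -[hs ->]; case: (pos_cases t) => -[ht ->].
  - by split; nra.
  - by have := h s (- t) hs; rewrite oppr_ge0 => /(_ ht) ?; split; nra.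
  - by have := h (- s) t; rewrite oppr_ge0 => /(_ hs ht) ?; split; nra.
  - by split; nra.
have F2 (s t : R) : `|2 * pos t - 2 * pos s| <= 2 * `|t - s|.
  rewrite -mulrBr normrM (ger0_norm (_ : 0 <= 2))// ler_wpM2l//.
  have [st|st] := leP 0 (t - s); [rewrite (ger0_norm st)|rewrite (ltr0_norm st)];
  rewrite ler_norml; case: (pos_cases s) => -[hs ->]; case: (pos_cases t) => -[ht ->]; apply/andP; split; lra.
have E i : (fun x : R2 => eta' k x * i x) = (fun x => 2 * pos (1 - rsq x / k ^+ 2) * (- 2 / k ^+ 2 * i x)).
  apply/funext => x; rewrite /eta'; ring.
have mp : @meas _ M R pos by apply: (meas_pos (f := id)); exact: measurable_id.
have mp2 : @meas _ M R (fun t => pos t ^+ 2) by exact: measX mp.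
have mp3 : @meas _ M R (fun t => 2 * pos t) by apply: measM => //; exact: meas_cst.
split.
- rewrite (E (fun x => x.1)); apply: (@wd_chain R setT (fun t => pos t ^+ 2) (fun t => 2 * pos t) 2 axis1 _ _ _ closedT _ _ _ mp2 mp3 _ w1 le) => //; first by left.
  by rewrite -(E (fun x => x.1)).
- rewrite (E (fun x => x.2)); apply: (@wd_chain R setT (fun t => pos t ^+ 2) (fun t => 2 * pos t) 2 axis2 _ _ _ closedT _ _ _ mp2 mp3 _ w2 le) => //; first by right.
  by rewrite -(E (fun x => x.2)).
Qed.

Lemma H_eta : [/\ Hspace (eta k), {ae mu, forall x, d1 (eta k) x = eta' k x * x.1},
  {ae mu, forall x, d2 (eta k) x = eta' k x * x.2} & {ae mu, forall x, dt (eta k) x = 0}].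
Proof.
have [w1 w2] := wd_eta; have [me me'] := meas_eta.
have T0 : TH (fun x : R2 => eta' k x * x.1) (fun x => eta' k x * x.2) = fun=> 0 by apply/funext => x; rewrite /TH; ring.
have e'0 x : ~ sq k x -> eta' k x = 0 by move=> /eta_out; rewrite /eta' => ->; rewrite mulr0.
have s1 : sqi mu (fun x : R2 => eta' k x * x.1).
  by apply: (@sqi_bdd _ k (4 / k)) => [|x|x /e'0 ->]; [apply: measM => //; exact: meas_x1|rewrite normrM; exact: (eta'_le x).1|rewrite mul0r].
have s2 : sqi mu (fun x : R2 => eta' k x * x.2).
  by apply: (@sqi_bdd _ k (4 / k)) => [|x|x /e'0 ->]; [apply: measM => //; exact: meas_x2|rewrite normrM; exact: (eta'_le x).2|rewrite mul0r].
have se : sqi mu (eta k).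
  apply: (@sqi_bdd _ k 1) => // x; first by rewrite ger0_norm ?eta_ge0//; exact: eta_le1.
  by move=> /eta_out h; rewrite /eta h expr0n.
have := HI se w1 w2 s1 s2; rewrite T0; apply; exact: sqi0.
Qed.

End Cutoff.

(** * Existence of minimisers on the nodal Nehari set *)

Section Nehari.
Context {R : realType}.
Local Notation R2 := (R * R)%type.
Local Notation mu := (leb2 R).
Local Notation pp u := (fun x => pos (u x)).
Local Notation pn u := (fun x => pos (- u x)).
Variable p : R.
Hypothesis p2 : 2 < p.
Let p0 : 0 < p. Proof. exact: lt_trans p2. Qed.
Implicit Types u v w z : R2 -> R.

Lemma one_powR (a : R) : 1 `^ a = 1 :> R. Proof. by rewrite powR1. Qed.

Lemma pos_comb (s t a : R) : 0 <= s -> 0 <= t ->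
  pos (s * pos a - t * pos (- a)) = s * pos a /\ pos (- (s * pos a - t * pos (- a))) = t * pos (- a).
Proof.
move=> s0 t0; case: (pos_cases a) => -[a0 ->].
  have -> : pos (- a) = 0 by rewrite /pos max_r// oppr_le0.
  rewrite mulr0 subr0; split; first by rewrite /pos max_l// mulr_ge0.
  by rewrite /pos max_r// oppr_le0 mulr_ge0.
have -> : pos (- a) = - a by rewrite /pos max_l// oppr_ge0.
rewrite mulr0 sub0r opprK; split; last by rewrite /pos max_l// mulr_ge0// oppr_ge0.
by rewrite /pos max_r// oppr_le0 mulr_ge0// oppr_ge0.
Qed.

Lemma HPN u : Hspace u -> Hspace (pn u).
Proof. by move=> /HN; exact: HP. Qed.

Lemma P_pos_neg u : Hspace u -> Pf p u = Pf p (pp u) + Pf p (pn u).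
Proof.
move=> hu; rewrite !PfE -(ID (P_itg p2 (HP hu)) (P_itg p2 (HPN hu))); apply: eq_Rintegral => x _.
rewrite (ger0_norm (pos_ge0 (u x))) (ger0_norm (pos_ge0 (- u x))); case: (pos_cases (u x)) => -[h].
  have -> : pos (- u x) = 0 by rewrite /pos max_r// oppr_le0.
  by move=> ->; rewrite powR0 ?gt_eqF// addr0 (ger0_norm h).
move=> ->; have -> : pos (- u x) = - u x by rewrite /pos max_l// oppr_ge0.
by rewrite powR0 ?gt_eqF// add0r (ler0_norm h).
Qed.

Lemma P_pos_sub u v : Hspace u -> Hspace v -> Pf p (fun x => pos (u x) - pos (v x)) <= Pf p (fun x => u x - v x).
Proof.
move=> hu hv; apply: (P_mono p2 (HB (HP hu) (HP hv)) (HB hu hv)) => x.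
have [h|h] := leP 0 (u x - v x); [rewrite (ger0_norm h)|rewrite (ltr0_norm h)];
  rewrite ler_norml; case: (pos_cases (u x)) => -[h1 ->]; case: (pos_cases (v x)) => -[h2 ->]; apply/andP; split; lra.
Qed.

Lemma P_neg_sub u v : Hspace u -> Hspace v -> Pf p (fun x => pos (- u x) - pos (- v x)) <= Pf p (fun x => u x - v x).
Proof.
move=> hu hv; apply: (le_trans (P_pos_sub (HN hu) (HN hv))).
by rewrite -PfN; under eq_fun do rewrite opprB opprK addrC.
Qed.

Lemma P_cont z (e : R) : Hspace z -> 0 < e -> exists2 d : R, 0 < d & forall u, Hspace u ->
  Pf p (fun x => u x - z x) <= d -> `|Pf p u - Pf p z| <= e.
Proof.
move=> hz e0; pose B := Pf p z; have B0 : 0 <= B by exact: Pf_ge0.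
pose eta := Num.min 1 (e / (4 * (B + 1 + e))).
have B1 : 0 < 4 * (B + 1 + e) by rewrite mulr_gt0//; lra.
have eta0 : 0 < eta by rewrite lt_min ltr01 divr_gt0.
have etaC : eta * (4 * (B + 1 + e)) <= e by rewrite -ler_pdivlMr// ge_min lexx orbT.
have eta1 : eta <= 1 by rewrite ge_min lexx.
have [C C0 hC] := P_tri p2 eta0; have C1 : 0 < C + 1 by rewrite ltr_wpDl.
exists (Num.min 1 (e / 4) / (C + 1)); first by rewrite divr_gt0// lt_min ltr01 divr_gt0.
move=> u hu; rewrite ler_pdivlMr// => hd.
have d1' : Pf p (fun x => u x - z x) * (C + 1) <= e / 4 by rewrite (le_trans hd)// ge_min lexx orbT.
have Cd : C * Pf p (fun x => u x - z x) <= e / 4.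
  by have := Pf_ge0 p (fun x => u x - z x); move: d1'; nra.
have h1 := hC _ _ hz (HB hu hz); have h2 := hC _ _ hu (HB hz hu).
have E1 : (fun x => z x + (u x - z x)) = u by apply/funext => x; ring.
have E2 : (fun x => u x + (z x - u x)) = z by apply/funext => x; ring.
have E3 : Pf p (fun x => z x - u x) = Pf p (fun x => u x - z x) by rewrite -PfN; under eq_fun do rewrite opprB.
rewrite E1 -/B in h1; rewrite E2 E3 -/B in h2.
have hB : Pf p u <= 2 * (B + 1 + e) by move: h1 Cd eta1; nra.
by rewrite ler_norml -/B; apply/andP; split; move: h1 h2 Cd eta1 etaC hB (Pf_ge0 p u); nra.
Qed.

Lemma P_lim (u_ : nat -> R2 -> R) z : (forall n, Hspace (u_ n)) -> Hspace z ->
  (forall e, 0 < e -> exists N, forall n, (N <= n)%N -> Pf p (fun x => u_ n x - z x) <= e) ->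
  forall e, 0 < e -> exists N, forall n, (N <= n)%N -> `|Pf p (u_ n) - Pf p z| <= e.
Proof.
move=> hu hz h e e0; have [d d0 hd] := P_cont hz e0; have [N hN] := h d d0.
by exists N => n Nn; exact: hd (hu n) (hN n Nn).
Qed.

(** A limit obtained from convex combinations satisfies the bound, and it coincides almost
    everywhere with [z], since both are limits of the same sequence for [Pf]. *)
Lemma lsc l C (u_ : nat -> R2 -> R) z : 0 < l -> (forall n, Hspace (u_ n)) -> Hspace z ->
  (forall e, 0 < e -> exists N, forall n, (N <= n)%N -> Pf p (fun x => u_ n x - z x) <= e) ->
  (exists N, forall n, (N <= n)%N -> Q l (u_ n) <= C) -> Q l z <= C.
Proof.
move=> l0 hu hz h [N0 hC].
have [A A0 hA] := P_tri p2 ltr01.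
have A1 : 0 < A + 2 by rewrite ltr_wpDl.
pose v_ n := u_ (N0 + n)%N.
have hv n : Hspace (v_ n) by exact: hu.
have vC n : Q l (v_ n) <= C by apply: hC; exact: leq_addr.
have near e : 0 < e -> exists N, forall n, (N <= n)%N -> Pf p (fun x => v_ n x - z x) <= e.
  by move=> e0; have [N hN] := h e e0; exists N => n Nn; apply: hN; exact: leq_trans Nn (leq_addl _ _).
have tri u v w : Hspace u -> Hspace v -> Hspace w -> Pf p (fun x => u x - w x) <=
    2 * Pf p (fun x => u x - v x) + A * Pf p (fun x => w x - v x).
  move=> hu' hv' hw; have := hA _ _ (HB hu' hv') (HB hv' hw).
  have -> : (fun x => u x - v x + (v x - w x)) = (fun x => u x - w x) by apply/funext => x; ring.
  rewrite (_ : 1 + 1 = 2)//; suff -> : Pf p (fun x => w x - v x) = Pf p (fun x => v x - w x) by [].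
  by rewrite -PfN; under eq_fun do rewrite opprB.
have cau e : 0 < e -> exists N, forall n m, (N <= n)%N -> (N <= m)%N -> Pf p (fun x => v_ n x - v_ m x) <= e.
  move=> e0; have [N hN] := near _ (divr_gt0 e0 A1); exists N => n m /hN; rewrite ler_pdivlMr// => h1 /hN.
  rewrite ler_pdivlMr// => h2; apply: (le_trans (tri _ _ _ (hv n) hz (hv m))).
  move: h1 h2 (Pf_ge0 p (fun x => v_ n x - z x)) (Pf_ge0 p (fun x => v_ m x - z x)); move: (Pf p _) (Pf p _) => a b.
  nra.
have [y [hy yC yl]] := mazur p2 l0 hv vC cau.
have zy : Pf p (fun x => z x - y x) <= 0.
  apply/ler_addgt0Pr => e e0; rewrite add0r.
  have [N1 h1] := near _ (divr_gt0 e0 A1); have [N2 h2] := yl _ (divr_gt0 e0 A1).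
  have {}h1 := h1 _ (leq_maxl N1 N2); have {}h2 := h2 _ (leq_maxr N1 N2).
  rewrite !ler_pdivlMr// in h1 h2.
  apply: (le_trans (tri _ _ _ hz (hv (maxn N1 N2)) hy)).
  have E (a b : R2 -> R) : Pf p (fun x => a x - b x) = Pf p (fun x => b x - a x).
    by rewrite -PfN; under eq_fun do rewrite opprB.
  rewrite (E z) (E y).
  move: h1 h2 (Pf_ge0 p (fun x => v_ (maxn N1 N2) x - z x)) (Pf_ge0 p (fun x => v_ (maxn N1 N2) x - y x)).
  move: (Pf p _) (Pf p _) => a b; nra.
have z0 : Pf p (fun x => z x - y x) = 0 by apply/eqP; rewrite eq_le zy Pf_ge0.
have zye := Pf_eq0 p2 (HB hz hy) z0.
rewrite (Q_ae l hz (H_sqi hy).1)//; by apply: (aeS zye) => x /eqP; rewrite subr_eq0 => /eqP.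
Qed.

(** Along the ray [Q] grows like s^2 and [Pf] like s^p; they meet at [s = (Q / Pf)^(1 / (p - 2))],
    the projection to the Nehari manifold. *)
Lemma scale l w : Hspace w -> 0 < Pf p w -> exists s : R, [/\ 0 < s,
  Q l (fun x => s * w x) = Pf p (fun x => s * w x), Q l w <= Pf p w -> s <= 1 &
  Q l w < Pf p w -> Pf p (fun x => s * w x) < Pf p w].
Proof.
move=> hw P0; have [S S0 hS] := P_sobolev p2.
have q0 : 0 < Q l w.
  rewrite lt_neqAle Q_ge0// andbT; apply/negP => /eqP h.
  have := hS l w hw; rewrite -h powR0 ?mulr0; first by rewrite leNgt P0.
  by rewrite gt_eqF// divr_gt0.
have p20 : 0 < p - 2 by rewrite subr_gt0.
pose s := (Q l w / Pf p w) `^ (p - 2)^-1.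
have s0 : 0 < s by apply: powR_gt0; rewrite divr_gt0.
have sp : s `^ (p - 2) = Q l w / Pf p w.
  by rewrite -powRrM mulVf ?gt_eqF// powRr1// divr_ge0 ?ltW.
exists s; split => //.
- rewrite (QZ _ _ hw) (PfZ p2 (ltW s0) hw).
  rewrite (_ : p = (p - 2) + 2); last by ring.
  rewrite powRS// sp addrNK -powR_mulrn ?(ltW s0)//; field; rewrite gt_eqF//.
- move=> h; rewrite -(one_powR (p - 2)^-1); apply: ge0_ler_powR; rewrite ?nnegrE ?divr_ge0 ?(ltW q0) ?(ltW P0)//.
    by rewrite invr_ge0 ltW.
  by rewrite ler_pdivrMr// mul1r.
- move=> h; rewrite (PfZ p2 (ltW s0) hw) -[ltRHS]mul1r ltr_pM2r//.
  rewrite -(one_powR p); apply: gt0_ltr_powR; rewrite ?nnegrE ?(ltW s0)//.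
  rewrite -(one_powR (p - 2)^-1); apply: gt0_ltr_powR; rewrite ?nnegrE ?divr_ge0 ?(ltW q0) ?(ltW P0)//.
    by rewrite invr_gt0.
  by rewrite ltr_pdivrMr// mul1r.
Qed.

(** Inequalities take the place of the two Nehari equations: they pass to limits, [Q] being lower
    semicontinuous, and strict ones are removed afterwards by shrinking a part. *)
Definition adm l u := [/\ Hspace u, 0 < Pf p (pp u), 0 < Pf p (pn u), Q l (pp u) <= Pf p (pp u) & Q l (pn u) <= Pf p (pn u)].

Lemma H_comb (s t : R) u : Hspace u -> Hspace (fun x => s * pos (u x) - t * pos (- u x)).
Proof. by move=> hu; apply: HB; apply: HZ; [exact: HP|exact: HPN]. Qed.

Lemma comb_parts (s t : R) u : 0 <= s -> 0 <= t ->
  (pp (fun x => s * pos (u x) - t * pos (- u x)) = (fun x => s * pos (u x))) *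
  (pn (fun x => s * pos (u x) - t * pos (- u x)) = (fun x => t * pos (- u x))).
Proof. by move=> s0 t0; split; apply/funext => x; have [] := pos_comb (u x) s0 t0. Qed.

Lemma P_gt0_cel u (h : R) (z : R2) : Hspace u -> 0 < h -> (forall x, cel h z x = 1 -> u x != 0) -> 0 < Pf p u.
Proof.
move=> hu h0 hz; rewrite lt_neqAle Pf_ge0 andbT eq_sym; apply/negP => /eqP /(Pf_eq0 p2 hu) u0.
have [ic ec] := @cel_itg R h z (ltW h0).
have : \int[mu]_x cel h z x = 0.
  rewrite -(I0 mu); apply: I_ae; [exact: cel_meas|exact: meas_cst|].
  apply: (aeS u0) => x ux; case: (cel01 h z x) => // /hz; by rewrite ux eqxx.
by rewrite ec => /eqP; rewrite expf_eq0/= gt_eqF.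
Qed.

Lemma Q_dt0 l l' u : Hspace u -> {ae mu, forall x, dt u x = 0} -> Q l u = Q l' u.
Proof.
move=> hu h; rewrite !QE//.
have -> : n2 mu (dt u) = 0.
  rewrite (n2_ae (H_dth hu).1 (meas_cst _) h) /n2; under eq_Rintegral do rewrite expr0n/=.
  exact: I0.
by rewrite !mulr0.
Qed.

(** The function [eta 1 - eta 2 / 2] is positive near the origin and negative between the radii 1
    and 2. Being radial, it has the same [Q l] for every [l]. *)
Lemma nodal_radial : exists z, [/\ Hspace z, 0 < Pf p (pp z), 0 < Pf p (pn z) &
  {ae mu, forall x, dt z x = 0}].
Proof.
have [h1 _ _ t1] := H_eta (@ltr01 R); have [h2 _ _ t2] := H_eta (@ltr0Sn R 1).
have [hz _ _ tz] := H_lin (- 2^-1) h2 h1.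
exists (fun x => - 2^-1 * eta 2 x + eta 1 x); split => //.
(* On this cell [|x|^2 <= 1/8], so [eta 1] exceeds 1/2 while [eta 2 <= 1]. *)
- apply: (P_gt0_cel (h := 4^-1) (z := (0, 0)) (HP hz)) => [|x]; first by rewrite invr_gt0.
  move=> /cel_in /= [/andP[a b] /andP[c d]]; rewrite gt_eqF// /pos lt_max; apply/orP; left.
  have r0 := rsq_ge0 x; have r1 : rsq x <= 8^-1 by rewrite /rsq; nra.
  rewrite /eta /pos max_l; last by lra.
  rewrite max_l; last by lra.
  by nra.
(* On this cell [1 <= |x|^2 <= 3], so [eta 1] vanishes and [eta 2] does not. *)
- apply: (P_gt0_cel (h := 4^-1) (z := (5 / 4, 0)) (HPN hz)) => [|x]; first by rewrite invr_gt0.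
  move=> /cel_in /= [/andP[a b] /andP[c d]]; rewrite gt_eqF// /pos lt_max; apply/orP; left.
  have r1 : rsq x <= 3 by rewrite /rsq; nra.
  have r2 : 1 <= rsq x by rewrite /rsq; nra.
  rewrite /eta /pos max_l; last by lra.
  rewrite max_r; last by lra.
  by nra.
- by apply: (aeS2 tz (ae_and t1 t2)) => x -> [-> ->]; rewrite mulr0 addr0.
Qed.

Lemma dt_pos0 u : Hspace u -> {ae mu, forall x, dt u x = 0} -> {ae mu, forall x, dt (pp u) x = 0}.
Proof. by move=> /H_wd_pos[_ _ _ h] h0; apply: (aeS2 h h0) => x -> ->; rewrite mulr0. Qed.

Lemma dt_neg0 u : Hspace u -> {ae mu, forall x, dt u x = 0} -> {ae mu, forall x, dt (pn u) x = 0}.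
Proof.
move=> hu h0; apply: dt_pos0; first exact: HN.
have [_ _ _ h] := H_lin (-1) hu H0; have [_ _ _ h1] := H_lin (-1) (@H0 R) H0.
have z0 : {ae mu, forall x, dt (fun=> 0 : R) x = 0}.
  have E : (fun x : R2 => -1 * (0 : R) + 0) = (fun=> 0) by apply/funext => x; rewrite mulr0 addr0.
  by rewrite E in h1; apply: (aeS h1) => x; rewrite mulN1r addNr.
have E : (fun x => -1 * u x + 0) = (fun x => - u x) by apply/funext => x; rewrite mulN1r addr0.
rewrite E in h; apply: (aeS2 h (ae_and h0 z0)) => x -> [-> ->]; by rewrite mulr0 addr0.
Qed.

(** The projection of a fixed radial sign-changing function to the Nehari set is the same for all
    [l], whence a level bound uniform in [l]. *)
Lemma adm_bound : exists K : R, forall l, exists2 u, adm l u & Pf p u <= K.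
Proof.
have [z [hz Pp Pn tz]] := nodal_radial.
have [s [s0 es _ _]] := scale 1 (HP hz) Pp; have [t [t0 et _ _]] := scale 1 (HPN hz) Pn.
exists (Pf p (fun x => s * pos (z x) - t * pos (- z x))) => l.
exists (fun x => s * pos (z x) - t * pos (- z x)); last exact: lexx.
rewrite /adm !(comb_parts _ (ltW s0) (ltW t0)); split.
- exact: H_comb.
- by rewrite (PfZ p2 (ltW s0) (HP hz)) mulr_gt0// powR_gt0.
- by rewrite (PfZ p2 (ltW t0) (HPN hz)) mulr_gt0// powR_gt0.
- by rewrite -es (QZ _ _ (HP hz)) (QZ _ _ (HP hz)) (Q_dt0 l 1 (HP hz) (dt_pos0 hz tz)).
- by rewrite -et (QZ _ _ (HPN hz)) (QZ _ _ (HPN hz)) (Q_dt0 l 1 (HPN hz) (dt_neg0 hz tz)).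
Qed.

Definition minim l z := [/\ adm l z, Q l (pp z) = Pf p (pp z), Q l (pn z) = Pf p (pn z) &
  forall v, adm l v -> Pf p z <= Pf p v].

(** The two parts have disjoint supports and are scaled independently. If both constraints hold and
    one is strict, [Pf] drops strictly on that part and does not grow on the other. *)
Lemma adm_scale l u : Hspace u -> 0 < Pf p (pp u) -> 0 < Pf p (pn u) -> exists s t : R,
  [/\ 0 < s, 0 < t & let z := fun x => s * pos (u x) - t * pos (- u x) in
  adm l z /\ (Q l (pp u) <= Pf p (pp u) -> Q l (pn u) <= Pf p (pn u) ->
    (Q l (pp u) < Pf p (pp u) \/ Q l (pn u) < Pf p (pn u)) -> Pf p z < Pf p u)].
Proof.
move=> hu Pp Pn.
have [s [s0 es s1 sl]] := scale l (HP hu) Pp; have [t [t0 et t1 tl]] := scale l (HPN hu) Pn.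
exists s, t; split; [exact: s0|exact: t0|]; cbv zeta; have hz := H_comb s t hu; split.
  rewrite /adm !(comb_parts _ (ltW s0) (ltW t0)); split; first exact: hz.
  - by rewrite (PfZ p2 (ltW s0) (HP hu)) mulr_gt0// powR_gt0.
  - by rewrite (PfZ p2 (ltW t0) (HPN hu)) mulr_gt0// powR_gt0.
  - by rewrite es lexx.
  - by rewrite et lexx.
move=> hp hn; rewrite (P_pos_neg hz) (P_pos_neg hu) !(comb_parts _ (ltW s0) (ltW t0)).
have le1 w r : Hspace w -> 0 < r -> r <= 1 -> Pf p (fun x => r * w x) <= Pf p w.
  move=> hw r0 r1; rewrite (PfZ p2 (ltW r0) hw) -[leRHS]mul1r ler_wpM2r ?Pf_ge0//.
  by rewrite -(one_powR p); apply: ge0_ler_powR; rewrite ?nnegrE ?(ltW p0)// ltW.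
move=> [h|h].
  by apply: ltr_leD; [exact: sl|exact: le1 (HPN hu) t0 (t1 hn)].
by apply: ler_ltD; [exact: le1 (HP hu) s0 (s1 hp)|exact: tl].
Qed.

(** A minimising sequence has [Q] bounded by [Pf], hence converges for [Pf] after extraction, and
    the limit inherits the constraints. Its parts are nonzero by the uniform lower bound, and a
    strict constraint would allow a rescaling below the infimum. *)
Lemma minim_ex l : 0 < l -> exists z, minim l z.
Proof.
move=> l0; have [K hK] := adm_bound.
pose S := [set t : R | exists2 u, adm l u & t = Pf p u].
have hS : has_inf S.
  split; first by have [u au _] := hK l; exists (Pf p u); exists u.
  by exists 0 => t [u _ ->]; exact: Pf_ge0.
pose k := inf S.
have kle u : adm l u -> k <= Pf p u by move=> au; apply: ge_inf; [exact: hS.2|exists u].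
have e0 (n : nat) : 0 < n.+1%:R^-1 :> R by rewrite invr_gt0.
have Y (n : nat) : {u | adm l u /\ Pf p u <= k + n.+1%:R^-1}.
  apply: cid; have [t [u au ->] lt] := inf_adherent (e0 n) hS.
  by exists u; split => //; exact: ltW.
pose y n := sval (Y n).
have ya n : adm l (y n) := (svalP (Y n)).1.
have yk n : Pf p (y n) <= k + n.+1%:R^-1 := (svalP (Y n)).2.
have hy n : Hspace (y n) by case: (ya n).
have yC n : Q l (y n) <= k + 1.
  rewrite (Q_pos_neg l (hy n)); have [_ _ _ q1 q2] := ya n.
  apply: (le_trans (lerD q1 q2)); rewrite -(P_pos_neg (hy n)); apply: (le_trans (yk n)).
  by rewrite lerD2l invf_le1// ler1n.
have [phi [phin cau]] := compact_Lp p2 l0 hy yC.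
have [z [hz zC zl]] := mazur p2 l0 (fun n => hy (phi n)) (fun n => yC (phi n)) cau.
have zlp e : 0 < e -> exists N, forall n, (N <= n)%N -> Pf p (fun x => pos (y (phi n) x) - pos (z x)) <= e.
  move=> ee; have [N hN] := zl e ee; exists N => n /hN h; exact: le_trans (P_pos_sub (hy _) hz) h.
have zln e : 0 < e -> exists N, forall n, (N <= n)%N -> Pf p (fun x => pos (- y (phi n) x) - pos (- z x)) <= e.
  move=> ee; have [N hN] := zl e ee; exists N => n /hN h; exact: le_trans (P_neg_sub (hy _) hz) h.
have lP := P_lim (fun n => hy (phi n)) hz zl.
have lPp := P_lim (fun n => HP (hy (phi n))) (HP hz) zlp.
have lPn := P_lim (fun n => HPN (hy (phi n))) (HPN hz) zln.
have zk : Pf p z <= k.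
  apply/ler_addgt0Pr => e ee; have e2 : 0 < e / 2 by rewrite divr_gt0.
  have [N hN] := lP _ e2; pose n := maxn N (Num.truncn (e / 2)^-1).
  have := hN n (leq_maxl _ _); rewrite ler_norml => /andP[h _].
  have : Pf p (y (phi n)) <= k + e / 2.
    apply: (le_trans (yk _)); rewrite lerD2l -[leRHS]invrK lef_pV2 ?posrE ?invr_gt0//.
    apply: (le_trans (ltW (truncnS_gt _))); rewrite ler_nat ltnS.
    exact: leq_trans (leq_maxr N _) (phin n).
  by move: h; clear; lra.
have [c c0 hc] := P_lower p2.
have Pp : 0 < Pf p (pp z).
  have c2 : 0 < c / 2 by rewrite divr_gt0.
  have [N hN] := lPp _ c2; have := hN N (leqnn _); have [_ a1 _ a2 _] := ya (phi N).
  by have := hc l _ (HP (hy (phi N))) a1 a2; rewrite ler_norml => ? /andP[_]; lra.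
have Pn : 0 < Pf p (pn z).
  have c2 : 0 < c / 2 by rewrite divr_gt0.
  have [N hN] := lPn _ c2; have := hN N (leqnn _); have [_ _ a1 _ a2] := ya (phi N).
  by have := hc l _ (HPN (hy (phi N))) a1 a2; rewrite ler_norml => ? /andP[_]; lra.
have Qp : Q l (pp z) <= Pf p (pp z).
  apply/ler_addgt0Pr => e ee; have [N hN] := lPp _ ee.
  apply: (lsc l0 (fun n => HP (hy (phi n))) (HP hz) zlp); exists N => n /hN.
  by have [_ _ _ + _] := ya (phi n); rewrite ler_norml => ? /andP[_]; lra.
have Qn : Q l (pn z) <= Pf p (pn z).
  apply/ler_addgt0Pr => e ee; have [N hN] := lPn _ ee.
  apply: (lsc l0 (fun n => HPN (hy (phi n))) (HPN hz) zln); exists N => n /hN.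
  by have [_ _ _ _] := ya (phi n); rewrite ler_norml => ? /andP[_]; lra.
have [s [t [s0 t0 [az lt]]]] := adm_scale l hz Pp Pn.
have no : ~ (Q l (pp z) < Pf p (pp z) \/ Q l (pn z) < Pf p (pn z)).
  by move=> /(lt Qp Qn) h; have := kle _ az; move: zk h; clear => *; lra.
exists z; split.
- by split.
- by apply/eqP; rewrite eq_le Qp leNgt/=; apply/negP => h; apply: no; left.
- by apply/eqP; rewrite eq_le Qn leNgt/=; apply/negP => h; apply: no; right.
- by move=> v /kle; exact: le_trans.
Qed.

End Nehari.

(** * Minimisers are critical points *)

Section Critical.
Context {R : realType}.
Local Notation M := (measurableTypeR R).
Local Notation T2 := (M * M)%type.
Local Notation R2 := (R * R)%type.
Local Notation mu := (leb2 R).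
Local Notation pp u := (fun x => pos (u x)).
Local Notation pn u := (fun x => pos (- u x)).
(** The tangent line of t^p at [x] lies below the graph, which is Young's inequality for [|x + y|]
    and [x^(p - 1)]. The modulus on the right admits increments that change the sign. *)
Lemma pow_tangent (p x y : R) : 1 < p -> 0 <= x -> x `^ p + p * x `^ (p - 1) * y <= `|x + y| `^ p.
Proof.
move=> lp x0; have p0 : 0 < p by exact: lt_trans lp.
have p1 : 0 < p - 1 by rewrite subr_gt0.
have [->|xn] := eqVneq x 0.
  by rewrite !powR0 ?gt_eqF// mulr0 mul0r addr0 powR_ge0.
have {xn x0}x0 : 0 < x by rewrite lt_neqAle eq_sym xn.
pose q := p / (p - 1); have q0 : 0 < q by rewrite divr_gt0.
have pq : p^-1 + q^-1 = 1 by rewrite /q invf_div; field; rewrite gt_eqF.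
have := conjugate_powR (normr_ge0 (x + y)) (powR_ge0 x (p - 1)) p0 q0 pq.
rewrite -powRrM (_ : (p - 1) * q = p); last by rewrite /q; field; rewrite gt_eqF.
have xp : x * x `^ (p - 1) = x `^ p by rewrite -[X in X * _]powRr1 ?(ltW x0)// -powRS// addrC subrK.
have := ler_wpM2r (powR_ge0 x (p - 1)) (ler_norm (x + y)); rewrite mulrDl xp => h1 h2.
have := le_trans h1 h2; rewrite -(ler_pM2l p0).
have -> : p * (`|x + y| `^ p / p + x `^ p / q) = `|x + y| `^ p + (p - 1) * x `^ p.
  by rewrite /q; field; rewrite !gt_eqF.
by lra.
Qed.

Variable p : R.
Hypothesis p2 : 2 < p.
Let p0 : 0 < p. Proof. exact: lt_trans p2. Qed.
Let lp : 1 < p. Proof. by move: p2; lra. Qed.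
Let p1 : 0 < p - 1. Proof. by move: p2; lra. Qed.
Implicit Types u v w z : R2 -> R.

Lemma cts_powR (a x : R) : 0 < x -> {for x, continuous (fun t : R => t `^ a)}.
Proof.
move=> x0; have h : (fun t : R => expR (a * ln t)) @ x --> expR (a * ln x).
  apply: continuous_cvg; first exact: continuous_expR.
  by apply: cvgM; [exact: cvg_cst|exact: continuous_ln].
have E : x `^ a = expR (a * ln x) by rewrite /powR gt_eqF.
rewrite /prop_for /continuous_at E; apply: cvg_trans h; apply: near_eq_cvg; near=> t.
have t0 : 0 < t by near: t; exact: lt_nbhsr.
by rewrite /powR gt_eqF.
Unshelve. all: by end_near.
Qed.

Lemma cvg_powR (U : Type) (F : set_system U) (FF : Filter F) (f : U -> R) (a x : R) : 0 < x ->
  f @ F --> x -> (fun t => f t `^ a) @ F --> x `^ a.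
Proof. by move=> x0 h; apply: (@continuous_cvg _ _ _ F FF f (fun t : R => t `^ a) x _ h); exact: cts_powR. Qed.

(** The fibre map s^2/2 - s^p/p is largest at s = 1. In the energy comparison this says that a part
    on the Nehari set is maximal along its ray. *)
Lemma young1 (s : R) : 0 <= s -> s ^+ 2 / 2 - s `^ p / p <= 2^-1 - p^-1.
Proof.
move=> s0; have ph : 0 < p / 2 by rewrite divr_gt0.
pose q := (p / 2) / (p / 2 - 1).
have ph1 : 0 < p / 2 - 1 by move: p2; lra.
have q0 : 0 < q by rewrite divr_gt0.
have pn0 : p != 0 by rewrite gt_eqF.
have pq : (p / 2)^-1 + q^-1 = 1.
  rewrite /q [(_ / (p / 2 - 1))^-1]invf_div; field; exact: pn0.
have := conjugate_powR (sqr_ge0 s) ler01 ph q0 pq.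
rewrite one_powR mulr1 -[X in X <= _]/(s ^+ 2) -powR_mulrn// -powRrM.
rewrite (_ : 2 * (p / 2) = p); last by field.
have -> : s `^ p / (p / 2) = 2 * (s `^ p / p) by field; rewrite gt_eqF.
have -> : 1 / q = 1 - 2 * p^-1 by rewrite mul1r -[LHS](addKr ((p / 2)^-1)) pq; field; rewrite gt_eqF.
rewrite powR_mulrn//; lra.
Qed.

Variable l : R.
Hypothesis l0 : 0 < l.

(** The neighbourhoods of [z] in H, as a filter, so that limits of functionals on H combine by the
    usual rules. *)
Definition nearH z : set_system (R2 -> R) :=
  [set S | exists2 d, 0 < d & forall u, Hspace u -> Q l (fun x => u x - z x) <= d -> S u].

Lemma nearH_filter z : Filter (nearH z).
Proof.
split.
- by exists 1.
- move=> P S [d1 d10 h1] [d2 d20 h2]; exists (Num.min d1 d2); first by rewrite lt_min d10.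
  by move=> u hu hq; split; [apply: h1|apply: h2] => //; apply: (le_trans hq); rewrite ge_min lexx ?orbT.
- by move=> P S PS [d d0 h]; exists d => // u hu hq; apply: PS; exact: h.
Qed.

(** Lower semicontinuity bounds [Q] of each part from below near [z]; since the two values add up to
    [Q l u], which is continuous, each is also bounded from above. *)
Lemma Q_pos_cont z (e : R) : Hspace z -> 0 < e -> exists2 d : R, 0 < d & forall u, Hspace u ->
  Q l (fun x => u x - z x) <= d -> `|Q l (pp u) - Q l (pp z)| <= e.
Proof.
have low z' e' : Hspace z' -> 0 < e' -> exists2 d : R, 0 < d & forall u, Hspace u ->
    Q l (fun x => u x - z' x) <= d -> Q l (pp z') - e' <= Q l (pp u).
  move=> hz e0; apply: contrapT => no.
  have Y (n : nat) : {u | [/\ Hspace u, Q l (fun x => u x - z' x) <= n.+1%:R^-1 & Q l (pp u) <= Q l (pp z') - e']}.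
    apply: cid; apply: contrapT => ny; apply: no; exists n.+1%:R^-1; first by rewrite invr_gt0.
    move=> u hu hq; rewrite leNgt; apply/negP => h; apply: ny; exists u; split => //; exact: ltW.
  pose y n := sval (Y n); have hy n : [/\ Hspace (y n), Q l (fun x => y n x - z' x) <= n.+1%:R^-1 & Q l (pp (y n)) <= Q l (pp z') - e'] := svalP (Y n).
  have : Q l (pp z') <= Q l (pp z') - e'.
    apply: (@lsc R p p2 l _ (fun n => pp (y n)) _ l0 _ (HP hz)).
    - by move=> n; apply: HP; case: (hy n).
    - move=> e1 e10; have [d d0 hd] := P_small p2 e10.
      exists (Num.truncn d^-1) => n Nn; have [h1 h2 _] := hy n.
      apply: (le_trans (P_pos_sub p2 h1 hz)); apply: (hd l _ (HB h1 hz)); apply: (le_trans h2).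
      rewrite -[leRHS]invrK lef_pV2 ?posrE ?invr_gt0//.
      by apply: (le_trans (ltW (truncnS_gt _))); rewrite ler_nat ltnS.
    - by exists 0%N => n _; case: (hy n).
  by move: e0; move: (Q l _) => qq; lra.
move=> hz e0; have e2 : 0 < e / 2 by rewrite divr_gt0.
have [d1 d10 h1] := low _ _ hz e2; have [d2 d20 h2] := low _ _ (HN hz) e2.
pose B := Q l z; have B0 : 0 <= B by exact: Q_ge0.
pose t := e / (4 * (B + 1)).
have B1 : 0 < 4 * (B + 1) by rewrite mulr_gt0//; lra.
have t0 : 0 < t by rewrite divr_gt0.
have tC : t * (4 * (B + 1)) = e by rewrite /t divfK// gt_eqF.
have i0 : 0 < 1 + t^-1 by rewrite addr_gt0// invr_gt0.
exists (Num.min (e / 4 / (1 + t^-1)) (Num.min d1 d2)); first by rewrite !lt_min d10 d20 !divr_gt0.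
move=> u hu; rewrite !le_min => /and3P[]; rewrite ler_pdivlMr// mulrC => h /(h1 u hu) {}h1 hd2.
have {}h2 := h2 _ (HN hu); rewrite (QBC _ (HN hu) (HN hz)) in h2.
have E2 : (fun x => - z x - - u x) = (fun x => u x - z x) by apply/funext => x; rewrite opprK addrC.
rewrite E2 in h2; have {}h2 := h2 hd2.
have := Q_young l t0 hz (HB hu hz).
have -> : (fun x => z x + (u x - z x)) = u by apply/funext => x; ring.
rewrite -/B => h3; have := Q_pos_neg l hu; have := Q_pos_neg l hz; rewrite -/B => q1 q2.
rewrite ler_norml; apply/andP; split; first by move: h1; lra.
by move: h h1 h2 h3 tC B0; rewrite q2 q1; clear; nra.
Qed.

Lemma neg_sub u z : (fun x => - u x - - z x) = (fun x => - (u x - z x)).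
Proof. by apply/funext => x; rewrite opprD. Qed.

Lemma QN u : Hspace u -> Q l (fun x => - u x) = Q l u.
Proof.
move=> hu; rewrite -[RHS]mul1r -(expr1n _ 2) -sqrrN -(QZ l (-1) hu).
by congr (Q l _); apply/funext => x; rewrite mulN1r.
Qed.

Lemma cvgH (f : (R2 -> R) -> R) z : (forall e : R, 0 < e -> exists2 d : R, 0 < d & forall u, Hspace u ->
  Q l (fun x => u x - z x) <= d -> `|f u - f z| <= e) -> f @ nearH z --> f z.
Proof.
have FF := nearH_filter z; move=> h; apply/cvgrPdist_le => e e0; have [d d0 hd] := h e e0.
by exists d => // u hu hq; rewrite distrC; exact: hd.
Qed.

Lemma cvgQp z : Hspace z -> (fun u => Q l (pp u)) @ nearH z --> Q l (pp z).
Proof. by move=> hz; apply: (@cvgH (fun u => Q l (pp u))) => e; exact: Q_pos_cont. Qed.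

Lemma cvgQn z : Hspace z -> (fun u => Q l (pn u)) @ nearH z --> Q l (pn z).
Proof.
move=> hz; apply: (@cvgH (fun u => Q l (pn u))) => e e0; have [d d0 hd] := Q_pos_cont (HN hz) e0.
by exists d => // u hu hq; apply: (hd _ (HN hu)); rewrite neg_sub (QN (HB hu hz)).
Qed.

Lemma cvgPp z : Hspace z -> (fun u => Pf p (pp u)) @ nearH z --> Pf p (pp z).
Proof.
move=> hz; apply: (@cvgH (fun u => Pf p (pp u))) => e e0; have [d d0 hd] := P_cont p2 (HP hz) e0.
have [d' d'0 hd'] := P_small p2 d0; exists d' => // u hu hq; apply: (hd _ (HP hu)).
exact: le_trans (P_pos_sub p2 hu hz) (hd' _ _ (HB hu hz) hq).
Qed.

Lemma cvgPn z : Hspace z -> (fun u => Pf p (pn u)) @ nearH z --> Pf p (pn z).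
Proof.
move=> hz; apply: (@cvgH (fun u => Pf p (pn u))) => e e0; have [d d0 hd] := P_cont p2 (HPN hz) e0.
have [d' d'0 hd'] := P_small p2 d0; exists d' => // u hu hq; apply: (hd _ (HPN hu)).
exact: le_trans (P_neg_sub p2 hu hz) (hd' _ _ (HB hu hz) hq).
Qed.

Lemma nearH_lt (f : (R2 -> R) -> R) z c : f @ nearH z --> f z -> f z < c -> nearH z (fun u => f u < c).
Proof. have FF := nearH_filter z; move=> h fc; exact: (@cvgr_lt R _ _ FF f _ h _ fc). Qed.

Lemma nearH_gt (f : (R2 -> R) -> R) z c : f @ nearH z --> f z -> c < f z -> nearH z (fun u => c < f u).
Proof. have FF := nearH_filter z; move=> h fc; exact: (@cvgr_gt R _ _ FF f _ h _ fc). Qed.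

Lemma nearH_dist (f : (R2 -> R) -> R) z (y e : R) : f @ nearH z --> y -> 0 < e -> nearH z (fun u => `|f u - y| < e).
Proof. have FF := nearH_filter z; move=> h e0; exact: (@cvgr_distC_lt R _ _ _ FF f y h e e0). Qed.

(* On the zero set of [bal] a single dilation puts both the positive and the negative part on the Nehari set. *)
Definition bal u := Q l (pp u) * Pf p (pn u) - Q l (pn u) * Pf p (pp u).

Lemma cvg_bal z : Hspace z -> bal @ nearH z --> bal z.
Proof.
have FF := nearH_filter z; move=> hz.
by apply: cvgB; apply: cvgM; [exact: cvgQp|exact: cvgPn|exact: cvgQn|exact: cvgPp].
Qed.

Definition pw z : R2 -> R := fun x => pos (z x) `^ (p - 1).

Lemma itg_pw z v : Hspace z -> Hspace v -> itg mu (fun x => pw z x * v x).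
Proof.
move=> hz hv; have i1 := P_itg p2 (HP hz); have i2 := P_itg p2 hv.
have mz : @meas _ T2 R (pw z) by apply: meas_powR; exact: (H_sqi (HP hz)).1.
have mm : @meas _ T2 R (fun x => pw z x * v x) := measM mz (H_sqi hv).1.
apply: (itg_le mm (itgD i1 i2)) => x.
pose q := p / (p - 1); have q0 : 0 < q by rewrite divr_gt0.
have pq : p^-1 + q^-1 = 1 by rewrite /q invf_div; field; rewrite gt_eqF.
rewrite normrM (ger0_norm (powR_ge0 _ _)) (ger0_norm (pos_ge0 _)) mulrC.
apply: (le_trans (conjugate_powR (normr_ge0 (v x)) (powR_ge0 _ _) p0 q0 pq)).
rewrite -powRrM (_ : (p - 1) * q = p); last by rewrite /q; field; rewrite gt_eqF.
have le1 (a b : R) : 0 <= a -> 0 < b -> 1 <= b -> a / b <= a by move=> a0 b0 b1; rewrite ler_pdivrMr// ler_peMr.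
rewrite addrC; apply: lerD; apply: le1; rewrite ?powR_ge0//.
  by rewrite /q ler_pdivlMr// mul1r; lra.
by move: p2; lra.
Qed.

(** A two-parameter deformation of [z]: [e] moves in the direction [v], and [t] shifts weight from
    the negative to the positive part. *)
Definition bend z v (e t : R) : R2 -> R := fun x => (1 + t) * pos (z x) - (1 - t) * pos (- z x) + e * v x.

(** The tangent inequality applied where [z] is positive and where it is negative. A lower bound is
    the useful side, as [Pf] enters the energy with a minus sign. *)
Lemma P_bend z v e t : Hspace z -> Hspace v -> 0 <= 1 + t -> 0 <= 1 - t ->
  (1 + t) `^ p * Pf p (pp z) + (1 - t) `^ p * Pf p (pn z) + p * e * ((1 + t) `^ (p - 1) * \int[mu]_x (pw z x * v x)
   - (1 - t) `^ (p - 1) * \int[mu]_x (pw (fun x => - z x) x * v x)) <= Pf p (bend z v e t).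
Proof.
move=> hz hv t1 t2.
have i1 := P_itg p2 (HP hz); have i2 := P_itg p2 (HPN hz).
have i3 := itg_pw hz hv; have i4 := itg_pw (HN hz) hv.
have i5 := P_itg p2 (HD (H_comb (1 + t) (1 - t) hz) (HZ e hv)).
rewrite !PfE -(IZ ((1 + t) `^ p) i1) -(IZ ((1 - t) `^ p) i2) -(IZ ((1 + t) `^ (p - 1)) i3) -(IZ ((1 - t) `^ (p - 1)) i4).
rewrite -(IB (itgZ _ i3) (itgZ _ i4)) -(IZ (p * e) (itgB (itgZ _ i3) (itgZ _ i4))).
rewrite -(ID (itgZ _ i1) (itgZ _ i2)).
rewrite -(ID (itgD (itgZ _ i1) (itgZ _ i2)) (itgZ _ (itgB (itgZ _ i3) (itgZ _ i4)))).
apply: I_le.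
- exact: (itgD (itgD (itgZ _ i1) (itgZ _ i2)) (itgZ _ (itgB (itgZ _ i3) (itgZ _ i4)))).
- exact: i5.
move=> x; rewrite /pw (ger0_norm (pos_ge0 (z x))) (ger0_norm (pos_ge0 (- z x))).
rewrite -!mulrA !mulrA -!powRM ?pos_ge0// /bend.
case: (pos_cases (z x)) => -[h E].
  have -> : pos (- z x) = 0 by rewrite /pos max_r// oppr_le0.
  rewrite !mulr0 !powR0 ?gt_eqF// mul0r subr0 addr0 subr0 E.
  have := pow_tangent (e * v x) lp (mulr_ge0 t1 h); rewrite powRM// powRM//; clear; lra.
rewrite E; have E' : pos (- z x) = - z x by rewrite /pos max_l// oppr_ge0.
have nz : 0 <= - z x by rewrite oppr_ge0.
rewrite E' !mulr0 !powR0 ?gt_eqF// mul0r !sub0r add0r.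
have := pow_tangent (- (e * v x)) lp (mulr_ge0 t2 nz); rewrite -normrN opprD opprK powRM// powRM//; clear; lra.
Qed.

Lemma H_bend z v e t : Hspace z -> Hspace v -> Hspace (bend z v e t).
Proof. by move=> hz hv; exact: HD (H_comb _ _ hz) (HZ e hv). Qed.

Lemma Q_bend z v e t : Hspace z -> Hspace v -> 0 <= 1 + t -> 0 <= 1 - t ->
  Q l (bend z v e t) = (1 + t) ^+ 2 * Q l (pp z) + (1 - t) ^+ 2 * Q l (pn z)
   + 2 * e * ((1 + t) * ip l (pp z) v - (1 - t) * ip l (pn z) v) + e ^+ 2 * Q l v.
Proof.
move=> hz hv t1 t2; have hc := H_comb (1 + t) (1 - t) hz.
rewrite /bend (QD _ hc (HZ e hv)) (QZ _ _ hv) (Q_pos_neg l hc) !(comb_parts _ t1 t2).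
rewrite (QZ _ _ (HP hz)) (QZ _ _ (HPN hz)) (ipC l _ (fun x => e * v x)) (ipZ _ _ hv hc) (ipC l v).
rewrite (ipB _ (HZ (1 + t) (HP hz)) (HZ (1 - t) (HPN hz)) hv) (ipZ _ _ (HP hz) hv) (ipZ _ _ (HPN hz) hv); ring.
Qed.

Lemma bend_near z v e t e' t' : Hspace z -> Hspace v ->
  Q l (fun x => bend z v e t x - bend z v e' t' x) <=
  2 * (t - t') ^+ 2 * Q l z + 2 * (e - e') ^+ 2 * Q l v.
Proof.
move=> hz hv.
have E : (fun x => bend z v e t x - bend z v e' t' x) =
   (fun x => (t - t') * (pos (z x) + pos (- z x)) + (e - e') * v x) by apply/funext => x; rewrite /bend; ring.
have hn := HD (HP hz) (HPN hz).
rewrite E; apply: (le_trans (QD_le l (HZ _ hn) (HZ _ hv))).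
rewrite (QZ _ _ hn) (QZ _ _ hv) (QD _ (HP hz) (HPN hz)) (ip_pos_neg _ hz) (Q_pos_neg l hz).
by rewrite le_eqVlt; apply/orP; left; apply/eqP; ring.
Qed.

Lemma bend00 z v : bend z v 0 0 = z.
Proof. by apply/funext => x; rewrite /bend [RHS]pos_neg; ring. Qed.

Lemma near_bend z v e t (S : set (R2 -> R)) : Hspace z -> Hspace v -> nearH (bend z v e t) S ->
  exists2 r : R, 0 < r & forall e' t', `|e' - e| <= r -> `|t' - t| <= r -> S (bend z v e' t').
Proof.
move=> hz hv [d d0 hS]; pose C := 2 * Q l z + 2 * Q l v + 1.
have q1 := Q_ge0 l hz; have q2 := Q_ge0 l hv.
have C1 : 1 <= C by rewrite /C; lra.
have C0 : 0 < C by exact: lt_le_trans C1.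
pose r := Num.min 1 (d / C).
have r0 : 0 < r by rewrite lt_min ltr01 divr_gt0.
have r1 : r <= 1 by rewrite ge_min lexx.
have rC : r * C <= d by rewrite -ler_pdivlMr// ge_min lexx orbT.
exists r => // e' t' he ht; apply: hS; first exact: H_bend.
apply: (le_trans (bend_near _ _ _ _ hz hv)); apply: le_trans rC.
have sq (s : R) : `|s| <= r -> s ^+ 2 <= r.
  move=> sr; rewrite -(real_normK (num_real s)); have := normr_ge0 s; nra.
by have := sq _ he; have := sq _ ht; move: (sqr_ge0 (t' - t)) (sqr_ge0 (e' - e)); rewrite /C; move: ((t' - t) ^+ 2) ((e' - e) ^+ 2) => a b; nra.
Qed.

(** The final energy estimate in atoms: [a] and [b] are the values of [Pf] on the two parts, [V] is
    [Q l v], [i] is 1/p, [S] is s^p, and [W4] to [W7] are powers of 1 + t and 1 - t. The hypotheses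
    come from [s^2 <= 4], the fibre maxima of the two parts and the tangent bound. *)
Lemma energy_ineq (s S i tp tn W4 W5 W6 W7 g1 g2 al be a b e V P : R) :
  e ^+ 2 * V * s ^+ 2 <= e ^+ 2 * V * 4 ->
  (s ^+ 2 * tn ^+ 2 / 2 - S * W5 * i) * b <= (2^-1 - i) * b ->
  (s ^+ 2 * tp ^+ 2 / 2 - S * W4 * i) * a <= (2^-1 - i) * a ->
  S * W4 * i * a + S * W5 * i * b + e * (S * (W6 * g1 - W7 * g2)) <= S * P * i ->
  2^-1 * (s ^+ 2 * (tp ^+ 2 * a + tn ^+ 2 * b + 2 * e * (tp * al - tn * be) + e ^+ 2 * V)) - S * P * i <=
  (2^-1 - i) * (a + b) + e * (s ^+ 2 * (tp * al - tn * be) - S * (W6 * g1 - W7 * g2)) + e ^+ 2 * (2 * V).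
Proof. lra. Qed.

(** If the derivative in the direction [v] were negative, a small step [e] along [v], followed by
    rebalancing the parts through [t] and a dilation by [s], would give an admissible function.
    Rebalancing and dilation cannot raise the energy, each part being maximal on its ray, so the
    energy would drop to first order in [e]. *)
Lemma minim_le z v : minim p l z -> Hspace v ->
  \int[mu]_x (pw z x * v x) - \int[mu]_x (pw (fun x => - z x) x * v x) <= ip l z v.
Proof.
move=> [[hz Pp Pn _ _] ea eb zmin] hv; rewrite leNgt; apply/negP.
have ipz : ip l z v = ip l (pp z) v - ip l (pn z) v.
  by rewrite -(ipB _ (HP hz) (HPN hz) hv); congr ip; apply/funext => x; exact: pos_neg.
rewrite ipz.
set al := ip l (pp z) v; set be := ip l (pn z) v; set g1 := \int[mu]_x _; set g2 := \int[mu]_x _ => hlt.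
pose m := g1 - g2 - (al - be); have m0 : 0 < m by rewrite subr_gt0.
pose a := Pf p (pp z); pose b := Pf p (pn z).
(* The coefficient of [e] in the energy bound after dilation by [t.1] with balance parameter [t.2];
   at (1, 0) it equals [- m]. *)
pose B (t : R * R) := t.1 ^+ 2 * ((1 + t.2) * al - (1 - t.2) * be) -
  t.1 `^ p * ((1 + t.2) `^ (p - 1) * g1 - (1 - t.2) `^ (p - 1) * g2).
have [dl [dl0 dl1 hB]] : exists d : R, [/\ 0 < d, d <= 2^-1 & forall s t : R, `|s - 1| <= d -> `|t| <= d -> B (s, t) < - (m / 2)].
  have c1 : (fun t : R * R => t.1) @ filter_prod (nbhs (1 : R)) (nbhs (0 : R)) --> (1 : R) by exact: cvg_fst.
  have c2 : (fun t : R * R => t.2) @ filter_prod (nbhs (1 : R)) (nbhs (0 : R)) --> (0 : R) by exact: cvg_snd.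
  have c3 : (fun t : R * R => 1 + t.2) @ filter_prod (nbhs (1 : R)) (nbhs (0 : R)) --> (1 + 0 : R) by apply: cvgD => //; exact: cvg_cst.
  have c4 : (fun t : R * R => 1 - t.2) @ filter_prod (nbhs (1 : R)) (nbhs (0 : R)) --> (1 - 0 : R) by apply: cvgB => //; exact: cvg_cst.
  have cB : B @ filter_prod (nbhs (1 : R)) (nbhs (0 : R)) -->
     ((1 * 1) * ((1 + 0) * al - (1 - 0) * be) - 1 `^ p * ((1 + 0) `^ (p - 1) * g1 - (1 - 0) `^ (p - 1) * g2) : R).
    apply: cvgB; apply: cvgM.
    - by apply: cvgM.
    - by apply: cvgB; apply: cvgM => //; exact: cvg_cst.
    - by apply: cvg_powR => //; exact: ltr01.
    - apply: cvgB; apply: cvgM; try exact: cvg_cst.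
      + by apply: cvg_powR => //; rewrite addr0.
      + by apply: cvg_powR => //; rewrite subr0.
  have E : ((1 * 1) * ((1 + 0) * al - (1 - 0) * be) - 1 `^ p * ((1 + 0) `^ (p - 1) * g1 - (1 - 0) `^ (p - 1) * g2) : R) = - m.
    by rewrite addr0 subr0 !one_powR /m; ring.
  rewrite E in cB; have ml : - m < - (m / 2) by lra.
  have [[S1 S2] /= [/nbhs_ballP[e1 /= e10 b1] /nbhs_ballP[e2 /= e20 b2]] S12] := cvgr_lt _ cB _ ml.
  exists (Num.min 2^-1 (Num.min (e1 / 2) (e2 / 2))); split.
  - by rewrite !lt_min invr_gt0 ltr0n !divr_gt0.
  - by rewrite ge_min lexx.
  - move=> s t; rewrite !le_min => /and3P[_ hs _] /and3P[_ _ ht]; apply: (S12 (s, t)); split => /=.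
      apply: b1; rewrite /ball/= distrC; apply: (le_lt_trans hs); move: e10; lra.
    apply: b2; rewrite /ball/= distrC subr0; apply: (le_lt_trans ht); move: e20; lra.
have q1 : 0 < p - 2 by rewrite subr_gt0.
(* The dilation that puts the positive part on the Nehari set; where [bal] vanishes it serves the
   negative part too, and it is close to 1 near [z]. *)
pose sg u := (Q l (pp u) / Pf p (pp u)) `^ (p - 2)^-1.
have FF := nearH_filter z.
have csg : sg @ nearH z --> (1 : R).
  have -> : 1 = (Q l (pp z) / Pf p (pp z)) `^ (p - 2)^-1 by rewrite ea divff ?gt_eqF// one_powR.
  apply: cvg_powR; first by rewrite ea divff ?gt_eqF.
  apply: cvgM; first exact: cvgQp.
  by apply: cvgV; [rewrite gt_eqF|exact: cvgPp].
have nz : nearH (bend z v 0 0) (fun u => [/\ 0 < Pf p (pp u), 0 < Pf p (pn u) & `|sg u - 1| <= dl]).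
  rewrite bend00.
  have n1 := nearH_gt (cvgPp hz) Pp; have n2 := nearH_gt (cvgPn hz) Pn; have n3 := nearH_dist csg dl0.
  by apply: filterS3 n1 n2 n3 => u u1 u2 /ltW.
have [r1 r10 hr1] := near_bend hz hv nz.
pose d := Num.min dl r1.
have d0 : 0 < d by rewrite lt_min dl0.
have ddl : d <= dl by rewrite ge_min lexx.
have dr1 : d <= r1 by rewrite ge_min lexx orbT.
have d12 : d <= 2^-1 by exact: le_trans dl1.
have dp : 0 <= 1 + d by rewrite addr_ge0// ltW.
have dm : 0 < 1 - d by rewrite subr_gt0 (le_lt_trans d12)// invf_lt1// ltr1n.
have dmp : 1 - d < 1 + d by rewrite ltrD2l (lt_trans _ d0)// oppr_lt0.
(* Without the step along [v], shifting weight makes [bal] negative for t > 0 and positive for t <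
   0; these signs persist for small [e], so there is a zero in between. *)
have bal0 t : 0 <= 1 + t -> 0 <= 1 - t -> bal (bend z v 0 t) =
   a * b * ((1 + t) ^+ 2 * (1 - t) `^ p - (1 - t) ^+ 2 * (1 + t) `^ p).
  move=> t1 t2; have E : bend z v 0 t = (fun x => (1 + t) * pos (z x) - (1 - t) * pos (- z x)).
    by apply/funext => x; rewrite /bend mul0r addr0.
  rewrite /bal E !(comb_parts _ t1 t2) !(QZ _ _ (HP hz)) !(QZ _ _ (HPN hz)) (PfZ p2 t1 (HP hz)) (PfZ p2 t2 (HPN hz)) ea eb.
  rewrite -/a -/b; ring.
have cmp (x y : R) : 0 < x -> x < y -> y ^+ 2 * x `^ p < x ^+ 2 * y `^ p.
  move=> x0 xy; have y0 : 0 < y by exact: lt_trans xy.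
  have h : x `^ (p - 2) < y `^ (p - 2) by apply: gt0_ltr_powR; rewrite ?nnegrE ?(ltW x0) ?(ltW y0).
  have pw2 t : 0 < t -> t `^ p = t ^+ 2 * t `^ (p - 2).
    move=> t0; rewrite -powR_mulrn ?(ltW t0)// -powRD; last by apply/implyP => _; rewrite gt_eqF.
    by congr powR; ring.
  rewrite (pw2 x x0) (pw2 y y0) [y ^+ 2 * _]mulrCA ltr_pM2l ?exprn_gt0// ltr_pM2l ?exprn_gt0//.
have ab0 : 0 < a * b by rewrite mulr_gt0.
have balp : bal (bend z v 0 d) < 0.
  by rewrite (bal0 d dp (ltW dm)) pmulr_rlt0// subr_lt0; exact: cmp.
have baln : 0 < bal (bend z v 0 (- d)).
  by rewrite bal0 ?opprK ?(ltW dm)// pmulr_rgt0// subr_gt0; exact: cmp.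
have [r2 r20 hr2] : exists2 r : R, 0 < r & forall e t, `|e - 0| <= r -> `|t - d| <= r -> bal (bend z v e t) < 0.
  by apply: (near_bend hz hv (S := fun u => bal u < 0)); exact: nearH_lt (cvg_bal (H_bend _ _ hz hv)) balp.
have [r3 r30 hr3] : exists2 r : R, 0 < r & forall e t, `|e - 0| <= r -> `|t - - d| <= r -> 0 < bal (bend z v e t).
  by apply: (near_bend hz hv (S := fun u => 0 < bal u)); exact: nearH_gt (cvg_bal (H_bend _ _ hz hv)) baln.
have qv := Q_ge0 l hv; have qv8 : 0 < 8 * (Q l v + 1) by rewrite mulr_gt0//; lra.
(* The radii [r1], [r2] and [r3] keep scaling and signs under control; the last entry makes the
   quadratic term [2 * e^2 * Q l v] smaller than [e * m / 2]. *)
pose e := Num.min (Num.min r1 r2) (Num.min r3 (m / (8 * (Q l v + 1)))).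
have e0 : 0 < e by rewrite !lt_min r10 r20 r30 divr_gt0.
have [er1 er2 er3 em] : [/\ e <= r1, e <= r2, e <= r3 & e * (8 * (Q l v + 1)) <= m].
  by rewrite -ler_pdivlMr// !ge_min !lexx ?orbT.
have ctt : continuous (fun t => bal (bend z v e t)).
  move=> t; apply/cvgrPdist_lt => r r0.
  have nb := nearH_dist (cvg_bal (H_bend e t hz hv)) r0.
  have [rr rr0 hrr] := near_bend hz hv nb.
  near=> t'; rewrite distrC; apply: hrr; first by rewrite subrr normr0 ltW.
  by near: t'; apply: (cvgr_distC_le _ _ (@cvg_id _ (nbhs t))).
have [t /andP[] ] : exists2 t, t \in `[- d, d] & bal (bend z v e t) = 0.
  apply: IVT; [by rewrite ge0_cp// ltW|exact: continuous_subspaceT|].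
  have b1 : bal (bend z v e (- d)) > 0 by apply: hr3; rewrite ?subr0 ?(ger0_norm (ltW e0))// subrr normr0 ltW.
  have b2 : bal (bend z v e d) < 0 by apply: hr2; rewrite ?subr0 ?(ger0_norm (ltW e0))// subrr normr0 ltW.
  by rewrite ge_min le_max (ltW b1) (ltW b2) orbT.
rewrite !bnd_simp => t1 t2 bt.
have td : `|t| <= d by rewrite ler_norml t1.
have [tp tn] : 0 <= 1 + t /\ 0 <= 1 - t by move: t1 t2 d12; clear => *; split; lra.
have [w1 w2 w3] : [/\ 0 < Pf p (pp (bend z v e t)), 0 < Pf p (pn (bend z v e t)) & `|sg (bend z v e t) - 1| <= dl].
  by apply: hr1; rewrite subr0 ?(ger0_norm (ltW e0))// (le_trans td).
have hw := H_bend e t hz hv.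
have Qb := Q_bend e hz hv tp tn; have Pb := P_bend e hz hv tp tn.
move: bt w1 w2 w3 hw Qb Pb; set w := bend z v e t; rewrite /bal => bt w1 w2 w3 hw Qb Pb.
pose s := sg w.
have [hs sle] : 0 < s /\ s <= 2.
  by move: w3; rewrite -/s; move: dl1; clear; rewrite ler_norml => h /andP[]; split; lra.
have qp : 0 < Q l (pp w).
  rewrite lt_neqAle Q_ge0 ?andbT; last exact: HP.
  apply/negP => /eqP h; move: hs; rewrite /s /sg -h mul0r powR0 ?ltxx// invr_neq0// gt_eqF//.
have sp : s `^ (p - 2) = Q l (pp w) / Pf p (pp w).
  by rewrite -powRrM mulVf ?gt_eqF// powRr1// divr_ge0 ?ltW.
have s2 : s `^ p = s ^+ 2 * (Q l (pp w) / Pf p (pp w)).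
  rewrite -sp -powR_mulrn ?(ltW hs)// -powRD; last by apply/implyP => _; rewrite gt_eqF.
  by congr powR; ring.
have sn : s `^ p = s ^+ 2 * (Q l (pn w) / Pf p (pn w)).
  rewrite s2; congr (_ * _); apply/eqP; rewrite eqr_div ?(gt_eqF w1) ?(gt_eqF w2)//; apply/eqP/subr0_eq.
  by rewrite -[RHS]bt.
pose y : R2 -> R := fun x => s * pos (w x) - s * pos (- w x).
have hy : Hspace y by exact: H_comb.
have s0 := ltW hs.
have yp : Q l (fun x => s * pos (w x)) = Pf p (fun x => s * pos (w x)).
  by rewrite (QZ _ _ (HP hw)) (PfZ p2 s0 (HP hw)) s2; field; rewrite gt_eqF.
have yn : Q l (fun x => s * pos (- w x)) = Pf p (fun x => s * pos (- w x)).
  by rewrite (QZ _ _ (HPN hw)) (PfZ p2 s0 (HPN hw)) sn; field; rewrite gt_eqF.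
have ay : adm p l y.
  rewrite /adm /y !(comb_parts _ s0 s0); split; first exact: hy.
  - by rewrite (PfZ p2 s0 (HP hw)) mulr_gt0// powR_gt0.
  - by rewrite (PfZ p2 s0 (HPN hw)) mulr_gt0// powR_gt0.
  - by rewrite yp lexx.
  - by rewrite yn lexx.
have yz := zmin y ay; rewrite (P_pos_neg p2 hz) -/a -/b in yz.
have yE : Pf p y = s `^ p * Pf p w.
  rewrite -(PfZ p2 s0 hw); congr Pf; apply/funext => x; rewrite /y -mulrBr; congr (_ * _).
  exact/esym/pos_neg.
have yQ : Pf p y = s ^+ 2 * Q l w.
  rewrite (P_pos_neg p2 hy) /y !(comb_parts _ s0 s0) -yp -yn (QZ _ _ (HP hw)) (QZ _ _ (HPN hw)) (Q_pos_neg l hw); ring.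
have Bs : B (s, t) < - (m / 2) by apply: hB => //; exact: le_trans ddl.
have Y1 := young1 (mulr_ge0 s0 tp); have Y2 := young1 (mulr_ge0 s0 tn).
rewrite !powRM// in Y1 Y2.
have hp2 : 0 < 2^-1 - p^-1 by rewrite subr_gt0 ltf_pV2 ?posrE.
have key : (2^-1 - p^-1) * (a + b) <= (2^-1 - p^-1) * (a + b) + e * B (s, t) + e ^+ 2 * (2 * Q l v).
  apply: (le_trans (ler_wpM2l (ltW hp2) yz)); rewrite mulrBl {1}yQ yE Qb ea eb -/a -/b -/al -/be.
  have spp : 0 <= s `^ p / p by rewrite divr_ge0 ?powR_ge0// ltW.
  have := ler_wpM2l spp Pb; rewrite -/g1 -/g2 -/a -/b.
  have := ler_wpM2r (ltW Pp) Y1; have := ler_wpM2r (ltW Pn) Y2; rewrite -/a -/b.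
  have s4 : s ^+ 2 <= 4 by move: s0 sle; clear; rewrite expr2; nra.
  have : e ^+ 2 * Q l v * s ^+ 2 <= e ^+ 2 * Q l v * 4 by rewrite ler_wpM2l// mulr_ge0// sqr_ge0.
  rewrite /B/= !exprMn.
  have -> : s `^ p / p * ((1 + t) `^ p * a + (1 - t) `^ p * b + p * e * ((1 + t) `^ (p - 1) * g1 - (1 - t) `^ (p - 1) * g2)) =
     s `^ p * (1 + t) `^ p / p * a + s `^ p * (1 - t) `^ p / p * b + e * (s `^ p * ((1 + t) `^ (p - 1) * g1 - (1 - t) `^ (p - 1) * g2)).
    by field; rewrite gt_eqF.
  rewrite (mulrAC _ (p^-1) (Pf p w)) (mulrC p^-1 (s `^ p * Pf p w)).
  exact: energy_ineq.
have : 0 <= e * (B (s, t) + e * (2 * Q l v)).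
  by move: key; clear; move: (B _) (Q l v) (_ * (a + b)) => W1 W2 W3; lra.
rewrite pmulr_rge0//; move: Bs em e0 m0; clear; move: (B _) (Q l v) => W1 W2; nra.
Unshelve. all: by end_near.
Qed.

End Critical.

(** * Minimisers and least energy nodal solutions *)

Section Solutions.
Context {R : realType}.
Local Notation M := (measurableTypeR R).
Local Notation T2 := (M * M)%type.
Local Notation R2 := (R * R)%type.
Local Notation mu := (leb2 R).
Local Notation pp u := (fun x => pos (u x)).
Local Notation pn u := (fun x => pos (- u x)).
Variable p : R.
Hypothesis p2 : 2 < p.
Let p0 : 0 < p. Proof. exact: lt_trans p2. Qed.
Let p1 : 0 < p - 1. Proof. by move: p2; lra. Qed.
Implicit Types u v w z : R2 -> R.

Lemma nl_pos (t : R) : `|t| `^ (p - 2) * t = pos t `^ (p - 1) - pos (- t) `^ (p - 1).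
Proof.
have h (s : R) : 0 <= s -> s `^ (p - 2) * s = s `^ (p - 1).
  rewrite le_eqVlt => /predU1P[<-|s0]; first by rewrite mulr0 powR0// gt_eqF.
  rewrite -[X in _ * X]powRr1 ?(ltW s0)// -powRS//; congr powR; ring.
case: (pos_cases t) => -[t0 ->].
  have -> : pos (- t) = 0 by rewrite /pos max_r// oppr_le0.
  by rewrite (ger0_norm t0) h// powR0 ?subr0// gt_eqF.
have -> : pos (- t) = - t by rewrite /pos max_l// oppr_ge0.
by rewrite (ler0_norm t0) powR0 ?gt_eqF// sub0r -h ?oppr_ge0// mulrN opprK.
Qed.

Lemma itg_nl z v : Hspace z -> Hspace v -> itg mu (fun x => `|z x| `^ (p - 2) * z x * v x) /\
  \int[mu]_x (`|z x| `^ (p - 2) * z x * v x) =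
  \int[mu]_x (pw p z x * v x) - \int[mu]_x (pw p (fun x => - z x) x * v x).
Proof.
move=> hz hv; have i1 := itg_pw p2 hz hv; have i2 := itg_pw p2 (HN hz) hv.
have E : (fun x => `|z x| `^ (p - 2) * z x * v x) = (fun x => pw p z x * v x - pw p (fun x => - z x) x * v x).
  by apply/funext => x; rewrite nl_pos mulrBl.
by rewrite E; split; [exact: itgB|exact: IB].
Qed.

Lemma nodal_pos u : Hspace u -> (0 < Pf p (pp u)) <-> (0 < mu [set x | (0 < u x)%R])%E.
Proof.
move=> hu; have mA : measurable ([set x | (0 < u x)%R] : set T2).
  have := (H_sqi hu).1 measurableT _ (measurable_itv `]0, +oo[).
  rewrite setTI; congr measurable; apply/seteqP; split => x /=; by rewrite in_itv/= andbT.
split.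
- move=> h; rewrite lt_neqAle measure_ge0 andbT; apply/negP => /eqP m0.
  have a0 : {ae mu, forall x, pos (u x) = 0}.
    apply/negligibleP.
      have := (H_sqi (HP hu)).1 measurableT _ (measurableC (measurable_set1 0)).
      rewrite setTI; congr measurable.
    transitivity (mu [set x | (0 < u x)%R]); last by rewrite -m0.
    congr (mu _); apply/seteqP; split => x /=; case: (pos_cases (u x)) => -[h1 ->].
    - by move=> /eqP; rewrite lt_neqAle eq_sym h1 => ->.
    - by [].
    - by move=> /gt_eqF ux /eqP; rewrite ux.
    - by rewrite ltNge h1.
  have : Pf p (pp u) = Pf p (fun=> 0 : R) by exact: (@Pf_ae _ p _ _ (HP hu) (@meas_cst _ T2 R 0) a0).
  rewrite [RHS]PfE; under eq_Rintegral do rewrite normr0 powR0 ?gt_eqF//.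
  by rewrite I0 => e; rewrite e ltxx in h.
- move=> h; rewrite lt_neqAle Pf_ge0 andbT eq_sym; apply/negP => /eqP /(Pf_eq0 p2 (HP hu)) a0.
  have : mu [set x | (0 < u x)%R] = 0%E.
    apply/eqP; rewrite -measure_le0; have [N [mN N0 sub]] := a0; rewrite -N0.
    apply: le_measure; rewrite ?inE// => x /= ux; apply: sub => /= e.
    by move: ux; case: (pos_cases (u x)) e => -[h1 ->]; [move=> ->; rewrite ltxx|rewrite ltNge h1].
  by move=> e; rewrite e ltxx in h.
Qed.

Lemma nodalE u : Hspace u -> nodal u <-> 0 < Pf p (pp u) /\ 0 < Pf p (pn u).
Proof.
move=> hu; have E : [set x | (u x < 0)%R] = [set x | (0 < - u x)%R].
  by apply/seteqP; split => x /=; rewrite oppr_gt0.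
have [a b] := nodal_pos hu; have [c d] := nodal_pos (HN hu); rewrite /nodal E.
by split => -[h k]; split; [exact: (b h)|exact: (d k)|exact: (a h)|exact: (c k)].
Qed.

(** The one-sided inequality is applied to [v] and to [- v]. *)
Lemma minim_solution l z v : 0 < l -> minim p l z -> Hspace v ->
  ip l z v = \int[mu]_x (`|z x| `^ (p - 2) * z x * v x).
Proof.
move=> l0 mz hv; have hz : Hspace z by case: mz => -[].
have h1 := minim_le p2 l0 mz hv; have h2 := minim_le p2 l0 mz (HZ (-1) hv).
have e1 w : Hspace w -> \int[mu]_x (pw p w x * (-1 * v x)) = - \int[mu]_x (pw p w x * v x).
  move=> hw; rewrite -(IN (itg_pw p2 hw hv)); apply: eq_Rintegral => x _; ring.
rewrite (e1 _ hz) (e1 _ (HN hz)) ipC (ipZ _ _ hv hz) mulN1r ipC in h2.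
rewrite (itg_nl hz hv).2; apply/eqP; rewrite eq_le h1 andbT; move: h2; clear.
by move: (\int[mu]_x _) (\int[mu]_x _) (ip _ _ _) => A B C; lra.
Qed.

Lemma energyE l u : Hspace u -> energy p l u = 2^-1 * Q l u - p^-1 * Pf p u.
Proof.
move=> hu; rewrite /energy PfE /Q ip.unlock /innerH; congr (_ * _ - _).
by apply: eq_Rintegral => x _; rewrite !real_normK ?num_real// !expr2.
Qed.

(** Testing the equation with the positive and the negative part gives the two Nehari equations, the
    mixed inner product being zero. *)
Lemma solution_adm l u : solution p l u -> nodal u ->
  [/\ adm p l u, Q l (pp u) = Pf p (pp u) & Q l (pn u) = Pf p (pn u)].
Proof.
move=> [hu sol] /(nodalE hu)[Pp Pn].
have sol' v : Hspace v -> ip l u v = \int[mu]_x (`|u x| `^ (p - 2) * u x * v x).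
  by move=> hv; rewrite -sol// ip.unlock.
have uE : u = (fun x => pos (u x) - pos (- u x)) by apply/funext => x; exact: pos_neg.
have hup := HP hu; have hun := HPN hu.
have ip0 := ip_pos_neg l hu.
have e1 : Q l (pp u) = Pf p (pp u).
  have := sol' _ hup; rewrite {1}uE (ipB _ hup hun hup) [ip l (pn u) _]ipC ip0 subr0 -/(Q l (pp u)) => ->.
  rewrite PfE; apply: eq_Rintegral => x _; rewrite nl_pos (ger0_norm (pos_ge0 _)).
  case: (pos_cases (u x)) => -[h E].
    have -> : pos (- u x) = 0 by rewrite /pos max_r// oppr_le0.
    rewrite powR0 ?gt_eqF// subr0 E; move: h; rewrite le_eqVlt => /predU1P[<-|s0].
      by rewrite mulr0 powR0// gt_eqF.
    by rewrite -[X in _ * X]powRr1 ?(ltW s0)// -powRS// subrK.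
  by rewrite E mulr0 powR0// gt_eqF.
have e2 : Q l (pn u) = Pf p (pn u).
  have := sol' _ hun; rewrite {1}uE (ipB _ hup hun hun) ip0 sub0r -/(Q l (pn u)) => /eqP; rewrite eqr_oppLR => /eqP ->.
  rewrite -(IN (itg_nl hu hun).1) PfE; apply: eq_Rintegral => x _; rewrite nl_pos (ger0_norm (pos_ge0 _)).
  case: (pos_cases (- u x)) => -[h E].
    have -> : pos (u x) = 0 by rewrite /pos max_r// -oppr_ge0.
    rewrite powR0 ?gt_eqF// sub0r E mulNr opprK; move: h; rewrite le_eqVlt => /predU1P[<-|s0].
      by rewrite mulr0 powR0// gt_eqF.
    by rewrite -[X in _ * X]powRr1 ?(ltW s0)// -powRS// subrK.
  by rewrite E mulr0 oppr0 powR0// gt_eqF.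
by split => //; split => //; rewrite ?e1 ?e2 lexx.
Qed.

Lemma energy_adm l u : Hspace u -> Q l (pp u) = Pf p (pp u) -> Q l (pn u) = Pf p (pn u) ->
  energy p l u = (2^-1 - p^-1) * Pf p u.
Proof. by move=> hu e1 e2; rewrite energyE// (Q_pos_neg l hu) e1 e2 -(P_pos_neg p2 hu) mulrBl. Qed.

Lemma minim_lens l z : 0 < l -> minim p l z -> least_energy_nodal_solution p l z.
Proof.
move=> l0 mz; have [az e1 e2 zmin] := mz; have [hz Pp Pn _ _] := az.
split.
- by split => // v hv; rewrite -(minim_solution l0 mz hv) ip.unlock.
- exact/(nodalE hz).
- move=> v sv nv; have [av f1 f2] := solution_adm sv nv; have hv : Hspace v by case: av.
  rewrite (energy_adm hz e1 e2) (energy_adm hv f1 f2) ler_wpM2l ?zmin//.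
  by rewrite subr_ge0 lef_pV2 ?posrE// ltW.
Qed.

(** Some minimiser exists and is itself a nodal solution, so a solution of least energy cannot have
    a larger [Pf], the energy being the same positive multiple of [Pf] on both. *)
Lemma lens_minim l z : 0 < l -> least_energy_nodal_solution p l z -> minim p l z.
Proof.
move=> l0 [sz nz hmin]; have [az e1 e2] := solution_adm sz nz; have hz : Hspace z by case: az.
have [y my] := minim_ex p2 l0; have [ay f1 f2 ymin] := my; have hy : Hspace y by case: ay.
have [sy ny _] := minim_lens l0 my.
split => // v /ymin; apply: le_trans; have := hmin y sy ny.
by rewrite (energy_adm hz e1 e2) (energy_adm hy f1 f2) ler_pM2l// subr_gt0 ltf_pV2 ?posrE.
Qed.

Lemma lens_ex l : 0 < l -> exists u, least_energy_nodal_solution p l u.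
Proof. by move=> l0; have [z mz] := minim_ex p2 l0; exists z; exact: minim_lens. Qed.

(** The bound holds for all [l] at once, which makes the threshold for radial symmetry independent
    of the solution. *)
Lemma minim_bound : exists2 K : R, 0 < K & forall l u, minim p l u -> Q l u <= K.
Proof.
have [K hK] := adm_bound p2; exists (Num.max 1 K); first by rewrite lt_max ltr01.
move=> l u [[hu _ _ _ _] e1 e2 umin]; have [v av vK] := hK l.
rewrite (Q_pos_neg l hu) e1 e2 -(P_pos_neg p2 hu) le_max; apply/orP; right.
exact: le_trans (umin v av) vK.
Qed.

End Solutions.

(** * Radial symmetry for small lambda *)

Section SmallLambda.
Context {R : realType}.
Local Notation M := (measurableTypeR R).
Local Notation T2 := (M * M)%type.
Local Notation R2 := (R * R)%type.
Local Notation mu := (leb2 R).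
Variable p : R.
Hypothesis p2 : 2 < p.
Let p0 : 0 < p. Proof. exact: lt_trans p2. Qed.
Let p1 : 0 < p - 1. Proof. by move: p2; lra. Qed.
Implicit Types u v w z : R2 -> R.

Let nl (t : R) : R := `|t| `^ (p - 2) * t.

Lemma pow_le_nat (m : nat) (t : R) : p - 2 <= m%:R -> 0 <= t -> t `^ (p - 2) <= 1 + t ^+ m.
Proof.
move=> pm t0; have p20 : 0 <= p - 2 by rewrite subr_ge0 ltW.
have tm : 0 <= t ^+ m by exact: exprn_ge0.
have [t1|t1] := leP t 1.
  apply: (@le_trans _ _ 1); last by rewrite lerDl.
  by rewrite -[leRHS](one_powR (p - 2)); apply: ge0_ler_powR; rewrite ?nnegrE.
apply: (@le_trans _ _ (t ^+ m)); last by rewrite lerDr.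
by rewrite -powR_mulrn//; apply: ler_powR => //; exact: ltW.
Qed.

(** For two values of the same sign this is the tangent inequality for t^(p-1), whose slope contains
    [|t|^(p-2)]; opposite signs are estimated separately. A natural exponent [m >= p - 2] brings the
    weights into the range of the even-power embeddings. *)
Lemma nl_lip (m : nat) (a b : R) : p - 2 <= m%:R ->
  `|nl a - nl b| <= (p - 1) * (2 + `|a| ^+ m + `|b| ^+ m) * `|a - b|.
Proof.
move=> pm; have q1 : 1 < p - 1 by move: p2; lra.
have pq : p - 1 - 1 = p - 2 by ring.
have qE (s : R) : 0 <= s -> s `^ (p - 1) = s `^ (p - 2) * s.
  rewrite le_eqVlt => /predU1P[<-|s0]; first by rewrite mulr0 powR0// gt_eqF.
  rewrite -[X in _ * X]powRr1 ?(ltW s0)// -powRS//; congr powR; ring.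
have mono (x y : R) : 0 <= x -> x <= y -> nl x <= nl y.
  move=> x0 xy; have y0 := le_trans x0 xy; rewrite /nl (ger0_norm x0) (ger0_norm y0) -!qE//.
  by apply: ge0_ler_powR; rewrite ?nnegrE// ltW.
have pospos (x y : R) : 0 <= x -> x <= y -> `|nl y - nl x| <= (p - 1) * (2 + `|y| ^+ m + `|x| ^+ m) * `|y - x|.
  move=> x0 xy; have y0 := le_trans x0 xy; rewrite ger0_norm ?subr_ge0 ?mono//.
  rewrite (ger0_norm (_ : 0 <= y - x)) ?subr_ge0//.
  have Ey : y + (x - y) = x by ring.
  have h := pow_tangent (x - y) q1 y0; rewrite pq Ey (ger0_norm x0) (qE _ x0) (qE _ y0) in h.
  rewrite /nl (ger0_norm x0) (ger0_norm y0).
  have h2 := pow_le_nat pm y0; have xm : 0 <= x ^+ m := exprn_ge0 m x0.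
  have : (p - 1) * y `^ (p - 2) * (y - x) <= (p - 1) * (2 + y ^+ m + x ^+ m) * (y - x).
    by apply: ler_wpM2r; [rewrite subr_ge0|apply: ler_wpM2l; [exact: ltW|lra]].
  by move: h; lra.
have posneg (x y : R) : 0 <= x -> 0 <= y -> `|nl x - nl (- y)| <= (p - 1) * (2 + `|x| ^+ m + `|- y| ^+ m) * `|x - - y|.
  move=> x0 y0; rewrite opprK /nl normrN (ger0_norm x0) (ger0_norm y0) mulrN opprK.
  rewrite (ger0_norm (addr_ge0 x0 y0)).
  have hx := pow_le_nat pm x0; have hy := pow_le_nat pm y0.
  have gx : 0 <= x `^ (p - 2) by exact: powR_ge0. have gy : 0 <= y `^ (p - 2) by exact: powR_ge0.
  rewrite ger0_norm ?addr_ge0 ?mulr_ge0//.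
  have : (x `^ (p - 2) + y `^ (p - 2)) * (x + y) <= (2 + x ^+ m + y ^+ m) * (x + y).
    by apply: ler_wpM2r; [exact: addr_ge0|lra].
  have : 0 <= (2 + x ^+ m + y ^+ m) * (x + y).
    by rewrite mulr_ge0 ?addr_ge0 ?exprn_ge0.
  have := mulr_ge0 gx y0; have := mulr_ge0 gy x0; move: q1; clear; nra.
have nlN (t : R) : nl (- t) = - nl t by rewrite /nl normrN mulrN.
have sym (x y : R) : (p - 1) * (2 + `|x| ^+ m + `|y| ^+ m) * `|x - y| = (p - 1) * (2 + `|y| ^+ m + `|x| ^+ m) * `|y - x|.
  by rewrite (distrC x) addrAC.
have [a0|a0] := leP 0 a; have [b0|b0] := leP 0 b.
- have [ab|ab] := leP a b; last by apply: pospos => //; exact: ltW.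
  by rewrite sym distrC; exact: pospos.
- by rewrite -(opprK b); apply: posneg => //; rewrite oppr_ge0 ltW.
- by rewrite sym distrC -(opprK a); apply: posneg => //; rewrite oppr_ge0 ltW.
- have a1 : 0 <= - a by rewrite oppr_ge0 ltW.
  have b1 : 0 <= - b by rewrite oppr_ge0 ltW.
  have E1 : `|nl a - nl b| = `|nl (- a) - nl (- b)| by rewrite !nlN -[LHS]normrN; congr `|_|; ring.
  have E2 : `|a - b| = `|- a - - b| by rewrite -[LHS]normrN; congr `|_|; ring.
  rewrite E1 E2 -(normrN a) -(normrN b).
  have [ab|ab] := leP (- a) (- b); last by apply: pospos => //; exact: ltW.
  by rewrite sym distrC; exact: pospos.
Qed.

(** Cauchy-Schwarz twice, first splitting off one factor [w] and then separating the powers of [u]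
    from [w^2]. The factor [n2 mu w] is kept, since it is the one that small [l] makes small. *)
Lemma mixed_bound (k : nat) : exists2 C : R, 0 <= C & forall l u w, Hspace u -> Hspace w ->
  itg mu (fun x => `|u x| ^+ k.+1 * w x ^+ 2) /\
  (\int[mu]_x (`|u x| ^+ k.+1 * w x ^+ 2)) ^+ 2 <= C * Q l u ^+ k.+1 * Q l w * n2 mu w.
Proof.
have [C1 C10 h1] := @H_even R (2 * k).+1; have [C2 C20 h2] := @H_even R 1.
(* The bound is proved after squaring, where [C1 * C2] appears; [1 + C1 * C2] dominates its square
   root. *)
exists (1 + C1 * C2); first by rewrite addr_ge0// mulr_ge0.
move=> l u w hu hw; have [i1 e1] := h1 l u hu; have [i2 e2] := h2 l w hw.
have mu_ := (H_sqi hu).1; have mw := (H_sqi hw).1.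
have mA : @meas _ T2 R (fun x => u x ^+ (2 * k).+2) := measX _ mu_.
have mB : @meas _ T2 R (fun x => w x ^+ 2) := measX _ mw.
have sA : sqi mu (fun x => u x ^+ (2 * k).+2) by split.
have sB : sqi mu (fun x => w x ^+ 2) by split.
have iAB := sqi_itgM sA sB.
have q1 := Q_ge0 l hu; have q2 := Q_ge0 l hw.
have pE x : (`|u x| ^+ k.+1) ^+ 2 = u x ^+ (2 * k).+2.
  rewrite exprAC (real_normK (num_real (u x))) -exprM; congr (_ ^+ _).
  exact: mulnS.
have sF : sqi mu (fun x => `|u x| ^+ k.+1 * w x).
  split; first by apply: measM => //; apply: measX; exact: meas_norm.
  by under [X in itg _ X]eq_fun do rewrite exprMn pE.
have Fn : n2 mu (fun x => `|u x| ^+ k.+1 * w x) = \int[mu]_x (u x ^+ (2 * k).+2 * w x ^+ 2).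
  by apply: eq_Rintegral => x _; rewrite exprMn pE.
have E : (fun x => `|u x| ^+ k.+1 * w x ^+ 2) = (fun x => `|u x| ^+ k.+1 * w x * w x).
  by apply/funext => x; rewrite expr2 mulrA.
rewrite E; split; first exact: sqi_itgM sF (H_sqi hw).
apply: (le_trans (CS sF (H_sqi hw))); apply: ler_wpM2r; first exact: n2_ge0.
have D0 : 0 <= Q l u ^+ k.+1 * Q l w by rewrite mulr_ge0// exprn_ge0.
rewrite Fn -mulrA -(@ler_pXn2r _ 2)// ?nnegrE.
- apply: (le_trans (CS sA sB)).
  have n1 : n2 mu (fun x => u x ^+ (2 * k).+2) <= C1 * (Q l u ^+ k.+1) ^+ 2.
    by rewrite -exprM (_ : (k.+1 * 2 = (2 * k).+2)%N)// mulnC mulnS.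
  apply: (le_trans (ler_pM (n2_ge0 _ _) (n2_ge0 _ _) n1 e2)).
  have -> : C1 * (Q l u ^+ k.+1) ^+ 2 * (C2 * Q l w ^+ 2) = (C1 * C2) * (Q l u ^+ k.+1 * Q l w) ^+ 2 by ring.
  rewrite [leRHS]exprMn; apply: ler_wpM2r; first exact: sqr_ge0.
  by have := mulr_ge0 C10 C20; nra.
- by apply: I_ge0 => x; rewrite -pE mulr_ge0// sqr_ge0.
- by rewrite mulr_ge0// addr_ge0// mulr_ge0.
Qed.

Lemma Pf_rot (s : R) u : Hspace u -> Pf p (fun x => u (rotc s x)) = Pf p u.
Proof. by move=> hu; rewrite !PfE; exact: (mp_I (rotc_mp s) (P_itg p2 hu)). Qed.

Lemma rotc1 (s : R) : cos s ^+ 2 + sin s ^+ 2 = 1. Proof. exact: cos2Dsin2. Qed.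

Lemma H_rotc (s : R) u : Hspace u -> Hspace (fun x => u (rotc s x)).
Proof. by move=> hu; have [] := H_rot (rotc1 s) hu. Qed.

Lemma minim_rot l (s : R) u : minim p l u -> minim p l (fun x => u (rotc s x)).
Proof.
move=> [[hu Pp Pn qp qn] e1 e2 umin]; have hup := HP hu; have hun := HPN hu.
have a1 := Q_rot l (rotc1 s) hup; have a2 := Q_rot l (rotc1 s) hun.
have b1 := Pf_rot s hup; have b2 := Pf_rot s hun; have b3 := Pf_rot s hu.
rewrite /minim /adm; split; last by move=> v; rewrite b3; exact: umin.
- by rewrite b1 b2; split; [exact: H_rotc|exact: Pp|exact: Pn|rewrite a1|rewrite a2].
- by rewrite a1 b1.
- by rewrite a2 b2.
Qed.

(* For w = u o rotc phi - u one has w o rotc phi = - w, so that the flow bound controls the L2 norm of w by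
   lambda times its energy norm; the equation satisfied by w then forces w = 0 for small lambda. *)
Lemma reflection_small : exists2 lam0 : R, 0 < lam0 & forall l u (phi : R), 0 < l -> l < lam0 -> minim p l u ->
  0 <= phi -> phi <= 4 -> {ae mu, forall x, u (rotc (phi + phi) x) = u x} ->
  {ae mu, forall x, u (rotc phi x) = u x}.
Proof.
have [K K0 hK] := minim_bound p2.
pose m := (Num.truncn (p - 2)).+1.
have pm : p - 2 <= m%:R by exact: ltW (truncnS_gt _).
have [C C0 hC] := mixed_bound (Num.truncn (p - 2)).
(* [E] dominates the square root of [C * K^m], the factor in the weighted integrals. *)
pose E := 1 + C * K ^+ m.
have CK : 0 <= C * K ^+ m by rewrite mulr_ge0// exprn_ge0// ltW.
have E1 : 1 <= E by rewrite lerDl.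
have c0 : 0 < (p - 1) * (8 + 4 * E) by rewrite mulr_gt0//; lra.
(* Below 1 one has [l^2 <= l], and the second entry makes the factor in
   [Q l w <= (p - 1) (8 + 4 E) l Q l w] less than 1. *)
exists (Num.min 1 ((p - 1) * (8 + 4 * E))^-1); first by rewrite lt_min ltr01 invr_gt0.
move=> l u phi l0; rewrite lt_min => /andP[l1 lE] mu_ f0 f4 inv.
have hu : Hspace u by case: mu_ => -[].
have hr := H_rotc phi hu; have mr := minim_rot phi mu_.
pose w : R2 -> R := fun x => u (rotc phi x) - u x.
have hw : Hspace w by exact: HB.
have qw := Q_ge0 l hw.
have wrot : {ae mu, forall x, w (rotc phi x) - w x = (-2) * w x}.
  by apply: (aeS inv) => x; rewrite /w rotcD => ->; ring.
(* The flow difference of [w] is [-2 w], so 4 times its squared norm is at most phi^2 <= 16 times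
   that of [dt w], itself at most l^2 times [Q l w]. *)
have nw : n2 mu w <= 4 * l ^+ 2 * Q l w.
  have h := flow_bound f0 hw.
  rewrite (n2_ae _ _ wrot) in h; last first.
  - by apply: measM; [exact: meas_cst|exact: (H_sqi hw).1].
  - by apply: measB; [exact: (H_sqi (H_rotc phi hw)).1|exact: (H_sqi hw).1].
  rewrite (n2Z _ (H_sqi hw)) in h.
  have [_ _ _ _ hd] := Q_parts l hw; rewrite mulrC ler_pdivrMr ?exprn_gt0// in hd.
  have f2 : phi ^+ 2 <= 16 by rewrite expr2; nra.
  have dd := n2_ge0 mu (dt w).
  have : phi ^+ 2 * n2 mu (dt w) <= 16 * (Q l w * l ^+ 2) by apply: ler_pM => //; exact: sqr_ge0.
  by move: h; rewrite (_ : (-2) ^+ 2 = 4 :> R); [lra|ring].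
have nw0 := n2_ge0 mu w.
have [i1 h1] := hC l _ _ hr hw; have [i2 h2] := hC l _ _ hu hw.
rewrite -/m in i1 i2 h1 h2.
have bd v : minim p l v -> C * Q l v ^+ m * Q l w * n2 mu w <= (2 * l * E * Q l w) ^+ 2.
  move=> mv; have hv : Hspace v by case: mv => -[].
  have q1 : Q l v ^+ m <= K ^+ m by apply: lerXn2r; rewrite ?nnegrE ?(ltW K0) ?Q_ge0 ?hK.
  have -> : (2 * l * E * Q l w) ^+ 2 = E ^+ 2 * Q l w * (4 * l ^+ 2 * Q l w) by ring.
  apply: ler_pM => //.
    by apply: mulr_ge0 qw; apply: mulr_ge0 C0 _; exact: exprn_ge0 (Q_ge0 l hv).
  apply: ler_wpM2r => //; apply: (le_trans (ler_wpM2l C0 q1)).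
  by rewrite /E; clear; nra.
have root (I : R) : I ^+ 2 <= (2 * l * E * Q l w) ^+ 2 -> I <= 2 * l * E * Q l w.
  have r0 : 0 <= 2 * l * E * Q l w by rewrite !mulr_ge0//; [exact: ltW|lra].
  by move=> h; have [I0|/ltW I0] := leP 0 I; [rewrite -(@ler_pXn2r _ 2)//|exact: le_trans r0].
have I1 := root _ (le_trans h1 (bd _ mr)); have I2 := root _ (le_trans h2 (bd _ mu_)).
have n1 := itg_nl p2 hr hw; have n2_ := itg_nl p2 hu hw.
have QE : Q l w = \int[mu]_x (nl (u (rotc phi x)) * w x - nl (u x) * w x).
  rewrite /nl (IB n1.1 n2_.1) -(minim_solution p2 l0 mr hw) -(minim_solution p2 l0 mu_ hw).
  by rewrite -(ipB l hr hu hw).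
have iw : itg mu (fun x => w x ^+ 2) := (H_sqi hw).2.
have key : Q l w <= (p - 1) * (2 * n2 mu w + \int[mu]_x (`|u (rotc phi x)| ^+ m * w x ^+ 2) + \int[mu]_x (`|u x| ^+ m * w x ^+ 2)).
  rewrite QE /n2 -(IZ 2 iw) -(ID (itgZ 2 iw) i1) -(ID (itgD (itgZ 2 iw) i1) i2) -(IZ _ (itgD (itgD (itgZ 2 iw) i1) i2)).
  apply: I_le.
  - exact: itgB n1.1 n2_.1.
  - exact: itgZ (itgD (itgD (itgZ 2 iw) i1) i2).
  - move=> x; rewrite -mulrBl; apply: (le_trans (ler_norm _)); rewrite normrM.
    apply: (le_trans (ler_wpM2r (normr_ge0 (w x)) (nl_lip (u (rotc phi x)) (u x) pm))).
    rewrite le_eqVlt; apply/orP; left; apply/eqP.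
    rewrite -/(w x) -(real_normK (num_real (w x))); ring.
have q0 : Q l w = 0.
  apply/eqP; rewrite eq_le qw andbT leNgt; apply/negP => qpos.
  have : Q l w <= (p - 1) * (8 + 4 * E) * l * Q l w.
    apply: (le_trans key); rewrite -!mulrA ler_pM2l// !mulrA.
    have l2 : l ^+ 2 <= l by rewrite expr2 -[leRHS]mulr1 ler_pM2l// ltW.
    have : l ^+ 2 * Q l w <= l * Q l w by rewrite ler_wpM2r.
    move: I1 I2 nw; clear; move: (n2 mu w) (\int[mu]_x _) (\int[mu]_x _) (Q l w) => A1 A2 A3 A4; lra.
  rewrite -[X in X <= _]mul1r ler_pM2r// leNgt => /negP; apply.
  by rewrite mulrC -ltr_pdivlMr// mul1r.
have [+ _ _ _ _] := Q_parts l hw; rewrite q0 => nle.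
have n0 : n2 mu w = 0 by apply/eqP; rewrite eq_le nle.
by apply: (aeS (n2_eq0 (H_sqi hw) n0)) => x /subr0_eq.
Qed.

End SmallLambda.

(** * From invariance under dyadic angles to radial functions *)

Section Radial.
Context {R : realType}.
Local Notation M := (measurableTypeR R).
Local Notation T2 := (M * M)%type.
Local Notation R2 := (R * R)%type.
Local Notation lam := (@lebesgue_measure R).
Local Notation mu := (leb2 R).
Implicit Types u v w z : R2 -> R.

Definition rotinv u (s : R) := {ae mu, forall x, u (rotc s x) = u x}.

Lemma rotinvD u s t : rotinv u s -> rotinv u t -> rotinv u (s + t).
Proof.
move=> hs ht; have hst := mp_ae (rotc_mp t) hs.
by apply: (aeS2 hst ht) => x; rewrite rotcD => -> ->.
Qed.

Lemma rotinvN u s : rotinv u s -> rotinv u (- s).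
Proof.
move=> hs; apply: (aeS (mp_ae (rotc_mp (- s)) hs)) => x.
by rewrite rotcD subrr /rotc cos0 sin0 rot10 => <-.
Qed.

Lemma rotinvM u s n : rotinv u s -> rotinv u (n%:R * s).
Proof.
move=> hs; elim: n => [|n IH]; first by rewrite mul0r; apply: aeW => x; rewrite /rotc cos0 sin0 rot10.
by rewrite -natr1 mulrDl mul1r; exact: rotinvD.
Qed.

Lemma rotinv_2pi u : rotinv u (pi + pi).
Proof.
apply: aeW => x; have -> : rotc (pi + pi) x = x; last by [].
by rewrite /rotc cosD sinD cospi sinpi !(mulr0, mul0r) mulrNN mulr1 subr0 addr0 rot10.
Qed.

(* Invariance under the angles pi / 2^k is enough because rotations act continuously on L2. *)
Lemma rotinv_dense u : Hspace u -> (forall k : nat, rotinv u (pi / 2 ^+ k)) -> forall s, rotinv u s.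
Proof.
move=> hu h; have su := H_sqi hu.
have main s : 0 <= s -> rotinv u s.
  move=> s0; pose D := n2 mu (dt u); have D0 : 0 <= D := n2_ge0 _ _.
  have sw t : sqi mu (fun x => u (rotc t x) - u x) := sqiB (mp_sqi (rotc_mp t) su) su.
  suff n0 : n2 mu (fun x => u (rotc s x) - u x) = 0.
    by apply: (aeS (n2_eq0 (sw s) n0)) => x /subr0_eq.
  apply/eqP; rewrite eq_le n2_ge0 andbT; apply/ler_addgt0Pr => e e0; rewrite add0r.
  have X0 : 0 <= pi ^+ 2 * D by rewrite mulr_ge0// sqr_ge0.
  have [k hk] := small_pow2 X0 e0.
  have k0 : 0 < 2 ^+ k :> R by rewrite exprn_gt0.
  have f0 : 0 < pi / 2 ^+ k :> R by rewrite divr_gt0// pi_gt0.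
  have sf : 0 <= s / (pi / 2 ^+ k) by rewrite divr_ge0// ltW.
  pose n := Num.truncn (s / (pi / 2 ^+ k)); pose r := s - n%:R * (pi / 2 ^+ k).
  have r0 : 0 <= r by rewrite subr_ge0 -ler_pdivlMr// truncn_le.
  have r1 : r <= pi / 2 ^+ k.
    by rewrite lerBlDl -[X in _ <= _ + X]mul1r -mulrDl natr1 -ler_pdivrMr// ltW// truncnS_gt.
  have hn := mp_ae (rotc_mp r) (rotinvM n (h k)).
  have e1 : n2 mu (fun x => u (rotc s x) - u x) = n2 mu (fun x => u (rotc r x) - u x).
    apply: n2_ae; [exact: (sw s).1|exact: (sw r).1|].
    by apply: (aeS hn) => x; rewrite rotcD /r addrC subrK => ->.
  rewrite e1; apply: (le_trans (flow_bound r0 hu)); apply: le_trans hk.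
  have r2 : r ^+ 2 <= (pi / 2 ^+ k) ^+ 2 by rewrite lerXn2r// nnegrE ltW.
  have -> : pi ^+ 2 * D / (2 ^+ k) ^+ 2 = (pi / 2 ^+ k) ^+ 2 * D by rewrite expr_div_n mulrAC.
  exact: ler_wpM2r.
move=> s; have [/main//|/ltW s0] := leP 0 s.
by rewrite -(opprK s); apply: rotinvN; apply: main; rewrite oppr_ge0.
Qed.

Lemma angle (x y : R2) : x.1 ^+ 2 + x.2 ^+ 2 = y.1 ^+ 2 + y.2 ^+ 2 ->
  exists2 t : R, - pi <= t <= pi & y = rotc t x.
Proof.
move=> e; pose r := x.1 ^+ 2 + x.2 ^+ 2.
have r0 : 0 <= r by rewrite addr_ge0// sqr_ge0.
have pi0 : 0 <= pi :> R := pi_ge0 R.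
have [rz|rn] := eqVneq r 0.
  exists 0; first by rewrite pi0 oppr_le0 pi0.
  have z (a b : R) : a ^+ 2 + b ^+ 2 = 0 -> a = 0 /\ b = 0.
    by move/eqP; rewrite paddr_eq0 ?sqr_ge0// !sqrf_eq0 => /andP[/eqP -> /eqP ->].
  have [x1 x2] := z _ _ rz; have [y1 y2] := z y.1 y.2 (etrans (esym e) rz).
  by rewrite /rotc cos0 sin0 rot10 (surjective_pairing x) (surjective_pairing y) x1 x2 y1 y2.
pose c := (x.1 * y.1 + x.2 * y.2) / r; pose s := (x.1 * y.2 - x.2 * y.1) / r.
have rot_cs : y = (c * x.1 - s * x.2, s * x.1 + c * x.2).
  rewrite [LHS]surjective_pairing /c /s; congr (_, _); rewrite /r; field; exact: rn.
have cs : c ^+ 2 + s ^+ 2 = 1.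
  have -> : c ^+ 2 + s ^+ 2 = (r * (y.1 ^+ 2 + y.2 ^+ 2)) / r ^+ 2 by rewrite /c /s /r; field; exact: rn.
  by rewrite -e -/r -expr2 divff// expf_neq0.
have c1 : -1 <= c <= 1.
  by rewrite -ler_norml -(@ler_pXn2r _ 2)// ?nnegrE// real_normK ?num_real// expr1n -cs lerDl sqr_ge0.
have sq : Num.sqrt (1 - c ^+ 2) = `|s| by rewrite -cs addrC addKr sqrtr_sqr.
have [s0|s0] := leP 0 s.
  exists (acos c); first by rewrite (acos_lepi c1) (le_trans _ (acos_ge0 c1))// oppr_le0.
  by rewrite rotcE acosK ?in_itv// sin_acos// sq ger0_norm.
exists (- acos c); first by rewrite lerN2 (acos_lepi c1) (le_trans _ pi0)// oppr_le0 (acos_ge0 c1).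
by rewrite rotcE cosN sinN acosK ?in_itv// sin_acos// sq ltr0_norm// opprK.
Qed.

(** Fubini exchanges the null sets attached to the angles for one null set of points, off which
    invariance holds for almost every angle. Two remaining points on one circle then have rotated
    copies that coincide and carry both their values, so [g] may read the value at either. *)
Lemma radial_of_inv u : Hspace u -> (forall s, rotinv u s) -> radial u.
Proof.
move=> hu inv; have su := H_sqi hu.
have mK : @meas _ (T2 * M)%type R (fun q => u (rotc q.2 q.1) - u q.1).
  apply: measB; last by apply: measurableT_comp; [exact: su.1|exact: measurable_fst].
  apply: measurableT_comp; first exact: su.1.
  by have := measurableT_comp rotc_meas (@measurable_swap _ _ T2 M).
have sw t : sqi mu (fun x => u (rotc t x) - u x) := sqiB (mp_sqi (rotc_mp t) su) su.
have n0 t : n2 mu (fun x => u (rotc t x) - u x) = 0.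
  have e0 : {ae mu, forall x, u (rotc t x) - u x = 0} by apply: (aeS (inv t)) => x ->; rewrite subrr.
  rewrite (n2_ae (sw t).1 (@meas_cst _ T2 R 0) e0).
  by rewrite /n2; under eq_Rintegral do rewrite expr0n; rewrite I0.
have iF : itg (leb2s \x lam)%E (fun q : T2 * M => (u (rotc q.2 q.1) - u q.1) ^+ 2).
  apply: (@itg_prod _ _ _ T2 M leb2s lam _ (fun=> 0)).
  - exact: measX mK.
  - by move=> s; exact: (sw s).2.
  - exact: itg0.
  - move=> s /=; under eq_Rintegral do rewrite ger0_norm ?sqr_ge0//.
    by have := n0 s; rewrite /n2 => ->.
have [a1 a2 i1 i2 e12] := FubR iF.
have z0 : \int[leb2s]_x \int[lam]_y (u (rotc y x) - u x) ^+ 2 = 0.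
  rewrite e12 /= -[RHS](I0 lam); apply: eq_Rintegral => s _; exact: n0.
have z1 := I_eq0_ae i1 (fun x => I_ge0 lam (fun y => sqr_ge0 (u (rotc y x) - u x))) z0.
have A : {ae mu, forall x, {ae lam, forall s : M, u (rotc s x) = u x}}.
  apply: (aeS2 a1 z1) => x ix zx; apply: (aeS (I_eq0_ae ix (fun y => sqr_ge0 (u (rotc y x) - u x)) zx)) => s /eqP.
  by rewrite sqrf_eq0 subr_eq0 => /eqP.
have eq x y : {ae lam, forall s : M, u (rotc s x) = u x} -> {ae lam, forall s : M, u (rotc s y) = u y} ->
    x.1 ^+ 2 + x.2 ^+ 2 = y.1 ^+ 2 + y.2 ^+ 2 -> u x = u y.
  move=> hx hy /angle[t _ yE].
  have hx' := mp_ae (mpres_shift t) hx.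
  have [s [h1 h2]] : exists s : M, u (rotc (s + t) x) = u x /\ u (rotc s y) = u y.
    apply: contrapT => no.
    have := ae_and hx' hy => -[N [mN N0 sub]].
    have : lam (`[0, 1]%classic : set M) = 0%E.
      apply/eqP; rewrite -measure_le0 -N0; apply: le_measure; rewrite ?inE//.
      by move=> s _; apply: sub => /= h; apply: no; exists s.
    rewrite lebesgue_measure_itv/= lte_fin ltr01 => /eqP; by rewrite -EFinD subr0 eqe oner_eq0.
  by rewrite -h1 -h2 yE rotcD.
pose P x := {ae lam, forall s : M, u (rotc s x) = u x}.
pose g (r : R) : R := if pselect (exists x, P x /\ Num.sqrt (x.1 ^+ 2 + x.2 ^+ 2) = r) is left h then u (sval (cid h)) else 0.
exists g; apply: (aeS A) => x hx; rewrite /g; case: pselect => [h|[]]; last by exists x.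
case: (cid h) => y /= [hy e]; apply: eq => //.
by apply/eqP; rewrite -(@eqr_sqrt R) ?addr_ge0 ?sqr_ge0// e.
Qed.

Variable p : R.
Hypothesis p2 : 2 < p.

(** The reflection argument halves the period: it starts from the full turn with [phi = pi], for
    which the bound 4 on the angle leaves room, and descends to pi / 2^k. *)
Lemma small_radial : exists2 lam0 : R, 0 < lam0 & forall l u, 0 < l -> l < lam0 -> minim p l u -> radial u.
Proof.
have [l0 l00 hl] := reflection_small p2; exists l0 => // l u lp ll mu_.
have hu : Hspace u by case: mu_ => -[].
apply: (radial_of_inv hu); apply: (rotinv_dense hu) => k.
have pi4 : pi <= 4 :> R by have [/andP[_]] := pihalf_02_cos_pihalf R; lra.
have half (j : nat) : pi / 2 ^+ j.+1 + pi / 2 ^+ j.+1 = pi / 2 ^+ j :> R.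
  by rewrite exprS; field; rewrite expf_neq0.
have small (j : nat) : pi / 2 ^+ j <= 4 :> R.
  apply: le_trans pi4; rewrite ler_pdivrMr ?exprn_gt0// ler_peMr ?pi_ge0// exprn_ege1 ?ler1n//.
have ge (j : nat) : 0 <= pi / 2 ^+ j :> R by rewrite divr_ge0 ?pi_ge0// exprn_ge0.
elim: k => [|k IH].
  by apply: (hl l u) => //; rewrite expr0 divr1; exact: rotinv_2pi.
by apply: (hl l u) => //; rewrite half.
Qed.

End Radial.

(** * Symmetry breaking for large lambda *)

Section Calculus.
Context {R : realType}.
Local Notation M := (measurableTypeR R).
Local Notation T2 := (M * M)%type.
Local Notation R2 := (R * R)%type.
Local Notation mu := (leb2 R).
Implicit Types u v w : R2 -> R.

Lemma trl_mp (a : R2) : @mpres _ T2 R mu (trl a).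
Proof. exact: mpres_translate. Qed.

(** A translation changes the angular derivative by a combination of the partial derivatives with
    constant coefficients, so H is stable. Of the forms [Q l], the invariant one is [Q 0]. *)
Lemma H_trl (a : R2) u : Hspace u -> [/\ Hspace (fun x => u (trl a x)),
  {ae mu, forall x, d1 (fun x => u (trl a x)) x = d1 u (trl a x)} &
  {ae mu, forall x, d2 (fun x => u (trl a x)) x = d2 u (trl a x)}].
Proof.
move=> hu; have mr := trl_mp a.
have E : TH (fun x => d1 u (trl a x)) (fun x => d2 u (trl a x)) =
    (fun x => dt u (trl a x) + (- a.1 * d2 u (trl a x) + a.2 * d1 u (trl a x))).
  by apply/funext => x; rewrite /TH !dtxE /trl /=; ring.
have [] := @HI R (fun x => u (trl a x)) (fun x => d1 u (trl a x)) (fun x => d2 u (trl a x)); try by [].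
- exact: (mp_sqi mr (H_sqi hu)).
- exact: wd_trl (H_wd1 hu).
- exact: wd_trl (H_wd2 hu).
- exact: (mp_sqi mr (H_d1 hu)).
- exact: (mp_sqi mr (H_d2 hu)).
- rewrite E; exact: (sqiD (mp_sqi mr (H_dth hu)) (sqiD (sqiZ (- a.1) (mp_sqi mr (H_d2 hu))) (sqiZ a.2 (mp_sqi mr (H_d1 hu))))).
Qed.

Lemma Q0E u : Hspace u -> Q 0 u = n2 mu (d1 u) + n2 mu (d2 u) + n2 mu u.
Proof. by move=> hu; rewrite QE// expr0n/= invr0 mul0r addr0. Qed.

Lemma QlE l u : Hspace u -> Q l u = Q 0 u + (l ^+ 2)^-1 * n2 mu (dt u).
Proof. by move=> hu; rewrite Q0E// QE//; ring. Qed.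

Lemma Q_trl (a : R2) u : Hspace u -> Q 0 (fun x => u (trl a x)) = Q 0 u.
Proof.
move=> hu; have [ht a1 a2] := H_trl a hu; have mr := trl_mp a.
rewrite !Q0E//; congr (_ + _ + _).
- rewrite -(mp_n2 mr (H_d1 hu)); exact: (n2_ae (H_d1 ht).1 (mp_sqi mr (H_d1 hu)).1 a1).
- rewrite -(mp_n2 mr (H_d2 hu)); exact: (n2_ae (H_d2 ht).1 (mp_sqi mr (H_d2 hu)).1 a2).
- exact: (mp_n2 mr (H_sqi hu)).
Qed.

(** The bounds concern the half-line containing the values of [u]; [|F s| <= N * s] makes the
    composition square integrable. *)
Lemma H_chain (F dF : R -> R) (L N : R) u : 0 <= L ->
  (forall s t, 0 <= s -> 0 <= t -> `|F t - F s - dF s * (t - s)| <= L * (t - s) ^+ 2) ->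
  (forall s t, 0 <= s -> 0 <= t -> `|dF t - dF s| <= L * `|t - s|) ->
  @meas _ M R F -> @meas _ M R dF -> (forall s, 0 <= s -> `|F s| <= N * s) -> (forall s, 0 <= s -> `|dF s| <= N) ->
  Hspace u -> (forall x, 0 <= u x) ->
  [/\ Hspace (fun x => F (u x)), {ae mu, forall x, d1 (fun x => F (u x)) x = dF (u x) * d1 u x},
   {ae mu, forall x, d2 (fun x => F (u x)) x = dF (u x) * d2 u x} &
   {ae mu, forall x, dt (fun x => F (u x)) x = dF (u x) * dt u x}].
Proof.
move=> L0 h1 h2 mF mdF FN dFN hu u0; have mu_ := (H_sqi hu).1.
have mFu : @meas _ T2 R (fun x => F (u x)) := measurableT_comp mF mu_.
have mdFu : @meas _ T2 R (fun x => dF (u x)) := measurableT_comp mdF mu_.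
have b x : `|dF (u x)| <= N := dFN _ (u0 x).
have sF : sqi mu (fun x => F (u x)).
  apply: (sqi_le mFu (sqiZ N (H_sqi hu))) => x; apply: (le_trans (FN _ (u0 x))); exact: ler_norm.
have s1 := sqiMb mdFu b (H_d1 hu); have s2 := sqiMb mdFu b (H_d2 hu); have s3 := sqiMb mdFu b (H_dth hu).
have E : TH (fun x => dF (u x) * d1 u x) (fun x => dF (u x) * d2 u x) = (fun x => dF (u x) * dt u x).
  by apply/funext => x; rewrite /TH !dtxE; ring.
have := @HI R (fun x => F (u x)) (fun x => dF (u x) * d1 u x) (fun x => dF (u x) * d2 u x); rewrite E; apply => //.
- apply: (@wd_chain R [set t | 0 <= t] F dF L axis1 _ _ _ _ L0 h1 h2 mF mdF u0 (H_wd1 hu) (sqi_locint sF) (sqi_locint s1)).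
    by left.
  exact: closed_ge.
- apply: (@wd_chain R [set t | 0 <= t] F dF L axis2 _ _ _ _ L0 h1 h2 mF mdF u0 (H_wd2 hu) (sqi_locint sF) (sqi_locint s2)).
    by right.
  exact: closed_ge.
Qed.

Lemma H_mul_eta k v : 0 < k -> Hspace v -> [/\ Hspace (fun x => eta k x * v x),
  {ae mu, forall x, d1 (fun x => eta k x * v x) x = eta k x * d1 v x + v x * (eta' k x * x.1)},
  {ae mu, forall x, d2 (fun x => eta k x * v x) x = eta k x * d2 v x + v x * (eta' k x * x.2)} &
  {ae mu, forall x, dt (fun x => eta k x * v x) x = eta k x * dt v x}].
Proof.
move=> k0 hv; have [w1 w2] := wd_eta k0; have [me me'] := meas_eta k.
have be x : `|eta k x| <= 1 by rewrite ger0_norm ?eta_ge0//; exact: eta_le1.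
have b1 (x : T2) : `|eta' k x * x.1| <= 4 / k by rewrite normrM; exact: (eta'_le k0 x).1.
have b2 (x : T2) : `|eta' k x * x.2| <= 4 / k by rewrite normrM; exact: (eta'_le k0 x).2.
have m1 : @meas _ T2 R (fun x => eta' k x * x.1) := measM me' meas_x1.
have m2 : @meas _ T2 R (fun x => eta' k x * x.2) := measM me' meas_x2.
have s0 := sqiMb me be (H_sqi hv).
have mulC (f g : R2 -> R) : (fun x => f x * g x) = (fun x => g x * f x) by apply/funext => x; rewrite mulrC.
have s1 : sqi mu (fun x => eta k x * d1 v x + v x * (eta' k x * x.1)).
  by apply: (sqiD (sqiMb me be (H_d1 hv))); rewrite mulC; exact: (sqiMb m1 b1 (H_sqi hv)).
have s2 : sqi mu (fun x => eta k x * d2 v x + v x * (eta' k x * x.2)).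
  by apply: (sqiD (sqiMb me be (H_d2 hv))); rewrite mulC; exact: (sqiMb m2 b2 (H_sqi hv)).
have s3 := sqiMb me be (H_dth hv).
have E : TH (fun x => eta k x * d1 v x + v x * (eta' k x * x.1)) (fun x => eta k x * d2 v x + v x * (eta' k x * x.2)) =
   (fun x => eta k x * dt v x) by apply/funext => x; rewrite /TH dtxE; ring.
have := @HI R (fun x => eta k x * v x) _ _ s0 _ _ s1 s2; rewrite E; apply => //.
- by apply: (wd_prod _ w1 (H_wd1 hv) (sqi_locint s0) (sqi_locint s1)); left.
- by apply: (wd_prod _ w2 (H_wd2 hv) (sqi_locint s0) (sqi_locint s2)); right.
Qed.

Lemma eta_lim (f : R2 -> R) (e : R) : sqi mu f -> 0 < e -> exists N, forall n, (N <= n)%N ->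
  n2 mu (fun x => eta n.+1%:R x * f x - f x) <= e.
Proof.
move=> sf e0; have mf2 : @meas _ T2 R (fun x => f x ^+ 2) := measX _ sf.1.
have me n : @meas _ T2 R (eta n.+1%:R) := (meas_eta _).1.
pose F n x := (eta n.+1%:R x * f x - f x) ^+ 2.
have FE n x : F n x = (1 - eta n.+1%:R x) ^+ 2 * f x ^+ 2 by rewrite /F; ring.
have mF n : @meas _ T2 R (F n) := measX _ (measB (measM (me n) sf.1) sf.1).
have lim x : F ^~ x @ \oo --> (0 : R).
  apply: cvg0_le => [n|r r0]; first exact: sqr_ge0.
  have c0 : 0 <= 2 * rsq x * f x ^+ 2 by exact: (mulr_ge0 (mulr_ge0 (ler0n _ 2) (rsq_ge0 x)) (sqr_ge0 _)).
  exists (Num.truncn ((2 * rsq x * f x ^+ 2) / r)) => n Nn.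
  have n0 : 0 < n.+1%:R :> R by [].
  have n1 : 1 <= n.+1%:R :> R by rewrite ler1n.
  have hn : 2 * rsq x * f x ^+ 2 / n.+1%:R <= r.
    rewrite ler_pdivrMr// [leRHS]mulrC -ler_pdivrMr//; apply: (le_trans (ltW (truncnS_gt _))).
    by rewrite ler_nat ltnS.
  apply: le_trans hn; rewrite FE [leRHS]mulrAC; apply: ler_wpM2r; first exact: sqr_ge0.
  have g0 := eta_ge0 n.+1%:R x; have g1 := eta_le1 n.+1%:R x.
  have : 1 - eta n.+1%:R x <= 2 * rsq x / n.+1%:R.
    have q0 : 0 <= rsq x / n.+1%:R ^+ 2 by rewrite divr_ge0 ?rsq_ge0// sqr_ge0.
    have q1 : rsq x / n.+1%:R ^+ 2 <= rsq x / n.+1%:R.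
      by rewrite ler_wpM2l ?rsq_ge0// lef_pV2 ?posrE ?exprn_gt0// expr2 ler_peMr// ltW.
    move: q0 q1; rewrite -mulrA /eta; clear.
    move: (rsq x / n.+1%:R ^+ 2) (rsq x / n.+1%:R) => A B.
    by case: (pos_cases (1 - A)) => -[h ->]; rewrite ?expr0n/=; nra.
  by move: g0 g1; clear; move: (2 * rsq x / _) (eta _ x) => A B; nra.
have aL : {ae mu, forall x, F ^~ x @ \oo --> (0 : R)} by apply: aeW => x; exact: lim.
have bF : {ae mu, forall x, forall n, `|F n x| <= f x ^+ 2}.
  apply: aeW => x n; rewrite ger0_norm ?sqr_ge0// FE -[leRHS]mul1r ler_wpM2r ?sqr_ge0//.
  have g0 := eta_ge0 n.+1%:R x; have g1 := eta_le1 n.+1%:R x; nra.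
have [_] := @itg_DCT _ T2 R mu F (fun=> 0) (fun x => f x ^+ 2) mF (@meas_cst _ T2 R 0) sf.2 aL bF.
rewrite I0 => /cvgrPdist_le /(_ e e0) [N _ hN]; exists N => n /hN /=.
by rewrite sub0r normrN; apply: le_trans; exact: ler_norm.
Qed.

(** Cutoffs make compactly supported functions dense for [Q 0], the partial derivatives of the
    cutoff being at most 4 / k. *)
Lemma eta_approx v (e : R) : Hspace v -> 0 < e -> exists2 k : R, 0 < k &
  Q 0 (fun x => eta k x * v x - v x) <= e.
Proof.
move=> hv e0; have e8 : 0 < e / 16 by rewrite divr_gt0.
have [N1 h1] := eta_lim (H_d1 hv) e8; have [N2 h2] := eta_lim (H_d2 hv) e8.
have [N3 h3] := eta_lim (H_sqi hv) e8.
pose B := n2 mu v; have B0 : 0 <= B := n2_ge0 _ _.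
pose n := maxn (maxn N1 N2) (maxn N3 (Num.truncn (64 * (1 + B) / (e / 16)))).
have {}h1 := h1 n (leq_trans (leq_maxl _ _) (leq_maxl _ _)).
have {}h2 := h2 n (leq_trans (leq_maxr _ _) (leq_maxl _ _)).
have {}h3 := h3 n (leq_trans (leq_maxl _ _) (leq_maxr _ _)).
have k0 : 0 < n.+1%:R :> R by [].
exists n.+1%:R => //; have [hk a1 a2 _] := H_mul_eta k0 hv; have [me me'] := @meas_eta R n.+1%:R.
have be (x : T2) : `|eta n.+1%:R x| <= 1 by rewrite ger0_norm ?eta_ge0//; exact: eta_le1.
have b1 (x : T2) : `|eta' n.+1%:R x * x.1| <= 4 / n.+1%:R by rewrite normrM; exact: (eta'_le k0 x).1.
have b2 (x : T2) : `|eta' n.+1%:R x * x.2| <= 4 / n.+1%:R by rewrite normrM; exact: (eta'_le k0 x).2.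
have m1 : @meas _ T2 R (fun x => eta' n.+1%:R x * x.1) := measM me' meas_x1.
have m2 : @meas _ T2 R (fun x => eta' n.+1%:R x * x.2) := measM me' meas_x2.
have small (i : R2 -> R) : @meas _ T2 R (fun x => eta' n.+1%:R x * i x) ->
    (forall x : T2, `|eta' n.+1%:R x * i x| <= 4 / n.+1%:R) ->
    sqi mu (fun x => eta' n.+1%:R x * i x * v x) /\ n2 mu (fun x => eta' n.+1%:R x * i x * v x) <= e / 16.
  move=> mi bi; have si := sqiMb mi bi (H_sqi hv); split => //.
  have : n2 mu (fun x => eta' n.+1%:R x * i x * v x) <= n2 mu (fun x => 4 / n.+1%:R * v x).
    apply: n2_le; [exact: si.1|exact: sqiZ (H_sqi hv)|move=> x].
    by rewrite [leLHS]normrM [leRHS]normrM; apply: ler_wpM2r => //; apply: (le_trans (bi x)); exact: ler_norm.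
  move=> h; apply: (le_trans h); rewrite (n2Z _ (H_sqi hv)) -/B.
  have n1 : 1 <= n.+1%:R :> R by rewrite ler1n.
  have : 64 * (1 + B) / (e / 16) <= n.+1%:R.
    apply: (le_trans (ltW (truncnS_gt _))); rewrite ler_nat ltnS.
    exact: leq_trans (leq_maxr _ _) (leq_maxr _ _).
  rewrite ler_pdivrMr// => hn.
  have -> : (4 / n.+1%:R) ^+ 2 * B = 16 * B / n.+1%:R ^+ 2 by rewrite expr_div_n; ring.
  rewrite ler_pdivrMr ?exprn_gt0//; apply: (@le_trans _ _ (n.+1%:R * (e / 16))); first by lra.
  by rewrite mulrC ler_pM2l// expr2 ler_peMr.
have [t1 q1] := small (fun x => x.1) m1 b1; have [t2 q2] := small (fun x => x.2) m2 b2.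
have g1 := sqiB (sqiMb me be (H_d1 hv)) (H_d1 hv); have g2 := sqiB (sqiMb me be (H_d2 hv)) (H_d2 hv).
rewrite (QBE 0 hk hv) expr0n/= invr0 mul0r addr0.
have k1 : n2 mu (fun x => d1 (fun x => eta n.+1%:R x * v x) x - d1 v x) <= 2 * (e / 16) + 2 * (e / 16).
  rewrite (@n2_ae _ _ _ mu _ (fun x => (eta n.+1%:R x * d1 v x - d1 v x) + eta' n.+1%:R x * x.1 * v x)).
  - apply: (le_trans (n2D_le g1 t1)); move: h1 q1; clear; lra.
  - exact: (sqiB (H_d1 hk) (H_d1 hv)).1.
  - exact: (sqiD g1 t1).1.
  - by apply: (aeS a1) => x ->; ring.
have k2 : n2 mu (fun x => d2 (fun x => eta n.+1%:R x * v x) x - d2 v x) <= 2 * (e / 16) + 2 * (e / 16).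
  rewrite (@n2_ae _ _ _ mu _ (fun x => (eta n.+1%:R x * d2 v x - d2 v x) + eta' n.+1%:R x * x.2 * v x)).
  - apply: (le_trans (n2D_le g2 t2)); move: h2 q2; clear; lra.
  - exact: (sqiB (H_d2 hk) (H_d2 hv)).1.
  - exact: (sqiD g2 t2).1.
  - by apply: (aeS a2) => x ->; ring.
by move: k1 k2 h3; lra.
Qed.

End Calculus.

(** * Reciprocals and logarithms in H *)

Section Logarithm.
Context {R : realType}.
Local Notation M := (measurableTypeR R).
Local Notation R2 := (R * R)%type.
Local Notation mu := (leb2 R).
Implicit Types u v w : R2 -> R.

Lemma meas_inv d (T : measurableType d) (f : T -> R) : meas f -> meas (fun x => (f x)^-1).
Proof.
move=> mf; have -> : (fun x => (f x)^-1) = (fun x => f x * (f x ^+ 2) `^ (-1)).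
  apply/funext => x; rewrite powR_inv1 ?sqr_ge0//; have [->|fx] := eqVneq (f x) 0.
    by rewrite mul0r invr0.
  by field.
by apply: measM => //; apply: meas_powR; exact: measX.
Qed.

Variable e : R.
Hypothesis e0 : 0 < e.
Let i := e^-1.
Let i0 : 0 < i. Proof. by rewrite invr_gt0. Qed.
Let r (t : R) := (t + e)^-1.

Let r_gt0 t : 0 <= t -> 0 < r t. Proof. by move=> t0; rewrite invr_gt0 ltr_wpDl. Qed.
Let r_le t : 0 <= t -> r t <= i.
Proof. by move=> t0; rewrite lef_pV2 ?posrE ?ltr_wpDl// lerDr. Qed.
Let r_sub s t : 0 <= s -> 0 <= t -> r s - r t = (t - s) * (r s * r t).
Proof. by move=> s0 t0; rewrite /r; field; rewrite !gt_eqF ?ltr_wpDl. Qed.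
Let r_mul s t : 0 <= s -> 0 <= t -> 0 <= r s * r t <= i ^+ 2.
Proof.
move=> s0 t0; have := r_gt0 s0; have := r_gt0 t0; have := r_le s0; have := r_le t0.
by move: (r s) (r t) => a b; move=> *; apply/andP; split; nra.
Qed.
Let meas_r : @meas _ M R r.
Proof. by apply: meas_inv; apply: measD; [exact: measurable_id|exact: meas_cst]. Qed.

(** Subtracting 1 / e, the value at u = 0, makes the reciprocal square integrable. *)
Lemma H_recip u : Hspace u -> (forall x, 0 <= u x) -> [/\ Hspace (fun x => (u x + e)^-1 - e^-1),
   {ae mu, forall x, d1 (fun x => (u x + e)^-1 - e^-1) x = - (u x + e)^-1 ^+ 2 * d1 u x} &
   {ae mu, forall x, d2 (fun x => (u x + e)^-1 - e^-1) x = - (u x + e)^-1 ^+ 2 * d2 u x}].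
Proof.
move=> hu u0.
have [] := @H_chain R (fun t => r t - i) (fun t => - r t ^+ 2) (2 * i ^+ 3) (i ^+ 2) u; try by [].
- by rewrite mulr_ge0// exprn_ge0// ltW.
- move=> s t s0 t0.
  have -> : r t - i - (r s - i) - - r s ^+ 2 * (t - s) = (r s ^+ 2 * r t) * (t - s) ^+ 2.
    by rewrite /r; field; rewrite !gt_eqF ?ltr_wpDl.
  have a0 := r_gt0 s0; have b0 := r_gt0 t0; have a1 := r_le s0; have b1 := r_le t0.
  have nn : 0 <= r s ^+ 2 * r t := mulr_ge0 (sqr_ge0 _) (ltW b0).
  rewrite (ger0_norm (mulr_ge0 nn (sqr_ge0 (t - s)))); apply: ler_wpM2r; first exact: sqr_ge0.
  have /andP[p0 p1] := r_mul s0 s0; rewrite -expr2 in p0 p1.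
  have : r s ^+ 2 * r t <= i ^+ 2 * i by apply: ler_pM => //; exact: ltW.
  by rewrite -exprSr => h; apply: (le_trans h); rewrite ler_peMl ?exprn_ge0 ?ltW// ltr1n.
- move=> s t s0 t0.
  have -> : - r t ^+ 2 - - r s ^+ 2 = (r s * r t) * (r s + r t) * (t - s).
    by rewrite /r; field; rewrite !gt_eqF ?ltr_wpDl.
  have a0 := r_gt0 s0; have b0 := r_gt0 t0; have a1 := r_le s0; have b1 := r_le t0.
  have /andP[p0 p1] := r_mul s0 t0.
  rewrite normrM ger0_norm ?mulr_ge0 ?addr_ge0 ?(ltW a0) ?(ltW b0)//; apply: ler_wpM2r => //.
  have : r s * r t * (r s + r t) <= i ^+ 2 * (i + i) by apply: ler_pM => //; [rewrite addr_ge0// ltW|exact: lerD].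
  by rewrite (_ : i ^+ 2 * (i + i) = 2 * i ^+ 3)//; ring.
- by apply: measB; [exact: meas_r|exact: meas_cst].
- by apply: measN; exact: measX meas_r.
- move=> s s0; have -> : r s - i = - s * (r s * i) by rewrite /r /i; field; rewrite !gt_eqF ?ltr_wpDl.
  have a0 := r_gt0 s0; have a1 := r_le s0.
  rewrite normrM normrN (ger0_norm s0) ger0_norm ?mulr_ge0 ?(ltW a0) ?(ltW i0)// mulrC.
  by apply: ler_wpM2r => //; rewrite expr2 ler_pM2r.
- move=> s s0; have /andP[p0 p1] := r_mul s0 s0; rewrite -expr2 in p0 p1.
  by rewrite normrN ger0_norm.
Qed.

(** The normalisation makes the logarithm vanish with [u]. Its quadratic tangent bound comes from
    [ln x <= x - 1] applied to the quotient of two values and to its inverse. *)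
Lemma H_log u : Hspace u -> (forall x, 0 <= u x) -> [/\ Hspace (fun x => ln (1 + u x / e)),
   {ae mu, forall x, d1 (fun x => ln (1 + u x / e)) x = (u x + e)^-1 * d1 u x} &
   {ae mu, forall x, d2 (fun x => ln (1 + u x / e)) x = (u x + e)^-1 * d2 u x}].
Proof.
move=> hu u0.
have lnle (x : R) : 0 < x -> ln x <= x - 1.
  move=> x0; have := @le_ln1Dx R (x - 1); rewrite (_ : 1 + (x - 1) = x); last by ring.
  by apply; move: x0; lra.
have q0 (s : R) : 0 <= s -> 0 < 1 + s / e by move=> s0; rewrite ltr_wpDr// divr_ge0// ltW.
have [] := @H_chain R (fun t => ln (1 + t / e)) r (i ^+ 2) i u; try by [].
- by rewrite exprn_ge0// ltW.
- move=> s t s0 t0; have a0 := r_gt0 s0; have b0 := r_gt0 t0.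
  have pa := q0 s s0; have pb := q0 t t0.
  have es : 1 + s / e = (s + e) * i by rewrite /i; field; rewrite gt_eqF.
  have et : 1 + t / e = (t + e) * i by rewrite /i; field; rewrite gt_eqF.
  have h1 := lnle _ (divr_gt0 pb pa); have h2 := lnle _ (divr_gt0 pa pb).
  rewrite !ln_div ?posrE// in h1 h2.
  have E1 : (1 + t / e) / (1 + s / e) - 1 = (t - s) * r s.
    by rewrite es et /r /i; field; rewrite !gt_eqF ?ltr_wpDl.
  have E2 : (1 + s / e) / (1 + t / e) - 1 = (s - t) * r t.
    by rewrite es et /r /i; field; rewrite !gt_eqF ?ltr_wpDl.
  rewrite E1 in h1; rewrite E2 in h2.
  have rs := r_sub s0 t0; have /andP[p0 p1] := r_mul s0 t0.
  have : (t - s) ^+ 2 * (r s * r t) <= (t - s) ^+ 2 * i ^+ 2 by apply: ler_wpM2l => //; exact: sqr_ge0.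
  have -> : (t - s) ^+ 2 * (r s * r t) = (t - s) * (r s - r t) by rewrite rs; ring.
  move: (sqr_ge0 ((t - s) * i)); rewrite exprMn ler_norml.
  move: h1 h2; clear; move: (ln _) (ln _) (r s) (r t) => A B C D h1 h2 h3 h4; apply/andP; split; lra.
- move=> s t s0 t0; rewrite (r_sub t0 s0) normrM mulrC distrC; have /andP[p0 p1] := r_mul t0 s0.
  by apply: ler_wpM2r => //; rewrite ger0_norm.
- have m1 : @meas _ M R (fun t : R => 1 + t / e).
    by apply: measD; [exact: meas_cst|apply: measM; [exact: measurable_id|exact: meas_cst]].
  exact: (measurableT_comp (@measurable_ln R) m1).
- move=> s s0; have pa := q0 s s0; have := lnle _ pa; rewrite ger0_norm.
    by move=> h; apply: (le_trans h); rewrite addrAC subrr add0r mulrC.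
  by apply: ln_ge0; rewrite lerDl divr_ge0// ltW.
- by move=> s s0; rewrite ger0_norm ?r_le// ltW// r_gt0.
Qed.

End Logarithm.

Section Arithmetic.
Context {R : realType}.
Implicit Types a b : R.

Lemma half_le a b : 2 * a <= b + b -> a <= b. Proof. lra. Qed.

Lemma shift_disj (K x : R) : 0 < K -> x + (2 * K + 1) <= K -> - K <= x - (2 * K + 1) -> False.
Proof. lra. Qed.

(** The integrand of the test with eta^2 / (w + e): [n] is eta with gradient (n1, n2), (x1, x2) is
    the gradient of w, [W] is w, [r] is 1 / (w + e) and [i] is 1 / e. Completing two squares absorbs
    the mixed terms. *)
Lemma test_pointwise (n n1 n2 x1 x2 W r i : R) : n ^+ 2 * (W * r) <= n ^+ 2 ->
  0 <= (2 * n1 - n * r * x1) ^+ 2 -> 0 <= (2 * n2 - n * r * x2) ^+ 2 ->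
  x1 * (n * (i * n1 + (n * (- r ^+ 2 * x1) + (r - i) * n1)) + n * r * n1) +
  x2 * (n * (i * n2 + (n * (- r ^+ 2 * x2) + (r - i) * n2)) + n * r * n2) + W * (n * (n * r)) <=
  2 * n1 ^+ 2 + 2 * n2 ^+ 2 + n ^+ 2 - 2^-1 * ((n * r * x1) ^+ 2 + (n * r * x2) ^+ 2).
Proof. lra. Qed.

Lemma pos_quarter b : b <= 2^-1 -> 4^-1 <= pos (1 - b) ^+ 2.
Proof. by move=> hb; rewrite /pos max_l; nra. Qed.

Lemma sq_quarter b : 4^-1 <= b -> 1 <= 16 * b ^+ 2. Proof. rewrite expr2; nra. Qed.

Lemma sq_split a b : a ^+ 2 <= 2 * (a - b) ^+ 2 + 2 * b ^+ 2.
Proof. by have := sqr_ge0 (a - 2 * b); lra. Qed.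

End Arithmetic.

(** * An optimal part cannot vanish on a set of positive measure *)

Section Nonradial.
Context {R : realType}.
Local Notation M := (measurableTypeR R).
Local Notation T2 := (M * M)%type.
Local Notation R2 := (R * R)%type.
Local Notation mu := (leb2 R).
Variable p : R.
Hypothesis p2 : 2 < p.
Let p0 : 0 < p. Proof. exact: lt_trans p2. Qed.
Let p20 : 0 < p - 2. Proof. by rewrite subr_gt0. Qed.
Implicit Types u v w phi : R2 -> R.

(** These play the two parts of a radial minimiser, [w] being one whose [Pf] is not the larger;
    [opt] says that no [l] allows an admissible level below twice that value. *)
Variables w w' : R2 -> R.
Hypotheses (hw : Hspace w) (hw' : Hspace w') (w0 : forall x, 0 <= w x) (w'0 : forall x, 0 <= w' x).
Hypotheses (ww' : forall x, w x * w' x = 0) (Pw : 0 < Pf p w) (Pw' : 0 < Pf p w').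
Let A := Pf p w.
Hypotheses (QA : Q 0 w = A) (opt : forall l v, 0 < l -> adm p l v -> 2 * A <= Pf p v).

Let A0 : 0 < A. Proof. exact: Pw. Qed.

(* As lambda tends to infinity, translates of [v] and [- v] placed far apart along the first axis become
   admissible competitors. *)
Lemma two_bump K v : 0 < K -> Hspace v -> (forall x, 0 <= v x) -> (forall x, ~ sq K x -> v x = 0) ->
  0 < Pf p v -> A `^ (p - 2) * Pf p v ^+ 2 <= Q 0 v `^ p.
Proof.
move=> K0 hv v0 vK; set P := Pf p v => P0; rewrite leNgt; apply/negP => hlt.
(* The claim compares [Q 0 v] with [T^(1/p)]; if it fails there is a gap, half of which, [e], is
   left for the angular term. *)
pose T := A `^ (p - 2) * P ^+ 2; have T0 : 0 < T by rewrite mulr_gt0 ?powR_gt0 ?exprn_gt0.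
have q0 : 0 <= Q 0 v := Q_ge0 0 hv.
have Tp : (T `^ p^-1) `^ p = T by rewrite -powRrM mulVf ?gt_eqF// powRr1// ltW.
have qT : Q 0 v < T `^ p^-1.
  rewrite ltNge; apply/negP => h; move: hlt; rewrite ltNge -/T -Tp => /negP; apply.
  by apply: ge0_ler_powR; rewrite ?nnegrE ?powR_ge0// ltW.
pose e := (T `^ p^-1 - Q 0 v) / 2; have e0 : 0 < e by rewrite divr_gt0// subr_gt0.
pose q := Q 0 v + e; have qpos : 0 < q by rewrite ltr_wpDl.
have qpT : q `^ p < T.
  rewrite -Tp; apply: gt0_ltr_powR; rewrite ?nnegrE ?powR_ge0 ?(ltW qpos)//.
  by rewrite /q /e; move: qT; lra.
(* The dilation at which a function with [Q = q] and [Pf = P] meets the Nehari set; [Q <= q] then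
   gives the Nehari inequality. *)
pose s := (q / P) `^ (p - 2)^-1.
have s0 : 0 < s by apply: powR_gt0; rewrite divr_gt0.
have sp : s `^ (p - 2) = q / P by rewrite -powRrM mulVf ?gt_eqF// powRr1// divr_ge0 ?ltW.
have spp : s `^ p * P = s ^+ 2 * q.
  have -> : s `^ p = s ^+ 2 * s `^ (p - 2).
    by rewrite -powR_mulrn ?(ltW s0)// -powRD; [congr powR; ring|apply/implyP => _; rewrite gt_eqF].
  by rewrite sp; field; rewrite gt_eqF.
(* Opposite shifts by [2 K + 1] separate the supports, which lie in the square of half-side [K]. *)
pose a : R2 := (2 * K + 1, 0); pose a' : R2 := (- (2 * K + 1), 0).
have [h1 _ _] := H_trl a hv; have [h2 _ _] := H_trl a' hv.
pose D := n2 mu (dt (fun x => v (trl a x))) + n2 mu (dt (fun x => v (trl a' x))).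
have D1 := n2_ge0 mu (dt (fun x => v (trl a x))); have D2 := n2_ge0 mu (dt (fun x => v (trl a' x))).
have D0 : 0 <= D by exact: addr_ge0.
(* For this [l] the angular term of each translate contributes at most [e]. *)
pose l := 1 + D / e; have De : 0 <= D / e by rewrite divr_ge0// ltW.
have l1 : 1 <= l by rewrite lerDl.
have l0 : 0 < l by exact: lt_le_trans l1.
have lD (d : R) : 0 <= d -> d <= D -> (l ^+ 2)^-1 * d <= e.
  move=> d0 dD; rewrite mulrC ler_pdivrMr ?exprn_gt0//; apply: (le_trans dD).
  have : D / e <= l ^+ 2 by apply: (@le_trans _ _ l); [rewrite lerDr|rewrite expr2 ler_peMr// ltW].
  by rewrite ler_pdivrMr// mulrC.
have Q1 : Q l (fun x => v (trl a x)) <= q.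
  by rewrite (QlE _ h1) (Q_trl a hv) lerD2l; apply: lD => //; rewrite lerDl.
have Q2 : Q l (fun x => v (trl a' x)) <= q.
  by rewrite (QlE _ h2) (Q_trl a' hv) lerD2l; apply: lD => //; rewrite lerDr.
have P1 : Pf p (fun x => v (trl a x)) = P by rewrite /P !PfE; exact: (mp_I (trl_mp a) (P_itg p2 hv)).
have P2 : Pf p (fun x => v (trl a' x)) = P by rewrite /P !PfE; exact: (mp_I (trl_mp a') (P_itg p2 hv)).
have dis x : v (trl a x) = 0 \/ v (trl a' x) = 0.
  have [c1|/vK] := pselect (sq K (trl a x)); last by left.
  have [c2|/vK] := pselect (sq K (trl a' x)); last by right.
  move: c1 c2 => /sqP[+ _] /sqP[+ _]; rewrite /trl/= !ler_norml => /andP[_ b1] /andP[b2 _].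
  by exfalso; exact: shift_disj K0 b1 b2.
pose z : R2 -> R := fun x => s * v (trl a x) - s * v (trl a' x).
have s0' := ltW s0.
have pz : (fun x => pos (z x)) = (fun x => s * v (trl a x)).
  apply/funext => x; rewrite /z /pos; case: (dis x) => ->; rewrite !mulr0 ?subr0 ?sub0r.
    by rewrite max_r// oppr_le0 mulr_ge0.
  by rewrite max_l// mulr_ge0.
have nz : (fun x => pos (- z x)) = (fun x => s * v (trl a' x)).
  apply/funext => x; rewrite /z /pos; case: (dis x) => ->; rewrite !mulr0 ?subr0 ?sub0r ?opprK.
    by rewrite max_l// mulr_ge0.
  by rewrite max_r// oppr_le0 mulr_ge0.
have hz : Hspace z := HB (HZ s h1) (HZ s h2).
have Pz1 : Pf p (fun x => s * v (trl a x)) = s `^ p * P by rewrite (PfZ p2 s0' h1) P1.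
have Pz2 : Pf p (fun x => s * v (trl a' x)) = s `^ p * P by rewrite (PfZ p2 s0' h2) P2.
have sP : 0 < s `^ p * P by rewrite mulr_gt0// powR_gt0.
have az : adm p l z.
  rewrite /adm pz nz Pz1 Pz2 (QZ _ _ h1) (QZ _ _ h2); split => //.
    by rewrite spp ler_pM2l// exprn_gt0.
  by rewrite spp ler_pM2l// exprn_gt0.
have := opt l0 az; rewrite (P_pos_neg p2 hz) pz nz Pz1 Pz2 => h.
have {}h := half_le h.
have : A `^ (p - 2) <= (s `^ p * P) `^ (p - 2).
  by apply: ge0_ler_powR; rewrite ?nnegrE ?(ltW p20) ?(ltW A0) ?(ltW sP).
rewrite powRM ?powR_ge0 ?(ltW P0)// -powRrM [p * _]mulrC powRrM sp => hA.
have P20 : 0 < P ^+ 2 by rewrite exprn_gt0.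
have : T <= P `^ (p - 2) * (q / P) `^ p * P ^+ 2 by rewrite /T ler_pM2r// [leRHS]mulrC.
have -> : P `^ (p - 2) * (q / P) `^ p * P ^+ 2 = q `^ p.
  have -> : P `^ (p - 2) * (q / P) `^ p * P ^+ 2 = (q / P) `^ p * (P ^+ 2 * P `^ (p - 2)) by ring.
  have -> : P ^+ 2 * P `^ (p - 2) = P `^ p.
    by rewrite -powR_mulrn ?(ltW P0)// -powRD; [congr powR; ring|apply/implyP => _; rewrite gt_eqF].
  by rewrite -powRM ?divfK ?gt_eqF// ?divr_ge0// ltW.
by rewrite leNgt qpT.
Qed.

(** Compactly supported functions satisfy [A^(p-2) <= Q^p / Pf^2], and [w] attains the bound. Adding
    [t * phi >= 0] does not lower [Pf], so a negative derivative of [Q] would bring the quotient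
    below the bound; cutting [w] off makes the competitor compactly supported. *)
Lemma test_pos K phi : 0 < K -> Hspace phi -> (forall x, 0 <= phi x) -> (forall x, ~ sq K x -> phi x = 0) ->
  0 <= ip 0 w phi.
Proof.
move=> K0 hf f0 fK; rewrite leNgt; apply/negP => hlt.
have qf := Q_ge0 0 hf; have qf1 : 0 < Q 0 phi + 1 by rewrite ltr_wpDl.
(* With this [t] the quadratic term [t^2 * Q 0 phi] is less than half of the linear gain. *)
pose t := - ip 0 w phi / (Q 0 phi + 1).
have t0 : 0 < t by rewrite divr_gt0// oppr_gt0.
have tq : t * (Q 0 phi + 1) = - ip 0 w phi by rewrite /t divfK// gt_eqF.
have ht := HZ t hf; have hwt := HD hw ht.
pose B := Q 0 (fun x => w x + t * phi x).
have B0 : 0 <= B := Q_ge0 0 hwt.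
have BA : B < A.
  rewrite /B (QD 0 hw ht) (QZ _ _ hf) ipC (ipZ _ _ hf hw) [ip 0 phi w]ipC QA.
  by move: tq t0 hlt; move: (ip 0 w phi) (Q 0 phi) => C D; nra.
pose dl := (A - B) / 2; have dl0 : 0 < dl by rewrite divr_gt0// subr_gt0.
have Adl : B + dl = A - dl by rewrite /dl; field.
have Ad0 : 0 < A - dl by rewrite -Adl ltr_wpDl.
have [c0 c00 hc0] := P_cont p2 hw dl0; have [c1 c10 hc1] := P_small p2 c00.
pose th := dl / (2 * (B + 1)); have B1 : 0 < 2 * (B + 1) by rewrite mulr_gt0// ltr_wpDl.
have th0 : 0 < th by rewrite divr_gt0.
have thB : th * (2 * (B + 1)) = dl by rewrite /th divfK// gt_eqF.
have i0 : 0 < 1 + th^-1 by rewrite addr_gt0// invr_gt0.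
have e0 : 0 < Num.min c1 (dl / 2 / (1 + th^-1)) by rewrite lt_min; apply/andP; split; [exact: c10|exact: (divr_gt0 (divr_gt0 dl0 (ltr0Sn _ 1)) i0)].
have [k k0] := eta_approx hw e0; rewrite le_min => /andP[k1 k2].
have [hk _ _ _] := H_mul_eta k0 hw; have hd := HB hk hw.
pose v x := eta k x * w x + t * phi x; have hv : Hspace v := HD hk ht.
have e0' x : 0 <= eta k x * w x by rewrite mulr_ge0 ?eta_ge0.
have tf x : 0 <= t * phi x by rewrite mulr_ge0// ltW.
have v0 x : 0 <= v x by rewrite addr_ge0.
have PA : A - dl <= Pf p (fun x => eta k x * w x).
  by have := hc0 _ hk (hc1 _ _ hd k1); rewrite ler_norml -/A => /andP[+ _]; lra.
have Pv : A - dl <= Pf p v.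
  apply: (le_trans PA); apply: (P_mono p2 hk hv) => x.
  by rewrite ger0_norm// ger0_norm// lerDl.
have qv : Q 0 v <= A - dl.
  have E : v = (fun x => (w x + t * phi x) + (eta k x * w x - w x)) by apply/funext => x; rewrite /v; ring.
  rewrite E; apply: (le_trans (Q_young 0 th0 hwt hd)); rewrite -/B -Adl.
  by move: k2; rewrite ler_pdivlMr// mulrC; move: thB th0 B0; move: (Q 0 _) => C; nra.
have vK x : ~ sq (Num.max k K) x -> v x = 0.
  move=> nx; rewrite /v fK ?mulr0 ?addr0.
    by rewrite /eta eta_out ?expr0n ?mul0r//; move=> /sqP[b1 b2]; apply: nx; apply/sqP; rewrite !le_max b1 b2.
  by move=> /sqP[b1 b2]; apply: nx; apply/sqP; rewrite !le_max b1 b2 !orbT.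
have m0 : 0 < Num.max k K by rewrite lt_max k0.
have Pv0 : 0 < Pf p v by exact: lt_le_trans Pv.
have h1 := two_bump m0 hv v0 vK Pv0.
have h2 : Q 0 v `^ p <= (A - dl) `^ p.
  by apply: ge0_ler_powR; rewrite ?nnegrE ?(ltW p0) ?(ltW Ad0) ?Q_ge0.
have h3 : A `^ (p - 2) * (A - dl) ^+ 2 <= A `^ (p - 2) * Pf p v ^+ 2.
  by rewrite ler_pM2l ?powR_gt0// lerXn2r// nnegrE ltW.
have := le_trans h3 (le_trans h1 h2).
have -> : (A - dl) `^ p = (A - dl) `^ (p - 2) * (A - dl) ^+ 2.
  by rewrite -powR_mulrn ?(ltW Ad0)// -powRD; [congr powR; ring|apply/implyP => _; rewrite gt_eqF].
rewrite ler_pM2r ?exprn_gt0// leNgt => /negP; apply.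
by apply: gt0_ltr_powR; rewrite ?nnegrE ?(ltW Ad0) ?(ltW A0)// gtrBl.
Qed.

(* Tests the inequality of [test_pos] with eta^2 / (w + e). *)
Lemma log_grad K : 0 < K -> exists2 C : R, 0 <= C & forall e, 0 < e ->
  let g := fun x => (eta K x * (w x + e)^-1 * d1 w x) ^+ 2 + (eta K x * (w x + e)^-1 * d2 w x) ^+ 2 in
  itg mu g /\ \int[mu]_x g x <= C.
Proof.
move=> K0; have [hE eE1 eE2 _] := H_eta K0; have [me me'] := @meas_eta R K.
have be (x : T2) : `|eta K x| <= 1 by rewrite ger0_norm ?eta_ge0//; exact: eta_le1.
have s1 : sqi mu (fun x : R2 => eta' K x * x.1) := sqi_ae (H_d1 hE) (measM me' meas_x1) eE1.
have s2 : sqi mu (fun x : R2 => eta' K x * x.2) := sqi_ae (H_d2 hE) (measM me' meas_x2) eE2.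
have iC := itgD (itgD (itgZ 2 s1.2) (itgZ 2 s2.2)) (H_sqi hE).2.
pose rhs (x : T2) := 2 * (eta' K x * x.1) ^+ 2 + 2 * (eta' K x * x.2) ^+ 2 + eta K x ^+ 2.
exists (2 * \int[mu]_x rhs x).
  by rewrite mulr_ge0//; apply: I_ge0 => x; rewrite !addr_ge0 ?sqr_ge0// mulr_ge0// sqr_ge0.
move=> e e0 /=.
have [hG a1 a2] := H_recip e0 hw w0.
have we x : 0 < w x + e by rewrite ltr_wpDl.
have mr : @meas _ T2 R (fun x => (w x + e)^-1).
  by apply: meas_inv; apply: measD; [exact: (H_sqi hw).1|exact: meas_cst].
have br (x : T2) : `|eta K x * (w x + e)^-1| <= e^-1.
  have r0 : 0 <= (w x + e)^-1 by rewrite invr_ge0 ltW.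
  rewrite (ger0_norm (mulr_ge0 (eta_ge0 K x) r0)) -[leRHS]mul1r.
  apply: (ler_pM (eta_ge0 K x) r0 (eta_le1 K x)).
  by rewrite lef_pV2 ?posrE// lerDr.
have mer : @meas _ T2 R (fun x => eta K x * (w x + e)^-1) := measM me mr.
have g1 := sqiMb mer br (H_d1 hw); have g2 := sqiMb mer br (H_d2 hw).
have ig := itgD g1.2 g2.2; split; first exact: ig.
have [hEG b1 b2 _] := H_mul_eta K0 hG.
have [hf0 c1 c2 _] := H_lin e^-1 hE hEG.
(* This is eta / (w + e), split so that the second summand contains the normalised reciprocal, which
   lies in H. *)
set f0 := (fun x => e^-1 * eta K x + eta K x * ((w x + e)^-1 - e^-1)) in hf0 c1 c2.
have f0E x : f0 x = eta K x * (w x + e)^-1 by rewrite /f0; ring.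
have [hf k1 k2 _] := H_mul_eta K0 hf0.
have fpos x : 0 <= eta K x * f0 x.
  rewrite f0E; apply: (mulr_ge0 (eta_ge0 K x) (mulr_ge0 (eta_ge0 K x) _)).
  by rewrite invr_ge0 ltW.
have fK x : ~ sq K x -> eta K x * f0 x = 0 by move=> nx; rewrite /eta eta_out// expr0n mul0r.
have := test_pos K0 hf fpos fK; rewrite ip_def expr0n/= invr0; under eq_Rintegral do rewrite mul0r addr0.
pose lhs x := d1 w x * d1 (fun x => eta K x * f0 x) x + d2 w x * d2 (fun x => eta K x * f0 x) x + w x * (eta K x * f0 x).
move=> h; have il : itg mu lhs.
  exact: (itgD (itgD (sqi_itgM (H_d1 hw) (H_d1 hf)) (sqi_itgM (H_d2 hw) (H_d2 hf))) (sqi_itgM (H_sqi hw) (H_sqi hf))).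
have h0 : 0 <= \int[mu]_x lhs x by exact: h.
have key : \int[mu]_x lhs x <= \int[mu]_x (rhs x - 2^-1 * ((eta K x * (w x + e)^-1 * d1 w x) ^+ 2 + (eta K x * (w x + e)^-1 * d2 w x) ^+ 2)).
  apply: I_le_ae; [exact: il|exact: itgB iC (itgZ _ ig)|].
  apply: (aeS2 (ae_and k1 (ae_and k2 (ae_and c1 c2))) (ae_and (ae_and a1 a2) (ae_and (ae_and b1 b2) (ae_and eE1 eE2)))).
  move=> x [q1 [q2 [r1 r2]]] [[t1 t2] [[u1 u2] [v1 v2]]].
  rewrite /lhs q1 q2 r1 r2 u1 u2 v1 v2 t1 t2 f0E /rhs.
  have rw : w x * (w x + e)^-1 <= 1 by rewrite ler_pdivrMr// mul1r lerDl ltW.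
  have et2 : 0 <= eta K x ^+ 2 by exact: sqr_ge0.
  have m1 := ler_wpM2l et2 rw; rewrite mulr1 in m1.
  have y1 := sqr_ge0 (2 * (eta' K x * x.1) - eta K x * (w x + e)^-1 * d1 w x).
  have y2 := sqr_ge0 (2 * (eta' K x * x.2) - eta K x * (w x + e)^-1 * d2 w x).
  exact: test_pointwise m1 y1 y2.
rewrite (IB iC (itgZ _ ig)) (IZ _ ig) in key.
by move: h0 key; rewrite /rhs; lra.
Qed.

(** The centred square of half-side n + 1 as a cell, so that the Poincare inequality applies to
    it. *)
Definition ccel (n : nat) : R2 -> R := cel (2 * n.+1%:R) (- n.+1%:R, - n.+1%:R).

Lemma ccelP n x : ccel n x = ((`|x.1| <= n.+1%:R) && (`|x.2| <= n.+1%:R))%R%:R.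
Proof.
rewrite /ccel /cel !iiP/=.
have -> : - n.+1%:R + 2 * n.+1%:R = n.+1%:R :> R by ring.
by rewrite -!ler_norml; case: (_ <= _); case: (_ <= _); rewrite ?mulr1 ?mulr0.
Qed.

(** Level 1 / (n + 1) and half-side n + 1 share one parameter, which makes the integral
    nondecreasing in [n]; a common [n] then serves [w] and [w']. *)
Lemma ccel_level v : Hspace v -> (forall x, 0 <= v x) -> 0 < Pf p v -> exists N, forall n, (N <= n)%N ->
  0 < \int[mu]_x (ccel n x * (0 < v x - n.+1%:R^-1)%R%:R).
Proof.
move=> hv v0 Pv.
pose F n (x : T2) : R := ccel n x * (0 < v x - n.+1%:R^-1)%R%:R.
have mi n : @meas _ T2 R (fun x => (0 < v x - n.+1%:R^-1)%R%:R : R).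
  by apply: ind_gt0_meas; apply: measB; [exact: (H_sqi hv).1|exact: meas_cst].
have b01 (b : bool) : 0 <= b%:R :> R by case: b.
have F0 n x : 0 <= F n x by rewrite mulr_ge0 ?cel_ge0.
have iF n : itg mu (F n).
  have [ic _] := @cel_itg R (2 * n.+1%:R) (- n.+1%:R, - n.+1%:R) (mulr_ge0 (ler0n _ 2) (ler0n _ _)).
  have b1 (x : T2) : `|(0 < v x - n.+1%:R^-1)%R%:R : R| <= 1 by case: (_ < _); rewrite ?normr0 ?normr1.
  have := itgMb (mi n) b1 ic; rewrite /F /ccel; congr itg; apply/funext => x; exact: mulrC.
have mono n m : (n <= m)%N -> \int[mu]_x F n x <= \int[mu]_x F m x.
  move=> nm; apply: I_le => // x; have nm' : n.+1%:R <= m.+1%:R :> R by rewrite ler_nat.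
  apply: ler_pM; rewrite ?cel_ge0//.
    rewrite !ccelP; case: (boolP (_ && _)) => // /andP[h1 h2].
    by rewrite (le_trans h1 nm') (le_trans h2 nm').
  have im : m.+1%:R^-1 <= n.+1%:R^-1 :> R by rewrite lef_pV2 ?posrE.
  case: (boolP (0 < v x - n.+1%:R^-1)) => // h; suff -> : 0 < v x - m.+1%:R^-1 by [].
  by move: h; rewrite !subr_gt0; exact: le_lt_trans.
suff [N hN] : exists N, 0 < \int[mu]_x F N x by exists N => n /mono; exact: lt_le_trans.
apply: contrapT => no.
have z n : {ae mu, forall x, F n x = 0}.
  apply: I_eq0_ae => //; apply/eqP; rewrite eq_le I_ge0// andbT leNgt; apply/negP => h.
  by apply: no; exists n.
have v00 : {ae mu, forall x, v x = 0}.
  apply: (aeS (ae_foralln z)) => x hx; apply/eqP; rewrite eq_le v0 andbT leNgt; apply/negP => vx.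
  pose n := maxn (Num.truncn (v x)^-1) (maxn (Num.truncn `|x.1|) (Num.truncn `|x.2|)).
  have := hx n; rewrite /F ccelP.
  have big (y : R) k : (Num.truncn y <= k)%N -> y < k.+1%:R.
    by move=> h; apply: (lt_le_trans (truncnS_gt y)); rewrite ler_nat ltnS.
  have -> : `|x.1| <= n.+1%:R by apply: ltW; apply: big; exact: leq_trans (leq_maxl _ _) (leq_maxr _ _).
  have -> : `|x.2| <= n.+1%:R by apply: ltW; apply: big; exact: leq_trans (leq_maxr _ _) (leq_maxr _ _).
  have -> : 0 < v x - n.+1%:R^-1.
    by rewrite subr_gt0 -[ltRHS]invrK ltf_pV2 ?posrE ?invr_gt0//; apply: big; exact: leq_maxl.
  by rewrite mulr1 => /eqP; rewrite oner_eq0.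
move: Pv; rewrite (@Pf_ae _ p _ _ hv (@meas_cst _ T2 R 0) v00) PfE.
by under eq_Rintegral do rewrite normr0 powR0 ?gt_eqF//; rewrite I0 ltxx.
Qed.

(* [ln (1 + w / e)] vanishes on {w' > 0}, blows up on {w > d} as e tends to 0, and has gradient bounded in L2
   uniformly in e: this contradicts the Poincare inequality. *)
Lemma no_optimum : False.
Proof.
have [N1 h1] := ccel_level hw w0 Pw; have [N2 h2] := ccel_level hw' w'0 Pw'.
pose n := maxn N1 N2; have {}h1 := h1 n (leq_maxl _ _); have {}h2 := h2 n (leq_maxr _ _).
set be := \int[mu]_x _ in h1; set al := \int[mu]_x _ in h2.
pose d : R := n.+1%:R^-1; have d0 : 0 < d by rewrite invr_gt0.
pose h : R := 2 * n.+1%:R; have hp : 0 < h by rewrite mulr_gt0.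
have [C C0 hC] := log_grad hp.
pose D := 2 * h ^+ 2 * (16 * C); have D0 : 0 <= D by rewrite !mulr_ge0// ltW.
pose E := 2 * D + 2 * h ^+ 2 * (D / al).
have E0 : 0 <= E by exact: (addr_ge0 (mulr_ge0 (ler0n _ 2) D0) (mulr_ge0 (mulr_ge0 (ler0n _ 2) (sqr_ge0 h)) (divr_ge0 D0 (ltW h2)))).
(* The value that the logarithm is to reach on {w > d}; [e] below solves [ln (1 + d / e) = m]. *)
pose m := 1 + E / be; have m1 : 1 <= m by rewrite lerDl divr_ge0// ltW.
have m0 : 0 < m by exact: lt_le_trans m1.
have ex1 : 0 < expR m - 1 by rewrite subr_gt0 -expR0 ltr_expR.
pose e := d / (expR m - 1); have e0 : 0 < e by rewrite divr_gt0.
have lnm : ln (1 + d / e) = m.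
  rewrite (_ : 1 + d / e = expR m) ?expRK// /e; field.
  by rewrite !gt_eqF.
have [hf f1 f2] := H_log e0 hw w0; set f := (fun x => ln (1 + w x / e)) in hf f1 f2.
have [ig gC] := hC e e0.
pose z : R2 := (- n.+1%:R, - n.+1%:R).
have := poincare z (H_sqi hf) (H_d1 hf) (H_d2 hf) (H_wd1 hf) (H_wd2 hf) hp.
set c := \int[mu]_x (cel h z x * f x) / h ^+ 2 => pc.
have grad (g : R2 -> R) (dw : R2 -> R) : {ae mu, forall x, g x = (w x + e)^-1 * dw x} ->
   {ae mu, forall x, cel h z x * g x ^+ 2 <= 16 * (eta h x * (w x + e)^-1 * dw x) ^+ 2}.
  move=> hg; apply: (aeS hg) => x ->.
  have := ccelP n x; rewrite /ccel -/h -/z => ->; case: (boolP (_ && _)) => [/andP[b1 b2]|_]; last first.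
    by rewrite mul0r mulr_ge0// sqr_ge0.
  (* On the cell [|x|^2] is at most 2 (n + 1)^2 = h^2 / 2, so the cutoff of radius [h] is at least
     1/4. *)
  have q : 4^-1 <= eta h x.
    have sx : sq n.+1%:R x by apply/sqP.
    have := rsq_sq sx; have N0 : 0 < n.+1%:R ^+ 2 :> R by rewrite exprn_gt0.
    move=> rs; have : rsq x / h ^+ 2 <= 2^-1.
      by rewrite ler_pdivrMr ?exprn_gt0// /h exprMn; lra.
    exact: pos_quarter.
  have -> : 16 * (eta h x * (w x + e)^-1 * dw x) ^+ 2 = (16 * eta h x ^+ 2) * ((w x + e)^-1 * dw x) ^+ 2 by ring.
  apply: ler_wpM2r; first exact: sqr_ge0.
  exact: sq_quarter q.
have G1 := grad _ _ f1; have G2 := grad _ _ f2.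
have I1 : \int[mu]_x (cel h z x * (f x - c) ^+ 2) <= D.
  apply: (le_trans pc); apply: ler_wpM2l; first by rewrite mulr_ge0// exprn_ge0// ltW.
  have i1 := itg_cel h z (H_d1 hf).2; have i2 := itg_cel h z (H_d2 hf).2.
  rewrite -(ID i1 i2); apply: (@le_trans _ _ (16 * C)) => //.
  apply: le_trans (ler_wpM2l (ler0n _ 16) gC); rewrite -(IZ 16 ig).
  apply: I_le_ae; [exact: itgD|exact: itgZ|].
  by apply: (aeS2 G1 G2) => x g1 g2; rewrite mulrDr; exact: lerD.
have [ic _] := @cel_itg R h z (ltW hp); have ec := (@cel_itg R h z (ltW hp)).2.
have [if2 _ _] := @cel_mean R f h z c (H_sqi hf) hp.
have ind u : @meas _ T2 R u -> itg mu (fun x => ccel n x * (0 < u x - d)%R%:R).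
  move=> mu_; have mi : @meas _ T2 R (fun x => (0 < u x - d)%R%:R : R).
    by apply: ind_gt0_meas; apply: measB; [exact: mu_|exact: meas_cst].
  have b1 (x : T2) : `|(0 < u x - d)%R%:R : R| <= 1 by case: (_ < _); rewrite ?normr0 ?normr1.
  have := itgMb mi b1 ic; rewrite /ccel -/h -/z; congr itg; apply/funext => x; exact: mulrC.
have ial := ind _ (H_sqi hw').1; have ibe := ind _ (H_sqi hw).1.
(* On {w' > d} the logarithm vanishes, so the Poincare inequality bounds its mean [c]. *)
have cal : c ^+ 2 * al <= D.
  apply: le_trans I1; rewrite /al -(IZ _ ial); apply: I_le => //; first exact: itgZ.
  move=> x; rewrite /ccel -/h -/z -/d mulrCA; apply: ler_wpM2l; first exact: cel_ge0.
  case: (boolP (0 < w' x - d)) => hx; last by rewrite mulr0 sqr_ge0.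
  have wx : w x = 0.
    have := ww' x => /eqP; rewrite mulf_eq0 => /orP[/eqP //|/eqP w'x].
    by exfalso; move: hx; rewrite w'x sub0r oppr_gt0 ltNge (ltW d0).
  by rewrite /f wx mul0r addr0 ln1 sub0r sqrrN mulr1.
have cal' : c ^+ 2 <= D / al by rewrite ler_pdivlMr.
(* On {w > d} the logarithm is at least [m]; with [c] bounded this bounds [m^2 * be] by [E], whereas
   [m] was chosen at least 1 and larger than [E / be]. *)
have cbe : m ^+ 2 * be <= 2 * D + 2 * c ^+ 2 * h ^+ 2.
  have : m ^+ 2 * be <= 2 * \int[mu]_x (cel h z x * (f x - c) ^+ 2) + 2 * c ^+ 2 * \int[mu]_x cel h z x.
    rewrite /be -(IZ _ ibe) -(IZ 2 if2) -(IZ _ ic) -(ID (itgZ 2 if2) (itgZ _ ic)); apply: I_le.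
    - exact: itgZ.
    - exact: itgD (itgZ 2 if2) (itgZ _ ic).
    move=> x; rewrite /ccel -/h -/z -/d.
    have -> : 2 * (cel h z x * (f x - c) ^+ 2) + 2 * c ^+ 2 * cel h z x = cel h z x * (2 * (f x - c) ^+ 2 + 2 * c ^+ 2) by ring.
    rewrite mulrCA; apply: ler_wpM2l; first exact: cel_ge0.
    case: (boolP (0 < w x - d)) => hx; last by rewrite mulr0 addr_ge0// mulr_ge0// sqr_ge0.
    have fm : m <= f x.
      apply: (@le_trans _ _ (ln (1 + d / e))); first by rewrite lnm.
      have pd : 0 < 1 + d / e by rewrite ltr_wpDr// divr_ge0// ltW.
      have pw : 0 < 1 + w x / e by rewrite ltr_wpDr// divr_ge0// ltW.
      rewrite ler_ln ?posrE// lerD2l ler_pM2r ?invr_gt0//.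
      by rewrite subr_gt0 in hx; exact: ltW.
    have fx0 : 0 <= f x by exact: le_trans (ltW m0) fm.
    have : m ^+ 2 <= f x ^+ 2 by rewrite lerXn2r// nnegrE ltW.
    by rewrite mulr1 => hh; exact: le_trans hh (sq_split _ _).
  by rewrite ec => hh; apply: (le_trans hh); rewrite lerD2r ler_pM2l.
have : m ^+ 2 * be <= E.
  apply: (le_trans cbe); rewrite /E lerD2l.
  have -> : 2 * c ^+ 2 * h ^+ 2 = 2 * h ^+ 2 * c ^+ 2 by ring.
  exact: (ler_wpM2l (mulr_ge0 (ler0n _ 2) (sqr_ge0 h)) cal').
have mE : E < m * be by rewrite /m mulrDl mul1r divfK ?gt_eqF// ltrDr.
have : m * be <= m ^+ 2 * be by rewrite ler_pM2r// expr2 ler_peMr// ltW.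
by move=> hh /(le_trans hh); rewrite leNgt mE.
Qed.

End Nonradial.

Section LargeLambda.
Context {R : realType}.
Local Notation R2 := (R * R)%type.
Local Notation mu := (leb2 R).
Variable p : R.
Hypothesis p2 : 2 < p.
Implicit Types u v w : R2 -> R.

Lemma adm_mono (l l' : R) u : 0 < l -> l <= l' -> adm p l u -> adm p l' u.
Proof.
move=> l0 ll [hu Pp Pn qp qn].
have mono v : Hspace v -> Q l' v <= Q l v.
  move=> hv; rewrite (QlE l' hv) (QlE l hv) lerD2l; apply: ler_wpM2r; first exact: n2_ge0.
  have l'0 : 0 < l' by exact: lt_le_trans ll.
  by rewrite lef_pV2 ?posrE ?exprn_gt0// lerXn2r// nnegrE ltW.
split; [exact: hu|exact: Pp|exact: Pn| |].
- exact: le_trans (mono _ (HP hu)) qp.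
- exact: le_trans (mono _ (HPN hu)) qn.
Qed.

(** Otherwise there are radial minimisers for arbitrarily large [l]; their angular derivative
    vanishes, so they are admissible for every [l]. As admissibility weakens when [l] grows, one of
    them is minimal among the functions admissible for any [l]. *)
Lemma large_nonradial : exists L : R, forall (l : R) u, L < l -> minim p l u -> ~ radial u.
Proof.
apply: contrapT => no.
have ex (L : R) : exists (l : R) u, [/\ L < l, minim p l u & radial u].
  apply: contrapT => nex; apply: no; exists L => l u Ll mlu ru; apply: nex; by exists l, u.
have dt0 l u : minim p l u -> radial u -> {ae mu, forall x, dt u x = 0}.
  by move=> [[hu _ _ _ _] _ _ _] ru; apply: (inv_dt0 hu); exact: radial_inv.
have [l1 [u [l11 m1 r1]]] := ex 1; have t1 := dt0 _ _ m1 r1.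
have l10 : 0 < l1 by exact: lt_trans l11.
have [[hu Pp Pn _ _] e1 e2 umin] := m1.
have opt l v : 0 < l -> adm p l v -> Pf p u <= Pf p v.
  move=> l0 av; have [l2 [u2 [l2l m2 r2]]] := ex l; have t2 := dt0 _ _ m2 r2.
  have [[hu2 Pp2 Pn2 q1 q2] _ _ umin2] := m2.
  apply: le_trans (umin2 v (adm_mono l0 (ltW l2l) av)); apply: umin; split => //.
  - by rewrite (Q_dt0 l1 l2 (HP hu2) (dt_pos0 hu2 t2)).
  - by rewrite (Q_dt0 l1 l2 (HPN hu2) (dt_neg0 hu2 t2)).
have wd0 x : pos (u x) * pos (- u x) = 0.
  case: (pos_cases (u x)) => -[h ->]; last by rewrite mul0r.
  by rewrite /pos max_r ?mulr0// oppr_le0.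
have q1 : Q 0 (fun x => pos (u x)) = Pf p (fun x => pos (u x)).
  by rewrite (Q_dt0 0 l1 (HP hu) (dt_pos0 hu t1)).
have q2 : Q 0 (fun x => pos (- u x)) = Pf p (fun x => pos (- u x)).
  by rewrite (Q_dt0 0 l1 (HPN hu) (dt_neg0 hu t1)).
have Pu := P_pos_neg p2 hu.
(* The part with the smaller [Pf] carries at most half of the total, as the optimality hypothesis
   requires. *)
have [h|h] := leP (Pf p (fun x => pos (u x))) (Pf p (fun x => pos (- u x))).
  apply: (@no_optimum R p p2 (fun x => pos (u x)) (fun x => pos (- u x)) (HP hu) (HPN hu) _ _ wd0 Pp Pn q1) => [x|x|l v l0 av].
  - exact: pos_ge0.
  - exact: pos_ge0.
  - by apply: le_trans (opt l v l0 av); rewrite Pu mulrDl !mul1r lerD2l.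
apply: (@no_optimum R p p2 (fun x => pos (- u x)) (fun x => pos (u x)) (HPN hu) (HP hu) _ _ _ Pn Pp q2) => [x|x|x|l v l0 av].
- exact: pos_ge0.
- exact: pos_ge0.
- by rewrite mulrC.
- by apply: le_trans (opt l v l0 av); rewrite Pu mulrDl !mul1r lerD2r ltW.
Qed.

End LargeLambda.

Theorem theorem1p2 (R : realType) (p : R) (hp : 2 < p) :
  (forall lambda : R, 0 < lambda ->
     exists u : R * R -> R, least_energy_nodal_solution p lambda u) /\
  exists lambda0 Lambda0 : R,
    [/\ 0 < lambda0,
        lambda0 <= Lambda0,
        (forall (lambda : R) (u : R * R -> R),
           0 < lambda -> lambda < lambda0 ->
           least_energy_nodal_solution p lambda u -> radial u) &
        (forall (lambda : R) (u : R * R -> R),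
           Lambda0 < lambda ->
           least_energy_nodal_solution p lambda u -> ~ radial u)].
Proof.
split=> [l l0|]; first exact: lens_ex hp _ l0.
have [l0 l00 small] := small_radial hp; have [L large] := large_nonradial hp.
exists l0, (Num.max l0 L); split => //; first by rewrite le_max lexx.
- by move=> l u lp ll /(lens_minim hp lp); exact: small.
- move=> l u; rewrite gt_max => /andP[l0l Ll] hu.
  exact: large Ll (lens_minim hp (lt_trans l00 l0l) hu).
Qed.
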